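(* Assume that $\mathbb{E}\,\xi_i = 0$ for each $1\le i\le n$ and $\sum_{i=1}^n \mathbb{E}\{\xi_i\xi_i^{\top}\} = I_d$. Then $$\sup_{A\in\mathcal{A}} \bigl|\mathbb{P}(T\in A)-\mathbb{P}(Z\in A)\bigr| \le 259\, d^{1/2}\gamma + 2\,\mathbb{E}\{\|W\|\Delta\} + 2\sum_{i=1}^n \mathbb{E}\bigl\{\|\xi_i\|\,|\Delta-\Delta^{(i)}|\bigr\}$$ for any random variables $\Delta$ and $(\Delta^{(i)})_{1\le i\le n}$ such that $\Delta\ge \|D\|$ and $\Delta^{(i)}$ is independent of $X_i$ for each $i$.
   Context: Let $X_1,\dots,X_n$ be independent random variables taking values in a space $\mathcal{X}$, let $T=T(X_1,\dots,X_n)$ be an $\mathbb{R}^d$-valued statistic, let $h_i:\mathcal{X}\to\mathbb{R}^d$ be Borel measurable functions, $\xi_i=h_i(X_i)$, $W=\sum_{i=1}^n\xi_i$, and $D=D(X_1,\dots,X_n)=T-W$, so $T=W+D$. Put $\gamma=\sum_{i=1}^n\mathbb{E}\|\xi_i\|^3$. $\|\cdot\|$ is the Euclidean norm, $I_d$ the $d\times d$ identity matrix, $\mathcal{A}$ the collection of all convex sets in $\mathbb{R}^d$, and $Z\sim N(0,I_d)$.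
   Formalization: ''Δ^(i) is independent of X_i'' is taken as: X_i is independent of Δ^(i) jointly with all X_j, j≠i (independence of X_i and Δ^(i) alone makes the bound false); A ranges over convex sets for which {T∈A} and {Z∈A} are events. *)

(* Defs.v *)
From HB Require Import structures.
From mathcomp Require Import all_boot all_order all_algebra.
From mathcomp Require Import all_classical all_reals all_analysis.

Set Implicit Arguments.
Unset Strict Implicit.
Unset Printing Implicit Defensive.

Import Order.TTheory GRing.Theory Num.Theory.
Import numFieldNormedType.Exports.

Local Open Scope classical_set_scope.
Local Open Scope ring_scope.

(* MathComp-Analysis equips matrices with the sup norm; that norm induces the
   usual topology but is not the Euclidean one. *)
Definition enorm (R : realType) (d : nat) (x : 'cV[R]_d) : R :=
  Num.sqrt (\sum_(j < d) x j 0 ^+ 2).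

Definition borel_fun (R : realType) (d : nat) (disp : measure_display)
    (S : measurableType disp) (f : S -> 'cV[R]_d) : Prop :=
  measurable_fun [set: S]
    (f : S -> g_sigma_algebraType (@open 'cV[R]_d)).

(* Some B i may be setT, so the product rule for every subfamily is included. *)
Definition mutually_independent (R : realType)
    (d1 d2 : measure_display) (Omega : measurableType d1)
    (S : measurableType d2) (P : probability Omega R) (n : nat)
    (X : 'I_n -> Omega -> S) : Prop :=
  forall B : 'I_n -> set S, (forall i, measurable (B i)) ->
    P (\bigcap_(i in [set: 'I_n]) (X i @^-1` B i)) =
    (\prod_(i < n) P (X i @^-1` B i))%E.

Definition independent_systems (R : realType) (d1 : measure_display)
    (Omega : measurableType d1) (P : probability Omega R)
    (F G : set (set Omega)) : Prop :=
  forall A B : set Omega, F A -> G B -> P (A `&` B) = (P A * P B)%E.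

(* Y does not involve X i: the sigma-algebra of X i is independent of the one
   generated by Y together with all the other X j.  Pairwise independence of Y
   and X i would be too weak for a Berry-Esseen bound: for independent signs
   X j = +-n^-1/2 with sum W and D = - W 1_{|W| <= e}, the variable |D| is a
   function of all the X j which is independent of each single one, while
   P(W + D = 0) stays of order e and E(|W| |D|) is of order e^3. *)
Definition independent_of_coordinate (R : realType)
    (d1 d2 : measure_display) (Omega : measurableType d1)
    (S : measurableType d2) (P : probability Omega R) (n : nat)
    (X : 'I_n -> Omega -> S) (i : 'I_n) (Y : Omega -> R) : Prop :=
  independent_systems P
    (preimage_set_system [set: Omega] (X i) measurable)
    <<s preimage_set_system [set: Omega] Y measurable `|`
        \bigcup_(j in [set j | j != i])
          preimage_set_system [set: Omega] (X j) measurable >>.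

(* Z ~ N(0, I_d), i.e. the law of Z is the d-fold product of N(0, 1). *)
Definition std_gaussian (R : realType) (d1 : measure_display)
    (Omega : measurableType d1) (P : probability Omega R) (d : nat)
    (Z : Omega -> 'cV[R]_d) : Prop :=
  [/\ borel_fun Z,
      forall (j : 'I_d) (B : set R), measurable B ->
        P [set w | B (Z w j 0)] = normal_prob 0 1 B
    & mutually_independent P (fun (j : 'I_d) (w : Omega) => Z w j 0)].

(* Convex sets need not be Borel: A ranges over all the convex sets for which
   both probabilities are defined, in particular over all Borel convex sets. *)
Definition convex_discrepancy (R : realType) (d1 d2 : measure_display)
    (Omega1 : measurableType d1) (Omega2 : measurableType d2)
    (P1 : probability Omega1 R) (P2 : probability Omega2 R) (d : nat)
    (Y : Omega1 -> 'cV[R]_d) (Z : Omega2 -> 'cV[R]_d) : \bar R :=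
  ereal_sup [set `|P1 (Y @^-1` A) - P2 (Z @^-1` A)|%E |
    A in [set A : set 'cV[R]_d |
      [/\ convex_set A, measurable (Y @^-1` A) & measurable (Z @^-1` A)]]].

(* Main.v *)
(* Let s be convex with unit subgradients u, the model case being a maximum of affine functions with
   unit normals, and let f(w) = clamp(s(w) - l) u(w), a monotone vector field. Expanding
   E <W, f(W)> over the independent summands, where replacing Delta by Delta^(i) costs
   E |xi_i| |Delta - Delta^(i)|, bounds the probability that s(W) lies in a slab of random width
   Delta: this is a concentration inequality without dimension-dependent loss beyond
   E |W| <= sqrt d, and it reduces T = W + D to W. The same field and Gaussian integration by parts
   bound the Gaussian measure of a collar of width q by sqrt d q.

   The Berry-Esseen bound for W itself comes from the Ornstein-Uhlenbeck interpolation
   c W + sqrt (1 - c^2) Z of a smoothed indicator of {s <= 0}. Each summand contributes a difference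
   of second Hermite coefficients of the indicator averaged over the other summands. At small times
   the concentration inequality controls it, at larger times a comparison with the Gaussian whose
   error is the bound being proved. That error enters with a factor smaller than 1, so iterating
   closes the argument.

   Finally a convex set is, up to enlarging it by an arbitrarily small amount, a countable
   intersection of half-spaces, hence a decreasing limit of sets {s <= 0}. *)

Require Import Defs.
From HB Require Import structures.
From mathcomp Require Import all_boot all_order all_algebra.
From mathcomp Require Import all_classical all_reals all_analysis.
From mathcomp Require Import measurable_realfun lebesgue_integral_under.
From mathcomp Require Import ring lra.

Set Implicit Arguments.
Unset Strict Implicit.
Unset Printing Implicit Defensive.

Import Order.TTheory GRing.Theory Num.Theory.
Import numFieldNormedType.Exports.

Local Open Scope classical_set_scope.
Local Open Scope ring_scope.

(** * Euclidean geometry of column vectors *)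

Section euclidean.
Context {R : realType} {d : nat}.
Implicit Types x y z : 'cV[R]_d.

(** The class of functions with unit subgradients is stable under adding constants, under
    [x |-> s (c x + v) / c] and under maxima, so one collar bound serves every conditioned and
    rescaled copy of the problem. At Ornstein-Uhlenbeck time t, with lam of order t^(-1/2), moving
    by a summand changes the rescaled second derivative by lam^3 |xi|, which is not integrable near
    t = 0. In the variable x = sqrt (2 t), the comparison with the Gaussian is therefore used only
    for x >= max (40 g, |xi|), where the integral of lam^3 is at most 1 / max (40 g, |xi|). With K
    the bound being proved, this costs at most 7/80 (K / g) |xi| per summand, hence 7/40 K in total:
    the smoothing width 40 g is chosen for this contraction. The other terms are of order sqrt d g,
    and 50 + 2 (125/4 + 7/2) 5/3 + 21/2 < 215 (1 - 7/40) gives the constant 215, to which the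
    nonlinear part adds 15. Time is discretised and the errors are sent to 0. The indicator is
    smoothed through a Moreau envelope, whose second differences are bounded independently of the
    dimension. *)

Definition dot x y : R := \sum_(j < d) x j 0 * y j 0.

Lemma dotC x y : dot x y = dot y x.
Proof. by apply: eq_bigr => j _; rewrite mulrC. Qed.

Lemma dotDl x y z : dot (x + y) z = dot x z + dot y z.
Proof. by rewrite -big_split; apply: eq_bigr => j _; rewrite mxE mulrDl. Qed.

Lemma dotDr x y z : dot z (x + y) = dot z x + dot z y.
Proof. by rewrite dotC dotDl !(dotC z). Qed.

Lemma dotZl a x y : dot (a *: x) y = a * dot x y.
Proof. by rewrite mulr_sumr; apply: eq_bigr => j _; rewrite mxE mulrA. Qed.

Lemma dotZr a x y : dot x (a *: y) = a * dot x y.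
Proof. by rewrite dotC dotZl dotC. Qed.

Lemma dotNl x y : dot (- x) y = - dot x y.
Proof. by rewrite -scaleN1r dotZl mulN1r. Qed.

Lemma dotNr x y : dot x (- y) = - dot x y.
Proof. by rewrite dotC dotNl dotC. Qed.

Lemma dotBl x y z : dot (x - y) z = dot x z - dot y z.
Proof. by rewrite dotDl dotNl. Qed.

Lemma dotBr x y z : dot z (x - y) = dot z x - dot z y.
Proof. by rewrite dotDr dotNr. Qed.

Lemma dot0l x : dot 0 x = 0.
Proof. by apply: big1 => j _; rewrite mxE mul0r. Qed.

Lemma dot0r x : dot x 0 = 0.
Proof. by rewrite dotC dot0l. Qed.

Lemma dot_suml (I : Type) (r : seq I) (f : I -> 'cV[R]_d) y :
  dot (\sum_(i <- r) f i) y = \sum_(i <- r) dot (f i) y.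
Proof.
elim: r => [|i r IH]; first by rewrite !big_nil dot0l.
by rewrite !big_cons dotDl IH.
Qed.

Lemma dotxx_ge0 x : 0 <= dot x x.
Proof. by apply: sumr_ge0 => j _; rewrite -expr2 sqr_ge0. Qed.

Lemma enormE x : enorm x = Num.sqrt (dot x x).
Proof. by congr Num.sqrt; apply: eq_bigr => j _; rewrite expr2. Qed.

Lemma enorm_ge0 x : 0 <= enorm x.
Proof. by rewrite enormE sqrtr_ge0. Qed.

Lemma sqr_enorm x : enorm x ^+ 2 = dot x x.
Proof. by rewrite enormE sqr_sqrtr// dotxx_ge0. Qed.

Lemma enorm0 : enorm (0 : 'cV[R]_d) = 0.
Proof. by rewrite enormE dot0l sqrtr0. Qed.

Lemma dot_le x y : dot x y <= enorm x * enorm y.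
Proof.
have q t : 0 <= t ^+ 2 * dot x x - 2 * t * dot x y + dot y y.
  have := dotxx_ge0 (t *: x - y); rewrite dotBl !dotBr !dotZl !dotZr (dotC y x).
  by nra.
have nx := enorm_ge0 x; have ny := enorm_ge0 y.
have x2 := sqr_enorm x; have y2 := sqr_enorm y.
have [x0|x0] := eqVneq (enorm x) 0.
  rewrite x0 mul0r leNgt; apply/negP => xy0.
  (* Since |x| = 0 the quadratic is affine in [t]; at this [t] it equals -1. *)
  have := q ((dot y y + 1) / (2 * dot x y)).
  rewrite -x2 x0 expr0n /= mulr0 sub0r.
  have -> : 2 * ((dot y y + 1) / (2 * dot x y)) * dot x y = dot y y + 1.
    by field; rewrite gt_eqF.
  by lra.
have {}x0 : 0 < enorm x by rewrite lt_def x0.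
have := q (enorm y / enorm x); rewrite -x2 -y2 => {}q.
have e1 : (enorm y / enorm x) ^+ 2 * enorm x ^+ 2 = enorm y ^+ 2.
  by field; rewrite gt_eqF.
rewrite e1 in q.
have : enorm y / enorm x * dot x y <= enorm y ^+ 2 by nra.
rewrite -(ler_pM2l x0) mulrA mulrCA divff ?gt_eqF// mulr1 => h.
have [y0|y0] := eqVneq (enorm y) 0; last first.
  have {}y0 : 0 < enorm y by rewrite lt_def y0.
  by rewrite -(ler_pM2l y0) (le_trans h)//; nra.
rewrite y0 mulr0 leNgt; apply/negP => xy0.
have yy0 : dot y y = 0 by rewrite -y2 y0 expr0n.
have zy : forall j, y j 0 = 0.
  move=> j; have := yy0; rewrite /dot => /eqP.
  rewrite psumr_eq0; last by move=> i _; rewrite -expr2 sqr_ge0.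
  by move=> /allP/(_ j (mem_index_enum _))/=; rewrite -expr2 sqrf_eq0 => /eqP.
by move: xy0; rewrite /dot big1 ?ltxx// => j _; rewrite zy mulr0.
Qed.

Lemma dot_le_abs x y : `|dot x y| <= enorm x * enorm y.
Proof.
rewrite ler_norml dot_le andbT lerNl -dotNl (le_trans (dot_le _ _))//.
by rewrite !enormE dotNl dotNr opprK.
Qed.

Lemma enormD x y : enorm (x + y) <= enorm x + enorm y.
Proof.
have nx := enorm_ge0 x; have ny := enorm_ge0 y.
rewrite -ler_sqr ?nnegrE ?enorm_ge0 ?addr_ge0//.
rewrite sqr_enorm dotDl !dotDr -!sqr_enorm (dotC y x).
by have := dot_le x y; nra.
Qed.

Lemma enormZ a x : enorm (a *: x) = `|a| * enorm x.
Proof.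
rewrite !enormE dotZl dotZr mulrA -expr2 sqrtrM ?sqr_ge0//.
by rewrite sqrtr_sqr.
Qed.

Lemma enormN x : enorm (- x) = enorm x.
Proof. by rewrite -scaleN1r enormZ normrN1 mul1r. Qed.

Lemma enormB x y : enorm (x - y) <= enorm x + enorm y.
Proof. by rewrite (le_trans (enormD _ _))// enormN. Qed.

Lemma enorm_distC x y : enorm (x - y) = enorm (y - x).
Proof. by rewrite -enormN opprB. Qed.

Lemma coord_le_enorm x j : `|x j 0| <= enorm x.
Proof.
rewrite -sqrtr_sqr enormE ler_sqrt ?dotxx_ge0//.
rewrite /dot (bigD1 j)//= expr2 lerDl.
by apply: sumr_ge0 => i _; rewrite -expr2 sqr_ge0.
Qed.

Lemma enorm_le_sum x : enorm x <= \sum_(j < d) `|x j 0|.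
Proof.
have s0 : 0 <= \sum_(j < d) `|x j 0| by apply: sumr_ge0.
rewrite -ler_sqr ?nnegrE ?enorm_ge0// sqr_enorm /dot expr2 mulr_suml.
apply: ler_sum => j _.
rewrite -expr2 -real_normK ?num_real// expr2 ler_wpM2l//.
by rewrite (bigD1 j)//= lerDl sumr_ge0.
Qed.

Definition bvec (j : 'I_d) : 'cV[R]_d := delta_mx j 0.

Lemma dot_bvec x j : dot x (bvec j) = x j 0.
Proof.
rewrite /dot (bigD1 j)//= mxE !eqxx mulr1 big1 ?addr0// => i /negPf ij.
by rewrite mxE ij mulr0.
Qed.

Lemma enorm_bvec j : enorm (bvec j) = 1.
Proof. by rewrite enormE dot_bvec mxE !eqxx sqrtr1. Qed.

Lemma sum_bvec x : \sum_j x j 0 *: bvec j = x.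
Proof.
apply/colP => i; rewrite summxE (bigD1 i)//= !mxE !eqxx mulr1 big1 ?addr0//.
by move=> j /negPf ji; rewrite !mxE eq_sym ji mulr0.
Qed.

End euclidean.

(** * Borel measurability by coordinates *)

Notation Rd R d := (g_sigma_algebraType (@open 'cV[R]_d)).

(** Coordinatewise form of Borel measurability (see [cmeas_borel] and [borel_cmeas]), which reduces
    closure properties to those of real functions. *)
Definition cmeas (R : realType) (d : nat) (disp : measure_display) (S : measurableType disp)
    (f : S -> 'cV[R]_d) : Prop :=
  forall j, measurable_fun [set: S] (fun x => f x j 0).

Section borel.
Context {R : realType} {d : nat}.
Implicit Types (disp : measure_display).

(** An open set is the countable union of the rational boxes that it contains, and the preimage of a
    box is a finite intersection of coordinate conditions. *)
Lemma cmeas_borel disp (S : measurableType disp) (f : S -> 'cV[R]_d) :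
  cmeas f -> measurable_fun [set: S] (f : S -> Rd R d).
Proof.
move=> mf; apply: (@measurability _ _ S (Rd R d) setT f (@open 'cV[R]_d) erefl).
move=> _ [U oU <-]; rewrite setTI.
pose box (p : 'cV[rat]_d * nat) := [set x : 'cV[R]_d |
  forall j, `|x j 0 - ratr (p.1 j 0)| < p.2.+1%:R^-1].
have -> : f @^-1` U = \bigcup_(p : 'cV[rat]_d * nat)
    (if `[< box p `<=` U >] then f @^-1` box p else set0).
  apply/seteqP; split => [w Uw|w [p _]]; last first.
    by case: asboolP => // pU /pU.
  have /nbhs_ballP[e /= e0 eU] := open_nbhs_nbhs (conj oU Uw).
  (* Half of [e]: both the distance from [f w] to the rational centre and the radius of the box are
     below [n.+1%:R^-1]. *)
  have [n ne] : exists n, n.+1%:R^-1 < e / 2.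
    have e2 : 0 < e / 2 by rewrite divr_gt0.
    have [n _ nP] := near_infty_natSinv_lt (PosNum e2).
    by exists n; exact: (nP n (leqnn n)).
  have q j : exists q : rat, `|f w j 0 - ratr q| < n.+1%:R^-1.
    have : f w j 0 - n.+1%:R^-1 < f w j 0 + n.+1%:R^-1.
      by rewrite ltrBlDr -addrA ltrDl addr_gt0// invr_gt0.
    move=> /rat_in_itvoo[q]; rewrite in_itv/= => qP; exists q.
    by rewrite ltr_distlC.
  have [Q QP] := choice q.
  exists (\col_j Q j, n) => //; rewrite asboolT.
    by move=> j; rewrite mxE.
  move=> x xP; apply: eU; split => // i j; rewrite ord1.
  have := xP i; have := QP i; rewrite /ball/= mxE.
  move=> h1 h2; rewrite (le_lt_trans (ler_distD (ratr (Q i)) _ _))//.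
  rewrite [ltRHS](splitr e) ltrD//; first exact: lt_trans ne.
  by rewrite distrC; exact: lt_trans ne.
apply: countable_bigcupT_measurable => // p.
case: ifPn => // _.
have -> : f @^-1` box p = \bigcap_(j in [set: 'I_d])
    ((fun w => `|f w j 0 - ratr (p.1 j 0)|) @^-1` `]-oo, p.2.+1%:R^-1[).
  apply/seteqP; split => [w wP j _|w wP j].
    by rewrite /= in_itv/=; exact: wP.
  by have := wP j Logic.I; rewrite /= in_itv.
apply: fin_bigcap_measurable => [|j _]; first exact: finite_finset.
rewrite -[X in measurable X]setTI.
have : measurable_fun setT (fun w => `|f w j 0 - ratr (p.1 j 0)|).
  by apply: measurableT_comp => //; apply: measurable_funB.
by apply.
Qed.

Lemma coord_borel (j : 'I_d) :
  measurable_fun [set: Rd R d] (fun x : Rd R d => x j 0).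
Proof.
apply: (measurability _ (RGenOpens.measurableE R)).
move=> _ [_ [a [b ->] <-]]; rewrite setTI; apply: sub_sigma_algebra.
apply: (@open_comp _ _ (fun x : 'cV[R]_d => x j 0)).
  by move=> x _; exact: coord_continuous.
exact: interval_open.
Qed.

Lemma borel_cmeas disp (S : measurableType disp) (f : S -> 'cV[R]_d) :
  measurable_fun [set: S] (f : S -> Rd R d) -> cmeas f.
Proof. by move=> mf j; exact: measurableT_comp (coord_borel j) mf. Qed.

Lemma cmeasD disp (S : measurableType disp) (f g : S -> 'cV[R]_d) :
  cmeas f -> cmeas g -> cmeas (fun w => f w + g w).
Proof.
by move=> mf mg j; under eq_fun do rewrite mxE; exact: measurable_funD.
Qed.

Lemma cmeasB disp (S : measurableType disp) (f g : S -> 'cV[R]_d) :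
  cmeas f -> cmeas g -> cmeas (fun w => f w - g w).
Proof.
by move=> mf mg j; under eq_fun do rewrite !mxE; exact: measurable_funB.
Qed.

Lemma cmeasZ disp (S : measurableType disp) (a : S -> R) (f : S -> 'cV[R]_d) :
  measurable_fun setT a -> cmeas f -> cmeas (fun w => a w *: f w).
Proof.
by move=> ma mf j; under eq_fun do rewrite !mxE; exact: measurable_funM.
Qed.

Lemma cmeas_cst disp (S : measurableType disp) (x : 'cV[R]_d) :
  cmeas (fun _ : S => x).
Proof. by move=> j. Qed.

Lemma cmeas_comp disp disp' (S : measurableType disp) (S' : measurableType disp')
    (f : S' -> 'cV[R]_d) (g : S -> S') :
  cmeas f -> measurable_fun setT g -> cmeas (fun w => f (g w)).
Proof. by move=> mf mg j; exact: measurableT_comp (mf j) mg. Qed.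

Lemma cmeas_sum disp (S : measurableType disp) (I : Type) (r : seq I)
    (p : pred I) (f : I -> S -> 'cV[R]_d) :
  (forall i, cmeas (f i)) -> cmeas (fun w => \sum_(i <- r | p i) f i w).
Proof.
move=> mf j; under eq_fun do rewrite summxE -big_filter.
apply: measurable_sum => i; exact: mf.
Qed.

Lemma cmeas_dot disp (S : measurableType disp) (f g : S -> 'cV[R]_d) :
  cmeas f -> cmeas g -> measurable_fun setT (fun w => dot (f w) (g w)).
Proof.
by move=> mf mg; apply: measurable_sum => j; exact: measurable_funM.
Qed.

Lemma cmeas_enorm disp (S : measurableType disp) (f : S -> 'cV[R]_d) :
  cmeas f -> measurable_fun setT (fun w => enorm (f w)).
Proof.
move=> mf; under eq_fun do rewrite enormE.
apply: (measurableT_comp (continuous_measurable_fun (@sqrt_continuous R))).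
exact: cmeas_dot.
Qed.

Definition lip (L : R) (f : 'cV[R]_d -> R) :=
  forall x y, `|f x - f y| <= L * enorm (x - y).

(** The topology comes from the sup norm, and [enorm x] is at most [d] times the sup norm of [x];
    hence [lip] gives continuity. *)
Lemma lip_borel L f : lip L f -> measurable_fun [set: Rd R d] (f : Rd R d -> R).
Proof.
move=> lf; apply: (measurability _ (RGenOpens.measurableE R)).
move=> _ [_ [a [b ->] <-]]; rewrite setTI; apply: sub_sigma_algebra.
apply: (@open_comp _ _ (f : 'cV[R]_d -> R)); last exact: interval_open.
move=> x _; apply/(@cvgrPdist_lt _ R _ (nbhs (x : 'cV[R]_d)) _ f) => e e0.
pose K := `|L| * d%:R + 1.
have K0 : 0 < K by rewrite ltr_pwDr// mulr_ge0.
apply/nbhs_ballP; exists (e / K); first exact: divr_gt0.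
move=> y [_ xy]; rewrite (le_lt_trans (lf _ _))//.
apply: (@le_lt_trans _ _ (`|L| * (d%:R * (e / K)))).
  apply: (@le_trans _ _ (`|L| * enorm (x - y))).
    by rewrite ler_wpM2r ?enorm_ge0// ler_norm.
  rewrite ler_wpM2l// (le_trans (enorm_le_sum _))//.
  rewrite mulr_natl -[X in _ *+ X]card_ord -sumr_const ler_sum// => j _.
  by rewrite !mxE ltW//; exact: xy.
have -> : `|L| * (d%:R * (e / K)) = e * (`|L| * d%:R / K) by ring.
by rewrite gtr_pMr// ltr_pdivrMr// mul1r ltrDl.
Qed.

End borel.

Lemma sublevel_meas d (T : measurableType d) (R : realType) (Y : T -> R) t :
  measurable_fun setT Y -> measurable [set w | Y w <= t].
Proof.
move=> mY; have := mY measurableT `]-oo, t]%classic (measurable_itv _).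
by rewrite setTI; congr measurable; apply/seteqP; split => w /=; rewrite in_itv.
Qed.

Lemma slab_meas d (T : measurableType d) (R : realType) (Y : T -> R) lo hi :
  measurable_fun setT Y -> measurable [set w | lo <= Y w <= hi].
Proof.
move=> mY; have := mY measurableT `[lo, hi]%classic (measurable_itv _).
by rewrite setTI; congr measurable; apply/seteqP; split => w /=; rewrite in_itv.
Qed.

(** * Real-valued expectations and Fubini's theorem *)

Definition itg d (T : measurableType d) (R : realType) (P : {measure set T -> \bar R}) (f : T -> R) :=
  P.-integrable setT (EFin \o f).

(** [Rintegral] takes the value 0 when the integral is infinite; this is why the rules below carry
    [itg] hypotheses. *)
Definition Ex d (T : measurableType d) (R : realType) (P : {measure set T -> \bar R}) (f : T -> R) : R :=
  Rintegral P setT f.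

Section expectation.
Context d (T : measurableType d) (R : realType).

Section gen.
Variable P : {measure set T -> \bar R}.
Implicit Types f g : T -> R.

Lemma itg_meas f : itg P f -> measurable_fun setT f.
Proof. by move=> /measurable_int/measurable_EFinP. Qed.

Lemma itgD f g : itg P f -> itg P g -> itg P (fun w => f w + g w).
Proof. by move=> If Ig; exact: integrableD If Ig. Qed.

Lemma itgB f g : itg P f -> itg P g -> itg P (fun w => f w - g w).
Proof. by move=> If Ig; exact: integrableB If Ig. Qed.

Lemma itgZ a f : itg P f -> itg P (fun w => a * f w).
Proof. by move=> If; exact: integrableZl If. Qed.

Lemma itg_sum I (r : seq I) (p : pred I) (f : I -> T -> R) :
  (forall i, p i -> itg P (f i)) -> itg P (fun w => \sum_(i <- r | p i) f i w).
Proof.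
move=> If; have := @integrable_sum _ T R P setT measurableT I r p (fun i => EFin \o f i) If.
by apply: eq_integrable => // w _ /=; rewrite sumEFin.
Qed.

Lemma itg_le f g : measurable_fun setT f -> itg P g ->
  (forall w, `|f w| <= g w) -> itg P f.
Proof.
move=> mf Ig fg; apply: (le_integrable measurableT _ _ Ig).
  exact/measurable_EFinP.
by move=> w _ /=; rewrite lee_fin (le_trans (fg w))// ler_norm.
Qed.

Lemma itg_abs f : itg P f -> itg P (fun w => `|f w|).
Proof. exact: integrable_norm. Qed.

Lemma itg_fin f : itg P f -> (\int[P]_w (f w)%:E)%E = (Ex P f)%:E.
Proof. by move=> If; rewrite /Ex /Rintegral fineK// integrable_fin_num. Qed.

Lemma ExD f g : itg P f -> itg P g ->
  Ex P (fun w => f w + g w) = Ex P f + Ex P g.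
Proof. exact: RintegralD. Qed.

Lemma ExB f g : itg P f -> itg P g ->
  Ex P (fun w => f w - g w) = Ex P f - Ex P g.
Proof. exact: RintegralB. Qed.

Lemma ExZ a f : itg P f -> Ex P (fun w => a * f w) = a * Ex P f.
Proof. exact: RintegralZl. Qed.

Lemma Ex0 : Ex P (fun=> 0) = 0.
Proof. by rewrite /Ex /Rintegral integral0. Qed.

Lemma Ex_sum I (r : seq I) (p : pred I) (f : I -> T -> R) :
  (forall i, p i -> itg P (f i)) ->
  Ex P (fun w => \sum_(i <- r | p i) f i w) = \sum_(i <- r | p i) Ex P (f i).
Proof.
move=> If; elim: r => [|i r IH].
  rewrite big_nil (_ : (fun w => _) = fun=> 0) ?Ex0//.
  by apply/funext => w; rewrite big_nil.
rewrite big_cons; case: ifPn => pi.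
  rewrite -IH -ExD; [|exact: If|exact: itg_sum].
  by congr Ex; apply/funext => w; rewrite big_cons pi.
by rewrite -IH; congr Ex; apply/funext => w; rewrite big_cons (negPf pi).
Qed.

Lemma Ex_le f g : itg P f -> itg P g -> (forall w, f w <= g w) ->
  Ex P f <= Ex P g.
Proof. by move=> If Ig fg; apply: le_Rintegral. Qed.

Lemma Ex_ge0 f : (forall w, 0 <= f w) -> 0 <= Ex P f.
Proof. by move=> f0; apply: Rintegral_ge0. Qed.

Lemma Ex_abs f : itg P f -> `|Ex P f| <= Ex P (fun w => `|f w|).
Proof. by move=> If; apply: le_normr_Rintegral. Qed.

Lemma Ex_ext f g : f =1 g -> Ex P f = Ex P g.
Proof. by move=> /funext->. Qed.

Lemma itg_ext f g : f =1 g -> itg P f -> itg P g.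
Proof. by move=> /funext->. Qed.

End gen.

Section prob.
Variable P : probability T R.
Implicit Types f g : T -> R.

Lemma Ex_cst c : Ex P (fun=> c) = c.
Proof. by rewrite /Ex Rintegral_cst// [X in fine X]probability_setT mulr1. Qed.

Lemma itg_cst c : itg P (fun=> c).
Proof. exact: finite_measure_integrable_cst. Qed.

Lemma itg_bnd f M : measurable_fun setT f -> (forall w, `|f w| <= M) -> itg P f.
Proof. by move=> mf fM; exact: itg_le mf (itg_cst M) fM. Qed.

Lemma Ex_bnd f M : measurable_fun setT f -> (forall w, `|f w| <= M) ->
  `|Ex P f| <= M.
Proof.
move=> mf fM; have If := itg_bnd mf fM.
rewrite (le_trans (Ex_abs If))// -[leRHS]Ex_cst Ex_le//.
  exact: itg_abs.
exact: itg_cst.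
Qed.

Definition pr (A : set T) : R := fine (P A).

Lemma pr_ge0 A : 0 <= pr A.
Proof. exact: fine_ge0. Qed.

Lemma pr_fin A : measurable A -> P A = (pr A)%:E.
Proof. by move=> mA; rewrite fineK// fin_num_measure. Qed.

Lemma pr_le1 A : measurable A -> pr A <= 1.
Proof. by move=> mA; rewrite -lee_fin -pr_fin// probability_le1. Qed.

Lemma le_pr A B : measurable A -> measurable B -> A `<=` B -> pr A <= pr B.
Proof.
by move=> mA mB AB; rewrite -lee_fin -!pr_fin//; apply: le_measure; rewrite ?inE.
Qed.

Lemma pr_setU A B : measurable A -> measurable B -> pr (A `|` B) <= pr A + pr B.
Proof.
move=> mA mB; rewrite -lee_fin EFinD -!pr_fin//; last exact: measurableU.
exact: measureU2.
Qed.

Lemma Ex_indic A : measurable A -> Ex P (fun w => \1_A w) = pr A.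
Proof.
by move=> mA; rewrite /Ex /Rintegral integral_indic// setIT.
Qed.

Lemma itg_indic A : measurable A -> itg P (fun w => \1_A w).
Proof. by move=> mA; exact: integrable_indic. Qed.

End prob.

Lemma itgM_bnd (P : {measure set T -> \bar R}) (f g : T -> R) M :
  measurable_fun setT f -> (forall w, `|f w| <= M) -> itg P g ->
  itg P (fun w => f w * g w).
Proof.
move=> mf fM Ig; apply: (@itg_le _ _ (fun w => M * `|g w|)).
- by apply: measurable_funM => //; exact: itg_meas Ig.
- exact/itgZ/itg_abs.
- by move=> w; rewrite normrM ler_wpM2r.
Qed.

End expectation.

Section fubini.
Context d1 d2 (T1 : measurableType d1) (T2 : measurableType d2) (R : realType).
Variables (P : {sigma_finite_measure set T1 -> \bar R})
  (Q : {sigma_finite_measure set T2 -> \bar R}).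
Variables (f : T1 -> T2 -> R) (a : T1 -> R) (b : T2 -> R).
Hypothesis mf : measurable_fun setT (fun x : T1 * T2 => f x.1 x.2).
Hypothesis Ia : itg P a.
Hypothesis Ib : itg Q b.
Hypothesis fab : forall x y, `|f x y| <= a x * b y.

Let mf1 x : measurable_fun setT (f x).
Proof. exact: measurableT_comp mf (pair1_measurable x). Qed.

Let mf2 y : measurable_fun setT (f ^~ y).
Proof. exact: measurableT_comp mf (pair2_measurable y). Qed.

Lemma dom_itg1 x : itg Q (f x).
Proof.
apply: (@itg_le _ _ _ _ _ (fun y => a x * b y)) => //; exact: itgZ.
Qed.

Lemma dom_itg2 y : itg P (f ^~ y).
Proof.
apply: (@itg_le _ _ _ _ _ (fun x => b y * a x)) => //; first exact: itgZ.
by move=> x; rewrite mulrC.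
Qed.

Let mprod : measurable_fun setT (fun x : T1 * T2 => (f x.1 x.2)%:E).
Proof. exact/measurable_EFinP. Qed.

(** The product bound makes the iterated integral of [|f|] at most the integral of [|a|] times that
    of [|b|], so integrability on the product reduces to one-variable integrability. *)
Lemma dom_itg : (P \x Q)%E.-integrable setT (fun x : T1 * T2 => (f x.1 x.2)%:E).
Proof.
apply/integrable12ltyP => //.
apply: (@le_lt_trans _ _ (\int[P]_x (`|a x| * Ex Q (fun y => `|b y|))%:E)%E).
  apply: ge0_le_integral => //.
  - by move=> x _; exact: integral_ge0.
  - apply: (@measurable_fun_fubini_tonelli_F _ _ _ _ _ Q
      (fun x : T1 * T2 => `|f x.1 x.2|%:E)) => //.
    by apply/measurable_EFinP; exact: measurableT_comp.
  - by apply/measurable_EFinP/measurable_funM => //; apply: measurableT_comp => //; exact: itg_meas Ia.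
  - move=> x _.
    have I1 : itg Q (fun y => `|a x| * `|b y|) by exact/itgZ/itg_abs.
    rewrite -ExZ; last exact: itg_abs.
    rewrite -itg_fin//; apply: ge0_le_integral => //.
    + by apply: measurableT_comp => //; exact/measurable_EFinP/mf1.
    + by apply/measurable_EFinP; exact: itg_meas I1.
    + by move=> y _; rewrite lee_fin -normrM (le_trans (fab x y))// ler_norm.
rewrite (@itg_fin _ _ _ P (fun x => `|a x| * Ex Q (fun y => `|b y|))) ?ltry//.
apply: (@itg_ext _ _ _ _ (fun x => Ex Q (fun y => `|b y|) * `|a x|)).
  by move=> x; rewrite mulrC.
exact/itgZ/itg_abs.
Qed.

Let Ie (x : T1) : (\int[Q]_y (f x y)%:E)%E = (Ex Q (f x))%:E.
Proof. by rewrite itg_fin//; exact: dom_itg1. Qed.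

Let Ie2 (y : T2) : (\int[P]_x (f x y)%:E)%E = (Ex P (f ^~ y))%:E.
Proof. by rewrite itg_fin//; exact: dom_itg2. Qed.

Lemma Ex_prod1 : itg P (fun x => Ex Q (f x)) /\
  Ex P (fun x => Ex Q (f x)) = Ex (P \x Q)%E (fun x : T1 * T2 => f x.1 x.2).
Proof.
split.
  have := integrable_fubini_F dom_itg; rewrite /fubini_F.
  by apply: eq_integrable => // x _ /=; rewrite Ie.
rewrite /Ex /Rintegral -(integral12_prod_meas1 dom_itg); congr fine.
by apply: eq_integral => x _; rewrite /fubini_F/= Ie.
Qed.

Lemma Ex_prod2 : itg Q (fun y => Ex P (f ^~ y)) /\
  Ex Q (fun y => Ex P (f ^~ y)) = Ex (P \x Q)%E (fun x : T1 * T2 => f x.1 x.2).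
Proof.
split.
  apply: (@itg_le _ _ _ _ _ (fun y => Ex P (fun x => `|a x|) * `|b y|)).
  - apply/measurable_EFinP; have := measurable_fubini_G dom_itg.
    by rewrite /fubini_G; under eq_fun do rewrite Ie2.
  - exact/itgZ/itg_abs.
  - move=> y; rewrite (le_trans (Ex_abs (dom_itg2 y)))// mulrC -ExZ; last exact: itg_abs.
    apply: Ex_le; [exact/itg_abs/dom_itg2|exact/itgZ/itg_abs|move=> x].
    by rewrite mulrC -normrM (le_trans (fab x y))// ler_norm.
rewrite /Ex /Rintegral -(integral21_prod_meas1 dom_itg); congr fine.
by apply: eq_integral => x _; rewrite /fubini_G/= Ie2.
Qed.

Lemma Ex_swap : Ex P (fun x => Ex Q (f x)) = Ex Q (fun y => Ex P (f ^~ y)).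
Proof. by rewrite Ex_prod1.2 Ex_prod2.2. Qed.

End fubini.

(** * Independence *)

Section independence.
Context d (T : measurableType d) (R : realType) (P : probability T R).
Local Open Scope ereal_scope.

Definition indep2 d1 d2 (S1 : measurableType d1) (S2 : measurableType d2)
    (U : T -> S1) (V : T -> S2) :=
  forall A B, measurable A -> measurable B ->
    P (U @^-1` A `&` V @^-1` B) = P (U @^-1` A) * P (V @^-1` B).

Section pair.
Context d1 d2 (S1 : measurableType d1) (S2 : measurableType d2).
Variables (U : T -> S1) (V : T -> S2).
Hypothesis mU : measurable_fun setT U.
Hypothesis mV : measurable_fun setT V.

Let U' : {mfun T >-> S1} := mfun_Sub (mem_set mU).
Let V' : {mfun T >-> S2} := mfun_Sub (mem_set mV).
Let UV' : {mfun T >-> (S1 * S2)%type} :=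
  mfun_Sub (mem_set (measurable_fun_pair mU mV)).

(** By uniqueness of the product measure, the joint law of [U] and [V] is the product of their laws,
    and Tonelli applies. Both integrals are pulled back to [T], so that laws do not appear
    afterwards. *)
Lemma indep2_integral (Phi : S1 * S2 -> \bar R) : indep2 U V ->
  measurable_fun setT Phi -> (forall x, 0 <= Phi x) ->
  \int[P]_w Phi (U w, V w) = \int[P]_w1 \int[P]_w2 Phi (U w1, V w2).
Proof.
move=> iUV mPhi Phi0.
have -> : \int[P]_w Phi (U w, V w) = \int[distribution P UV']_x Phi x.
  by rewrite ge0_integral_distribution.
have E X : measurable X ->
    (distribution P U' \x distribution P V') X = distribution P UV' X.
  move=> mX; apply: product_measure_unique => //.
rewrite (eq_measure_integral (distribution P U' \x distribution P V')); last first.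
  by move=> A mA _; exact/esym/E.
rewrite fubini_tonelli1//.
rewrite ge0_integral_distribution//; last 2 first.
- exact: measurable_fun_fubini_tonelli_F.
- by move=> x; exact: integral_ge0.
apply: eq_integral => w _; rewrite /fubini_F /=.
rewrite ge0_integral_distribution//.
exact: measurableT_comp mPhi (pair1_measurable _).
Qed.

End pair.
End independence.

Section grouping.
Context d1 d2 (Omega : measurableType d1) (S : measurableType d2) (R : realType).
Variables (P : probability Omega R) (n : nat) (X : 'I_n -> Omega -> S).
Hypothesis mX : forall i, measurable_fun setT (X i).

Definition other_events (i : 'I_n) (Y : Omega -> R) : set (set Omega) :=
  preimage_set_system [set: Omega] Y measurable `|`
    \bigcup_(j in [set j | j != i]) preimage_set_system [set: Omega] (X j) measurable.

(** [Omega] with a coarser sigma-algebra: a map measurable from this space is a function of [Y] and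
    of the [X j] with [j != i], and inherits their independence of [X i]. *)
Definition others i Y := g_sigma_algebraType (other_events i Y).

Lemma meas_other i Y j : j != i -> measurable_fun setT (X j : others i Y -> S).
Proof.
move=> ji _ B mB; apply: sub_sigma_algebra; right; exists j => //.
by exists B.
Qed.

Lemma meas_extra i Y : measurable_fun setT (Y : others i Y -> R).
Proof. by move=> _ B mB; apply: sub_sigma_algebra; left; exists B. Qed.

Lemma indep_coord_indep2 i Y d3 (S3 : measurableType d3) (V : Omega -> S3) :
  independent_of_coordinate P X i Y ->
  measurable_fun setT (V : others i Y -> S3) ->
  indep2 P (X i) V.
Proof.
move=> h mV A B mA mB; apply: h.
  by exists A => //; rewrite setTI.
by have := mV measurableT _ mB; rewrite setTI.
Qed.

(** Pi-lambda argument: the rectangles whose side [i] is full are stable under intersection and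
    generate the sigma-algebra of the other coordinates, while the events obeying the product rule
    form a lambda-system. The constant [Y] adds only trivial events. *)
Lemma mutual_indep_coord i : mutually_independent P X ->
  independent_of_coordinate P X i (fun=> 0).
Proof.
move=> indX.
pose C := [set G : set Omega | exists B : 'I_n -> set S,
  [/\ forall j, measurable (B j), B i = setT &
     G = \bigcap_(j in [set: 'I_n]) (X j @^-1` B j)]].
have CI : setI_closed C.
  move=> _ _ [B1 [mB1 B1i ->]] [B2 [mB2 B2i ->]].
  exists (fun j => B1 j `&` B2 j); split.
  - by move=> j; exact: measurableI.
  - by rewrite B1i B2i setIT.
  - by rewrite -bigcapI.
have CT : C setT.
  by exists (fun=> setT); split => //; rewrite bigcapT.
have subC : <<s other_events i (fun=> 0) >> `<=` <<s C >>.
  apply: smallest_sub; first exact: smallest_sigma_algebra.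
  move=> _ [[B mB <-]|[j ji [B mB <-]]].
    rewrite setTI preimage_cst; case: ifPn => _.
      exact: sub_sigma_algebra.
    by have [] := smallest_sigma_algebra setT C.
  apply: sub_sigma_algebra; exists (fun k => if k == j then B else setT); split.
  - by move=> k; case: ifP.
  - by rewrite eq_sym (negbTE ji).
  - rewrite setTI; apply/seteqP; split => [w Bw k _|w /(_ j Logic.I)/=].
      by case: eqP => [->|].
    by rewrite eqxx.
move=> _ G [B mB <-] /subC GC; rewrite setTI.
pose H := [set G : set Omega | measurable G /\
  P (X i @^-1` B `&` G) = (P (X i @^-1` B) * P G)%E].
have mA : measurable (X i @^-1` B).
  by have := @mX i measurableT B mB; rewrite setTI.
suff : <<s C >> `<=` H by move=> /(_ _ GC)[].
apply: lambda_system_subset => //.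
- apply/dynkin_lambda_system; split.
  + by split => //; rewrite setIT probability_setT mule1.
  + move=> K [mK PK]; split; first exact: measurableC.
    rewrite probability_setC// muleBr ?fin_num_measure//.
    rewrite mule1 -PK -measureD//.
    by rewrite ltey_eq fin_num_measure.
  + move=> F tF HF; split; first by apply: bigcup_measurable => k _; have [] := HF k.
    have mF k : measurable (F k) by have [] := HF k.
    rewrite setI_bigcupr !measure_bigcup//=.
    * rewrite (pr_fin P mA) -nneseriesZl//; apply: eq_eseriesr => k _.
      by rewrite -pr_fin//; have [] := HF k.
    * by move=> k _; exact: measurableI.
    * exact: trivIset_setIl.
- move=> _ [D [mD Di ->]]; split.
    apply: fin_bigcap_measurable => [|j _]; first exact: finite_finset.
    by have := @mX j measurableT _ (mD j); rewrite setTI.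
  (* Intersecting with the event on [X i] replaces the full side [D i] by [B]. *)
  pose D' j := if j == i then B else D j.
  have -> : X i @^-1` B `&` \bigcap_(j in [set: 'I_n]) X j @^-1` D j =
      \bigcap_(j in [set: 'I_n]) X j @^-1` D' j.
    apply/seteqP; split=> [w [Bw Dw] j _|w Dw].
      by rewrite /D'; case: eqP => [->//|_]; exact: Dw.
    split; first by have := Dw i Logic.I; rewrite /D' eqxx.
    move=> j _; have := Dw j Logic.I; rewrite /D'; case: eqP => // -> _.
    by rewrite Di.
  rewrite !indX//; last by move=> j; rewrite /D'; case: ifP.
  rewrite (bigD1 i)//= {1}/D' eqxx [in RHS](bigD1 i)//= Di preimage_setT.
  rewrite probability_setT mul1e; congr (_ * _)%E.
  by apply: eq_bigr => j /negbTE ji; rewrite /D' ji.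
Qed.

End grouping.

(** * Gaussian vectors *)

Section gauss1.
Context (R : realType).
Local Open Scope ereal_scope.
Local Notation mu := (@lebesgue_measure R).
Local Notation nu := (@normal_prob R 0 1).
Local Notation phi := (@normal_pdf R 0 1).

(** Change of variables holds for the Radon-Nikodym derivative, which agrees almost everywhere with
    the Gaussian density because both have the same integral over every measurable set. *)
Lemma integral_normal (f : R -> \bar R) : measurable_fun setT f ->
  (forall x, 0 <= f x) -> \int[nu]_x f x = \int[mu]_x (f x * (phi x)%:E).
Proof.
move=> mf f0; have dom := normal_prob_dominates (0 : R) 1%R.
rewrite -(Radon_Nikodym_SigmaFinite.change_of_variables dom)//.
have mR : mu.-integrable setT (Radon_Nikodym_SigmaFinite.f nu mu).
  exact: Radon_Nikodym_SigmaFinite.f_integrable.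
have mphi : measurable_fun setT (EFin \o phi).
  by apply/measurable_EFinP; exact: measurable_normal_pdf.
apply: ae_eq_integral => //.
- by apply: emeasurable_funM => //; exact: measurable_int mR.
- exact: emeasurable_funM.
- apply: ae_eqe_mul2l.
  apply: integral_ae_eq => //.
  move=> E _ mE; rewrite -Radon_Nikodym_SigmaFinite.f_integral//.
Qed.

(** The image of Lebesgue measure under [x |-> b x + a], multiplied by [b], gives every interval its
    length, hence is Lebesgue measure. *)
Lemma lebesgue_affine (a b : R) (f : R -> \bar R) : (0 < b)%R ->
  measurable_fun setT f -> (forall x, 0 <= f x) ->
  b%:E * (\int[mu]_x f (b * x + a)%R) = \int[mu]_x f x.
Proof.
move=> b0 mf f0.
pose T : R -> measurableTypeR R := fun x => (b * x + a)%R.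
have mT : measurable_fun setT T.
  by apply: measurable_funD => //; apply: measurable_funM.
unshelve epose (pm := (pushforward mu T : {measure set (measurableTypeR R) -> \bar R})).
  exact: mT.
pose m := mscale (NngNum (ltW b0)) pm.
have E A : measurable A -> mu A = m A.
  apply: lebesgue_measure_unique => _ [[p q] _ <-].
  rewrite -[RHS]/(b%:E * mu [set x | (T x \in `]p, q])]).
  have -> : [set x | (T x \in `]p, q])] = `]((p - a) / b)%R, ((q - a) / b)%R]%classic.
    apply/seteqP; split => x /=; rewrite !in_itv/= /T.
      by rewrite ltr_pdivrMr// ler_pdivlMr// ltrBlDr lerBrDr (mulrC x).
    by rewrite ltr_pdivrMr// ler_pdivlMr// ltrBlDr lerBrDr (mulrC x).
  rewrite !lebesgue_measure_itv/= !lte_fin ltr_pM2r ?invr_gt0// ltrD2r.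
  case: ifP => pq; last by rewrite mule0.
  by rewrite -!EFinB -EFinM; congr EFin; field; rewrite gt_eqF.
rewrite [RHS](eq_measure_integral m) => [|A mA _]; last exact: E.
by rewrite ge0_integral_mscale// ge0_integral_pushforward.
Qed.

Lemma phiE x : phi x = (normal_peak 1 * expR (- (x ^+ 2) / 2))%R.
Proof.
by rewrite normal_pdfE ?oner_eq0// /normal_fun subr0 expr1n.
Qed.

(** Cameron-Martin formula in dimension one: translate Lebesgue measure and complete the square. *)
Lemma normal_shift (a : R) (f : R -> \bar R) : measurable_fun setT f ->
  (forall x, 0 <= f x) ->
  \int[nu]_x f (x + a)%R = \int[nu]_x (f x * (expR (a * x - a ^+ 2 / 2))%:E).
Proof.
move=> mf f0.
have mE : measurable_fun setT (fun x : R => (expR (a * x - a ^+ 2 / 2))%:E).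
  apply/measurable_EFinP; apply: measurableT_comp => //.
  by apply: measurable_funB => //; exact: measurable_funM.
rewrite !integral_normal//; last 3 first.
- exact: emeasurable_funM.
- by move=> x; rewrite mule_ge0// lee_fin expR_ge0.
- by apply: (measurableT_comp mf); exact: measurable_funD.
rewrite -[RHS](@lebesgue_affine a 1)//; last 2 first.
- apply: emeasurable_funM; first exact: emeasurable_funM.
  by apply/measurable_EFinP; exact: measurable_normal_pdf.
- by move=> x; rewrite !mule_ge0// lee_fin ?expR_ge0// normal_pdf_ge0.
rewrite mul1e; apply: eq_integral => x _.
rewrite mul1r -muleA -EFinM !phiE; congr (_ * _%:E).
by rewrite mulrCA -expRD; congr (_ * expR _)%R; field.
Qed.

(** Rotation invariance in the plane: for independent standard normal x and y, [al x + be y] is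
    again standard normal. *)
Lemma normal_convol (al be : R) (f : R -> \bar R) : (0 < be)%R ->
  (al ^+ 2 + be ^+ 2 = 1)%R -> measurable_fun setT f ->
  (forall x, 0 <= f x) ->
  \int[nu]_x \int[nu]_y f (al * x + be * y)%R = \int[nu]_x f x.
Proof.
move=> be0 e1 mf f0.
have mphi : measurable_fun setT (EFin \o phi).
  by apply/measurable_EFinP; exact: measurable_normal_pdf.
have phi0 x : 0 <= (phi x)%:E by rewrite lee_fin normal_pdf_ge0.
pose K (x u : R) := (phi ((u - al * x) / be))%:E.
have mK1 x : measurable_fun setT (K x).
  apply: (measurableT_comp mphi); apply: measurable_funM => //.
  exact: measurable_funB.
have inner x : \int[nu]_y f (al * x + be * y)%R =
    (be^-1)%:E * \int[mu]_u (f u * K x u).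
  rewrite integral_normal//; last first.
    by apply: (measurableT_comp mf); apply: measurable_funD => //; apply: measurable_funM.
  rewrite -(@lebesgue_affine (al * x)%R be (fun u => f u * K x u))//; last 2 first.
  - exact: emeasurable_funM.
  - by move=> u; rewrite mule_ge0// phi0.
  rewrite muleA -EFinM mulVf ?gt_eqF// mul1e; apply: eq_integral => y _.
  rewrite /K addrK mulrAC divff ?gt_eqF// mul1r addrC//.
under eq_integral do rewrite inner.
have mKK : measurable_fun setT (fun z : R * R => f z.2 * K z.1 z.2).
  apply: emeasurable_funM; first exact: measurableT_comp mf measurable_snd.
  apply: (measurableT_comp mphi); apply: measurable_funM => //.
  by apply: measurable_funB => //; apply: measurable_funM.
have K0 x u : 0 <= f u * K x u by rewrite mule_ge0// phi0.
rewrite [LHS]integral_normal; last 2 first.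
- apply: emeasurable_funM => //.
  exact: (@measurable_fun_fubini_tonelli_F _ _ _ _ _ mu _ mKK).
- by move=> x; rewrite mule_ge0 ?lee_fin ?invr_ge0 ?(ltW be0)// integral_ge0.
have be10 : 0 <= (be^-1)%:E by rewrite lee_fin invr_ge0 ltW.
transitivity (\int[mu]_x \int[mu]_u ((phi x)%:E * ((be^-1)%:E * (f u * K x u)))).
  apply: eq_integral => x _; have mfK : measurable_fun setT (fun u => f u * K x u) by exact: emeasurable_funM.
  have mfK' : measurable_fun setT (fun u => (be^-1)%:E * (f u * K x u)).
    exact: emeasurable_funM.
  rewrite muleC -[X in _ * X]ge0_integralZl// -ge0_integralZl//.
  by move=> u _; exact: mule_ge0.
rewrite (@fubini_tonelli _ _ _ _ _ mu mu
  (fun z : R * R => (phi z.1)%:E * ((be^-1)%:E * (f z.2 * K z.1 z.2))))/=; last 2 first.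
- apply: emeasurable_funM; first exact: (measurableT_comp mphi measurable_fst).
  exact: emeasurable_funM.
- by move=> x; apply: mule_ge0 => //; exact: mule_ge0.
rewrite integral_normal//; apply: eq_integral => u _.
(* Bayes' rule for a Gaussian pair with correlation [al]: the joint density of x and u is the
   density of u times that of x given u, and the latter integrates to 1. *)
have key x : (phi x)%:E * ((be^-1)%:E * (f u * K x u)) =
    (f u * (phi u)%:E) * ((be^-1)%:E * (phi (be^-1 * x + - al * u / be))%:E).
  rewrite (muleCA (be^-1)%:E) (muleCA (phi x)%:E (f u)) -[RHS]muleA.
  congr (_ * _).
  rewrite -!EFinM; congr EFin.
  rewrite (mulrCA (phi x)) (mulrCA (phi u)); congr (_ * _)%R.
  rewrite !phiE mulrACA [RHS]mulrACA -!expRD; congr (_ * expR _)%R.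
  have a2 : (al ^+ 2 = 1 - be ^+ 2)%R by rewrite -e1 addrK.
  have bn0 : (be != 0)%R by rewrite gt_eqF.
  apply: (@mulfI _ (2 * be ^+ 2)%R); first by rewrite mulf_neq0// sqrf_eq0.
  have -> : (2 * be ^+ 2 * (- x ^+ 2 / 2 + - ((u - al * x) / be) ^+ 2 / 2) =
    - (be ^+ 2 * x ^+ 2 + (u - al * x) ^+ 2))%R by field.
  have -> : (2 * be ^+ 2 * (- u ^+ 2 / 2 + - (be^-1 * x + - al * u / be) ^+ 2 / 2) =
    - (be ^+ 2 * u ^+ 2 + (x - al * u) ^+ 2))%R by field.
  have b2 : (be ^+ 2 = 1 - al ^+ 2)%R by rewrite a2; ring.
  by rewrite b2; ring.
under eq_integral do rewrite key.
have mp : measurable_fun setT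
    (fun x => (phi (be^-1 * x + - al * u / be))%:E).
  by apply: (measurableT_comp mphi); apply: measurable_funD => //; apply: measurable_funM.
rewrite ge0_integralZl//; last 3 first.
- exact: emeasurable_funM.
- by move=> x _; exact: mule_ge0.
- exact: mule_ge0.
rewrite ge0_integralZl//.
rewrite (@lebesgue_affine (- al * u / be)%R be^-1 (EFin \o phi)) ?invr_gt0//.
by rewrite integral_normal_pdf mule1.
Qed.

End gauss1.

Section gaussd.
Context (R : realType) (d : nat) (disp : measure_display)
  (OZ : measurableType disp) (PZ : probability OZ R) (Z : OZ -> 'cV[R]_d).
Hypothesis HZ : std_gaussian PZ Z.
Local Open Scope ereal_scope.
Local Notation nu := (@normal_prob R 0 1).
Implicit Types (Phi : Rd R d -> \bar R) (j : 'I_d) (z a : 'cV[R]_d).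

Lemma gauss_cmeas : cmeas Z.
Proof. by apply: borel_cmeas; case: HZ. Qed.

Definition upd z j (x : R) : 'cV[R]_d := \col_k (if k == j then x else z k 0%R).

Lemma cmeas_upd d1 (S : measurableType d1) (f : S -> 'cV[R]_d) (g : S -> R) j :
  cmeas f -> measurable_fun setT g -> cmeas (fun w => upd (f w) j (g w)).
Proof.
move=> mf mg k; under eq_fun do rewrite mxE.
by case: (k == j); [exact: mg|exact: mf].
Qed.

Lemma indep2C d1 d2 (S1 : measurableType d1) (S2 : measurableType d2)
    (U : OZ -> S1) (V : OZ -> S2) : indep2 PZ U V -> indep2 PZ V U.
Proof. by move=> h A B mA mB; rewrite setIC h// muleC. Qed.

Lemma cmeas_id : cmeas (fun v : Rd R d => v).
Proof. by move=> k; exact: coord_borel. Qed.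

(** A coordinate is independent of the others, so replacing it by a fresh N(0, 1) variable keeps the
    law of [Z]. Identities in dimension [d] thus follow from those in dimension one, one coordinate
    at a time. *)
Lemma integral_resample Phi j : measurable_fun setT Phi ->
  (forall z, 0 <= Phi z) ->
  \int[PZ]_w Phi (Z w) = \int[PZ]_w \int[nu]_x Phi (upd (Z w) j x).
Proof.
move=> mPhi Phi0; have [_ lawZ indZ] := HZ; have mZ := gauss_cmeas.
pose V (w : OZ) : Rd R d := upd (Z w) j 0.
have mV : measurable_fun setT V.
  by apply: cmeas_borel; exact: cmeas_upd.
have mV' : measurable_fun setT
    (V : others (fun k w => Z w k 0%R) j (fun=> 0%R : R) -> Rd R d).
  apply: cmeas_borel => k.
  have [kj|kj] := eqVneq k j.
    have -> : (fun x => V x k 0%R) = cst 0%R.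
      by apply/funext => w; rewrite mxE kj eqxx.
    exact: measurable_cst.
  have -> : (fun x => V x k 0%R) = (fun w => Z w k 0%R).
    by apply/funext => w; rewrite mxE (negbTE kj).
  exact: (@meas_other _ _ _ _ _ _ (fun k w => Z w k 0%R)).
have ind : indep2 PZ V (fun w => Z w j 0%R).
  apply: indep2C; apply: (@indep_coord_indep2 _ _ _ _ _ PZ d (fun k w => Z w k 0%R)) mV'.
  by apply: mutual_indep_coord => //; exact: mZ.
have mu2 : measurable_fun setT (fun v : Rd R d * R => Phi (upd v.1 j v.2)).
  apply: (measurableT_comp mPhi); apply: cmeas_borel; apply: cmeas_upd.
    exact: cmeas_comp cmeas_id measurable_fst.
  exact: measurable_snd.
have := indep2_integral mV (mZ j) ind mu2 (fun v => Phi0 _).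
rewrite /= /V.
have E w x : upd (upd (Z w) j 0) j x = upd (Z w) j x.
  by apply/colP => k; rewrite !mxE; case: eqP.
under eq_integral do rewrite E.
have E2 w : upd (Z w) j (Z w j 0%R) = Z w.
  by apply/colP => k; rewrite !mxE; case: eqP => [->|].
under eq_integral do rewrite E2.
move=> ->; apply: eq_integral => w _.
pose Zj : OZ -> measurableTypeR R := fun w => Z w j 0%R.
have mZj : measurable_fun setT Zj by exact: mZ.
pose X : {RV PZ >-> measurableTypeR R} := mfun_Sub (mem_set mZj).
under eq_integral do rewrite E.
have mf : measurable_fun setT (fun x : R => Phi (upd (Z w) j x)).
  by apply: (measurableT_comp mPhi); apply: cmeas_borel; exact: cmeas_upd.
rewrite -(ge0_integral_distribution X (mf : measurable_fun [set: measurableTypeR R] _))//.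
apply: (eq_measure_integral nu) => A mA _.
exact: (lawZ j A mA).
Qed.

Lemma integral_shift1 Phi j (t : R) : measurable_fun setT Phi ->
  (forall z, 0 <= Phi z) ->
  \int[PZ]_w Phi (Z w + t *: bvec j)%R =
  \int[PZ]_w (Phi (Z w) * (expR (t * Z w j 0%R - t ^+ 2 / 2))%:E).
Proof.
move=> mPhi Phi0.
have mS : measurable_fun setT (fun v : Rd R d => Phi (v + t *: bvec j)%R).
  apply: (measurableT_comp mPhi); apply: cmeas_borel; apply: cmeasD.
    exact: cmeas_id.
  exact: cmeas_cst.
have mE : measurable_fun setT
    (fun x : R => (expR (t * x - t ^+ 2 / 2))%:E).
  apply/measurable_EFinP; apply: measurableT_comp => //.
  by apply: measurable_funB => //; exact: measurable_funM.
have mE2 : measurable_fun setT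
    (fun v : Rd R d => Phi v * (expR (t * v j 0%R - t ^+ 2 / 2))%:E).
  apply: emeasurable_funM => //.
  exact: measurableT_comp mE (coord_borel j).
rewrite (integral_resample j mS)//.
rewrite (integral_resample j mE2); last first.
  by move=> z; rewrite mule_ge0// lee_fin expR_ge0.
apply: eq_integral => w _.
have mf : measurable_fun setT (fun x : R => Phi (upd (Z w) j x)).
  by apply: (measurableT_comp mPhi); apply: cmeas_borel; apply: cmeas_upd.
transitivity (\int[nu]_x Phi (upd (Z w) j (x + t)%R)).
  apply: eq_integral => x _; congr Phi; apply/colP => k; rewrite !mxE.
  by case: (k == j); rewrite ?mulr1// mulr0 addr0.
rewrite [LHS](normal_shift t mf (fun x => Phi0 _)); apply: eq_integral => x _.
by rewrite mxE eqxx.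
Qed.

(** Cameron-Martin formula by induction on a duplicate-free list of coordinates. The integrand is
    general in the induction because each one-dimensional shift is absorbed into it. *)
Lemma gauss_shift Phi a : measurable_fun setT Phi -> (forall z, 0 <= Phi z) ->
  \int[PZ]_w Phi (Z w + a)%R =
  \int[PZ]_w (Phi (Z w) * (expR (dot a (Z w) - dot a a / 2))%:E).
Proof.
move=> mPhi Phi0.
have gen (s : seq 'I_d) Phi' : uniq s -> measurable_fun setT Phi' ->
    (forall z, 0 <= Phi' z) ->
    \int[PZ]_w Phi' (Z w + \sum_(j <- s) a j 0%R *: bvec j)%R =
    \int[PZ]_w (Phi' (Z w) * (expR (dot (\sum_(j <- s) a j 0%R *: bvec j) (Z w) -
       dot (\sum_(j <- s) a j 0%R *: bvec j) (\sum_(j <- s) a j 0%R *: bvec j) / 2))%:E).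
  elim: s Phi' => [|j s IH] Phi' /= us mP P0.
    by apply: eq_integral => w _; rewrite big_nil addr0 !dot0l mul0r subr0 expR0 mule1.
  move: us => /andP[js us]; rewrite big_cons.
  set b := (\sum_(k <- s) a k 0%R *: bvec k)%R in IH *.
  have bj : dot b (bvec j) = 0%R.
    rewrite /b dot_suml big_seq big1// => k ks; rewrite dotZl dot_bvec mxE.
    by rewrite (_ : (j == k) = false) ?mulr0//; apply: contraNF js => /eqP->.
  have mS : measurable_fun setT (fun v : Rd R d => Phi' (v + a j 0%R *: bvec j)%R).
    apply: (measurableT_comp mP); apply: cmeas_borel; apply: cmeasD.
      exact: cmeas_id.
    exact: cmeas_cst.
  have mE : measurable_fun setT
      (fun v : Rd R d => (expR (dot b v - dot b b / 2))%:E).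
    apply/measurable_EFinP; apply: measurableT_comp => //.
    apply: measurable_funB => //; apply: cmeas_dot; first exact: cmeas_cst.
    exact: cmeas_id.
  under eq_integral do rewrite addrA.
  have := IH _ us mS (fun z => P0 _); rewrite /=.
  under eq_integral do rewrite addrAC.
  move=> ->.
  pose Psi (v : Rd R d) := Phi' v * (expR (dot b v - dot b b / 2))%:E.
  transitivity (\int[PZ]_w Psi (Z w + a j 0%R *: bvec j)%R).
    by apply: eq_integral => w _; rewrite /Psi dotDr dotZr bj mulr0 addr0.
  rewrite integral_shift1; last 2 first.
  - exact: emeasurable_funM.
  - by move=> z; rewrite mule_ge0// lee_fin expR_ge0.
  apply: eq_integral => w _; rewrite /Psi -muleA -EFinM -expRD.
  congr (_ * (expR _)%:E); rewrite !dotDl !dotDr !dotZl !dotZr.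
  rewrite (dotC (bvec j) b) bj (dotC (bvec j) (Z w)) !dot_bvec mxE !eqxx/=.
  by field.
have := gen (index_enum 'I_d) Phi (index_enum_uniq _) mPhi Phi0.
by rewrite sum_bvec.
Qed.

(** Stability of the Gaussian law. The vector [mix s] combines [Z] and [Z'] on the coordinates in
    [s] only; adding a coordinate resamples it in both vectors, after a Tonelli exchange, and
    applies [normal_convol]. *)
Lemma gauss_stable (al be : R) Phi : (0 < al)%R -> (al ^+ 2 + be ^+ 2 = 1)%R ->
  measurable_fun setT Phi -> (forall z, 0 <= Phi z) ->
  \int[PZ]_w' \int[PZ]_w Phi (al *: Z w + be *: Z w')%R = \int[PZ]_w Phi (Z w).
Proof.
move=> al0 e1 mPhi Phi0; have mZ := gauss_cmeas.
pose mix (s : seq 'I_d) z z' : 'cV[R]_d :=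
  (\col_j (if j \in s then al * z j 0%R + be * z' j 0%R else z j 0%R))%R.
have mmix s dd (S : measurableType dd) (f g : S -> 'cV[R]_d) : cmeas f -> cmeas g ->
    cmeas (fun w => mix s (f w) (g w)).
  move=> mf mg k; under eq_fun do rewrite mxE; case: (k \in s); last exact: mf.
  by apply: measurable_funD; apply: measurable_funM.
have mP dd (S : measurableType dd) (f : S -> 'cV[R]_d) : cmeas f ->
    measurable_fun setT (fun w => Phi (f w)).
  by move=> mf; apply: (measurableT_comp mPhi); exact: cmeas_borel.
have mc dd (S : measurableType dd) (f g : S -> R) : measurable_fun setT f ->
    measurable_fun setT g -> measurable_fun setT (fun w => al * f w + be * g w)%R.
  by move=> mf mg; apply: measurable_funD; apply: measurable_funM.
have gen s : uniq s ->
    \int[PZ]_w' \int[PZ]_w Phi (mix s (Z w) (Z w')) = \int[PZ]_w Phi (Z w).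
  elim: s => [|j s IH] /=.
    have mix0 z z' : mix [::] z z' = z by apply/colP => k; rewrite mxE.
    move=> _; under eq_integral do under eq_integral do rewrite mix0.
    by rewrite integral_cst// [X in _ * X]probability_setT mule1.
  move=> /andP[js us]; rewrite -(IH us).
  have mixE z z' : mix (j :: s) z z' = upd (mix s z z') j (al * z j 0%R + be * z' j 0%R)%R.
    by apply/colP => k; rewrite !mxE in_cons; case: eqP => [->|].
  have updE z z' x y : upd (mix s (upd z j x) z') j y = upd (mix s z z') j y.
    by apply/colP => k; rewrite !mxE; case: eqP.
  have updE' z z' x y : upd (mix s z (upd z' j x)) j y = upd (mix s z z') j y.
    by apply/colP => k; rewrite !mxE; case: eqP.
  have mixupd z z' x : mix s (upd z j x) z' = upd (mix s z z') j x.
    apply/colP => k; rewrite !mxE; case: eqP => [->|//].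
    by rewrite (negbTE js).
  have s1 w' : \int[PZ]_w Phi (mix (j :: s) (Z w) (Z w')) =
      \int[PZ]_w \int[nu]_x Phi (upd (mix s (Z w) (Z w')) j (al * x + be * Z w' j 0%R)%R).
    have mm : measurable_fun setT (fun v : Rd R d => Phi (mix (j :: s) v (Z w'))).
      by apply: mP; apply: mmix; [exact: cmeas_id|exact: cmeas_cst].
    etransitivity; first exact: (integral_resample j mm (fun z => Phi0 _)).
    apply: eq_integral => w _; apply: eq_integral => x _.
    by rewrite mixE updE mxE eqxx.
  have s2 w' : \int[PZ]_w Phi (mix s (Z w) (Z w')) =
      \int[PZ]_w \int[nu]_x Phi (upd (mix s (Z w) (Z w')) j x).
    have mm : measurable_fun setT (fun v : Rd R d => Phi (mix s v (Z w'))).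
      by apply: mP; apply: mmix; [exact: cmeas_id|exact: cmeas_cst].
    etransitivity; first exact: (integral_resample j mm (fun z => Phi0 _)).
    apply: eq_integral => w _; apply: eq_integral => x _.
    by rewrite mixupd.
  under eq_integral do rewrite s1.
  under [RHS]eq_integral do rewrite s2.
  have mj2 : measurable_fun setT (fun p : OZ * OZ => Z p.2 j 0%R).
    exact: measurableT_comp (mZ j) measurable_snd.
  have m1 : measurable_fun setT (fun p : OZ * OZ => \int[nu]_x
      Phi (upd (mix s (Z p.2) (Z p.1)) j (al * x + be * Z p.1 j 0%R)%R)).
    apply: (@measurable_fun_fubini_tonelli_F _ _ _ _ _ nu (fun q : (OZ * OZ) * R =>
      Phi (upd (mix s (Z q.1.2) (Z q.1.1)) j (al * q.2 + be * Z q.1.1 j 0%R)%R))) => //.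
    apply: mP; apply: cmeas_upd; first apply: mmix.
    - exact: cmeas_comp mZ (measurableT_comp measurable_snd measurable_fst).
    - exact: cmeas_comp mZ (measurableT_comp measurable_fst measurable_fst).
    - apply: mc => //.
      exact: measurableT_comp (mZ j) (measurableT_comp measurable_fst measurable_fst).
  have m2 : measurable_fun setT (fun p : OZ * OZ => \int[nu]_x
      Phi (upd (mix s (Z p.2) (Z p.1)) j x)).
    apply: (@measurable_fun_fubini_tonelli_F _ _ _ _ _ nu (fun q : (OZ * OZ) * R =>
      Phi (upd (mix s (Z q.1.2) (Z q.1.1)) j q.2))) => //.
    apply: mP; apply: cmeas_upd => //; apply: mmix.
    - exact: cmeas_comp mZ (measurableT_comp measurable_snd measurable_fst).
    - exact: cmeas_comp mZ (measurableT_comp measurable_fst measurable_fst).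
  have p1 (p : OZ * OZ) : 0 <= \int[nu]_x
      Phi (upd (mix s (Z p.2) (Z p.1)) j (al * x + be * Z p.1 j 0%R)).
    exact: integral_ge0.
  have p2 (p : OZ * OZ) : 0 <= \int[nu]_x Phi (upd (mix s (Z p.2) (Z p.1)) j x).
    exact: integral_ge0.
  etransitivity; first exact: (@fubini_tonelli _ _ _ _ _ PZ PZ _ m1 p1).
  etransitivity; last exact/esym/(@fubini_tonelli _ _ _ _ _ PZ PZ _ m2 p2).
  apply: eq_integral => w _.
  have m3 : measurable_fun setT (fun v : Rd R d => \int[nu]_x
      Phi (upd (mix s (Z w) v) j (al * x + be * v j 0%R)%R)).
    apply: (@measurable_fun_fubini_tonelli_F _ _ _ _ _ nu (fun q : (Rd R d) * R =>
      Phi (upd (mix s (Z w) q.1) j (al * q.2 + be * q.1 j 0%R)%R))) => //.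
    apply: mP; apply: cmeas_upd; first apply: mmix.
    - exact: cmeas_cst.
    - exact: cmeas_comp cmeas_id measurable_fst.
    - apply: mc => //; exact: measurableT_comp (coord_borel j) measurable_fst.
  have p3 (v : Rd R d) : 0 <= \int[nu]_x
      Phi (upd (mix s (Z w) v) j (al * x + be * v j 0%R)).
    exact: integral_ge0.
  etransitivity; first exact: (integral_resample j m3 p3).
  apply: eq_integral => w' _ /=.
  under eq_integral => y _ do under eq_integral => x _ do rewrite updE' mxE eqxx addrC.
  have m4 : measurable_fun setT (fun y : R => Phi (upd (mix s (Z w) (Z w')) j y)).
    by apply: mP; apply: cmeas_upd => //; exact: cmeas_cst.
  apply: (@normal_convol _ be al _ al0 _ m4) => //.
  by rewrite addrC.
have := gen (index_enum 'I_d) (index_enum_uniq _); move=> <-.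
apply: eq_integral => w' _; apply: eq_integral => w _; congr Phi.
by apply/colP => k; rewrite !mxE mem_index_enum.
Qed.

End gaussd.

(** * Gaussian smoothing and Hermite weights *)

Definition der (R : realType) (f : R -> R) (r l : R) :=
  is_derive (r : R) (1 : R) f l.

Section calculus.
Context {R : realType}.
Implicit Types (f g : R -> R) (r a b : R).

Lemma der_eq f r a b : der f r a -> a = b -> der f r b.
Proof. by move=> h <-. Qed.

Lemma der_id r : der id r 1.
Proof. exact: is_derive_id. Qed.

Lemma der_cst c r : der (fun=> c) r 0.
Proof. exact: is_derive_cst. Qed.

Lemma derB f g r a b : der f r a -> der g r b -> der (fun x => f x - g x) r (a - b).
Proof. exact: is_deriveB. Qed.

Lemma derM f g r a b : der f r a -> der g r b ->
  der (fun x => f x * g x) r (f r * b + g r * a).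
Proof. exact: is_deriveM. Qed.

Lemma derZ c f r a : der f r a -> der (fun x => c * f x) r (c * a).
Proof.
by move=> h; apply: der_eq (derM (der_cst c r) h) _; rewrite mulr0 addr0.
Qed.

Lemma derX n f r a : der f r a ->
  der (fun x => f x ^+ n) r (n%:R * f r ^+ n.-1 * a).
Proof.
move=> h; have := @is_deriveX _ _ f n _ _ _ h.
by rewrite (_ : f ^+ n = (fun x => f x ^+ n))//; apply/funext => x; rewrite fctE.
Qed.

Lemma der_comp f g x a b : der f (g x) a -> der g x b ->
  der (fun y => f (g y)) x (a * b).
Proof. exact: is_derive1_comp. Qed.

Lemma der_exp f r a : der f r a -> der (fun x => expR (f x)) r (a * expR (f r)).
Proof.
move=> h; apply: der_eq (der_comp (is_derive_expR _) h) _.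
by rewrite mulrC.
Qed.

Lemma mvt01 f f' : (forall r, der f r (f' r)) ->
  exists2 c, 0 <= c <= 1 & f 1 - f 0 = f' c.
Proof.
move=> df; have [|c] := @MVT R f f' 0 1 ltr01 (fun r _ => df r).
  apply: derivable_within_continuous => x _; by have [] := df x.
rewrite in_itv/= => /andP[c0 c1] ->; exists c; first by rewrite !ltW.
by rewrite subr0 mulr1.
Qed.

(** Second-order Taylor formula with a Lipschitz second derivative, through two uses of the mean
    value theorem; this yields [C] in place of the sharp [C / 6]. *)
Lemma taylor01 f f1 f2 (C : R) : (forall r, der f r (f1 r)) ->
  (forall r, der f1 r (f2 r)) ->
  (forall r, `|f2 r - f2 0| <= C * `|r|) ->
  `|f 1 - f 0 - f1 0 - f2 0 / 2| <= C.
Proof.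
move=> d1 d2 h.
have C0 : 0 <= C by have := h 1; rewrite normr1 mulr1; apply: le_trans.
have h1 r : 0 <= r <= 1 -> `|f1 r - f1 0 - r * f2 0| <= C.
  move=> /andP[r0 r1].
  have D q : der (fun q => f1 (q * r) - q * (r * f2 0)) q (r * (f2 (q * r) - f2 0)).
    have dl : der (fun q => q * r) q r.
      by apply: der_eq (derM (der_id q) (der_cst r q)) _; rewrite mulr0 add0r mulr1.
    have e2 : der (fun q => q * (r * f2 0)) q (r * f2 0).
      by apply: der_eq (derM (der_id q) (der_cst _ q)) _; rewrite mulr0 add0r mulr1.
    by apply: der_eq (derB (@der_comp f1 (fun q => q * r) _ _ _ (d2 (q * r)) dl) e2) _; ring.
  have [c /andP[c0 c1] ] := mvt01 D.
  rewrite !mul0r !mul1r subr0 => E.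
  rewrite addrAC E normrM ger0_norm//.
  rewrite (le_trans (ler_wpM2l r0 (h _)))// ger0_norm ?mulr_ge0//.
  by rewrite mulrCA ler_piMr// mulr_ile1 ?mulr_ge0 ?mulr_ile1.
have D q : der (fun q => f q - q * f1 0 - q ^+ 2 * (f2 0 / 2)) q
    (f1 q - f1 0 - q * f2 0).
  have e2 : der (fun q => q * f1 0) q (f1 0).
    by apply: der_eq (derM (der_id q) (der_cst _ q)) _; rewrite mulr0 add0r mulr1.
  have e3 : der (fun q => q ^+ 2 * (f2 0 / 2)) q (q * f2 0).
    apply: der_eq (derM (derX 2 (der_id q)) (der_cst _ q)) _.
    by rewrite /= expr1; field.
  exact: derB (derB (d1 q) e2) e3.
have [c c01] := mvt01 D.
rewrite !mul0r !mul1r expr0n/= mul0r !subr0 expr1n mul1r => E.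
rewrite (_ : f 1 - f 0 - f1 0 - f2 0 / 2 = f1 c - f1 0 - c * f2 0); first exact: h1.
by rewrite -E; ring.
Qed.

End calculus.

Section gauss_calculus.
Context (R : realType) (d : nat) (disp : measure_display)
  (OZ : measurableType disp) (PZ : probability OZ R) (Z : OZ -> 'cV[R]_d).
Hypothesis HZ : std_gaussian PZ Z.
Implicit Types (F : Rd R d -> R) (a b y : 'cV[R]_d).

Let mZ : cmeas Z. Proof. exact: gauss_cmeas HZ. Qed.

Definition mRd F := measurable_fun [set: Rd R d] F.
Definition shf y F : Rd R d -> R := fun z => F (z + y).
Definition dens a (w : OZ) : R := expR (dot a (Z w) - dot a a / 2).

Lemma mRd_comp F dd (S : measurableType dd) (f : S -> 'cV[R]_d) :
  mRd F -> cmeas f -> measurable_fun setT (fun w => F (f w)).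
Proof. by move=> mF mf; apply: (measurableT_comp mF); exact: cmeas_borel. Qed.

Lemma mRd_Z F : mRd F -> measurable_fun setT (fun w => F (Z w)).
Proof. by move=> mF; exact: mRd_comp mF mZ. Qed.

Lemma mRd_shf y F : mRd F -> mRd (shf y F).
Proof.
move=> mF; apply: mRd_comp => //; apply: cmeasD; last exact: cmeas_cst.
exact: cmeas_id.
Qed.

Lemma mRd_dot a : mRd (dot a).
Proof. by apply: cmeas_dot; [exact: cmeas_cst|exact: cmeas_id]. Qed.

Lemma meas_dotZ a : measurable_fun setT (fun w => dot a (Z w)).
Proof. exact: mRd_Z (mRd_dot a). Qed.

Lemma meas_dens a : measurable_fun setT (dens a).
Proof.
by apply: measurableT_comp => //; apply: measurable_funB => //; exact: meas_dotZ.
Qed.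

Lemma Ex_shift F a : mRd F ->
  Ex PZ (fun w => F (Z w + a)) = Ex PZ (fun w => F (Z w) * dens a w).
Proof.
move=> mF; rewrite /Ex /Rintegral; congr fine.
rewrite [LHS]integralE [RHS]integralE.
have mE : measurable_fun [set: Rd R d] (EFin \o F) by exact/measurable_EFinP.
congr (_ - _)%E.
  have := @gauss_shift _ _ _ _ _ _ HZ (EFin \o F)^\+%E a
    (measurable_funepos mE) (fun z => funepos_ge0 _ _).
  move=> h; apply: (etrans _ (etrans h _)); apply: eq_integral => w _.
    by rewrite !funeposE.
  by rewrite !funeposE/= EFinM maxe_pMl ?lee_fin ?expR_ge0// mul0e.
have := @gauss_shift _ _ _ _ _ _ HZ (EFin \o F)^\-%E a
  (measurable_funeneg mE) (fun z => funeneg_ge0 _ _).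
move=> h; apply: (etrans _ (etrans h _)); apply: eq_integral => w _.
  by rewrite !funenegE.
by rewrite !funenegE/= maxe_pMl ?lee_fin ?expR_ge0// mul0e -EFinM mulNr.
Qed.

Lemma itg_exp a : itg PZ (fun w => expR (dot a (Z w))).
Proof.
have mex : measurable_fun setT (fun w => expR (dot a (Z w))).
  by apply: measurableT_comp => //; exact: meas_dotZ.
apply/integrableP; split; first exact/measurable_EFinP.
have := @gauss_shift _ _ _ _ _ _ HZ (fun=> (expR (dot a a / 2))%:E) a
  (@measurable_cst _ _ _ _ _ _) (fun z => _).
rewrite /= integral_cst// => h.
apply: (@le_lt_trans _ _ ((expR (dot a a / 2))%:E * PZ setT)%E).
  rewrite h; last by rewrite lee_fin expR_ge0.
  apply: ge0_le_integral => //.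
  - by apply/measurable_EFinP; apply: measurableT_comp => //; exact: measurableT_comp.
  - by apply/measurable_EFinP; apply: measurable_funM => //; exact: meas_dens.
  - move=> w _; rewrite -EFinM lee_fin ger0_norm ?expR_ge0//.
    by rewrite -expRD addrCA subrr addr0.
by rewrite [X in (_ * X)%E]probability_setT mule1 ltry.
Qed.

Lemma itg_exp2 a b : itg PZ (fun w => expR (`|dot a (Z w)| + `|dot b (Z w)|)).
Proof.
apply: (@itg_le _ _ _ _ _ (fun w => expR (dot (a + b) (Z w)) + expR (dot (a - b) (Z w))
   + (expR (dot (- a + b) (Z w)) + expR (dot (- a - b) (Z w))))).
- apply: measurableT_comp => //; apply: measurable_funD;
    by apply: measurableT_comp => //; exact: meas_dotZ.
- by apply: itgD; apply: itgD; exact: itg_exp.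
- move=> w; rewrite ger0_norm ?expR_ge0// !dotDl !dotNl.
  set x := dot a (Z w); set y := dot b (Z w).
  have := expR_ge0 (x + y); have := expR_ge0 (x - y).
  have := expR_ge0 (- x + y); have := expR_ge0 (- x - y).
  by case: (ger0P x) => _; case: (ger0P y) => _; lra.
Qed.

Lemma itg_dom F f a b C : mRd F -> (forall w, f w = F (Z w)) ->
  (forall w, `|f w| <= C * expR (`|dot a (Z w)| + `|dot b (Z w)|)) -> itg PZ f.
Proof.
move=> mF fF fC; apply: itg_le (itgZ C (itg_exp2 a b)) fC.
by rewrite (_ : f = fun w => F (Z w)); [exact: mRd_Z|exact/funext].
Qed.

(** [F] is only bounded and measurable, so the Cameron-Martin formula first moves the shift [r *: b]
    from [F] to the density, and the derivative is then taken under the integral. This is Gaussian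
    integration by parts. For [k = 0] the factor [k%:R] annihilates the term with [k.-1]. *)
Lemma der_gauss F (M : R) k a b r : mRd F -> (forall z, `|F z| <= M) ->
  der (fun r => Ex PZ (fun w => F (Z w + r *: b) * dot a (Z w) ^+ k)) r
    (Ex PZ (fun w => F (Z w + r *: b) * (dot a (Z w) ^+ k * dot b (Z w) -
       k%:R * dot a (Z w) ^+ k.-1 * dot a b))).
Proof.
move=> mF FM.
have M0 : 0 <= M by exact: le_trans (FM 0).
pose c := dot a b; pose q := dot b b.
pose f (r : R) (w : OZ) : R := F (Z w) *
  ((dot a (Z w) - r * c) ^+ k * expR (r * dot b (Z w) - r ^+ 2 * (q / 2))).
pose df (r : R) (w : OZ) : R := F (Z w) *
  (((dot a (Z w) - r * c) ^+ k * (dot b (Z w) - r * q) -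
    k%:R * (dot a (Z w) - r * c) ^+ k.-1 * c)
   * expR (r * dot b (Z w) - r ^+ 2 * (q / 2))).
have densE t w : dens (t *: b) w = expR (t * dot b (Z w) - t ^+ 2 * (q / 2)).
  by rewrite /dens !dotZl dotZr /q; congr expR; ring.
have mS t : measurable_fun [set: Rd R d] (fun z : Rd R d => z - t *: b : Rd R d).
  by apply: cmeas_borel; apply: cmeasB; [exact: cmeas_id|exact: cmeas_cst].
have mp (u : 'cV[R]_d) t : mRd (fun z => dot u (z - t *: b)).
  by exact: measurableT_comp (mRd_dot u) (mS t).
have fE t : Ex PZ (fun w => F (Z w + t *: b) * dot a (Z w) ^+ k) = Ex PZ (f t).
  have mG : mRd (fun z => F z * dot a (z - t *: b) ^+ k).
    by apply: measurable_funM => //; apply: measurable_funX; exact: mp.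
  have := Ex_shift (t *: b) mG.
  under Ex_ext do rewrite addrK.
  move=> ->; apply: Ex_ext => w; rewrite /f densE dotBr dotZr -!mulrA.
  by rewrite /c.
have dfE t : Ex PZ (fun w => F (Z w + t *: b) * (dot a (Z w) ^+ k * dot b (Z w) -
       k%:R * dot a (Z w) ^+ k.-1 * dot a b)) = Ex PZ (df t).
  have mG : mRd (fun z => F z * (dot a (z - t *: b) ^+ k * dot b (z - t *: b) -
      k%:R * dot a (z - t *: b) ^+ k.-1 * dot a b)).
    apply: measurable_funM => //; apply: measurable_funB.
      by apply: measurable_funM; [apply: measurable_funX|]; exact: mp.
    apply: measurable_funM => //; apply: measurable_funM => //.
    by apply: measurable_funX; exact: mp.
  have := Ex_shift (t *: b) mG.
  under Ex_ext do rewrite addrK.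
  move=> ->; apply: Ex_ext => w; rewrite /df densE !dotBr !dotZr -!mulrA.
  by rewrite /c /q; congr (_ * (_ * _)); ring.
(* A bound of |x| on the unit neighbourhood of [r], so that the dominating function [G] does not
   depend on x. *)
pose rho : R := `|r| + 1.
have rho0 : 0 <= rho by rewrite addr_ge0.
pose C := expR (k%:R * (rho * `|c|)) * (1 + expR (rho * `|q|)
   + (k%:R * `|c|)).
(* Powers up to [k] are absorbed by [|x| ^+ n <= expR (n%:R * |x|)]. In direction [b], [rho]
   accounts for the density and the additional 1 for the linear factor of the derivative. *)
pose G (w : OZ) : R := M * C * expR (`|dot (k%:R *: a) (Z w)| + `|dot ((rho + 1) *: b) (Z w)|).
have powe (x : R) n : `|x| ^+ n <= expR (n%:R * `|x|).
  rewrite expRM_natl lerXn2r ?nnegrE ?expR_ge0//.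
  by rewrite (le_trans _ (expR_ge1Dx _))// lerDr.
have inI x : `]r - 1, r + 1[%classic x -> `|x| <= rho.
  rewrite /= in_itv/= => /andP[x1 x2]; rewrite /rho.
  have := ler_norm r; have := ler_norm (- r); rewrite normrN => h1 h2.
  by rewrite ler_norml; apply/andP; split; lra.
have dfder x w : der (f ^~ w) x (df x w).
  rewrite /f /df; apply: derZ.
  have d1 : der (fun r => dot a (Z w) - r * c) x (- c).
    apply: der_eq (derB (der_cst _ x) (derM (der_id x) (der_cst c x))) _.
    by ring.
  have d2 : der (fun r => r * dot b (Z w) - r ^+ 2 * (q / 2)) x (dot b (Z w) - x * q).
    apply: der_eq (derB (derM (der_id x) (der_cst (dot b (Z w)) x))
      (derM (derX 2 (der_id x)) (der_cst (q / 2) x))) _.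
    by rewrite /= expr1; field.
  by apply: der_eq (derM (derX k d1) (der_exp d2)) _; ring.
have bnd x w : `]r - 1, r + 1[%classic x ->
   `|f x w| <= G w /\ `|df x w| <= G w.
  move=> /inI xr.
  set A := dot a (Z w); set B := dot b (Z w).
  have eb : expR (x * B - x ^+ 2 * (q / 2)) <= expR (rho * `|B|).
    rewrite ler_expR lerBlDr (@le_trans _ _ (rho * `|B|))//.
      by rewrite (le_trans (ler_norm _))// normrM ler_wpM2r.
    by rewrite lerDl mulr_ge0 ?sqr_ge0// divr_ge0// dotxx_ge0.
  have Ac : `|A - x * c| <= `|A| + rho * `|c|.
    by rewrite (le_trans (ler_normB _ _))// lerD2l normrM ler_wpM2r.
  have pw n : (n <= k)%N ->
      `|A - x * c| ^+ n <= expR (k%:R * `|A|) * expR (k%:R * (rho * `|c|)).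
    move=> nk; rewrite (le_trans (powe _ _))// -expRD ler_expR -mulrDr.
    by apply: ler_pM; rewrite ?ler0n ?ler_nat.
  set E1 := expR (k%:R * `|A|) in pw *; set E2 := expR (k%:R * _) in pw *.
  have E10 : 0 <= E1 by exact: expR_ge0.
  have E20 : 0 <= E2 by exact: expR_ge0.
  pose E3 := expR (rho * `|B|); have E30 : 0 <= E3 by exact: expR_ge0.
  pose E4 := expR `|B|; have E41 : 1 <= E4 by rewrite -expR0 ler_expR.
  have GE : G w = M * (E2 * (1 + expR (rho * `|q|) + k%:R * `|c|)) * (E1 * E3 * E4).
    rewrite /G /C /E1 /E3 /E4 !dotZl !normrM normr_nat (@ger0_norm _ (rho + 1)) ?addr_ge0// -/A -/B.
    rewrite -!mulrA; congr (_ * _).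
    have -> : (rho + 1) * `|B| = rho * `|B| + `|B| by ring.
    by rewrite /E2 !addrA !expRD !mulrA.
  have Bq : `|B - x * q| <= E4 * expR (rho * `|q|).
    rewrite -expRD (le_trans _ (expR_ge1Dx _))//.
    rewrite (le_trans (ler_normB _ _))// normrM.
    have : `|x| * `|q| <= rho * `|q| by rewrite ler_wpM2r.
    by lra.
  have Eq0 : 0 <= expR (rho * `|q|) by exact: expR_ge0.
  have kc0 : 0 <= k%:R * `|c| by rewrite mulr_ge0.
  rewrite GE /f /df !normrM !normrX (ger0_norm (expR_ge0 _)) -/A -/B.
  split.
    rewrite -!mulrA; apply: ler_pM => //; rewrite ?(mulr_ge0, exprn_ge0, expR_ge0)//.
    apply: (@le_trans _ _ (E1 * E2 * E3)).
      by apply: ler_pM; rewrite ?(exprn_ge0, expR_ge0)//; [exact: pw|by rewrite expr2 -mulrA in eb].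
    have -> : E2 * ((1 + expR (rho * `|q|) + k%:R * `|c|) * (E1 * (E3 * E4))) =
      (E1 * E2 * E3) * (E4 * (1 + expR (rho * `|q|) + k%:R * `|c|)) by ring.
    by rewrite ler_peMr ?mulr_ge0// mulr_ege1//; lra.
  rewrite -!mulrA; apply: ler_pM => //; rewrite ?(mulr_ge0, exprn_ge0, expR_ge0)//.
  apply: (@le_trans _ _ ((E1 * E2 * (E4 * expR (rho * `|q|)) + k%:R * `|c| * (E1 * E2)) * E3)).
    apply: ler_pM; rewrite ?expR_ge0//; last by rewrite expr2 -mulrA in eb.
    rewrite (le_trans (ler_normB _ _))// !normrM !normrX normr_nat lerD//.
      by apply: ler_pM; rewrite ?exprn_ge0// pw.
    rewrite -mulrA ler_wpM2l// mulrC ler_wpM2l// pw// leq_pred//.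
  have -> : E2 * ((1 + expR (rho * `|q|) + k%:R * `|c|) * (E1 * (E3 * E4))) =
      (E1 * E2 * E3) * (E4 * (1 + expR (rho * `|q|) + k%:R * `|c|)) by ring.
  have -> : (E1 * E2 * (E4 * expR (rho * `|q|)) + k%:R * `|c| * (E1 * E2)) * E3 =
      (E1 * E2 * E3) * (E4 * expR (rho * `|q|) + k%:R * `|c|) by ring.
  by rewrite ler_wpM2l ?mulr_ge0//; nra.
have IG : itg PZ G.
  by apply/itgZ/itg_exp2.
have mfx x : measurable_fun setT (f x).
  apply: measurable_funM; first exact: mRd_Z.
  apply: measurable_funM.
    by apply: measurable_funX; apply: measurable_funB => //; exact: meas_dotZ.
  apply: measurableT_comp => //; apply: measurable_funB => //.
  by apply: measurable_funM => //; exact: meas_dotZ.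
have Ir : `]r - 1, r + 1[%classic r by rewrite /= in_itv/= ltrBlDr ltrDl ltr01.
have intf x : `]r - 1, r + 1[%classic x -> PZ.-integrable setT (EFin \o f x).
  by move=> xI; apply: itg_le IG _ => // w; have [] := bnd _ w xI.
have derf x w : `]r - 1, r + 1[%classic x -> setT w -> derivable (f ^~ w) x 1.
  by move=> _ _; have [] := dfder x w.
have p1E x w : partial1of2 f x w = df x w.
  by rewrite partial1of2E; have [_ ->] := dfder x w.
have G0 w : 0 <= G w.
  by rewrite /G !mulr_ge0 ?expR_ge0// !addr_ge0 ?expR_ge0// mulr_ge0.
have Gub x w : `]r - 1, r + 1[%classic x -> setT w -> `|partial1of2 f x w| <= G w.
  by move=> xI _; rewrite p1E; have [] := bnd _ w xI.
have -> : (fun r0 : R => Ex PZ (fun w : OZ => F (Z w + r0 *: b) * dot a (Z w) ^+ k)) =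
    (fun x' => \int[PZ]_(w in setT) f x' w).
  by apply/funext => t; rewrite fE.
rewrite dfE; split.
  exact: (derivable_under_integral measurableT Ir intf derf G0 IG Gub).
rewrite -derive1E.
rewrite (differentiation_under_integral measurableT Ir intf derf G0 IG Gub).
by apply: Ex_ext => w; rewrite p1E.
Qed.

Lemma itg_gauss F (M : R) k a b y : mRd F -> (forall z, `|F z| <= M) ->
  itg PZ (fun w => F (Z w + y) * (dot a (Z w) ^+ k * dot b (Z w) ^+ 1)).
Proof.
move=> mF FM; have M0 : 0 <= M by exact: le_trans (FM 0).
apply: (@itg_dom (fun z => F (z + y) * (dot a z ^+ k * dot b z ^+ 1)) _
  (k%:R *: a) b M) => //.
  apply: measurable_funM; first exact: mRd_shf.
  by apply: measurable_funM; apply: measurable_funX; exact: mRd_dot.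
move=> w; rewrite normrM; apply: ler_pM => //.
rewrite normrM expRD; apply: ler_pM => //.
  rewrite normrX dotZl normrM normr_nat expRM_natl lerXn2r ?nnegrE ?expR_ge0//.
  by rewrite (le_trans _ (expR_ge1Dx _))// lerDr.
by rewrite expr1 (le_trans _ (expR_ge1Dx _))// lerDr.
Qed.

Lemma itg_pol F (M : R) k a y : mRd F -> (forall z, `|F z| <= M) ->
  itg PZ (fun w => F (Z w + y) * dot a (Z w) ^+ k).
Proof.
move=> mF FM; have M0 : 0 <= M by exact: le_trans (FM 0).
apply: (@itg_dom (fun z => F (z + y) * dot a z ^+ k) _ (k%:R *: a) 0 M) => //.
  by apply: measurable_funM; [exact: mRd_shf|apply: measurable_funX; exact: mRd_dot].
move=> w; rewrite normrM; apply: ler_pM => //.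
rewrite dot0l normr0 addr0 normrX dotZl normrM normr_nat expRM_natl.
rewrite lerXn2r ?nnegrE ?expR_ge0//.
by rewrite (le_trans _ (expR_ge1Dx _))// lerDr.
Qed.

Lemma itg_mom k a : itg PZ (fun w => dot a (Z w) ^+ k).
Proof.
have := @itg_pol (fun=> 1) 1 k a 0 (@measurable_cst _ _ _ _ _ _) (fun z => _).
under eq_fun do rewrite mul1r; apply.
by rewrite normr1.
Qed.

Lemma der_cst_eq0 (f : R -> R) r l : (forall x, f x = f r) -> der f r l -> l = 0.
Proof.
move=> fc [_ <-]; rewrite (_ : f = cst (f r)) ?derive_cst//.
exact/funext.
Qed.

(** For [F = 1] the expectation differentiated in [der_gauss] does not depend on [r], so its
    derivative vanishes. *)
Lemma stein_mom k a b :
  Ex PZ (fun w => dot a (Z w) ^+ k * dot b (Z w)) =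
  k%:R * dot a b * Ex PZ (fun w => dot a (Z w) ^+ k.-1).
Proof.
have n1 : forall z : Rd R d, `|(fun=> 1 : R) z| <= 1 by move=> z; rewrite normr1.
have := @der_gauss (fun=> 1) 1 k a b 0 (@measurable_cst _ _ _ _ _ _) n1.
under Ex_ext do rewrite mul1r.
move=> /der_cst_eq0 => /(_ (fun x => erefl)).
under Ex_ext do rewrite mul1r.
have i1 : itg PZ (fun w => dot a (Z w) ^+ k * dot b (Z w)).
  have := @itg_gauss (fun=> 1) 1 k a b 0 (@measurable_cst _ _ _ _ _ _) n1.
  by apply: itg_ext => w; rewrite mul1r expr1.
rewrite ExB//; last first.
  by apply: (itg_ext _ (itgZ (k%:R * dot a b) (itg_mom k.-1 a))) => w; ring.
move=> /eqP; rewrite subr_eq0 => /eqP ->.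
by rewrite -ExZ ?itg_mom//; apply: Ex_ext => w; ring.
Qed.

(* H0, H1, H2, H3: the derivatives at y = 0 of the Gaussian smoothing y |-> E F (Z + y), as
   integrals against Hermite polynomials. *)
Definition H0 F := Ex PZ (fun w => F (Z w)).
Definition H1 F a := Ex PZ (fun w => F (Z w) * dot a (Z w)).
Definition H2 F a := Ex PZ (fun w => F (Z w) * (dot a (Z w) ^+ 2 - dot a a)).
Definition H3 F a b := Ex PZ (fun w => F (Z w) *
  ((dot a (Z w) ^+ 2 - dot a a) * dot b (Z w) - 2 * dot a (Z w) * dot a b)).

Lemma Ex_dot1 a : Ex PZ (fun w => dot a (Z w)) = 0.
Proof.
have := stein_mom 0 0 a; rewrite !mul0r => <-.
by apply: Ex_ext => w; rewrite expr0 mul1r.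
Qed.

Lemma Ex_dot2 a : Ex PZ (fun w => dot a (Z w) ^+ 2) = dot a a.
Proof.
have := stein_mom 1 a a; under Ex_ext do rewrite expr1.
rewrite mul1r /= Ex_cst mulr1 => <-; exact: Ex_ext.
Qed.

Lemma Ex_dot4 a : Ex PZ (fun w => dot a (Z w) ^+ 4) = 3 * dot a a ^+ 2.
Proof.
have := stein_mom 3 a a; rewrite Ex_dot2 => h.
transitivity (3 * dot a a * dot a a); last by ring.
by rewrite -h; apply: Ex_ext => w; rewrite exprSr.
Qed.

Let i2 a : itg PZ (fun w => dot a (Z w) ^+ 2 - dot a a).
Proof. by apply: itgB; [exact: itg_mom|exact: itg_cst]. Qed.

Lemma Ex_herm2_sqr a :
  Ex PZ (fun w => (dot a (Z w) ^+ 2 - dot a a) ^+ 2) = 2 * dot a a ^+ 2.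
Proof.
transitivity (Ex PZ (fun w => dot a (Z w) ^+ 4 -
    (2 * dot a a) * dot a (Z w) ^+ 2 + dot a a ^+ 2)).
  by apply: Ex_ext => w; ring.
rewrite ExD; [|by apply: itgB; [exact: itg_mom|apply: itgZ; exact: itg_mom]|exact: itg_cst].
rewrite ExB; [|exact: itg_mom|by apply: itgZ; exact: itg_mom].
by rewrite ExZ ?itg_mom// Ex_dot4 Ex_dot2 Ex_cst; ring.
Qed.

Let i22 a : itg PZ (fun w => (dot a (Z w) ^+ 2 - dot a a) ^+ 2).
Proof.
apply: (itg_ext _ (itgD (itgB (itg_mom 4 a) (itgZ (2 * dot a a) (itg_mom 2 a)))
   (itg_cst _ (dot a a ^+ 2)))) => w; ring.
Qed.

(* Cauchy-Schwarz against a constant, through [|x| <= (x^2 / s + s) / 2]. *)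
Lemma Ex_abs_le (P : probability OZ R) (f : OZ -> R) s : 0 <= s -> itg P f -> itg P (fun w => f w ^+ 2) ->
  Ex P (fun w => f w ^+ 2) <= s ^+ 2 -> Ex P (fun w => `|f w|) <= s.
Proof.
move=> s0 If If2 h; apply/ler_addgt0Pr => e e0.
have se0 : 0 < s + e by lra.
have i1 : itg P (fun w => (s + e)^-1 * f w ^+ 2 + (s + e)).
  by apply: itgD; [exact: itgZ|exact: itg_cst].
apply: (@le_trans _ _ (2^-1 * Ex P (fun w => (s + e)^-1 * f w ^+ 2 + (s + e)))).
  rewrite -ExZ//; apply: Ex_le => [||w]; [exact: itg_abs|exact: itgZ|].
  have : 0 <= (s + e)^-1 * (`|f w| - (s + e)) ^+ 2.
    by rewrite mulr_ge0 ?sqr_ge0// invr_ge0 ltW.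
  rewrite -[f w ^+ 2]real_normK ?num_real//.
  have -> : (s + e)^-1 * (`|f w| - (s + e)) ^+ 2 =
    (s + e)^-1 * `|f w| ^+ 2 - 2 * `|f w| + (s + e) by field; rewrite gt_eqF.
  by lra.
rewrite ExD; [|exact: itgZ|exact: itg_cst].
rewrite ExZ// Ex_cst.
have : (s + e)^-1 * Ex P (fun w => f w ^+ 2) <= s + e.
  rewrite mulrC ler_pdivrMr// -expr2 (le_trans h)// lerXn2r ?nnegrE; lra.
by lra.
Qed.

Lemma Ex_mul_le (P : probability OZ R) (F : OZ -> R) (M : R) p : measurable_fun setT F -> (forall w, `|F w| <= M) ->
  itg P p -> `|Ex P (fun w => F w * p w)| <= M * Ex P (fun w => `|p w|).
Proof.
move=> mF FM Ip.
have iF : itg P (fun w => F w * p w).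
  apply: (itg_le _ (itgZ M (itg_abs Ip))).
    by apply: measurable_funM => //; exact: itg_meas Ip.
  by move=> w; rewrite normrM ler_wpM2r.
rewrite (le_trans (Ex_abs iF))// -ExZ ?itg_abs//.
apply: Ex_le => [||w]; [exact: itg_abs|by apply: itgZ; exact: itg_abs|].
by rewrite normrM ler_wpM2r.
Qed.

Lemma itg_dot a : itg PZ (fun w => dot a (Z w)).
Proof. exact: itg_mom 1 a. Qed.

Lemma Ex_abs_dot a : Ex PZ (fun w => `|dot a (Z w)|) <= enorm a.
Proof.
apply: Ex_abs_le; rewrite ?enorm_ge0 ?Ex_dot2 ?sqr_enorm//.
  exact: itg_dot.
exact: itg_mom.
Qed.

(** Cauchy-Schwarz with the second moment [2 * dot a a ^+ 2]; 3/2 is a rational above the square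
    root of 2. *)
Lemma Ex_abs_herm2 a :
  Ex PZ (fun w => `|dot a (Z w) ^+ 2 - dot a a|) <= 3 / 2 * enorm a ^+ 2.
Proof.
apply: Ex_abs_le => //; first by rewrite mulr_ge0 ?exprn_ge0 ?enorm_ge0//; lra.
rewrite Ex_herm2_sqr exprMn sqr_enorm ler_wpM2r ?sqr_ge0//; lra.
Qed.

Lemma itg_herm3 a b : itg PZ (fun w =>
  (dot a (Z w) ^+ 2 - dot a a) * dot b (Z w) - 2 * dot a (Z w) * dot a b).
Proof.
have n1 : forall z : Rd R d, `|(fun=> 1 : R) z| <= 1 by move=> z; rewrite normr1.
have mc : mRd (fun=> 1) := @measurable_cst _ _ _ _ _ _.
apply: (itg_ext _ (itgB (itgB (itg_gauss 2 a b 0 mc n1) (itgZ (dot a a) (itg_dot b)))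
  (itgZ (2 * dot a b) (itg_dot a)))) => w.
by ring.
Qed.

Lemma Ex_abs_herm3 a b :
  Ex PZ (fun w => `|(dot a (Z w) ^+ 2 - dot a a) * dot b (Z w) - 2 * dot a (Z w) * dot a b|)
  <= 7 / 2 * enorm a ^+ 2 * enorm b.
Proof.
have [a0 b0] := (enorm_ge0 a, enorm_ge0 b).
have [b00|bN0] := eqVneq (enorm b) 0.
  have d0 y : dot y b = 0.
    by apply/eqP; rewrite -normr_le0 (le_trans (dot_le_abs _ _))// b00 mulr0.
  rewrite b00 mulr0 (_ : (fun w => _) = fun=> 0) ?Ex0//; apply/funext => w.
  by rewrite d0 (dotC b) d0 !mulr0 subr0 normr0.
have [a00|aN0] := eqVneq (enorm a) 0.
  have d0 y : dot a y = 0.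
    by apply/eqP; rewrite -normr_le0 (le_trans (dot_le_abs _ _))// a00 mul0r.
  rewrite a00 expr0n/= mulr0 mul0r (_ : (fun w => _) = fun=> 0) ?Ex0//; apply/funext => w.
  by rewrite !d0 expr0n/= !mulr0 subrr mul0r subr0 normr0.
(* Weight in [x y <= x^2 / (2 s) + s y^2 / 2], close to the optimum, which has sqrt 2 for 3/2. The
   two squares contribute 2/3 and 3/4 and the linear term 2, in all 41/12 <= 7/2. *)
pose s := 3 / 2 * enorm a ^+ 2 / enorm b.
have bp : 0 < enorm b by rewrite lt_def bN0.
have ap : 0 < enorm a by rewrite lt_def aN0.
have s0 : 0 < s by rewrite divr_gt0// mulr_gt0 ?exprn_gt0//; lra.
have I1 : itg PZ (fun w => (2 * s)^-1 * (dot a (Z w) ^+ 2 - dot a a) ^+ 2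
   + s / 2 * dot b (Z w) ^+ 2).
  by apply: itgD; apply: itgZ; [exact: i22|exact: itg_mom].
have I2 : itg PZ (fun w => 2 * `|dot a b| * `|dot a (Z w)|).
  by apply: itgZ; apply: itg_abs; exact: itg_dot.
apply: (@le_trans _ _ (Ex PZ (fun w => ((2 * s)^-1 * (dot a (Z w) ^+ 2 - dot a a) ^+ 2
   + s / 2 * dot b (Z w) ^+ 2) + 2 * `|dot a b| * `|dot a (Z w)|))).
  apply: Ex_le => [||w]; [by apply: itg_abs; exact: itg_herm3|exact: itgD|].
  rewrite (le_trans (ler_normB _ _))// lerD//; last first.
    by rewrite !normrM normr_nat mulrAC.
  set x := _ - dot a a; set y := dot b (Z w).
  have : 0 <= (2 * s)^-1 * (`|x| - s * `|y|) ^+ 2.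
    by rewrite mulr_ge0 ?sqr_ge0// invr_ge0 mulr_ge0// ltW.
  rewrite -(real_normK (num_real x)) -(real_normK (num_real y)) normrM.
  have -> : (2 * s)^-1 * (`|x| - s * `|y|) ^+ 2 =
    (2 * s)^-1 * `|x| ^+ 2 - `|x| * `|y| + s / 2 * `|y| ^+ 2.
    by field; rewrite gt_eqF.
  by lra.
rewrite ExD// ExD; [|by apply: itgZ; exact: i22|by apply: itgZ; exact: itg_mom].
rewrite !ExZ ?Ex_herm2_sqr ?Ex_dot2; [|by apply: itg_abs; exact: itg_dot|exact: itg_mom|exact: i22].
rewrite -!sqr_enorm.
have h1 : `|dot a b| * Ex PZ (fun w => `|dot a (Z w)|) <= (enorm a * enorm b) * enorm a.
  by apply: ler_pM; rewrite ?dot_le_abs ?Ex_abs_dot//; apply: Ex_ge0.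
have -> : (2 * s)^-1 * (2 * (enorm a ^+ 2) ^+ 2) = 2 / 3 * enorm a ^+ 2 * enorm b.
  by rewrite /s; field; rewrite bN0 aN0.
have -> : s / 2 * enorm b ^+ 2 = 3 / 4 * enorm a ^+ 2 * enorm b.
  by rewrite /s; field.
have := mulr_ge0 (sqr_ge0 (enorm a)) b0.
by rewrite -mulrA; move: h1; rewrite expr2; lra.
Qed.

Section bounded.
Variables (F : Rd R d -> R) (M : R).
Hypotheses (mF : mRd F) (FM : forall z, `|F z| <= M).

Let M0 : 0 <= M. Proof. exact: le_trans (FM 0). Qed.

Lemma H1_le a : `|H1 F a| <= M * enorm a.
Proof.
rewrite (le_trans (Ex_mul_le (mRd_Z mF) (fun w => FM (Z w)) (itg_dot a)))//.
by rewrite ler_wpM2l// Ex_abs_dot.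
Qed.

Lemma H2_le a : `|H2 F a| <= 3 / 2 * M * enorm a ^+ 2.
Proof.
rewrite (le_trans (Ex_mul_le (mRd_Z mF) (fun w => FM (Z w)) (i2 a)))//.
by rewrite (mulrC _ M) -mulrA ler_wpM2l// Ex_abs_herm2.
Qed.

Lemma H3_le a b : `|H3 F a b| <= 7 / 2 * M * enorm a ^+ 2 * enorm b.
Proof.
rewrite (le_trans (Ex_mul_le (mRd_Z mF) (fun w => FM (Z w)) (itg_herm3 a b)))//.
rewrite [leRHS](_ : _ = M * (7 / 2 * enorm a ^+ 2 * enorm b)); last by ring.
by rewrite ler_wpM2l// Ex_abs_herm3.
Qed.

Let ig k a y := itg_pol k a y mF FM.

Lemma der_H0 b r : der (fun r => H0 (shf (r *: b) F)) r (H1 (shf (r *: b) F) b).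
Proof.
have := @der_gauss F M 0 0 b r mF FM; rewrite /H0 /H1 /shf.
under [X in der X]eq_fun do under Ex_ext do rewrite expr0 mulr1.
by move/der_eq; apply; apply: Ex_ext => w; rewrite expr0 mul1r !mul0r subr0.
Qed.

Lemma der_H1 a b r : der (fun r => H1 (shf (r *: b) F) a) r
  (Ex PZ (fun w => F (Z w + r *: b) * (dot a (Z w) * dot b (Z w) - dot a b))).
Proof.
apply: der_eq (@der_gauss F M 1 a b r mF FM) _.
by apply: Ex_ext => w; rewrite /= mulr1 mul1r expr1.
Qed.

Lemma der_H1_diag b r :
  der (fun r => H1 (shf (r *: b) F) b) r (H2 (shf (r *: b) F) b).
Proof. by apply: der_eq (der_H1 b b r) _; apply: Ex_ext => w; rewrite expr2. Qed.

Lemma H2E a y : H2 (shf y F) a =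
  Ex PZ (fun w => F (Z w + y) * dot a (Z w) ^+ 2) - dot a a * H0 (shf y F).
Proof.
have i0 : itg PZ (fun w => F (Z w + y)).
  by apply: itg_ext (ig 0 a y) => w; rewrite expr0 mulr1.
rewrite /H0 -ExZ// -ExB//; last exact: itgZ.
by apply: Ex_ext => w; rewrite /shf; ring.
Qed.

Lemma der_H2 a b r :
  der (fun r => H2 (shf (r *: b) F) a) r (H3 (shf (r *: b) F) a b).
Proof.
rewrite (_ : (fun r => H2 _ a) = fun r =>
  Ex PZ (fun w => F (Z w + r *: b) * dot a (Z w) ^+ 2) - dot a a * H0 (shf (r *: b) F)); last first.
  by apply/funext => t; exact: H2E.
apply: der_eq (derB (@der_gauss F M 2 a b r mF FM) (derZ (dot a a) (der_H0 b r))) _.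
have i1 : itg PZ (fun w => F (Z w + r *: b) * dot b (Z w)) := ig 1 b _.
rewrite /H1 -ExZ// -ExB; last exact: itgZ.
  by apply: Ex_ext => w; rewrite /shf /= expr1; ring.
apply: (itg_ext _ (itgB (itg_gauss 2 a b (r *: b) mF FM) (itgZ (2 * dot a b) (ig 1 a (r *: b))))) => w.
by rewrite /= !expr1; ring.
Qed.

End bounded.

Lemma shf0 F : shf 0 F = F.
Proof. by apply/funext => z; rewrite /shf addr0. Qed.

Lemma shf_mvt (g : (Rd R d -> R) -> R) (g' : R -> R) F b C :
  (forall r, der (fun r => g (shf (r *: b) F)) r (g' r)) ->
  (forall r, `|g' r| <= C) -> `|g (shf b F) - g F| <= C.
Proof.
move=> dg gC; have [c _] := mvt01 dg.
by rewrite scale1r scale0r shf0 => ->.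
Qed.

Section bounded2.
Variables (F : Rd R d -> R) (M : R).
Hypotheses (mF : mRd F) (FM : forall z, `|F z| <= M).

Lemma H0_shift b : `|H0 (shf b F) - H0 F| <= M * enorm b.
Proof.
apply: (shf_mvt (g := H0) (der_H0 mF FM b)) => r.
by apply: H1_le; [exact: mRd_shf|move=> z; exact: FM].
Qed.

Lemma H2_shift a b : `|H2 (shf b F) a - H2 F a| <= 7 / 2 * M * enorm a ^+ 2 * enorm b.
Proof.
apply: (shf_mvt (g := H2^~ a) (der_H2 mF FM a b)) => r.
by apply: H3_le; [exact: mRd_shf|move=> z; exact: FM].
Qed.

Lemma shf_shf x y : shf x (shf y F) = shf (x + y) F.
Proof. by apply/funext => z; rewrite /shf addrA. Qed.

Lemma H0_taylor y :
  `|H0 (shf y F) - H0 F - H1 F y - H2 F y / 2| <= 7 / 2 * M * enorm y ^+ 3.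
Proof.
have := @taylor01 _ _ _ _ (7 / 2 * M * enorm y ^+ 3) (der_H0 mF FM y) (der_H1_diag mF FM y).
rewrite /= scale1r scale0r shf0; apply=> r.
rewrite (le_trans (H2_shift _ _))// enormZ.
rewrite [leRHS](_ : _ = 7 / 2 * M * enorm y ^+ 2 * (`|r| * enorm y))//; ring.
Qed.

(* Only the values of F at distance at most 1 enter: H2 F e is compared with a difference of
   H1 F e along e, by the mean value theorem. *)
Lemma H2_osc e (om : R) : enorm e = 1 ->
  (forall z r, 0 <= r <= 1 -> `|F (z + r *: e) - F z| <= om) ->
  `|H2 F e| <= 5 / 2 * om.
Proof.
move=> e1 Fom.
have om0 : 0 <= om by apply: le_trans (Fom 0 0 _); rewrite // lexx ler01.
have [c c01] := mvt01 (der_H1_diag mF FM e).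
rewrite scale1r scale0r shf0 => E.
pose G r : Rd R d -> R := fun z => F (z + r *: e) - F z.
have mG r : mRd (G r) by apply: measurable_funB => //; exact: mRd_shf.
have Gom r : 0 <= r <= 1 -> forall z, `|G r z| <= om by move=> r01 z; exact: Fom.
have i1 y : itg PZ (fun w => F (Z w + y) * dot e (Z w)) := itg_pol 1 e y mF FM.
have i2' y : itg PZ (fun w => F (Z w + y) * (dot e (Z w) ^+ 2 - dot e e)).
  apply: (itg_ext _ (itgB (itg_pol 2 e y mF FM) (itgZ (dot e e) (itg_pol 0 e y mF FM)))) => w.
  by rewrite expr0 ; ring.
have B1 : `|H1 (shf e F) e - H1 F e| <= om.
  have := H1_le (mG 1) (Gom 1 _) e; rewrite ler01 lexx e1 mulr1 => /(_ erefl).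
  rewrite /H1 -ExB; [|exact: i1|by apply: itg_ext (i1 0) => w; rewrite addr0].
  by congr (`|_| <= _); apply: Ex_ext => w; rewrite /G /shf scale1r mulrBl.
have B2 : `|H2 (shf (c *: e) F) e - H2 F e| <= 3 / 2 * om.
  have := H2_le (mG c) (Gom c c01) e; rewrite e1 expr1n mulr1.
  rewrite /H2 -ExB; [|exact: i2'|by apply: itg_ext (i2' 0) => w; rewrite addr0].
  by congr (`|_| <= _); apply: Ex_ext => w; rewrite /G /shf mulrBl.
rewrite -E in B2; move: B1 B2; rewrite !ler_norml => /andP[? ?] /andP[? ?].
by apply/andP; split; lra.
Qed.

End bounded2.

Section bounded3.
Variables (F : Rd R d -> R) (M : R).
Hypotheses (mF : mRd F) (FM : forall z, `|F z| <= M).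

Let i0 y : itg PZ (fun w => F (Z w + y)).
Proof. by apply: itg_ext (itg_pol 0 0 y mF FM) => w; rewrite expr0 mulr1. Qed.

Lemma itg_H1 a : itg PZ (fun w => F (Z w) * dot a (Z w)).
Proof. by apply: itg_ext (itg_pol 1 a 0 mF FM) => w; rewrite addr0. Qed.

Lemma itg_H2 a y : itg PZ (fun w => F (Z w + y) * (dot a (Z w) ^+ 2 - dot a a)).
Proof.
apply: (itg_ext _ (itgB (itg_pol 2 a y mF FM) (itgZ (dot a a) (i0 y)))) => w.
by rewrite mulrBr [X in _ - X]mulrC.
Qed.

Lemma itg_H20 a : itg PZ (fun w => F (Z w) * (dot a (Z w) ^+ 2 - dot a a)).
Proof. by apply: itg_ext (itg_H2 a 0) => w; rewrite addr0. Qed.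

Lemma H1Z c a : H1 F (c *: a) = c * H1 F a.
Proof.
by rewrite /H1 -ExZ; [apply: Ex_ext => w; rewrite dotZl; ring|exact: itg_H1].
Qed.

Lemma H2Z c a : H2 F (c *: a) = c ^+ 2 * H2 F a.
Proof.
rewrite /H2 -ExZ; last exact: itg_H20.
by apply: Ex_ext => w; rewrite !dotZl dotZr; ring.
Qed.

(* H2 F a is the limit of eta^-2 times the Gaussian mean of the second difference of F in the
   direction eta a, and a Gaussian mean moves by at most the sup norm times enorm b. *)
Lemma H2_snd a b (C eta0 : R) : 0 < eta0 -> 0 <= C ->
  (forall z eta, 0 < eta <= eta0 ->
    `|F (z + eta *: a) + F (z - eta *: a) - 2 * F z| <= C * eta ^+ 2) ->
  `|H2 (shf b F) a - H2 F a| <= C * enorm b.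
Proof.
move=> eta00 C0 FC; apply/ler_addgt0Pr => e e0.
have M0 : 0 <= M by exact: le_trans (FM 0).
(* A second difference combines two Taylor remainders 7/2, and it is expanded both at 0 and at
   [b]. *)
pose L := 14 * M * enorm a ^+ 3.
have L0 : 0 <= L by rewrite !mulr_ge0 ?exprn_ge0 ?enorm_ge0.
pose eta := Num.min eta0 (e / (L + 1)).
have eta_gt0 : 0 < eta by rewrite lt_min eta00 divr_gt0//; lra.
have etale : eta <= eta0 by rewrite ge_min lexx.
have etaL : L * eta <= e.
  apply: (@le_trans _ _ (L * (e / (L + 1)))); first by rewrite ler_wpM2l// ge_min lexx orbT.
  by rewrite mulrA ler_pdivrMr; [rewrite mulrDr mulrC; lra|lra].
pose G : Rd R d -> R := fun z => shf (eta *: a) F z + shf (- eta *: a) F z - 2 * F z.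
have mG : mRd G.
  apply: measurable_funB; last exact: measurable_funM.
  by apply: measurable_funD; exact: mRd_shf.
have GC z : `|G z| <= C * eta ^+ 2.
  by rewrite /G /shf scaleNr; apply: FC; rewrite eta_gt0.
have sd y : `|H0 (shf y G) - eta ^+ 2 * H2 (shf y F) a| <= eta ^+ 2 * (L / 2 * eta).
  have mFy := mRd_shf y mF.
  have FMy z : `|shf y F z| <= M by exact: FM.
  have E : H0 (shf y G) = H0 (shf (eta *: a) (shf y F)) + H0 (shf (- eta *: a) (shf y F)) - 2 * H0 (shf y F).
    rewrite /H0 -ExZ; last exact: i0.
    rewrite -ExD; last 2 first.
    - by apply: itg_ext (i0 (eta *: a + y)) => w; rewrite /shf addrA.
    - by apply: itg_ext (i0 (- eta *: a + y)) => w; rewrite /shf addrA.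
    rewrite -ExB; last 2 first.
    - apply: (itg_ext _ (itgD (i0 (eta *: a + y)) (i0 (- eta *: a + y)))) => w.
      by rewrite /shf !addrA.
    - by apply: itgZ; exact: i0.
    by apply: Ex_ext => w; rewrite /G /shf !(addrAC _ y).
  have T1 := H0_taylor mFy FMy (eta *: a).
  have T2 := H0_taylor mFy FMy (- eta *: a).
  have Z1 c : H1 (shf y F) (c *: a) = c * H1 (shf y F) a.
    rewrite /H1 -ExZ; last exact: (itg_pol 1 a y mF FM).
    by apply: Ex_ext => w; rewrite dotZl; ring.
  have Z2 c : H2 (shf y F) (c *: a) = c ^+ 2 * H2 (shf y F) a.
    rewrite /H2 -ExZ; last exact: itg_H2.
    by apply: Ex_ext => w; rewrite !dotZl dotZr; ring.
  rewrite Z1 Z2 enormZ (@gtr0_norm _ eta)// in T1; rewrite Z1 Z2 enormZ normrN sqrrN (@gtr0_norm _ eta)// in T2.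
  have <- : 7 / 2 * M * (eta * enorm a) ^+ 3 + 7 / 2 * M * (eta * enorm a) ^+ 3 =
    eta ^+ 2 * (L / 2 * eta) by rewrite /L; field.
  rewrite E; apply: le_trans (lerD T1 T2); apply: le_trans (ler_normD _ _).
  by rewrite le_eqVlt; apply/orP; left; apply/eqP; congr `|_|; field.
have := H0_shift mG GC b; have := sd b; have := sd 0; rewrite !shf0 => s0 sb sh.
have e20 : 0 < eta ^+ 2 by rewrite exprn_gt0.
rewrite -(ler_pM2l e20) -[X in X * `|_|]gtr0_norm// -normrM.
have -> : eta ^+ 2 * (H2 (shf b F) a - H2 F a) =
  - (H0 (shf b G) - eta ^+ 2 * H2 (shf b F) a) + (H0 (shf b G) - H0 G)
  + (H0 G - eta ^+ 2 * H2 F a) by ring.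
have -> : eta ^+ 2 * (C * enorm b + e) = C * eta ^+ 2 * enorm b + eta ^+ 2 * e by ring.
rewrite (le_trans (ler_normD _ _))// (le_trans (lerD (ler_normD _ _) (lexx _)))// normrN.
have : eta ^+ 2 * (L / 2 * eta) + eta ^+ 2 * (L / 2 * eta) <= eta ^+ 2 * e.
  by rewrite -mulrDr ler_pM2l//; lra.
by lra.
Qed.

End bounded3.

End gauss_calculus.

(** * Convex functions with unit subgradients *)

Section indep_expectation.
Context d (T : measurableType d) (R : realType) (P : probability T R).
Context d1 d2 (S1 : measurableType d1) (S2 : measurableType d2).
Variables (U : T -> S1) (V : T -> S2) (a b : T -> R).
Hypothesis mU : measurable_fun setT U.
Hypothesis mV : measurable_fun setT V.
Hypothesis UV : indep2 P U V.
Hypothesis Ia : itg P a.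
Hypothesis Ib : itg P b.

Let mpair (Phi : S1 -> S2 -> R) :
  measurable_fun setT (fun x : S1 * S2 => Phi x.1 x.2) ->
  measurable_fun setT (fun x : T * T => Phi (U x.1) (V x.2)).
Proof.
move=> mPhi; have mg : measurable_fun setT (fun x : T * T => (U x.1, V x.2)).
  apply/measurable_fun_pairP; split.
    exact: measurableT_comp mU measurable_fst.
  exact: measurableT_comp mV measurable_snd.
exact: measurableT_comp mPhi mg.
Qed.

Let indep2_Ex_ge0 (Phi : S1 -> S2 -> R) :
  measurable_fun setT (fun x : S1 * S2 => Phi x.1 x.2) ->
  (forall x y, 0 <= Phi x y) ->
  (forall w1 w2, `|Phi (U w1) (V w2)| <= a w1 * b w2) ->
  itg P (fun w => Phi (U w) (V w)) /\
  Ex P (fun w => Phi (U w) (V w)) =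
    Ex P (fun w1 => Ex P (fun w2 => Phi (U w1) (V w2))).
Proof.
move=> mPhi Phi0 bd.
have mE : measurable_fun setT (fun x : S1 * S2 => (Phi x.1 x.2)%:E).
  exact/measurable_EFinP.
have h := indep2_integral mU mV UV mE (fun x => _).
have h' : (\int[P]_w (Phi (U w) (V w))%:E)%E =
    (Ex P (fun w1 => Ex P (fun w2 => Phi (U w1) (V w2))))%:E.
  rewrite h; last by move=> x; rewrite lee_fin.
  transitivity (\int[P]_w1 (Ex P (fun w2 => Phi (U w1) (V w2)))%:E)%E.
    by apply: eq_integral => w1 _; rewrite itg_fin//; exact: (dom_itg1 (f := fun x y => Phi (U x) (V y)) (mpair mPhi) Ib bd).
  by rewrite itg_fin//; exact: (Ex_prod1 (f := fun x y => Phi (U x) (V y)) (mpair mPhi) Ia Ib bd).1.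
split; last by rewrite /Ex /Rintegral h'.
apply/integrableP; split.
  apply/measurable_EFinP; apply: (measurableT_comp mPhi (g := fun w => (U w, V w))).
  exact/measurable_fun_pairP.
under eq_integral do rewrite /= ger0_norm//.
by rewrite h' ltry.
Qed.

(** Splitting [Phi] into positive and negative parts reduces the claim to Tonelli. The domination is
    stated along [U] and [V], where moments of the summands provide it. *)
Lemma indep2_Ex (Phi : S1 -> S2 -> R) :
  measurable_fun setT (fun x : S1 * S2 => Phi x.1 x.2) ->
  (forall w1 w2, `|Phi (U w1) (V w2)| <= a w1 * b w2) ->
  itg P (fun w => Phi (U w) (V w)) /\
  Ex P (fun w => Phi (U w) (V w)) =
    Ex P (fun w1 => Ex P (fun w2 => Phi (U w1) (V w2))).
Proof.
move=> mPhi bd.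
pose p x y := Num.max (Phi x y) 0; pose q x y := Num.max (- Phi x y) 0.
have mp : measurable_fun setT (fun x : S1 * S2 => p x.1 x.2).
  exact: measurable_maxr.
have mq : measurable_fun setT (fun x : S1 * S2 => q x.1 x.2).
  by apply: measurable_maxr => //; exact: measurable_funN.
have p0 x y : 0 <= p x y by rewrite le_max lexx orbT.
have q0 x y : 0 <= q x y by rewrite le_max lexx orbT.
have bp w1 w2 : `|p (U w1) (V w2)| <= a w1 * b w2.
  rewrite (le_trans _ (bd w1 w2))// ger0_norm// ge_max normr_ge0 andbT.
  exact: ler_norm.
have bq w1 w2 : `|q (U w1) (V w2)| <= a w1 * b w2.
  rewrite (le_trans _ (bd w1 w2))// ger0_norm// ge_max normr_ge0 andbT -normrN.
  exact: ler_norm.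
have E x y : Phi x y = p x y - q x y by rewrite /p /q; case: (lerP (Phi x y) 0); case: (lerP (- Phi x y) 0); lra.
have [Ip Ep] := indep2_Ex_ge0 mp p0 bp.
have [Iq Eq] := indep2_Ex_ge0 mq q0 bq.
have EE : (fun w => Phi (U w) (V w)) = (fun w => p (U w) (V w) - q (U w) (V w)).
  by apply/funext => w; rewrite E.
split; first by rewrite EE; exact: itgB.
rewrite EE (ExB Ip Iq) Ep Eq -ExB; last 2 first.
- exact: (Ex_prod1 (f := fun x y => p (U x) (V y)) (mpair mp) Ia Ib bp).1.
- exact: (Ex_prod1 (f := fun x y => q (U x) (V y)) (mpair mq) Ia Ib bq).1.
apply: Ex_ext => w1; rewrite -ExB.
- by apply: Ex_ext => w2; rewrite E.
- exact: (dom_itg1 (f := fun x y => p (U x) (V y)) (mpair mp) Ib bp).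
- exact: (dom_itg1 (f := fun x y => q (U x) (V y)) (mpair mq) Ib bq).
Qed.

End indep_expectation.

Section usub.
Context {R : realType} {d : nat}.
Implicit Types (s : 'cV[R]_d -> R) (u : 'cV[R]_d -> 'cV[R]_d) (x y w xi : 'cV[R]_d).

(* The model case is the maximum of finitely many affine functions x |-> dot v x - c with v of
   norm 1, whose sublevel sets are the polytopes. *)
Definition usub s u := [/\ cmeas (u : Rd R d -> 'cV[R]_d),
  forall x, enorm (u x) = 1 & forall x y, s x + dot (u x) (y - x) <= s y].

Lemma usub_lip s u : usub s u -> lip 1 s.
Proof.
case=> _ u1 su x y; rewrite mul1r ler_norml.
have h1 := su x y; have h2 := su y x.
have := dot_le_abs (u x) (y - x); have := dot_le_abs (u y) (x - y).
rewrite !u1 !mul1r (enorm_distC y x) !ler_norml => /andP[? ?] /andP[? ?].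
by apply/andP; split; lra.
Qed.

Lemma usub_meas s u : usub s u -> measurable_fun [set: Rd R d] (s : Rd R d -> R).
Proof. by move=> /usub_lip; exact: lip_borel. Qed.

Lemma usub_comp_meas dT (T : measurableType dT) (Y : T -> 'cV[R]_d) s u :
  cmeas Y -> usub s u -> measurable_fun setT (fun v : T => s (Y v)).
Proof. by move=> mY su; exact: measurableT_comp (usub_meas su) (cmeas_borel mY). Qed.

Lemma usubD s u c : usub s u -> usub (fun x => s x + c) u.
Proof.
case=> mu u1 su; split => // x y.
by rewrite addrAC lerD2r.
Qed.

(** Division by [c] keeps the subgradients at norm 1. A window of width q for [s] at [c *: V + v]
    thus becomes a window of width q / c for a function of the same class at [V]. *)
Lemma usub_scale s u (c : R) v : 0 < c -> usub s u ->
  usub (fun x => s (c *: x + v) / c) (fun x => u (c *: x + v)).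
Proof.
move=> c0 [mu u1 su]; split => //.
- apply: (cmeas_comp (S' := Rd R d) (g := fun x : Rd R d => (c *: x + v : Rd R d)) mu).
  apply: cmeas_borel; by apply: cmeasD; [apply: cmeasZ => //; exact: cmeas_id|exact: cmeas_cst].
- move=> x y; have := su (c *: x + v) (c *: y + v).
  rewrite -(ler_pM2r (_ : 0 < c^-1)) ?invr_gt0//.
  have -> : c *: y + v - (c *: x + v) = c *: (y - x).
    by rewrite scalerBr opprD addrACA subrr addr0.
  by rewrite dotZr mulrDl mulrAC divff ?mul1r// gt_eqF.
Qed.

Definition clamp (a r : R) := Num.max 0 (Num.min r a).

(* Monotone, being a subgradient of a convex increasing function of s: this drives both the
   Gaussian and the randomized concentration inequalities. *)
Definition vfield s u (l a : R) w := clamp a (s w - l) *: u w.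

Lemma clamp_ge0 a r : 0 <= clamp a r.
Proof. by rewrite le_max lexx. Qed.

Lemma clamp_le a r : 0 <= a -> clamp a r <= a.
Proof. by move=> a0; rewrite ge_max a0 ge_min lexx orbT. Qed.

Lemma clamp_id a r : 0 <= r <= a -> clamp a r = r.
Proof. by move=> /andP[r0 ra]; rewrite /clamp (min_idPl ra) (max_idPr r0). Qed.

Lemma clamp_mono a r t : r <= t -> clamp a r <= clamp a t.
Proof.
rewrite /clamp => rt; case: (lerP r a) => ra; case: (lerP t a) => ta.
all: rewrite ge_max le_max lexx /= le_max; apply/orP; right; lra.
Qed.

Lemma clampD_lip (a b r : R) (sg : bool) : 0 <= a -> 0 <= b ->
  `|clamp a (r + sg%:R * a) - clamp b (r + sg%:R * b)| <= `|a - b|.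
Proof.
rewrite /clamp => a0 b0.
have H (x y : R) : x - y <= `|a - b| -> y - x <= `|a - b| -> `|x - y| <= `|a - b|.
  by move=> ? ?; rewrite ler_norml; apply/andP; split; lra.
have := ler_norm (a - b); have := ler_norm (b - a); rewrite distrC => n1 n2.
case: sg => /=; rewrite ?mul1r ?mul0r ?addr0; apply: H;
repeat match goal with |- context [Num.min ?x ?y] => case: (lerP x y) => ? end;
repeat match goal with |- context [Num.max ?x ?y] => case: (lerP x y) => ? end; lra.
Qed.

Section monotone.
Variables (s : 'cV[R]_d -> R) (u : 'cV[R]_d -> 'cV[R]_d) (l a : R).
Hypothesis su : usub s u.

Lemma enorm_vfield w : enorm (vfield s u l a w) = clamp a (s w - l).
Proof. by case: su => _ u1 _; rewrite enormZ u1 mulr1 ger0_norm ?clamp_ge0. Qed.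

Lemma vfield_meas : cmeas (vfield s u l a : Rd R d -> 'cV[R]_d).
Proof.
case: (su) => mu _ _; apply: cmeasZ => //; apply: measurable_maxr => //.
apply: measurable_minr => //; apply: measurable_funB => //; exact: usub_meas su.
Qed.

(** Convexity gives [q <= s w - s (w - xi) <= p] for the slopes along [xi] at the two ends, and the
    clamped factors are ordered like the values of [s]. *)
Lemma vfield_mono w xi :
  0 <= dot xi (vfield s u l a w - vfield s u l a (w - xi)).
Proof.
case: su => _ _ sub; rewrite dotBr !dotZr.
have h1 := sub w (w - xi); have h2 := sub (w - xi) w.
rewrite addrAC subrr sub0r dotNr in h1; rewrite opprB addrCA subrr addr0 in h2.
rewrite (dotC xi (u w)) (dotC xi (u (w - xi))).
set p := dot (u w) xi in h1 *; set q := dot _ xi in h2 *.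
set A := clamp _ _; set B := clamp _ _.
have A0 : 0 <= A by exact: clamp_ge0.
have B0 : 0 <= B by exact: clamp_ge0.
case: (lerP (s (w - xi)) (s w)) => ss.
  have AB : B <= A by apply: clamp_mono; lra.
  by nra.
have AB : A <= B by apply: clamp_mono; lra.
by nra.
Qed.

(** The margins make the clamp the identity at [w] and at [w - xi], with value at least [k] at the
    latter. With delta the increment of [s], the difference is p delta + (s (w - xi) - l) (p - q);
    since q <= delta <= p <= k, the second term is at least p (p - delta), and the sum at least
    p^2. *)
Lemma vfield_collar w xi k : enorm xi <= k -> l + 2 * k <= s w <= l + a - k ->
  dot xi (u w) ^+ 2 <= dot xi (vfield s u l a w - vfield s u l a (w - xi)).
Proof.
move=> xk /andP[w1 w2]; case: (su) => _ u1 sub.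
have := usub_lip su w (w - xi); rewrite mul1r opprB addrCA subrr addr0 ler_norml => /andP[l1 l2].
have h1 := sub w (w - xi); have h2 := sub (w - xi) w.
rewrite addrAC subrr sub0r dotNr in h1; rewrite opprB addrCA subrr addr0 in h2.
have k0 : 0 <= k by exact: le_trans (enorm_ge0 _) xk.
have := dot_le (u w) xi; rewrite u1 mul1r => pk.
rewrite dotBr !dotZr !clamp_id; last 2 first.
- by apply/andP; split; lra.
- by apply/andP; split; lra.
rewrite (dotC xi (u w)) (dotC xi (u (w - xi))).
set p := dot (u w) xi in h1 pk *; set q := dot _ xi in h2 *.
have : 0 <= (s (w - xi) - l) * (p - q) - k * (p - (s w - s (w - xi))).
  rewrite subr_ge0; apply: ler_pM => //; lra.
have : 0 <= (k - p) * (p - (s w - s (w - xi))) by rewrite mulr_ge0//; lra.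
rewrite expr2; lra.
Qed.

End monotone.
End usub.

Section gauss_collar.
Context (R : realType) (d : nat) (disp : measure_display)
  (OZ : measurableType disp) (PZ : probability OZ R) (Z : OZ -> 'cV[R]_d).
Hypothesis HZ : std_gaussian PZ Z.

Let mZ : cmeas Z. Proof. exact: gauss_cmeas HZ. Qed.

Lemma sum_coord_sqr (x : 'cV[R]_d) : \sum_j x j 0 ^+ 2 = enorm x ^+ 2.
Proof. by rewrite sqr_enorm /dot; apply: eq_bigr => j _; rewrite expr2. Qed.

Lemma itg_gauss_norm2 : itg PZ (fun w => enorm (Z w) ^+ 2).
Proof.
apply: (@itg_ext _ _ _ _ (fun w => \sum_j dot (bvec j : 'cV[R]_d) (Z w) ^+ 2)).
  by move=> w; rewrite -sum_coord_sqr; apply: eq_bigr => j _; rewrite dotC dot_bvec.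
by apply: itg_sum => j _; exact: itg_mom HZ _ _.
Qed.

Lemma Ex_gauss_norm2 : Ex PZ (fun w => enorm (Z w) ^+ 2) = d%:R.
Proof.
transitivity (Ex PZ (fun w => \sum_j dot (bvec j : 'cV[R]_d) (Z w) ^+ 2)).
  by apply: Ex_ext => w; rewrite -sum_coord_sqr; apply: eq_bigr => j _; rewrite dotC dot_bvec.
rewrite Ex_sum => [|j _]; last exact: itg_mom HZ _ _.
under eq_bigr do rewrite (Ex_dot2 HZ) -sqr_enorm enorm_bvec expr1n.
by rewrite sumr_const card_ord.
Qed.

Lemma itg_gauss_norm : itg PZ (fun w => enorm (Z w)).
Proof.
apply: itg_le (itgD itg_gauss_norm2 (itg_cst PZ 1)) _.
  exact: cmeas_enorm.
move=> w; rewrite ger0_norm ?enorm_ge0//.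
by have := sqr_ge0 (enorm (Z w) - 1); have := enorm_ge0 (Z w); nra.
Qed.

Lemma Ex_gauss_norm : Ex PZ (fun w => enorm (Z w)) <= Num.sqrt d%:R.
Proof.
rewrite (@Ex_ext _ _ _ _ _ (fun w => `|enorm (Z w)|)); last first.
  by move=> w; rewrite ger0_norm ?enorm_ge0.
apply: Ex_abs_le; [exact: sqrtr_ge0|exact: itg_gauss_norm|exact: itg_gauss_norm2|].
by rewrite Ex_gauss_norm2 sqr_sqrtr.
Qed.

Section collar.
Variables (s : 'cV[R]_d -> R) (u : 'cV[R]_d -> 'cV[R]_d).
Hypothesis su : usub s u.

Lemma gauss_collar_meas (l a : R) : measurable [set w | l <= s (Z w) <= a].
Proof. exact: slab_meas (usub_comp_meas (gauss_cmeas HZ) su). Qed.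

(** The increment of coordinate [j] of the field along [eta *: bvec j] has mean at most [eta * H1]
    up to O(eta^2), and at least eta times the mean of [u_j^2] on the collar. Summing over [j], the
    squares add up to 1 and the [H1] terms to the mean of [dot (vfield Z) Z], at most a times the
    mean of |Z|. *)
Let step (l a eta : R) : 0 <= a -> 0 < eta ->
  pr PZ [set w | l + 2 * eta <= s (Z w) <= l + a - eta] <=
  Num.sqrt d%:R * a + (5 * a * d%:R) * (eta + eta ^+ 2).
Proof.
move=> a0 eta0; case: (su) => _ u1 _.
pose f (j : 'I_d) : Rd R d -> R := fun z => vfield s u l a z j 0.
have mf j : mRd (f j) by exact: vfield_meas su j.
have fa j z : `|f j z| <= a.
  by rewrite (le_trans (coord_le_enorm _ _))// enorm_vfield// clamp_le.
pose A := [set w | l + 2 * eta <= s (Z w) <= l + a - eta].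
have mA : measurable A by exact: gauss_collar_meas.
have iu j : itg PZ (fun w => u (Z w) j 0 ^+ 2 * \1_A w).
  apply: (@itg_bnd _ _ _ _ _ 1).
    apply: measurable_funM; last exact: measurable_indic.
    apply: measurable_funX; case: (su) => mu _ _.
    exact: mRd_Z HZ _ (mu j).
  move=> w; rewrite normrM mulr_ile1//; last by rewrite indicE normr_nat; case: (_ \in _).
  by rewrite normrX expr_le1// -(u1 (Z w)) coord_le_enorm.
have H j : eta * Ex PZ (fun w => u (Z w) j 0 ^+ 2 * \1_A w) <=
    H1 PZ Z (f j) (bvec j) * eta + 5 * a * (eta ^+ 2 + eta ^+ 3).
  set e : 'cV[R]_d := bvec j.
  have T := H0_taylor HZ (mf j) (fa j) (- eta *: e).
  rewrite (H1Z HZ (mf j) (fa j)) (H2Z HZ (mf j) (fa j)) enormZ normrN enorm_bvec mulr1 sqrrN (gtr0_norm eta0) in T.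
  have B2 := H2_le HZ (mf j) (fa j) e; rewrite enorm_bvec expr1n mulr1 in B2.
  have i0 y : itg PZ (fun w => f j (Z w + y)).
    by apply: itg_ext (itg_pol HZ 0 0 y (mf j) (fa j)) => w; rewrite expr0 mulr1.
  have i00 : itg PZ (fun w => f j (Z w)).
    by apply: itg_ext (i0 0) => w; rewrite addr0.
  have : eta * Ex PZ (fun w => u (Z w) j 0 ^+ 2 * \1_A w) <=
      H0 PZ Z (f j) - H0 PZ Z (shf (- eta *: e) (f j)).
    rewrite /H0 -ExB; [|exact: i00|exact: i0].
    rewrite -ExZ; last exact: iu.
    apply: Ex_le; [by apply: itgZ; exact: iu|by apply: itgB; [exact: i00|exact: i0]|move=> w].
    rewrite /shf /f scaleNr.
    have dd (x y : 'cV[R]_d) : eta * (x j 0 - y j 0) = dot (eta *: e) (x - y).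
      by rewrite dotZl dotC dot_bvec !mxE.
    rewrite -(ler_pM2l eta0) dd indicE.
    case: (boolP (w \in A)) => [/set_mem wA|_]; last by rewrite !mulr0 vfield_mono.
    rewrite mulr1; apply: le_trans (vfield_collar su _ wA); last first.
      by rewrite enormZ enorm_bvec mulr1 gtr0_norm.
    by rewrite dotZl dotC dot_bvec exprMn mulrA -expr2.
  move: T B2; rewrite !ler_norml => /andP[T1 T2] /andP[B1 B2].
  have e2 : 0 <= eta ^+ 2 by exact: sqr_ge0.
  have e3 : 0 <= a * eta ^+ 3 by rewrite mulr_ge0// exprn_ge0// ltW.
  have : eta ^+ 2 * H2 PZ Z (f j) e <= eta ^+ 2 * (3 / 2 * a) by rewrite ler_wpM2l.
  have : eta ^+ 2 * (- (3 / 2 * a)) <= eta ^+ 2 * H2 PZ Z (f j) e by rewrite ler_wpM2l.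
  have : 0 <= eta ^+ 2 * a by rewrite mulr_ge0.
  rewrite -/e; lra.
have S1 : pr PZ A = \sum_j Ex PZ (fun w => u (Z w) j 0 ^+ 2 * \1_A w).
  rewrite -Ex_indic// -Ex_sum => [|j _]; last exact: iu.
  apply: Ex_ext => w; rewrite -mulr_suml sum_coord_sqr u1 expr1n mul1r//.
have S2 : \sum_j H1 PZ Z (f j) (bvec j) <= a * Num.sqrt d%:R.
  rewrite /H1 -Ex_sum => [|j _]; last exact: (itg_H1 HZ (mf j) (fa j)).
  apply: (@le_trans _ _ (Ex PZ (fun w => a * enorm (Z w)))).
    apply: Ex_le; [apply: itg_sum => j _; exact: (itg_H1 HZ (mf j) (fa j))| |].
      by apply: itgZ; exact: itg_gauss_norm.
    move=> w; apply: (@le_trans _ _ (dot (vfield s u l a (Z w)) (Z w))).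
      by rewrite [leRHS]/dot ler_sum// => j _; rewrite dotC dot_bvec.
    rewrite (le_trans (dot_le _ _))// ler_wpM2r ?enorm_ge0//.
    by rewrite enorm_vfield// clamp_le.
  by rewrite ExZ ?ler_wpM2l ?Ex_gauss_norm//; exact: itg_gauss_norm.
have : eta * pr PZ A <= eta * (Num.sqrt d%:R * a + 5 * a * d%:R * (eta + eta ^+ 2)).
  rewrite S1 mulr_sumr (le_trans (ler_sum _ (fun j _ => H j)))// big_split/= -mulr_suml sumr_const card_ord.
  rewrite -mulr_natr.
  have : (\sum_j H1 PZ Z (f j) (bvec j)) * eta <= a * Num.sqrt d%:R * eta by rewrite ler_pM2r.
  by rewrite !exprS expr0; lra.
by rewrite ler_pM2l.
Qed.

(** Widening the window by 2 eta below and eta above compensates the margins in [step]; then eta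
    tends to 0. *)
Lemma gauss_collar (l q : R) : 0 <= q ->
  pr PZ [set w | l <= s (Z w) <= l + q] <= Num.sqrt d%:R * q.
Proof.
move=> q0; apply/ler_addgt0Pr => e e0.
pose C : R := 3 * Num.sqrt d%:R + 10 * (q + 3) * d%:R.
have C0 : 0 <= C by rewrite addr_ge0 ?mulr_ge0 ?sqrtr_ge0//; lra.
pose eta := Num.min 1 (e / (C + 1)).
have eta0 : 0 < eta by rewrite lt_min ltr01 divr_gt0//; lra.
have eta1 : eta <= 1 by rewrite ge_min lexx.
have etaC : C * eta <= e.
  apply: (@le_trans _ _ (C * (e / (C + 1)))); first by rewrite ler_wpM2l// ge_min lexx orbT.
  by rewrite mulrA ler_pdivrMr; [rewrite mulrDr mulrC; lra|lra].
have := @step (l - 2 * eta) (q + 3 * eta) eta _ eta0.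
rewrite subrK (_ : l - 2 * eta + (q + 3 * eta) - eta = l + q); last by ring.
move=> /(_ _)/le_trans; apply; first by rewrite addr_ge0// mulr_ge0// ltW.
apply: (@le_trans _ _ (Num.sqrt d%:R * q + C * eta)); last by rewrite lerD2l.
have : eta + eta ^+ 2 <= 2 * eta by rewrite expr2; nra.
have : q + 3 * eta <= q + 3 by lra.
set x := q + 3 * eta => h1 h2.
have : 5 * x * d%:R * (eta + eta ^+ 2) <= 5 * (q + 3) * d%:R * (2 * eta).
  apply: ler_pM => //; [|exact: addr_ge0 (ltW eta0) (sqr_ge0 _)|].
    by rewrite !mulr_ge0// /x; lra.
  by rewrite ler_wpM2r// ler_wpM2l.
rewrite /x /C; lra.
Qed.

End collar.
End gauss_collar.

(** * Randomized concentration *)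

Section measurability.
Context {R : realType} {d : nat}.

(** [vfield_collar] asks for summands of norm at most [k]. Sending the longer ones to 0 loses in
    total at most [g / k] of the variance in any unit direction, see [trunc_var]. *)
Definition trunc (k : R) (x : 'cV[R]_d) : 'cV[R]_d := if enorm x <= k then x else 0.

Lemma trunc_meas k : cmeas (trunc k : Rd R d -> 'cV[R]_d).
Proof.
move=> j.
have -> : (fun x : Rd R d => trunc k x j 0) = (fun x => if enorm x <= k then x j 0 else 0).
  by apply/funext => x; rewrite /trunc; case: ifP => //; rewrite mxE.
apply: measurable_fun_ifT => //; last exact: cmeas_id.
by apply: measurable_fun_ler => //; apply: cmeas_enorm; exact: cmeas_id.
Qed.

Lemma enorm_trunc_le k x : 0 <= k -> enorm (trunc k x) <= k.
Proof. by move=> k0; rewrite /trunc; case: ifP => // _; rewrite enorm0. Qed.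

Lemma enorm_trunc k x : enorm (trunc k x) <= enorm x.
Proof. by rewrite /trunc; case: ifP => // _; rewrite enorm0 enorm_ge0. Qed.

Lemma vfield_meas2 disp (T : measurableType disp) s u (X : T -> 'cV[R]_d) (l a : T -> R) :
  usub s u -> cmeas X -> measurable_fun setT l -> measurable_fun setT a ->
  cmeas (fun w => vfield s u (l w) (a w) (X w)).
Proof.
move=> su mX ml ma; case: (su) => mu _ _.
have mX' : measurable_fun setT (X : T -> Rd R d) by exact: cmeas_borel.
apply: cmeasZ; last exact: (cmeas_comp (S' := Rd R d) mu mX').
apply: measurable_maxr => //; apply: measurable_minr => //.
apply: measurable_funB => //; exact: measurableT_comp (usub_meas su) mX'.
Qed.

End measurability.

Section moments.
Context d0 (Omega : measurableType d0) (R : realType) (P : probability Omega R) (d : nat).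
Variable x : Omega -> 'cV[R]_d.
Hypothesis mx : cmeas x.
Hypothesis i3 : itg P (fun w => enorm (x w) ^+ 3).

Lemma itg_norm_pow k : (k <= 3)%N -> itg P (fun w => enorm (x w) ^+ k).
Proof.
move=> k3; apply: itg_le (itgD i3 (itg_cst P 1)) _.
  by apply: measurable_funX; exact: cmeas_enorm.
move=> w; have e0 := enorm_ge0 (x w); rewrite ger0_norm ?exprn_ge0//.
case: (lerP (enorm (x w)) 1) => e1.
  by rewrite (@le_trans _ _ 1) ?exprn_ile1// lerDr exprn_ge0.
by rewrite (@le_trans _ _ (enorm (x w) ^+ 3)) ?ler_eXn2l ?lerDl// ltW.
Qed.

Lemma itg_norm : itg P (fun w => enorm (x w)).
Proof. exact: (@itg_norm_pow 1). Qed.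

Lemma itg_norm2 : itg P (fun w => enorm (x w) ^+ 2).
Proof. exact: itg_norm_pow. Qed.

Lemma itg_coord j : itg P (fun w => x w j 0).
Proof. by apply: itg_le itg_norm _ => // w; exact: coord_le_enorm. Qed.

Lemma itg_dotc y : itg P (fun w => dot (x w) y).
Proof. by apply: itg_sum => j _; under eq_fun do rewrite mulrC; exact/itgZ/itg_coord. Qed.

Lemma Ex_dot_eq0 y : (forall j, Ex P (fun w => x w j 0) = 0) ->
  Ex P (fun w => dot (x w) y) = 0.
Proof.
move=> h; rewrite /dot Ex_sum => [|j _].
  rewrite big1// => j _; under Ex_ext do rewrite mulrC.
  by rewrite ExZ ?h ?mulr0//; exact: itg_coord.
by under eq_fun do rewrite mulrC; exact/itgZ/itg_coord.
Qed.

End moments.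

Section concentration.
Context d0 (Omega : measurableType d0) (R : realType) (P : probability Omega R)
  (n d : nat).
Variables (xi : 'I_n -> Omega -> 'cV[R]_d) (De : Omega -> R) (Di : 'I_n -> Omega -> R).
Variables (B g k th : R).
Hypothesis mxi : forall i, cmeas (xi i).
Hypothesis i3 : forall i, itg P (fun w => enorm (xi i w) ^+ 3).
Hypothesis mean0 : forall i j, Ex P (fun w => xi i w j 0) = 0.
Hypothesis g0 : 0 < g.
Hypothesis k0 : 0 < k.
Hypothesis mom3 : \sum_i Ex P (fun w => enorm (xi i w) ^+ 3) <= g.
Hypothesis pair_indep : forall i j, i != j -> indep2 P (xi i : Omega -> Rd R d) (xi j : Omega -> Rd R d).
Let W w := \sum_i xi i w.
Let Wo i w := W w - xi i w.
Hypothesis mDe : measurable_fun setT De.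
Hypothesis mDi : forall i, measurable_fun setT (Di i).
Hypothesis De_bnd : forall w, 0 <= De w <= B.
Hypothesis Di_bnd : forall i w, 0 <= Di i w <= B.
Hypothesis Di_indep : forall i, indep2 P (xi i : Omega -> Rd R d)
  (fun w => (Wo i w : Rd R d, Di i w)).
Hypothesis th_le : forall e, enorm e = 1 ->
  th <= \sum_i Ex P (fun w => dot (trunc k (xi i w)) e ^+ 2).
Variables (s : 'cV[R]_d -> R) (u : 'cV[R]_d -> 'cV[R]_d) (sg : bool).
Hypothesis su : usub s u.

Let mxi' i : measurable_fun setT (xi i : Omega -> Rd R d).
Proof. exact: cmeas_borel. Qed.

Let mT i : cmeas (fun w => trunc k (xi i w)).
Proof. exact: (cmeas_comp (S' := Rd R d) (trunc_meas k) (mxi' i)). Qed.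

Let y j l (x : Rd R d) : R := trunc k x j 0 * trunc k x l 0.

Let my j l : measurable_fun setT (y j l).
Proof. by apply: measurable_funM; exact: trunc_meas. Qed.

Let y_bnd j l x : `|y j l x| <= k ^+ 2.
Proof.
rewrite normrM expr2; have h i := le_trans (coord_le_enorm (trunc k x) i) (enorm_trunc_le x (ltW k0)).
exact: ler_pM.
Qed.

Let c i j l := Ex P (fun w => y j l (xi i w)).

Let c_bnd i j l : `|c i j l| <= k ^+ 2.
Proof. by apply: Ex_bnd => [|w]; [exact: measurableT_comp (my j l) (mxi' i)|exact: y_bnd]. Qed.

Let Y i j l (x : Rd R d) : R := y j l x - c i j l.

Let mY i j l : measurable_fun setT (Y i j l).
Proof. exact: measurable_funB. Qed.

Let Y_bnd i j l x : `|Y i j l x| <= 2 * k ^+ 2.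
Proof. by rewrite (le_trans (ler_normB _ _))// mulr_natl mulr2n lerD. Qed.

Let mYw i j l : measurable_fun setT (fun w => Y i j l (xi i w)).
Proof. exact: measurableT_comp (mY i j l) (mxi' i). Qed.

Let iY i j l : itg P (fun w => Y i j l (xi i w)).
Proof. exact: itg_bnd (mYw i j l) (fun w => Y_bnd i j l _). Qed.

Let iYY i i' j l : itg P (fun w => Y i j l (xi i w) * Y i' j l (xi i' w)).
Proof.
apply: itgM_bnd => //; exact: (fun w => Y_bnd i j l _).
Qed.

Let ExY i j l : Ex P (fun w => Y i j l (xi i w)) = 0.
Proof.
rewrite /Y ExB ?Ex_cst ?subrr//; last exact: itg_cst.
apply: (@itg_bnd _ _ _ _ _ (k ^+ 2)) => [|w]; last exact: y_bnd.
exact: measurableT_comp (my j l) (mxi' i).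
Qed.

(* Centred empirical covariance of the truncated summands; by independence its mean square is
   at most k * g, which is what makes the bound below pathwise up to a small error. *)
Let N j l w := \sum_i Y i j l (xi i w).

(** The cross terms vanish by pairwise independence, and each variance is at most the second
    moment. *)
Let N_sqr j l : itg P (fun w => N j l w ^+ 2) /\
  Ex P (fun w => N j l w ^+ 2) <= \sum_i Ex P (fun w => y j l (xi i w) ^+ 2).
Proof.
have E : (fun w => N j l w ^+ 2) =
    (fun w => \sum_i \sum_i' Y i j l (xi i w) * Y i' j l (xi i' w)).
  apply/funext => w; rewrite expr2 /N mulr_suml; apply: eq_bigr => i _.
  by rewrite mulr_sumr.
split; first by rewrite E; apply: itg_sum => i _; apply: itg_sum => i' _.
rewrite E Ex_sum => [|i _]; last by apply: itg_sum.
apply: ler_sum => i _; rewrite Ex_sum// (bigD1 i)//= big1 ?addr0 => [|i' ii'].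
  have iy : itg P (fun w => y j l (xi i w)).
    apply: (@itg_bnd _ _ _ _ _ (k ^+ 2)) => [|w]; last exact: y_bnd.
    exact: measurableT_comp (my j l) (mxi' i).
  have iy2 : itg P (fun w => y j l (xi i w) ^+ 2).
    under eq_fun do rewrite expr2; apply: (@itgM_bnd _ _ _ _ _ _ (k ^+ 2)) => [|w|//]; last exact: y_bnd.
    exact: measurableT_comp (my j l) (mxi' i).
  have : Ex P (fun w => Y i j l (xi i w) * Y i j l (xi i w)) =
      Ex P (fun w => y j l (xi i w) ^+ 2) - c i j l ^+ 2.
    rewrite (_ : (fun w => Y i j l (xi i w) * Y i j l (xi i w)) =
       fun w => y j l (xi i w) ^+ 2 - (2 * c i j l) * y j l (xi i w) + c i j l ^+ 2).
      have j1 := itgZ (2 * c i j l) iy; have j2 := itgB iy2 j1.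
      rewrite ExD//; last exact: itg_cst.
      by rewrite ExB// ExZ// Ex_cst -/(c i j l); ring.
    by apply/funext => w; rewrite /Y; ring.
  by move=> ->; rewrite lerBlDr lerDl sqr_ge0.
have nii : i != i' by rewrite eq_sym.
have mPhi : measurable_fun setT (fun z : Rd R d * Rd R d => Y i j l z.1 * Y i' j l z.2).
  by apply: measurable_funM; exact: measurableT_comp.
have bPhi w1 w2 : `|Y i j l (xi i w1) * Y i' j l (xi i' w2)| <= 2 * k ^+ 2 * (2 * k ^+ 2).
  by rewrite normrM; apply: ler_pM.
have [_ E2] := indep2_Ex (Phi := fun x x' => Y i j l x * Y i' j l x')
  (mxi' i) (mxi' i') (pair_indep nii) (itg_cst P (2 * k ^+ 2)) (itg_cst P (2 * k ^+ 2)) mPhi bPhi.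
rewrite [LHS]E2; under Ex_ext => w do rewrite ExZ// ExY mulr0.
by rewrite Ex0.
Qed.

(** For each summand the squares [y j l ^+ 2] add up to the fourth power of the truncated norm, at
    most [k] times the cube of the norm. *)
Let N_sum : \sum_j \sum_l Ex P (fun w => N j l w ^+ 2) <= k * g.
Proof.
apply: (@le_trans _ _ (\sum_j \sum_l \sum_i Ex P (fun w => y j l (xi i w) ^+ 2))).
  by apply: ler_sum => j _; apply: ler_sum => l _; case: (N_sqr j l).
have iy2 i j l : itg P (fun w => y j l (xi i w) ^+ 2).
  apply: (@itg_bnd _ _ _ _ _ ((k ^+ 2) ^+ 2)) => [|w].
    by apply: measurable_funX; exact: measurableT_comp (my j l) (mxi' i).
  by rewrite normrX lerXn2r ?nnegrE ?exprn_ge0 ?(ltW k0)// y_bnd.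
under eq_bigr do rewrite exchange_big/=.
rewrite exchange_big/= (le_trans _ (ler_wpM2l (ltW k0) mom3))// mulr_sumr.
apply: ler_sum => i _.
under eq_bigr do rewrite -Ex_sum//.
rewrite -Ex_sum => [|j _]; last exact: itg_sum.
rewrite -ExZ//; apply: Ex_le; [by apply: itg_sum => j _; exact: itg_sum|exact: itgZ|move=> w].
have -> : \sum_j \sum_l y j l (xi i w) ^+ 2 = enorm (trunc k (xi i w)) ^+ 4.
  rewrite (exprM _ 2 2) -sum_coord_sqr expr2 mulr_suml; apply: eq_bigr => j _.
  by rewrite mulr_sumr; apply: eq_bigr => l _; rewrite /y exprMn.
rewrite exprS; apply: ler_pM; rewrite ?exprn_ge0 ?enorm_ge0 ?enorm_trunc_le//; first exact: ltW.
by rewrite lerXn2r ?nnegrE ?enorm_ge0 ?enorm_trunc.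
Qed.

(** The boolean places the window of width [a] above 0 ([false]) or below 0 ([true]). *)
Let fl (a : R) x := vfield s u (- (sg%:R * a)) a x.

Let fl_le a x : 0 <= a -> enorm (fl a x) <= a.
Proof. by move=> a0; rewrite enorm_vfield// clamp_le. Qed.

Let fl_lip a b x : 0 <= a -> 0 <= b -> enorm (fl a x - fl b x) <= `|a - b|.
Proof.
move=> a0 b0; rewrite /fl /vfield -scalerBl enormZ; case: (su) => _ -> _.
by rewrite mulr1 !opprK; exact: clampD_lip.
Qed.

(** The bound must hold for all unit [e] at once, because it is used at the random direction
    [u (W w)]. The fluctuation is the quadratic form of [N] at [e], bounded by its Frobenius norm;
    the arithmetic-geometric inequality with weight [g] turns this into squares, of mean at most
    [(g + k) / 2]. *)
Let Q_ge w e : enorm e = 1 ->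
  th <= \sum_i dot (trunc k (xi i w)) e ^+ 2 + (g + (\sum_j \sum_l N j l w ^+ 2) / g) / 2.
Proof.
move=> e1; apply: (le_trans (th_le e1)).
have E (f : 'I_d -> R) : (\sum_j f j * e j 0) ^+ 2 = \sum_j \sum_l e j 0 * e l 0 * (f j * f l).
  rewrite expr2 mulr_suml; apply: eq_bigr => j _; rewrite mulr_sumr.
  by apply: eq_bigr => l _; ring.
have iy i j l : itg P (fun w => y j l (xi i w)).
  apply: (@itg_bnd _ _ _ _ _ (k ^+ 2)) => [|v]; last exact: y_bnd.
  exact: measurableT_comp (my j l) (mxi' i).
have -> : \sum_i Ex P (fun w => dot (trunc k (xi i w)) e ^+ 2) =
    \sum_i \sum_j \sum_l e j 0 * e l 0 * c i j l.
  apply: eq_bigr => i _; under Ex_ext do rewrite E.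
  rewrite Ex_sum => [|j _]; last by apply: itg_sum => l _; apply: itgZ; exact: iy.
  apply: eq_bigr => j _; rewrite Ex_sum => [|l _]; last by apply: itgZ; exact: iy.
  by apply: eq_bigr => l _; rewrite ExZ//; exact: iy.
under [X in _ <= X + _]eq_bigr do rewrite E.
rewrite -lerBlDl -sumrB.
have -> : \sum_i (\sum_j \sum_l e j 0 * e l 0 * c i j l -
     \sum_j \sum_l e j 0 * e l 0 * (trunc k (xi i w) j 0 * trunc k (xi i w) l 0)) =
   - \sum_j \sum_l e j 0 * e l 0 * N j l w.
  rewrite -sumrN [RHS](_ : _ = \sum_j \sum_i \sum_l - (e j 0 * e l 0 * Y i j l (xi i w))).
    rewrite exchange_big/=; apply: eq_bigr => i _; rewrite -sumrB; apply: eq_bigr => j _.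
    by rewrite -sumrB; apply: eq_bigr => l _; rewrite /Y /y; ring.
  apply: eq_bigr => j _; rewrite exchange_big/= -sumrN; apply: eq_bigr => l _.
  by rewrite /N mulr_sumr sumrN.
have e2 : \sum_j \sum_l (e j 0 * e l 0) ^+ 2 = 1.
  transitivity ((\sum_j e j 0 ^+ 2) * (\sum_l e l 0 ^+ 2)); last by rewrite sum_coord_sqr e1 expr1n mulr1.
  rewrite mulr_suml; apply: eq_bigr => j _; rewrite mulr_sumr.
  by apply: eq_bigr => l _; rewrite exprMn.
rewrite [leRHS](_ : _ = \sum_j \sum_l (g * (e j 0 * e l 0) ^+ 2 + N j l w ^+ 2 / g) / 2).
  rewrite -sumrN; apply: ler_sum => j _; rewrite -sumrN.
  apply: ler_sum => l _; set p := e j 0 * e l 0; set q := N j l w.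
  have : 0 <= (g * p + q) ^+ 2 / g by rewrite divr_ge0 ?sqr_ge0// ltW.
  have -> : (g * p + q) ^+ 2 / g = g * p ^+ 2 + q ^+ 2 / g + 2 * (p * q).
    by field; rewrite gt_eqF.
  by lra.
transitivity ((g * (\sum_j \sum_l (e j 0 * e l 0) ^+ 2) + (\sum_j \sum_l N j l w ^+ 2) / g) / 2).
  by rewrite e2 mulr1.
rewrite mulr_sumr [_ / g]mulr_suml -big_split/= mulr_suml; apply: eq_bigr => j _.
by rewrite mulr_sumr [_ / g]mulr_suml -big_split/= mulr_suml.
Qed.

Let mW : cmeas W. Proof. exact: cmeas_sum. Qed.

Let mWo i : cmeas (Wo i). Proof. exact: cmeasB. Qed.

(** The additional [3 * k] pays for the margins [2 * k] and [k] of [vfield_collar]: the collar that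
    remains has width [De w]. *)
Let a w := De w + 3 * k.

Let a_ge0 w : 0 <= a w.
Proof. by have /andP[h _] := De_bnd w; rewrite addr_ge0// mulr_ge0// ltW. Qed.

Let ai_ge0 i w : 0 <= Di i w + 3 * k.
Proof. by have /andP[h _] := Di_bnd i w; rewrite addr_ge0// mulr_ge0// ltW. Qed.

Lemma enorm_sum (I : Type) (r : seq I) (f : I -> 'cV[R]_d) :
  enorm (\sum_(i <- r) f i) <= \sum_(i <- r) enorm (f i).
Proof.
elim/big_ind2 : _ => //; first by rewrite enorm0.
by move=> x1 x2 y1 y2 h1 h2; rewrite (le_trans (enormD _ _))// lerD.
Qed.

Let collar := [set w | - (sg%:R * a w) + 2 * k <= s (W w) <= - (sg%:R * a w) + a w - k].

Lemma collar_meas : measurable collar.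
Proof.
have ms := usub_comp_meas mW su.
have ma : measurable_fun setT a by exact: measurable_funD.
have mla : measurable_fun setT (fun w => - (sg%:R * a w)).
  by apply: measurable_funN; exact: measurable_funM.
have m1 : measurable_fun setT (fun w => (- (sg%:R * a w) + 2 * k <= s (W w)) &&
   (s (W w) <= - (sg%:R * a w) + a w - k)).
  apply: measurable_and; apply: measurable_fun_ler => //.
    exact: measurable_funD.
  by apply: measurable_funB => //; exact: measurable_funD.
have mt : measurable ([set true] : set bool) by [].
have := m1 measurableT [set true] mt.
by rewrite setTI; congr measurable; apply/seteqP; split => w /=.
Qed.

(** Pathwise form of the concentration inequality. The telescoped increments of the field are
    bounded above by the product of |W| with the amplitude, at the price of replacing [De] by [Di i]
    at the deleted sum; the subtracted sum has mean 0 by [fl0]. *)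
Let key w : th * \1_collar w <= enorm (W w) * (De w + 3 * k) +
  \sum_i enorm (xi i w) * `|De w - Di i w|
  - \sum_i dot (xi i w) (fl (Di i w + 3 * k) (Wo i w))
  + (g + (\sum_j \sum_l N j l w ^+ 2) / g) / 2.
Proof.
set E := (X in _ <= _ + X).
have E0 : 0 <= E.
  rewrite divr_ge0// addr_ge0 ?divr_ge0 ?(ltW g0)//.
  by apply: sumr_ge0 => j _; apply: sumr_ge0 => l _; exact: sqr_ge0.
have h1 : \sum_i dot (xi i w) (fl (a w) (W w) - fl (a w) (Wo i w)) <=
   enorm (W w) * (De w + 3 * k) + \sum_i enorm (xi i w) * `|De w - Di i w|
  - \sum_i dot (xi i w) (fl (Di i w + 3 * k) (Wo i w)).
  have -> : \sum_i dot (xi i w) (fl (a w) (W w) - fl (a w) (Wo i w)) =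
     dot (W w) (fl (a w) (W w)) - \sum_i dot (xi i w) (fl (a w) (Wo i w)).
    by rewrite /W dot_suml -sumrB; apply: eq_bigr => i _; rewrite dotBr.
  rewrite -!addrA; apply: lerD.
    by rewrite (le_trans (dot_le _ _))// ler_wpM2l ?enorm_ge0// fl_le.
  rewrite -!sumrN -big_split/=; apply: ler_sum => i _.
  rewrite -lerBlDr opprK addrC -dotBr (le_trans (dot_le _ _))// ler_wpM2l ?enorm_ge0//.
  rewrite (le_trans (fl_lip _ _ _))// /a opprD addrACA subrr addr0 distrC//.
rewrite indicE; case: (boolP (w \in collar)) => [/set_mem wc|_]; last first.
  rewrite mulr0 addr_ge0//; apply: le_trans h1; apply: sumr_ge0 => i _.
  by rewrite /Wo; exact: vfield_mono.
rewrite mulr1; case: (su) => _ u1 _.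
(* On the collar, summands of norm at most [k] are bounded below by [vfield_collar]; the others were
   truncated to 0, and monotonicity suffices for them. *)
apply: le_trans (Q_ge w (u1 (W w))) _; rewrite lerD2r; apply: le_trans h1.
apply: ler_sum => i _; rewrite /Wo /trunc; case: ifPn => xk.
  by apply: vfield_collar xk _.
by rewrite dot0l expr0n; exact: vfield_mono.
Qed.

(** The field depends only on [Wo i] and [Di i], hence is independent of the centred [xi i]. *)
Let fl0 i : itg P (fun w => dot (xi i w) (fl (Di i w + 3 * k) (Wo i w))) /\
  Ex P (fun w => dot (xi i w) (fl (Di i w + 3 * k) (Wo i w))) = 0.
Proof.
pose V w : (Rd R d * R)%type := (Wo i w : Rd R d, Di i w).
have mV : measurable_fun setT V.
  by apply: measurable_fun_pair; [exact: cmeas_borel|exact: mDi].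
have B0 : 0 <= B + 3 * k.
  by have /andP[? ?] := Di_bnd i (point : Omega); have := k0; lra.
pose Phi (v : (Rd R d * R)%type) (x : Rd R d) := dot x (fl (v.2 + 3 * k) v.1).
have mPhi : measurable_fun setT (fun z : (Rd R d * R) * Rd R d => Phi z.1 z.2).
  have m1 : measurable_fun setT (fun z : (Rd R d * R) * Rd R d => z.1.2 + 3 * k).
    by apply: measurable_funD => //; exact: measurableT_comp.
  apply: cmeas_dot.
    by move=> j; apply: measurableT_comp (cmeas_id j) _.
  apply: vfield_meas2 su _ _ _ => //.
    by move=> j; apply: measurableT_comp (cmeas_id j) _; exact: measurableT_comp.
  by apply: measurable_funN; exact: measurable_funM.
have bPhi w1 w2 : `|Phi (V w1) (xi i w2)| <= (B + 3 * k) * enorm (xi i w2).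
  rewrite (le_trans (dot_le_abs _ _))// mulrC ler_wpM2r ?enorm_ge0//.
  by apply: le_trans (fl_le _ (ai_ge0 i w1)) _; rewrite lerD2r; have /andP[] := Di_bnd i w1.
have [I E] := indep2_Ex mV (mxi' i) (indep2C (Di_indep i)) (itg_cst _ _)
  (itg_norm (mxi i) (i3 i)) mPhi bPhi.
split; [exact: I|rewrite [LHS]E].
under Ex_ext do rewrite /Phi (Ex_dot_eq0 (mxi i) (i3 i))//.
by rewrite Ex0.
Qed.

Lemma concentration : th * pr P collar <= Ex P (fun w => enorm (W w) * (De w + 3 * k)) +
  \sum_i Ex P (fun w => enorm (xi i w) * `|De w - Di i w|) + (g + k) / 2.
Proof.
have iN : itg P (fun w => \sum_j \sum_l N j l w ^+ 2).
  by apply: itg_sum => j _; apply: itg_sum => l _; case: (N_sqr j l).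
have i1 : itg P (fun w => enorm (W w) * (De w + 3 * k)).
  under eq_fun do rewrite mulrC; apply: (@itgM_bnd _ _ _ _ _ _ (B + 3 * k)).
  - exact: measurable_funD.
  - move=> w; rewrite ger0_norm ?a_ge0// lerD2r; by have /andP[] := De_bnd w.
  - have h : itg P (fun w => \sum_i enorm (xi i w)).
      by apply: itg_sum => i _; exact: itg_norm (mxi i) (i3 i).
    apply: itg_le h _.
      exact: cmeas_enorm.
    by move=> w; rewrite ger0_norm ?enorm_ge0// enorm_sum.
have i2 i : itg P (fun w => enorm (xi i w) * `|De w - Di i w|).
  under eq_fun do rewrite mulrC; apply: (@itgM_bnd _ _ _ _ _ _ B).
  - by apply: measurableT_comp => //; exact: measurable_funB.
  - move=> w; rewrite normr_id ler_norml.
    by have /andP[? ?] := De_bnd w; have /andP[? ?] := Di_bnd i w; apply/andP; split; lra.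
  - exact: itg_norm (mxi i) (i3 i).
have i4 : itg P (fun w => \sum_i dot (xi i w) (fl (Di i w + 3 * k) (Wo i w))).
  by apply: itg_sum => i _; case: (fl0 i).
have i5 : itg P (fun w => (g + (\sum_j \sum_l N j l w ^+ 2) / g) / 2).
  apply: (itg_ext _ (itgD (itg_cst P (g / 2)) (itgZ (2 * g)^-1 iN))) => w.
  by field; rewrite gt_eqF.
rewrite -Ex_indic; last exact: collar_meas.
rewrite -ExZ; last exact: itg_indic collar_meas.
apply: (@le_trans _ _ (Ex P (fun w => enorm (W w) * (De w + 3 * k) +
  \sum_i enorm (xi i w) * `|De w - Di i w|
  - \sum_i dot (xi i w) (fl (Di i w + 3 * k) (Wo i w))
  + (g + (\sum_j \sum_l N j l w ^+ 2) / g) / 2))).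
  apply: Ex_le => //; first by apply: itgZ; exact: itg_indic collar_meas.
  by apply: itgD => //; apply: itgB => //; apply: itgD => //; exact: itg_sum.
have i2s : itg P (fun w => \sum_i enorm (xi i w) * `|De w - Di i w|) by exact: itg_sum.
have i12 := itgD i1 i2s; have i124 := itgB i12 i4.
rewrite ExD// ExB// ExD//.
have -> : Ex P (fun w => \sum_i dot (xi i w) (fl (Di i w + 3 * k) (Wo i w))) = 0.
  rewrite Ex_sum => [|i _]; last by case: (fl0 i).
  by rewrite big1// => i _; case: (fl0 i).
have -> : Ex P (fun w => \sum_i enorm (xi i w) * `|De w - Di i w|) =
  \sum_i Ex P (fun w => enorm (xi i w) * `|De w - Di i w|) by rewrite Ex_sum.
rewrite subr0 lerD2l.
rewrite (@Ex_ext _ _ _ _ _ (fun w => g / 2 + (2 * g)^-1 * \sum_j \sum_l N j l w ^+ 2)); last first.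
  by move=> w; field; rewrite gt_eqF.
have ENN : Ex P (fun w => \sum_j \sum_l N j l w ^+ 2) = \sum_j \sum_l Ex P (fun w => N j l w ^+ 2).
  rewrite Ex_sum => [|j _]; last by apply: itg_sum => l _; case: (N_sqr j l).
  by apply: eq_bigr => j _; rewrite Ex_sum// => l _; case: (N_sqr j l).
rewrite ExD; [|exact: itg_cst|exact: itgZ].
rewrite Ex_cst ExZ// ENN.
have := ler_wpM2l (_ : 0 <= (2 * g)^-1) N_sum; rewrite invr_ge0 mulr_ge0 ?(ltW g0)// => /(_ erefl).
have -> : (2 * g)^-1 * (k * g) = k / 2 by field; rewrite gt_eqF.
by lra.
Qed.

End concentration.

(** * Sums of independent summands and deletion of one of them *)

Section independent_functions.
Context d1 d2 (Omega : measurableType d1) (S : measurableType d2) (R : realType)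
  (P : probability Omega R) (n d : nat).
Variables (X : 'I_n -> Omega -> S) (h : 'I_n -> S -> 'cV[R]_d).
Hypothesis mX : forall i, measurable_fun setT (X i).
Hypothesis mh : forall i, cmeas (h i).
Hypothesis iX : mutually_independent P X.

Lemma cmeas_hX i : cmeas (fun w => h i (X i w)).
Proof. exact: cmeas_comp (mh i) (mX i). Qed.

Let comp_indep i d3 (S3 : measurableType d3) (V : Omega -> S3) :
  indep2 P (X i) V -> indep2 P (fun w => h i (X i w) : Rd R d) V.
Proof.
move=> iXV A B mA mB; apply: (iXV (h i @^-1` A) B) => //.
by rewrite -[X in measurable X]setTI; exact: cmeas_borel (mh i) measurableT _ mA.
Qed.

Let rest i w : 'cV[R]_d := \sum_i0 h i0 (X i0 w) - h i (X i w).

Let meas_rest i (Y : Omega -> R) : cmeas (rest i : others X i Y -> 'cV[R]_d).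
Proof.
rewrite (_ : rest i = fun w => \sum_(i0 | i0 != i) h i0 (X i0 w)); last first.
  by apply/funext => w; rewrite /rest (bigD1 i)//= addrAC subrr add0r.
have -> : (fun w => \sum_(i0 | i0 != i) h i0 (X i0 w)) =
  (fun w => \sum_i0 (if i0 != i then h i0 (X i0 w) else 0)).
  by apply/funext => w; rewrite big_mkcond.
apply: cmeas_sum => i0; case: (boolP (i0 != i)) => i0i; last exact: cmeas_cst.
by move=> k; apply: measurableT_comp (mh i0 k) _; exact: meas_other.
Qed.

Lemma indep_rest_extra i Y : independent_of_coordinate P X i Y ->
  indep2 P (fun w => h i (X i w) : Rd R d)
    (fun w => (\sum_i0 h i0 (X i0 w) - h i (X i w) : Rd R d, Y w)).
Proof.
move=> iY; apply: comp_indep; apply: (indep_coord_indep2 iY).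
apply: measurable_fun_pair; last exact: meas_extra.
by apply: cmeas_borel; exact: meas_rest.
Qed.

Lemma indep_rest i : indep2 P (fun w => h i (X i w) : Rd R d)
    (fun w => \sum_i0 h i0 (X i0 w) - h i (X i w) : Rd R d).
Proof.
have iY := mutual_indep_coord mX (i := i) iX.
apply: comp_indep; apply: (indep_coord_indep2 iY).
by apply: cmeas_borel; exact: meas_rest.
Qed.

Lemma indep_rest_cst i (c : R) :
  indep2 P (fun w => h i (X i w) : Rd R d)
    (fun w => (\sum_i0 h i0 (X i0 w) - h i (X i w) : Rd R d, c)).
Proof.
have iY := mutual_indep_coord mX (i := i) iX.
apply: comp_indep; apply: (indep_coord_indep2 iY).
apply: measurable_fun_pair => //.
by apply: cmeas_borel; exact: meas_rest.
Qed.

Lemma indep_pair i j : i != j ->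
  indep2 P (fun w => h i (X i w) : Rd R d) (fun w => h j (X j w) : Rd R d).
Proof.
move=> ij; have iY := mutual_indep_coord mX (i := i) iX.
apply: comp_indep; apply: (indep_coord_indep2 iY).
have ji : j != i by rewrite eq_sym.
have : cmeas ((fun w => h j (X j w)) : others X i (fun=> 0 : R) -> 'cV[R]_d).
  by move=> k; apply: measurableT_comp (mh j k) _; exact: meas_other.
exact: cmeas_borel.
Qed.

End independent_functions.

Section sum_moments.
Context d0 (Omega : measurableType d0) (R : realType) (P : probability Omega R)
  (n d : nat).
Variables (xi : 'I_n -> Omega -> 'cV[R]_d).
Hypothesis mxi : forall i, cmeas (xi i).
Hypothesis i3 : forall i, itg P (fun w => enorm (xi i w) ^+ 3).
Hypothesis mean0 : forall i j, Ex P (fun w => xi i w j 0) = 0.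
Hypothesis pair_indep : forall i j, i != j ->
  indep2 P (xi i : Omega -> Rd R d) (xi j : Omega -> Rd R d).

Let dot_indep i j : itg P (fun w => dot (xi i w) (xi j w)) /\
  (i != j -> Ex P (fun w => dot (xi i w) (xi j w)) = 0).
Proof.
have [<-|ij] := eqVneq i j.
  split=> //; apply: itg_ext (itg_norm2 (mxi i) (i3 i)) => w.
  by rewrite sqr_enorm.
have mPhi : measurable_fun setT (fun z : Rd R d * Rd R d => dot z.1 z.2).
  by apply: cmeas_dot => k; apply: measurableT_comp (cmeas_id k) _.
have bPhi w1 w2 : `|dot (xi i w1) (xi j w2)| <= enorm (xi i w1) * enorm (xi j w2).
  exact: dot_le_abs.
have [I E] := indep2_Ex (Phi := fun x y => dot x y) (cmeas_borel (mxi i)) (cmeas_borel (mxi j))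
  (pair_indep ij) (itg_norm (mxi i) (i3 i)) (itg_norm (mxi j) (i3 j)) mPhi bPhi.
split=> [|_]; first exact: I.
rewrite [LHS]E; under Ex_ext do under Ex_ext do rewrite dotC.
by under Ex_ext do rewrite (Ex_dot_eq0 (mxi j) (i3 j))//; rewrite Ex0.
Qed.

Lemma Ex_norm2_sum : Ex P (fun w => enorm (\sum_i xi i w) ^+ 2) =
  \sum_i Ex P (fun w => enorm (xi i w) ^+ 2).
Proof.
have E w : enorm (\sum_i xi i w) ^+ 2 = \sum_i \sum_j dot (xi i w) (xi j w).
  rewrite sqr_enorm dot_suml; apply: eq_bigr => i _.
  by rewrite dotC dot_suml; apply: eq_bigr => j _; rewrite dotC.
under Ex_ext do rewrite E.
rewrite Ex_sum => [|i _]; last by apply: itg_sum => j _; case: (dot_indep i j).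
apply: eq_bigr => i _; rewrite Ex_sum => [|j _]; last by case: (dot_indep i j).
rewrite (bigD1 i)//= big1 ?addr0 => [|j ji].
  by apply: Ex_ext => w; rewrite sqr_enorm.
by case: (dot_indep i j) => _; apply; rewrite eq_sym.
Qed.

Lemma cube_add_le (x y : R) : 0 <= x -> 0 <= y -> (x + y) ^+ 3 <= 4 * x ^+ 3 + 4 * y ^+ 3.
Proof.
move=> x0 y0; have : 0 <= 3 * (x + y) * (x - y) ^+ 2.
  by rewrite mulr_ge0 ?sqr_ge0// mulr_ge0// addr_ge0.
by rewrite !exprS !expr0; lra.
Qed.

Lemma itg_norm_sum3 : itg P (fun w => enorm (\sum_i xi i w) ^+ 3).
Proof.
elim: (index_enum _) => [|i r IH].
  by apply: itg_ext (itg_cst P 0) => w; rewrite big_nil enorm0 expr0n.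
apply: itg_le (itgD (itgZ 4 (i3 i)) (itgZ 4 IH)) _.
  by apply: measurable_funX; apply: cmeas_enorm; exact: cmeas_sum.
move=> w; rewrite ger0_norm ?exprn_ge0 ?enorm_ge0// big_cons.
apply: le_trans (cube_add_le (enorm_ge0 _) (enorm_ge0 _)).
by rewrite lerXn2r ?nnegrE ?addr_ge0 ?enorm_ge0 ?enormD.
Qed.

Let mW : cmeas (fun w => \sum_i xi i w). Proof. exact: cmeas_sum. Qed.

Lemma Ex_norm_sum (D : R) : \sum_i Ex P (fun w => enorm (xi i w) ^+ 2) <= D ->
  Ex P (fun w => enorm (\sum_i xi i w)) <= Num.sqrt D.
Proof.
move=> hD; have i1 := itg_norm mW itg_norm_sum3; have i2 := itg_norm2 mW itg_norm_sum3.
have D0 : 0 <= D by apply: le_trans hD; apply: sumr_ge0 => i _; apply: Ex_ge0 => w; exact: sqr_ge0.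
rewrite (@Ex_ext _ _ _ _ _ (fun w => `|enorm (\sum_i xi i w)|)); last first.
  by move=> w; rewrite ger0_norm ?enorm_ge0.
by apply: Ex_abs_le => //; rewrite Ex_norm2_sum sqr_sqrtr.
Qed.

End sum_moments.

Section deleted.
Context d1 d2 (Omega : measurableType d1) (S : measurableType d2) (R : realType)
  (P : probability Omega R) (n d : nat).
Variables (X : 'I_n -> Omega -> S) (h : 'I_n -> S -> 'cV[R]_d) (g : R).
Hypothesis mX : forall i, measurable_fun setT (X i).
Hypothesis mh : forall i, cmeas (h i).
Hypothesis iX : mutually_independent P X.
Let xi i w := h i (X i w).
Hypothesis i3 : forall i, itg P (fun w => enorm (xi i w) ^+ 3).
Hypothesis mean0 : forall i j, Ex P (fun w => xi i w j 0) = 0.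
Hypothesis cov1 : forall j l, \sum_i Ex P (fun w => xi i w j 0 * xi i w l 0) = (j == l)%:R.
Hypothesis g0 : 0 < g.
Hypothesis mom3 : \sum_i Ex P (fun w => enorm (xi i w) ^+ 3) <= g.
Let W w := \sum_i xi i w.

Let mxi i : cmeas (xi i). Proof. exact: (cmeas_hX mX mh). Qed.

Let icoord i j l : itg P (fun w => xi i w j 0 * xi i w l 0).
Proof.
apply: itg_le (itg_norm2 (mxi i) (i3 i)) _ => [|w].
  by apply: measurable_funM; exact: mxi.
by rewrite normrM expr2; apply: ler_pM; rewrite ?coord_le_enorm.
Qed.

Lemma sum_dot2 e : \sum_i Ex P (fun w => dot (xi i w) e ^+ 2) = enorm e ^+ 2.
Proof.
have E i w : dot (xi i w) e ^+ 2 = \sum_j \sum_l e j 0 * e l 0 * (xi i w j 0 * xi i w l 0).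
  rewrite expr2 mulr_suml; apply: eq_bigr => j _; rewrite mulr_sumr.
  by apply: eq_bigr => l _; ring.
transitivity (\sum_i \sum_j \sum_l e j 0 * e l 0 * Ex P (fun w => xi i w j 0 * xi i w l 0)).
  apply: eq_bigr => i _; under Ex_ext do rewrite E.
  rewrite Ex_sum => [|j _]; last by apply: itg_sum => l _; exact: itgZ.
  by apply: eq_bigr => j _; rewrite Ex_sum => [|l _]; [apply: eq_bigr => l _; rewrite ExZ|exact: itgZ].
rewrite exchange_big/= -sum_coord_sqr; apply: eq_bigr => j _.
rewrite exchange_big/= (bigD1 j)//= [X in _ + X]big1 ?addr0 => [|l lj].
  by rewrite -mulr_sumr cov1 eqxx mulr1 expr2.
by rewrite -mulr_sumr cov1 eq_sym (negbTE lj) mulr0.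
Qed.

Lemma sum_norm2 : \sum_i Ex P (fun w => enorm (xi i w) ^+ 2) = d%:R.
Proof.
transitivity (\sum_i \sum_j Ex P (fun w => xi i w j 0 * xi i w j 0)).
  apply: eq_bigr => i _; rewrite -Ex_sum//; apply: Ex_ext => w.
  by rewrite -sum_coord_sqr; apply: eq_bigr => j _; rewrite expr2.
rewrite exchange_big/=; under eq_bigr do rewrite cov1 eqxx.
by rewrite sumr_const card_ord.
Qed.

Let pair i j (ij : i != j) := indep_pair mX mh iX ij.

Lemma Ex_norm_W : Ex P (fun w => enorm (W w)) <= Num.sqrt d%:R.
Proof. by apply: Ex_norm_sum => //; rewrite sum_norm2. Qed.

Lemma Ex_norm2_W : Ex P (fun w => enorm (W w) ^+ 2) = d%:R.
Proof. by rewrite (Ex_norm2_sum mxi)// ?sum_norm2//; by move=> i j ij; exact: pair. Qed.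

Let itr i (k : R) e : itg P (fun w => dot (trunc k (xi i w)) e ^+ 2).
Proof.
apply: itg_le (itgZ (enorm e ^+ 2) (itg_norm2 (mxi i) (i3 i))) _ => [|w].
  apply: measurable_funX; apply: cmeas_dot; last exact: cmeas_cst.
  exact: (cmeas_comp (S' := Rd R d) (trunc_meas k) (cmeas_borel (mxi i))).
rewrite ger0_norm ?sqr_ge0// -real_normK ?num_real// -exprMn mulrC.
rewrite lerXn2r ?nnegrE ?mulr_ge0 ?enorm_ge0//.
by rewrite (le_trans (dot_le_abs _ _))// ler_wpM2r ?enorm_ge0 ?enorm_trunc.
Qed.

(** Where |xi| > k, the lost square is at most |xi|^3 / k. *)
Lemma trunc_var (k : R) e : 0 < k -> enorm e = 1 ->
  1 - g / k <= \sum_i Ex P (fun w => dot (trunc k (xi i w)) e ^+ 2).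
Proof.
move=> k0 e1.
have id2 i : itg P (fun w => dot (xi i w) e ^+ 2).
  apply: itg_le (itgZ (enorm e ^+ 2) (itg_norm2 (mxi i) (i3 i))) _ => [|w].
    by apply: measurable_funX; apply: cmeas_dot; [exact: mxi|exact: cmeas_cst].
  rewrite ger0_norm ?sqr_ge0// -real_normK ?num_real// -exprMn mulrC.
  by rewrite lerXn2r ?nnegrE ?mulr_ge0 ?enorm_ge0// dot_le_abs.
have -> : 1 = \sum_i Ex P (fun w => dot (xi i w) e ^+ 2) by rewrite sum_dot2 e1 expr1n.
rewrite lerBlDl -lerBlDr (le_trans _ (ler_wpM2r _ mom3)) ?invr_ge0 ?(ltW k0)//.
rewrite -sumrB mulr_suml; apply: ler_sum => i _.
rewrite -ExB// mulrC -ExZ//; apply: Ex_le; [exact: itgB|exact: itgZ|move=> w].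
rewrite /trunc; case: (lerP (enorm (xi i w)) k) => xk.
  by rewrite subrr mulr_ge0 ?invr_ge0 ?exprn_ge0 ?enorm_ge0 ?(ltW k0).
rewrite dot0l expr0n subr0 (@le_trans _ _ (enorm (xi i w) ^+ 2))//.
  rewrite -real_normK ?num_real// lerXn2r ?nnegrE ?enorm_ge0//.
  by rewrite (le_trans (dot_le_abs _ _))// e1 mulr1.
by rewrite [leRHS]mulrC ler_pdivlMr// [leRHS]exprSr ler_wpM2l ?sqr_ge0// ltW.
Qed.

Section collar_deleted.
Variables (i : 'I_n) (s : 'cV[R]_d -> R) (u : 'cV[R]_d -> 'cV[R]_d).
Hypothesis su : usub s u.
Hypothesis d0 : (0 < d)%N.
Hypothesis g_small : g <= 1 / 100.

(** Replacing summand [i] by 0 keeps the index set and the family [X], so that [concentration]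
    applies to the deleted sum as it is. *)
Let h' j : S -> 'cV[R]_d := if j == i then (fun=> 0) else h j.
Let mh' j : cmeas (h' j).
Proof. by rewrite /h'; case: ifP => // _; exact: cmeas_cst. Qed.

Lemma deleted_sum w : \sum_j h' j (X j w) = W w - xi i w.
Proof.
rewrite /W (bigD1 i)//= [X in _ = X - _](bigD1 i)//= /h' eqxx add0r [RHS]addrAC subrr add0r.
by apply: eq_bigr => j /negbTE ->.
Qed.

Let h'E (F : 'cV[R]_d -> R) j : F 0 = 0 ->
  Ex P (fun w => F (h' j (X j w))) = if j == i then 0 else Ex P (fun w => F (xi j w)).
Proof. by move=> F0; rewrite /h'; case: ifP => // _; rewrite F0 Ex0. Qed.

Let i3' j : itg P (fun w => enorm (h' j (X j w)) ^+ 3).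
Proof.
rewrite /h'; case: ifP => _; last exact: i3.
by apply: itg_ext (itg_cst P 0) => w; rewrite enorm0 expr0n.
Qed.

Let mean0' j l : Ex P (fun w => h' j (X j w) l 0) = 0.
Proof. by rewrite (h'E (F := fun x => x l 0)) ?mxE//; case: ifP. Qed.

Let sub_sum (F : 'cV[R]_d -> R) : F 0 = 0 -> (forall x, 0 <= F x) ->
  \sum_j Ex P (fun w => F (h' j (X j w))) <= \sum_j Ex P (fun w => F (xi j w)).
Proof.
move=> F0 Fp; apply: ler_sum => j _; rewrite (h'E _ F0); case: ifP => // _.
exact: Ex_ge0.
Qed.

Lemma Ex_norm_deleted : Ex P (fun w => enorm (W w - xi i w)) <= Num.sqrt d%:R.
Proof.
under Ex_ext do rewrite -deleted_sum.
apply: (Ex_norm_sum (fun j => cmeas_hX mX mh' j) i3' mean0' (fun j l jl => indep_pair mX mh' iX jl)).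
rewrite -sum_norm2; apply: (sub_sum (F := fun x => enorm x ^+ 2)) => [|x].
  by rewrite enorm0 expr0n.
exact: sqr_ge0.
Qed.

(** Concentration with [k = 3 g] and a constant width [q]. Truncation keeps 2/3 of the variance and
    deletion costs at most (3 g)^2 <= 1/100, which leaves 3/5, hence the factor 5/3. The 11 is 9
    from [3 * k], plus 2 from [(g + k) / 2] since sqrt d >= 1. *)
Lemma deleted_collar (q : R) : 0 <= q ->
  pr P [set w | 0 <= s (W w - xi i w) <= q] <= 5 / 3 * Num.sqrt d%:R * (q + 11 * g).
Proof.
move=> q0; have k0 : 0 < 3 * g by rewrite mulr_gt0.
(* The shift by [2 * k] compensates the lower margin, so that the collar starts at 0. *)
have su' := usubD (2 * (3 * g)) su.
have d1' : 1 <= Num.sqrt d%:R :> R by rewrite -[leLHS]sqrtr1 ler_wsqrtr// ler1n.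
have th' e : enorm e = 1 ->
    3 / 5 <= \sum_j Ex P (fun w => dot (trunc (3 * g) (h' j (X j w))) e ^+ 2).
  move=> e1; have := trunc_var k0 e1.
  rewrite (_ : g / (3 * g) = 1 / 3); last by field; rewrite gt_eqF.
  rewrite (bigD1 i)//= [in X in _ -> X](bigD1 i)//= => hh.
  have E1 : Ex P (fun w => dot (trunc (3 * g) (xi i w)) e ^+ 2) <= (3 * g) ^+ 2.
    rewrite -[leRHS](Ex_cst P); apply: Ex_le; [exact: itr|exact: itg_cst|move=> w].
    rewrite -real_normK ?num_real// lerXn2r ?nnegrE ?(ltW k0)//.
    by rewrite (le_trans (dot_le_abs _ _))// e1 mulr1 enorm_trunc_le// ltW.
  have E2 : \sum_(j | j != i) Ex P (fun w => dot (trunc (3 * g) (h' j (X j w))) e ^+ 2) =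
      \sum_(j | j != i) Ex P (fun w => dot (trunc (3 * g) (xi j w)) e ^+ 2).
    by apply: eq_bigr => j /negbTE ji; rewrite /h' ji.
  rewrite E2; have : 0 <= Ex P (fun w => dot (trunc (3 * g) (h' i (X i w))) e ^+ 2).
    by apply: Ex_ge0 => w; exact: sqr_ge0.
  have : (3 * g) ^+ 2 <= 1 / 100.
    have := g0; have := g_small; rewrite expr2 => g1 g2; nra.
  by move: hh E1; set x := Ex P _; set y := Ex P _; lra.
have mom3' : \sum_j Ex P (fun w => enorm (h' j (X j w)) ^+ 3) <= g.
  apply: le_trans mom3; apply: (sub_sum (F := fun x => enorm x ^+ 3)) => [|x].
    by rewrite enorm0 expr0n.
  by rewrite exprn_ge0 ?enorm_ge0.
have := concentration (fun j => cmeas_hX mX mh' j) i3' mean0' g0 k0 mom3'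
  (fun j l => @indep_pair _ _ _ _ _ _ _ _ _ _ mX mh' iX j l)
  (@measurable_cst _ _ _ _ setT q) (fun _ => @measurable_cst _ _ _ _ setT q)
  (B := q) _ _ (fun j => indep_rest_cst mX mh' iX j q) th' false su'.
have qq (w : Omega) : 0 <= cst q w <= q by rewrite /= q0 lexx.
move=> /(_ qq (fun _ => qq)).
rewrite [X in _ <= _ + X + _]big1 => [|j _]; last first.
  by under Ex_ext do rewrite subrr normr0 mulr0; rewrite Ex0.
set A := [set w | _]; set A' := [set w | _].
have -> : A = A'.
  apply/seteqP; split => w; rewrite /A /A' /= mul0r oppr0 !add0r deleted_sum.
    by move=> /andP[? ?]; apply/andP; split; lra.
  by move=> /andP[? ?]; apply/andP; split; lra.
have -> : Ex P (fun w => enorm (\sum_i0 h' i0 (X i0 w)) * (cst q w + 3 * (3 * g))) =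
    (q + 3 * (3 * g)) * Ex P (fun w => enorm (W w - xi i w)).
  rewrite -ExZ; first by apply: Ex_ext => w; rewrite deleted_sum mulrC.
  have I3 := itg_norm_sum3 (fun j => cmeas_hX mX mh' j) i3'.
  apply: itg_ext (itg_norm _ I3) => [w|]; first by rewrite deleted_sum.
  by apply: cmeas_sum => j; exact: cmeas_hX mX mh' j.
have := Ex_norm_deleted; set E := Ex P _ => HE H.
have gp := g0.
have : (q + 3 * (3 * g)) * E <= (q + 3 * (3 * g)) * Num.sqrt d%:R.
  by rewrite ler_wpM2l//; lra.
move: H; set p := pr P A'; set r := Num.sqrt d%:R in d1' *.
have : 2 * g <= r * (2 * g) by rewrite ler_peMl//; lra.
by lra.
Qed.

End collar_deleted.
End deleted.

(** * Smoothed indicators *)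

Section step_function.
Context {R : realType}.
Implicit Types x y m p q : R.

Definition pp x : R := Num.max 0 x ^+ 2.

(* the C^{1,1} quadratic spline which is 1 on ]-oo, 0] and 0 on [1, +oo[ *)
Definition rho x : R := 1 - 2 * pp x + 4 * pp (x - 1 / 2) - 2 * pp (x - 1).

Definition drho x : R :=
  - (4 * Num.max 0 x) + 8 * Num.max 0 (x - 1 / 2) - 4 * Num.max 0 (x - 1).

Lemma rho_left x : x <= 0 -> rho x = 1.
Proof.
move=> x0; rewrite /rho /pp !max_l; last 3 first.
- by lra.
- by lra.
- by lra.
by rewrite expr0n/=; lra.
Qed.

Lemma rho_right x : 1 <= x -> rho x = 0.
Proof.
move=> x1; rewrite /rho /pp !max_r; last 3 first.
- by lra.
- by lra.
- by lra.
by rewrite !expr2; lra.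
Qed.

Lemma rho_mono_lip x y : x <= y -> 0 <= rho x - rho y <= 2 * (y - x).
Proof.
move=> xy; rewrite /rho /pp.
case: (lerP 0 x) => ?; case: (lerP 0 (x - 1/2)) => ?; case: (lerP 0 (x - 1)) => ?; try lra;
case: (lerP 0 y) => ?; case: (lerP 0 (y - 1/2)) => ?; case: (lerP 0 (y - 1)) => ?; try lra;
by rewrite !expr2; apply/andP; split; nra.
Qed.

Lemma rho_le x y : x <= y -> rho y <= rho x.
Proof. by move=> /rho_mono_lip/andP[h _]; rewrite -subr_ge0. Qed.

Lemma rho_lip x y : `|rho x - rho y| <= 2 * `|x - y|.
Proof.
wlog xy : x y / x <= y.
  by move=> h; case/orP: (le_total x y) => /h //; rewrite distrC (distrC y).
have /andP[h1 h2] := rho_mono_lip xy.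
by rewrite ger0_norm// distrC ger0_norm ?subr_ge0.
Qed.

Lemma rho01 x : 0 <= rho x <= 1.
Proof.
apply/andP; split.
  by rewrite -(@rho_right (Num.max x 1)) ?le_max ?lexx ?orbT// rho_le// le_max lexx.
by rewrite -(@rho_left (Num.min x 0)) ?ge_min ?lexx ?orbT// rho_le// ge_min lexx.
Qed.

Let pp_taylor m p : 0 <= pp p - pp m - 2 * Num.max 0 m * (p - m) <= (p - m) ^+ 2.
Proof.
have := sqr_ge0 p; have := sqr_ge0 m; have := sqr_ge0 (p - m); rewrite /pp !expr2.
case: (lerP 0 m) => m0; case: (lerP 0 p) => p0 ? ? ?.
- by apply/andP; split; lra.
- have : 0 <= m * - p by rewrite mulr_ge0// oppr_ge0 ltW.
  by move=> ?; apply/andP; split; lra.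
- have : 0 <= p * - m by rewrite mulr_ge0// oppr_ge0 ltW.
  by move=> ?; apply/andP; split; lra.
- by apply/andP; split; lra.
Qed.

Let rho_taylor m p : `|rho p - rho m - drho m * (p - m)| <= 4 * (p - m) ^+ 2.
Proof.
have := pp_taylor m p; have := pp_taylor (m - 1 / 2) (p - 1 / 2); have := pp_taylor (m - 1) (p - 1).
have -> : p - 1 / 2 - (m - 1 / 2) = p - m by ring.
have -> : p - 1 - (m - 1) = p - m by ring.
rewrite /rho /drho.
move=> /andP[? ?] /andP[? ?] /andP[? ?]; rewrite ler_norml; apply/andP; split; lra.
Qed.

Let drho_le m : `|drho m| <= 2.
Proof.
rewrite /drho; case: (lerP 0 m) => ?; case: (lerP 0 (m - 1/2)) => ?; case: (lerP 0 (m - 1)) => ?; rewrite ler_norml; apply/andP; split; lra.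
Qed.

(** Chain rule for second differences: [drho] is at most 2 in absolute value, and the first-order
    Taylor remainder of [rho] is at most 4 times the squared increment. *)
Lemma rho_snd m p q :
  `|rho p + rho q - 2 * rho m| <= 2 * `|p + q - 2 * m| + 4 * ((p - m) ^+ 2 + (q - m) ^+ 2).
Proof.
have h1 := rho_taylor m p; have h2 := rho_taylor m q.
have -> : rho p + rho q - 2 * rho m = drho m * (p + q - 2 * m) +
  ((rho p - rho m - drho m * (p - m)) + (rho q - rho m - drho m * (q - m))) by ring.
rewrite (le_trans (ler_normD _ _))// lerD//.
  by rewrite normrM ler_wpM2r.
by rewrite (le_trans (ler_normD _ _))// [leRHS]mulrDr lerD.
Qed.

End step_function.

Section layer_cake.
Context d1 d2 (T1 : measurableType d1) (T2 : measurableType d2) (R : realType)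
  (P1 : probability T1 R) (P2 : probability T2 R).
Variables (Y1 : T1 -> R) (Y2 : T2 -> R) (D : R).
Hypothesis mY1 : measurable_fun setT Y1.
Hypothesis mY2 : measurable_fun setT Y2.
Hypothesis YD : forall t, pr P1 [set w | Y1 w <= t] <= pr P2 [set w | Y2 w <= t] + D.

Lemma rho_meas : measurable_fun setT (rho : R -> R).
Proof.
apply: measurable_funB.
  apply: measurable_funD.
    apply: measurable_funB => //; apply: measurable_funM => //.
    by apply: measurable_funX; exact: measurable_maxr.
  apply: measurable_funM => //; apply: measurable_funX; apply: measurable_maxr => //.
  exact: measurable_funB.
apply: measurable_funM => //; apply: measurable_funX; apply: measurable_maxr => //.
exact: measurable_funB.
Qed.

(** A decreasing function from 1 to 0 is a mixture of indicators of half-lines with weights of sum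
    1. A comparison of all levels with error [D] therefore passes to the expectations with the same
    error. *)
Lemma Ex_rho_le : Ex P1 (fun w => rho (Y1 w)) <= Ex P2 (fun w => rho (Y2 w)) + D.
Proof.
apply/ler_addgt0Pr => e e0.
(* Since [rho] is 2-Lipschitz, rounding to a grid of mesh 1 / N costs 2 / N <= e. *)
pose N := (Num.truncn (2 / e)).+1.
have N0 : 0 < N%:R :> R by rewrite ltr0n.
have NE : 2 / N%:R <= e.
  rewrite ler_pdivrMr// mulrC -ler_pdivrMr// ltW// truncnS_gt//.
pose t (j : nat) : R := j%:R / N%:R.
pose w j := rho (t j) - rho (t j.+1).
have tS j : t j.+1 = t j + N%:R^-1 by rewrite /t -natr1 mulrDl mul1r.
have w0 j : 0 <= w j by rewrite subr_ge0 rho_le// tS lerDl invr_ge0 ltW.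
(* The part of the drop of [rho] over the cell [j] that lies to the right of y; these parts
   telescope to [rho y]. *)
pose te y j := rho (Num.max y (t j)) - rho (Num.max y (t j.+1)).
have te0 y j : 0 <= te y j.
  by rewrite subr_ge0 rho_le// ge_max !le_max lexx /= tS lerDl invr_ge0 (ltW N0) orbT.
have tel y : \sum_(j < N) te y j = rho y.
  rewrite -(big_mkord xpredT (te y)).
  rewrite (@telescope_sumr_eq _ _ _ (fun j => - rho (Num.max y (t j))))//; last first.
    by move=> k _; rewrite /te opprK addrC.
  rewrite /t divff ?gt_eqF// mul0r (@rho_right _ (Num.max y 1)) ?le_max ?lexx ?orbT//.
  rewrite oppr0 add0r opprK; case: (lerP y 0) => y0; last by [].
  by rewrite !rho_left.
(* The mixture counts the whole drop of a cell as soon as y is at most its right end, so [G] lies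
   between [rho y] and [rho (y - N%:R^-1)]. *)
pose G y : R := \sum_(j < N) w j * \1_[set x | x <= t j.+1] y.
have Gge y : rho y <= G y.
  rewrite -tel; apply: ler_sum => j _; rewrite indicE.
  case: (boolP (y \in _)) => [/set_mem/= yt|/negP yt].
    rewrite mulr1 /te (max_r yt) lerD2r rho_le// le_max lexx orbT//.
  have {}yt : t j.+1 < y by rewrite ltNge; apply/negP => yt'; apply: yt; rewrite inE.
  have tt : t j <= t j.+1 by rewrite tS lerDl invr_ge0 ltW.
  rewrite mulr0 /te !max_l ?subrr//; [exact: ltW|exact: le_trans tt (ltW yt)].
have Gle y : G y <= rho y + e.
  apply: (@le_trans _ _ (rho (y - N%:R^-1))); last first.
    have := rho_lip (y - N%:R^-1) y; have -> : y - N%:R^-1 - y = - N%:R^-1 by ring.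
    rewrite normrN [X in _ <= 2 * X]ger0_norm ?invr_ge0 ?(ltW N0)// => /(le_trans (ler_norm _)) h.
    by move: NE h; lra.
  rewrite -tel; apply: ler_sum => j _; rewrite indicE.
  case: (boolP (y \in _)) => [/set_mem/= yt|_]; last by rewrite mulr0.
  have h1 : y - N%:R^-1 <= t j by rewrite lerBlDr -tS.
  have h2 : y - N%:R^-1 <= t j.+1 by rewrite lerBlDr (le_trans yt)// lerDl invr_ge0 ltW.
  by rewrite mulr1 /te /w (max_r h1) (max_r h2).
have sw : \sum_(j < N) w j = 1.
  have := tel 0; rewrite rho_left// => <-; apply: eq_bigr => j _.
  by rewrite /w /te !max_r// divr_ge0.
have ExG d (T : measurableType d) (P : probability T R) (Y : T -> R) : measurable_fun setT Y ->
    itg P (fun x => G (Y x)) /\ Ex P (fun x => G (Y x)) = \sum_(j < N) w j * pr P [set x | Y x <= t j.+1].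
  move=> mY; have ii (j : 'I_N) : itg P (fun x => \1_[set x | Y x <= t j.+1] x).
    by apply: itg_indic; exact: sublevel_meas.
  have GE x : G (Y x) = \sum_(j < N) w j * \1_[set x | Y x <= t j.+1] x.
    by apply: eq_bigr => j _; rewrite !indicE; congr (_ * _%:R); rewrite !inE.
  split; first by under eq_fun do rewrite GE; apply: itg_sum => j _; exact: itgZ.
  under Ex_ext do rewrite GE.
  rewrite Ex_sum => [|j _]; last exact: itgZ.
  by apply: eq_bigr => j _; rewrite ExZ// Ex_indic//; exact: sublevel_meas.
have irho d (T : measurableType d) (P : probability T R) (Y : T -> R) : measurable_fun setT Y ->
    itg P (fun x => rho (Y x)).
  move=> mY; apply: (@itg_bnd _ _ _ _ _ 1); first exact: measurableT_comp rho_meas mY.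
  by move=> x; have /andP[? ?] := rho01 (Y x); rewrite ger0_norm.
have [iG1 EG1] := ExG _ _ P1 _ mY1; have [iG2 EG2] := ExG _ _ P2 _ mY2.
apply: (@le_trans _ _ (Ex P1 (fun x => G (Y1 x)))); first by apply: Ex_le => //; exact: irho.
apply: (@le_trans _ _ (Ex P2 (fun x => G (Y2 x)) + D)).
  rewrite EG1 EG2 -[D]mul1r -sw mulr_suml -big_split/=; apply: ler_sum => j _.
  by rewrite -mulrDr ler_wpM2l.
rewrite addrAC lerD2r -[e](Ex_cst P2) -ExD; [|exact: irho|exact: itg_cst].
by apply: Ex_le => //; apply: itgD; [exact: irho|exact: itg_cst].
Qed.

End layer_cake.

Section moreau.
Context {R : realType} {d : nat}.
Variables (s : 'cV[R]_d -> R) (u : 'cV[R]_d -> 'cV[R]_d) (l : R).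
Hypothesis su : usub s u.
Hypothesis l0 : 0 < l.

Definition moreau_obj (w y : 'cV[R]_d) : R := s y + dot (w - y) (w - y) / l.

(** Infimal convolution with a quadratic: the envelope stays convex and 1-Lipschitz, and its second
    differences are at most [2 / l] times the squared increment, whatever the dimension. *)
Definition moreau (w : 'cV[R]_d) : R := inf [set moreau_obj w y | y in setT].

(** By the Lipschitz bound the objective exceeds [s w] by at least r^2 / l - r with r = |w - y|,
    whose minimum, at r = l / 2, is - l / 4. *)
Lemma moreau_obj_ge w y : s w - l / 4 <= moreau_obj w y.
Proof.
have := usub_lip su w y; rewrite mul1r ler_norml /moreau_obj -sqr_enorm => /andP[_ h].
have : 0 <= (enorm (w - y) - l / 2) ^+ 2 / l by rewrite divr_ge0 ?sqr_ge0// ltW.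
have -> : (enorm (w - y) - l / 2) ^+ 2 / l = enorm (w - y) ^+ 2 / l - enorm (w - y) + l / 4.
  by field; rewrite gt_eqF.
by lra.
Qed.

Let lb w : has_lbound [set moreau_obj w y | y in setT].
Proof. by exists (s w - l / 4) => _ [y _ <-]; exact: moreau_obj_ge. Qed.

Lemma moreau_le w y : moreau w <= moreau_obj w y.
Proof. by apply: ge_inf => //; exists y. Qed.

Lemma le_moreau w c : (forall y, c <= moreau_obj w y) -> c <= moreau w.
Proof.
move=> h; apply: lb_le_inf; first by exists (moreau_obj w 0), 0.
by move=> _ [y _ <-].
Qed.

Lemma moreau_ge_fun w : s w - l / 4 <= moreau w.
Proof. by apply: le_moreau => y; exact: moreau_obj_ge. Qed.

Lemma moreau_le_fun w : moreau w <= s w.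
Proof.
by rewrite (le_trans (moreau_le w w))// /moreau_obj subrr dot0l mul0r addr0.
Qed.

Lemma moreau_shift w v : moreau (w + v) <= moreau w + enorm v.
Proof.
rewrite -lerBlDr; apply: le_moreau => y; rewrite lerBlDr.
rewrite (le_trans (moreau_le _ (y + v)))// /moreau_obj opprD addrACA subrr addr0 addrAC lerD2r.
have := usub_lip su (y + v) y; rewrite mul1r addrAC subrr add0r ler_norml => /andP[_].
by lra.
Qed.

Lemma moreau_lip : lip 1 moreau.
Proof.
move=> x y; rewrite mul1r ler_norml.
have := moreau_shift x (y - x); have := moreau_shift y (x - y).
rewrite !(addrC _ (_ - _)) !subrK (enorm_distC y x) => ? ?.
by apply/andP; split; lra.
Qed.

(** Below: the midpoint of competitors at [x + v] and [x - v] competes at [x], and both terms of the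
    objective are convex. Above: one competitor serves at both points, and the parallelogram law
    leaves [2 / l] times the square of |v|. *)
Lemma moreau_snd x v :
  0 <= moreau (x + v) + moreau (x - v) - 2 * moreau x <= 2 / l * enorm v ^+ 2.
Proof.
have li0 : 0 < l^-1 by rewrite invr_gt0.
apply/andP; split.
  case: (su) => _ _ sub.
  have mid y z : 2 * s (2^-1 *: (y + z)) <= s y + s z.
    set m := 2^-1 *: _; have := sub m y; have := sub m z.
    have : dot (u m) (z - m) + dot (u m) (y - m) = 0.
      rewrite -dotDr (_ : z - m + (y - m) = 0) ?dot0r//.
      by apply/matrixP => i j; rewrite /m !mxE; field.
    by lra.
  have H y z : 2 * moreau x <= moreau_obj (x + v) y + moreau_obj (x - v) z.
    have := moreau_le x (2^-1 *: (y + z)); rewrite -(ler_pM2l (_ : 0 < 2 :> R))// => /le_trans; apply.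
    rewrite /moreau_obj mulrDr addrACA lerD ?mid//.
    rewrite -mulrDl mulrA ler_pM2r//.
    have -> : x - 2^-1 *: (y + z) = 2^-1 *: ((x + v - y) + (x - v - z)).
      rewrite (_ : x + v - y + (x - v - z) = (2 : R) *: x - (y + z)).
        by rewrite scalerBr scalerA mulVf ?scale1r// pnatr_eq0.
      by rewrite scaler_nat mulr2n; apply/matrixP => i j; rewrite !mxE; ring.
    move: (x + v - y) (x - v - z) => A B.
    rewrite dotZl dotZr dotDl !dotDr (dotC B A).
    have := dotxx_ge0 (A - B); rewrite dotBl !dotBr (dotC B A).
    by lra.
  have H2 y : 2 * moreau x - moreau_obj (x + v) y <= moreau (x - v).
    by apply: le_moreau => z; rewrite lerBlDl.
  have : 2 * moreau x - moreau (x - v) <= moreau (x + v).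
    by apply: le_moreau => y; have := H2 y; lra.
  by lra.
have : (moreau (x + v) + moreau (x - v)) / 2 - enorm v ^+ 2 / l <= moreau x.
  apply: le_moreau => y.
  have := moreau_le (x + v) y; have := moreau_le (x - v) y; rewrite /moreau_obj sqr_enorm.
  have -> : x + v - y = (x - y) + v by rewrite addrAC.
  have -> : x - v - y = (x - y) - v by rewrite addrAC.
  move: (x - y) => A.
  move: (moreau (x + v)) (moreau (x - v)) => a b.
  rewrite !dotDl !dotDr !dotNl !dotNr (dotC v A) !mulrDl !mulNr.
  by lra.
have -> : 2 / l * enorm v ^+ 2 = 2 * (enorm v ^+ 2 / l) by ring.
by lra.
Qed.

End moreau.

Ltac pos := repeat first [ done | apply: sqr_ge0 | apply: enorm_ge0 | (apply: ltW; assumption)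
  | apply: sqrtr_ge0 | apply: ler0n | rewrite invr_ge0 | apply: exprn_ge0 | apply: mulr_ge0 | apply: addr_ge0 ].

Lemma dist_le2 (R : realType) (a b e : R) : a <= b + e -> b <= a + e -> `|b - a| <= e.
Proof. by move=> ? ?; rewrite ler_norml; apply/andP; split; lra. Qed.

Lemma num_collar1 (R : realType) (g p q : R) : 2 * p <= g -> q <= 5 / 4 * (40 * g) + p -> q <= - p + 51 * g.
Proof. by lra. Qed.

Lemma num_collar2 (R : realType) (g sc t m q : R) :
  m <= t * (40 * g) -> q - 40 * g / 4 <= m -> q <= t * (40 * g) - sc + (sc + 10 * g).
Proof. by lra. Qed.

Lemma num_collar3 (R : realType) (t sc m q q' r : R) :
  m <= q' -> q' - q <= r -> r <= sc -> q < t - sc -> m <= t.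
Proof. by lra. Qed.

Lemma num_collar4 (R : realType) (t g q m c : R) :
  m <= t -> q - 40 * g / 4 <= m -> 10 * g <= 25 * g * c -> q <= t + 25 * g * c.
Proof. by lra. Qed.

Lemma num_sum2 (R : realType) (p q om : R) : p <= 5 / 2 * om -> q <= 5 / 2 * om -> p + q <= 5 * om.
Proof. by lra. Qed.

Lemma num_diff0 (R : realType) (k p q r : R) : p = 0 -> q = 0 -> 0 <= r -> k * `|p - q| <= r.
Proof. by move=> -> -> r0; rewrite subrr normr0 mulr0. Qed.

Lemma num_scaled_diff (R : realType) (L C p q p0 q0 B : R) :
  L ^+ 2 * p = C ^+ 2 * p0 -> L ^+ 2 * q = C ^+ 2 * q0 ->
  C ^+ 2 * `|p0 - q0| <= B -> L ^+ 2 * `|p - q| <= B.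
Proof.
move=> hp hq; rewrite -[X in X * `|p0 - _|](ger0_norm (sqr_ge0 C)) -normrM mulrBr -hp -hq -mulrBr.
by rewrite normrM (ger0_norm (sqr_ge0 L)).
Qed.

Lemma num_c (R : realType) (g c : R) : 0 <= g -> 0 <= c -> c <= 1 ->
  51 * g * c + 11 * g * c ^+ 2 <= 62 * g.
Proof.
move=> g0 c0 c1; have h1 : g * c <= g by rewrite ler_piMr.
have h2 : g * c ^+ 2 <= g by rewrite ler_piMr// exprn_ile1.
lra.
Qed.

Lemma num_25 (R : realType) (g c : R) : 0 <= g -> 2 / 5 <= c -> 10 * g <= 25 * g * c.
Proof.
move=> g0 c0; have : g * (2 / 5) <= g * c by rewrite ler_wpM2l.
by lra.
Qed.

Lemma num_36 (R : realType) (x g : R) : x <= 25 * g -> x + 11 * g <= 36 * g.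
Proof. by lra. Qed.

Lemma num_split (R : realType) (e1 e0 p1 p0 q1 q0 : R) : e1 = p1 - q1 -> e0 = p0 - q0 ->
  p1 - p0 = (e1 - e0) + (q1 - q0).
Proof. by move=> -> ->; ring. Qed.

Lemma num_homog (R : realType) (k r p q p' q' B : R) :
  p = r ^+ 2 * p' -> q = r ^+ 2 * q' -> k * `|p' - q'| <= B -> k * `|p - q| <= B * r ^+ 2.
Proof.
move=> -> -> h; rewrite -mulrBr normrM (ger0_norm (sqr_ge0 r)) mulrCA mulrC.
by rewrite ler_wpM2r ?sqr_ge0.
Qed.

Lemma der_unique (R : realType) (f : R -> R) r a b : der f r a -> der f r b -> a = b.
Proof. by move=> [_ <-] [_ <-]. Qed.

Section smooth_indicator.
Context {R : realType} {d : nat}.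
Variables (s : 'cV[R]_d -> R) (u : 'cV[R]_d -> 'cV[R]_d) (l : R).
Hypothesis su : usub s u.
Hypothesis l0 : 0 < l.

Definition smooth x := rho (moreau s l x / l).

Lemma smooth01 x : 0 <= smooth x <= 1. Proof. exact: rho01. Qed.

Lemma smooth_abs x : `|smooth x| <= 1.
Proof. by have /andP[? ?] := smooth01 x; rewrite ger0_norm. Qed.

Lemma smooth_lip : lip (2 / l) smooth.
Proof.
move=> x y; rewrite (le_trans (rho_lip _ _))// -mulrBl normrM (@ger0_norm _ l^-1) ?invr_ge0 ?(ltW l0)//.
have := moreau_lip su l0 x y; rewrite mul1r mulrA mulrAC => h.
by rewrite ler_wpM2l// divr_ge0// ltW.
Qed.

Lemma smooth_meas : measurable_fun [set: Rd R d] (smooth : Rd R d -> R).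
Proof. exact: lip_borel smooth_lip. Qed.

Lemma smooth_eq1 x : s x <= 0 -> smooth x = 1.
Proof.
move=> sx; rewrite /smooth rho_left// pmulr_lle0 ?invr_gt0//.
exact: le_trans (moreau_le_fun su l0 x) sx.
Qed.

(** 5/4 is 1 for the transition of [rho] plus 1/4 for the gap between [s] and its envelope. *)
Lemma smooth_eq0 x : 5 / 4 * l <= s x -> smooth x = 0.
Proof.
move=> sx; rewrite /smooth rho_right// ler_pdivlMr// mul1r.
by have := moreau_ge_fun su l0 x; lra.
Qed.

(** Outside the collar all three points lie on one flat side of [rho]. Inside, [rho_snd] gives 12 =
    2 * 2 + 4 * 2: the first term from the second difference of the envelope, the other from its two
    increments. *)
Lemma smooth_snd x v : `|smooth (x + v) + smooth (x - v) - 2 * smooth x| <=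
  12 / l ^+ 2 * enorm v ^+ 2 * \1_[set z | - enorm v <= s z <= 5 / 4 * l + enorm v] x.
Proof.
have l1 := moreau_lip su l0 (x + v) x; have l2 := moreau_lip su l0 (x - v) x.
rewrite !mul1r in l1 l2.
have e1 : x + v - x = v by rewrite addrAC subrr add0r.
have e2 : x - v - x = - v by rewrite addrAC subrr add0r.
rewrite e1 in l1; rewrite e2 enormN in l2.
have := l1; rewrite {1}ler_norml => /andP[a1 a2].
have := l2; rewrite {1}ler_norml => /andP[b1 b2].
rewrite indicE; case: (boolP (x \in _)) => [_|/negP xn].
  rewrite mulr1 /smooth.
  have /andP[m1 m2] := moreau_snd su l0 x v.
  apply: le_trans (rho_snd _ _ _) _.
  have li : 0 <= l^-1 by rewrite invr_ge0 ltW.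
  have -> : moreau s l (x + v) / l + moreau s l (x - v) / l - 2 * (moreau s l x / l) =
    (moreau s l (x + v) + moreau s l (x - v) - 2 * moreau s l x) / l by ring.
  rewrite -!mulrBl !exprMn ger0_norm; last by rewrite mulr_ge0.
  have h1 : (moreau s l (x + v) + moreau s l (x - v) - 2 * moreau s l x) / l <= 2 / l ^+ 2 * enorm v ^+ 2.
    rewrite ler_pdivrMr// (le_trans m2)// le_eqVlt; apply/orP; left; apply/eqP.
    by field; rewrite gt_eqF.
  have sq (p : R) : `|p| <= enorm v -> p ^+ 2 * l^-1 ^+ 2 <= enorm v ^+ 2 * l^-1 ^+ 2.
    move=> h; rewrite ler_wpM2r ?sqr_ge0// -real_normK ?num_real//.
    by rewrite lerXn2r ?nnegrE ?enorm_ge0.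
  have := sq _ l1; have := sq _ l2.
  rewrite exprVn; set V := enorm v ^+ 2; set L := (l ^+ 2)^-1 in h1 *.
  by rewrite -/V in h1 *; move: h1; lra.
have z0 (p q m : R) : (p <= 0 /\ q <= 0 /\ m <= 0) \/ (1 <= p /\ 1 <= q /\ 1 <= m) ->
   rho p + rho q - 2 * rho m = 0.
  move=> [[p0 [q0 m0]]|[p1 [q1 m1]]]; first by rewrite !rho_left//; ring.
  by rewrite !rho_right//; ring.
rewrite mulr0 /smooth z0 ?normr0//.
have li : 0 < l^-1 by rewrite invr_gt0.
have h1 := moreau_ge_fun su l0 x; have h2 := moreau_le_fun su l0 x.
case: (lerP (- enorm v) (s x)) => s1.
  have {}s2 : 5 / 4 * l + enorm v < s x.
    by rewrite ltNge; apply/negP => s2; apply: xn; rewrite inE /= s1 s2.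
  by right; rewrite !ler_pdivlMr// !mul1r; split; [lra|split; lra].
by left; rewrite !pmulr_lle0//; split; [lra|split; lra].
Qed.

End smooth_indicator.

(* V is the sum with one summand removed; avgG is the Gaussian counterpart of avg. *)
Section one_coordinate.
Context d0 dZ (Omega : measurableType d0) (OZ : measurableType dZ) (R : realType)
  (P : probability Omega R) (PZ : probability OZ R) (d : nat).
Variables (Z : OZ -> 'cV[R]_d) (V : Omega -> 'cV[R]_d).
Hypothesis HZ : std_gaussian PZ Z.
Hypothesis mV : cmeas V.
Variables (s : 'cV[R]_d -> R) (u : 'cV[R]_d -> 'cV[R]_d) (g A D c sc : R).
Hypothesis su : usub s u.
Hypothesis g0 : 0 < g.
Hypothesis A0 : 0 <= A.
Hypothesis c0 : 0 < c.
Hypothesis sc0 : 0 < sc.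
Hypothesis csc : c ^+ 2 + sc ^+ 2 = 1.
Hypothesis collarV : forall s u, usub s u -> forall q, 0 <= q ->
  pr P [set w | 0 <= s (V w) <= q] <= A * (q + 11 * g).

Variables l lam : R.
Hypothesis lE : l = 40 * g.
Hypothesis lamE : lam = c / sc.
Let l0 : 0 < l. Proof. by rewrite lE mulr_gt0. Qed.
Let lam0 : 0 < lam. Proof. by rewrite lamE divr_gt0. Qed.
Let mZ : cmeas Z. Proof. exact: gauss_cmeas HZ. Qed.
Let c1 : c <= 1.
Proof. have := csc; have := sqr_ge0 sc; have := c0; rewrite !expr2 => ? ? ?; nra. Qed.

(** Since [lam * sc = c], the Gaussian mean of [shf (lam *: y) avg] is the interpolated mean with
    [y] in the place of the removed summand; hence the shifts by [lam *: y] below. *)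
Definition avg (z : 'cV[R]_d) : R := Ex P (fun w => smooth s l (c *: V w + sc *: z)).

Let hh := smooth s l.

Let mhh : measurable_fun [set: Rd R d] (hh : Rd R d -> R). Proof. exact: smooth_meas su l0. Qed.

Let marg z : cmeas (fun w => c *: V w + sc *: z).
Proof. by apply: cmeasD; [exact: cmeasZ|exact: cmeas_cst]. Qed.

Let mhV z : measurable_fun setT (fun w => hh (c *: V w + sc *: z)).
Proof. exact: measurableT_comp mhh (cmeas_borel (marg z)). Qed.

Let ihV z : itg P (fun w => hh (c *: V w + sc *: z)).
Proof. exact: itg_bnd (mhV z) (fun w => smooth_abs _ _ _). Qed.

Lemma avg01 z : 0 <= avg z <= 1.
Proof.
apply/andP; split; first by apply: Ex_ge0 => w; have /andP[] := smooth01 s l (c *: V w + sc *: z).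
rewrite -[leRHS](Ex_cst P); apply: Ex_le; [exact: ihV|exact: itg_cst|move=> w].
by have /andP[] := smooth01 s l (c *: V w + sc *: z).
Qed.

Lemma avg_abs z : `|avg z| <= 1.
Proof. by have /andP[? ?] := avg01 z; rewrite ger0_norm. Qed.

Let shift_sc (x y z : 'cV[R]_d) : x + sc *: y - (x + sc *: z) = sc *: (y - z).
Proof. by rewrite opprD addrACA subrr add0r scalerBr. Qed.

Lemma avg_lip : lip (2 / l * sc) avg.
Proof.
move=> x y; rewrite /avg -ExB; [|exact: ihV|exact: ihV].
apply: Ex_bnd => [|w]; first by apply: measurable_funB; exact: mhV.
rewrite (le_trans (smooth_lip su l0 _ _))// shift_sc enormZ gtr0_norm// mulrA//.
Qed.

Lemma avg_meas : measurable_fun [set: Rd R d] (avg : Rd R d -> R).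
Proof. exact: lip_borel avg_lip. Qed.

Let scaled_collar v lo q : 0 <= q ->
  pr P [set w | lo <= s (c *: V w + v) <= lo + q] <= A * (q / c + 11 * g).
Proof.
move=> q0; have su' := usubD (- (lo / c)) (usub_scale v c0 su).
have := collarV su' (q := q / c); rewrite divr_ge0 ?(ltW c0)// => /(_ erefl).
congr (pr P _ <= _); apply/seteqP; split => w /=; rewrite -mulrBl.
  by rewrite pmulr_lge0 ?invr_gt0// ler_pM2r ?invr_gt0// subr_ge0 lerBlDl.
by move=> /andP[h1 h2]; rewrite pmulr_lge0 ?invr_gt0// ler_pM2r ?invr_gt0// subr_ge0 lerBlDl h1.
Qed.

Let meas_collar lo hi v : measurable [set w | lo <= s (c *: V w + v) <= hi].
Proof.
apply/slab_meas/(usub_comp_meas _ su).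
by apply: cmeasD; [exact: cmeasZ|exact: cmeas_cst].
Qed.

Let lamsc : lam * sc = c. Proof. by rewrite lamE mulfVK// gt_eqF. Qed.

(** The second differences of the smoothed indicator live on a collar, whose probability under [V]
    is at most [A * (51 g / c + 11 g)]; [H2_snd] converts them into a bound on [H2]. With
    [lam * sc = c <= 1] the constant is 93/200 = 12 * (51 + 11) / 40^2. *)
Lemma avg_H2_small a y :
  lam ^+ 2 * `|H2 PZ Z (shf (lam *: y) avg) a - H2 PZ Z avg a| <=
  93 / 200 * A / g * lam * enorm y * enorm a ^+ 2.
Proof.
(* For eta <= eta0 the displacement [v] below satisfies [2 * enorm v <= g]. *)
pose eta0 := g / (2 * sc * enorm a + 1).
have ea := enorm_ge0 a.
have D0 : 0 < 2 * sc * enorm a + 1 by rewrite ltr_wpDl// !mulr_ge0// ltW.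
have eta00 : 0 < eta0 by rewrite divr_gt0.
pose C := 12 / l ^+ 2 * (sc * enorm a) ^+ 2 * (A * (51 * g / c + 11 * g)).
have C0 : 0 <= C.
  have g0' := ltW g0; have c0' := ltW c0.
  by rewrite /C; pos.
have H : `|H2 PZ Z (shf (lam *: y) avg) a - H2 PZ Z avg a| <= C * enorm (lam *: y).
  apply: (H2_snd HZ avg_meas avg_abs (lam *: y) eta00 C0) => z eta /andP[e0 e1].
  pose v := sc *: (eta *: a).
  have ev : enorm v = sc * (eta * enorm a) by rewrite !enormZ !gtr0_norm.
  have ev2 : 2 * enorm v <= g.
    rewrite ev; have : eta * (2 * sc * enorm a + 1) <= g by rewrite -ler_pdivlMr.
    by have := ltW e0; lra.
  (* The collar has width 5/4 * 40 g + 2 |v|, which is at most 51 g. *)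
  pose S := [set w | - enorm v <= s (c *: V w + sc *: z) <= - enorm v + 51 * g].
  have mS : measurable S by exact: meas_collar.
  have I1 : itg P (fun w => hh (c *: V w + sc *: (z + eta *: a)) +
     hh (c *: V w + sc *: (z - eta *: a)) - 2 * hh (c *: V w + sc *: z)).
    by apply: itgB; [apply: itgD; exact: ihV|apply: itgZ; exact: ihV].
  have I2 : itg P (fun w => 12 / l ^+ 2 * enorm v ^+ 2 * \1_S w) by apply: itgZ; exact: itg_indic.
  apply: (@le_trans _ _ (Ex P (fun w => 12 / l ^+ 2 * enorm v ^+ 2 * \1_S w))); last first.
    rewrite ExZ ?Ex_indic//; last exact: itg_indic.
    rewrite ev /C; have := scaled_collar (sc *: z) (- enorm v) (q := 51 * g); rewrite mulr_ge0 ?(ltW g0)// => /(_ erefl) hS.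
    have -> : 12 / l ^+ 2 * (sc * enorm a) ^+ 2 * (A * (51 * g / c + 11 * g)) * eta ^+ 2 =
      12 / l ^+ 2 * (sc * (eta * enorm a)) ^+ 2 * (A * (51 * g / c + 11 * g)) by ring.
    by rewrite ler_wpM2l// mulr_ge0 ?sqr_ge0// divr_ge0 ?sqr_ge0.
  have E : avg (z + eta *: a) + avg (z - eta *: a) - 2 * avg z = Ex P (fun w => hh (c *: V w + sc *: (z + eta *: a)) +
     hh (c *: V w + sc *: (z - eta *: a)) - 2 * hh (c *: V w + sc *: z)).
    rewrite ExB; [|by apply: itgD; exact: ihV|by apply: itgZ; exact: ihV].
    by rewrite ExD; [rewrite ExZ//; exact: ihV|exact: ihV|exact: ihV].
  rewrite E (le_trans (Ex_abs I1))//; apply: Ex_le => [||w]; [exact: itg_abs|exact: I2|].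
  have -> : c *: V w + sc *: (z + eta *: a) = (c *: V w + sc *: z) + v by rewrite scalerDr addrA.
  have -> : c *: V w + sc *: (z - eta *: a) = (c *: V w + sc *: z) - v by rewrite scalerBr addrA.
  rewrite (le_trans (smooth_snd su l0 _ _))// ler_wpM2l//.
    by rewrite mulr_ge0 ?sqr_ge0// divr_ge0 ?sqr_ge0.
  rewrite !indicE; case: (boolP (_ \in _)) => [/set_mem/= /andP[h1 h2]|_]; last by case: (_ \in _).
  rewrite (_ : w \in S)// inE /S /= h1 /=; move: h2; rewrite lE.
  exact: num_collar1.
have lam20 : 0 <= lam ^+ 2 by exact: sqr_ge0.
apply: le_trans (ler_wpM2l lam20 H) _.
rewrite enormZ gtr0_norm//.
have -> : lam ^+ 2 * (C * (lam * enorm y)) =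
   12 / l ^+ 2 * (A * (51 * g * c + 11 * g * c ^+ 2)) * (lam * enorm y * enorm a ^+ 2).
  by rewrite /C -lamsc lE; field; rewrite !gt_eqF.
have -> : 93 / 200 * A / g * lam * enorm y * enorm a ^+ 2 = (93 / 200 * A / g) * (lam * enorm y * enorm a ^+ 2) by ring.
rewrite ler_wpM2r ?mulr_ge0 ?sqr_ge0 ?enorm_ge0 ?(ltW lam0)//.
have -> : 93 / 200 * A / g = 12 / l ^+ 2 * (A * (62 * g)).
  by rewrite lE; field; rewrite gt_eqF.
rewrite ler_wpM2l ?divr_ge0 ?sqr_ge0// ler_wpM2l//.
exact: (num_c (ltW g0) (ltW c0) c1).
Qed.

Let mS z : measurable_fun setT (fun w => moreau s l (c *: V w + sc *: z) / l).
Proof.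
apply: measurable_funM => //; apply: measurableT_comp (lip_borel (moreau_lip su l0)) _.
exact: cmeas_borel.
Qed.

Let mSt z t : measurable [set w | moreau s l (c *: V w + sc *: z) / l <= t].
Proof. exact: sublevel_meas. Qed.

Variable om : R.
Hypothesis omE : om = A * ((sc + 10 * g) / c + 11 * g).

(** Level by level: passing from [z] to [z + v] moves [s] by at most [sc], and the envelope is
    within [l / 4 = 10 g] of [s]. Only a window of width [sc + 10 g] can change side. *)
Let avg_osc1 z v : enorm v <= 1 -> avg z <= avg (z + v) + om.
Proof.
move=> v1; apply: Ex_rho_le => // t.
pose q := sc + 10 * g; have q0 : 0 <= q by rewrite addr_ge0 ?mulr_ge0 ?ltW.
apply: le_trans (_ : _ <= pr P ([set w | moreau s l (c *: V w + sc *: (z + v)) / l <= t] `|`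
   [set w | t * l - sc <= s (c *: V w + sc *: z) <= t * l - sc + q])) _.
  apply: le_pr; [exact: mSt|apply: measurableU; [exact: mSt|exact: meas_collar]|].
  move=> w /=; rewrite !ler_pdivrMr// => h.
  have h1 := moreau_ge_fun su l0 (c *: V w + sc *: z).
  have h2 := moreau_le_fun su l0 (c *: V w + sc *: (z + v)).
  have := usub_lip su (c *: V w + sc *: (z + v)) (c *: V w + sc *: z).
  rewrite shift_sc addrAC subrr add0r mul1r enormZ (gtr0_norm sc0) => /(le_trans (ler_norm _)) h3.
  have h4 : sc * enorm v <= sc by rewrite ler_piMr// ltW.
  case: (lerP (t * l - sc) (s (c *: V w + sc *: z))) => h5; [right|left]; last exact: num_collar3 h2 h3 h4 h5.
  apply/andP; split => //; rewrite /q; move: h h1; rewrite lE.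
  exact: num_collar2.
apply: le_trans (pr_setU _ (mSt _ _) (meas_collar _ _ _)) _.
by rewrite lerD2l omE; exact: scaled_collar.
Qed.

Lemma avg_osc z v : enorm v <= 1 -> `|avg (z + v) - avg z| <= om.
Proof.
move=> v1; have h1 := avg_osc1 z v1; have := @avg_osc1 (z + v) (- v); rewrite enormN addrK => /(_ v1).
exact: dist_le2.
Qed.

(** Each of the two values of [H2] is at most 5/2 of the oscillation in a unit direction. In
    [lam ^+ 2 * om] the part with [sc / c] becomes [lam], and 36 = 25 + 11 because [c >= 2/5] gives
    10 g / c <= 25 g. *)
Lemma avg_H2_mid a y : 2 / 5 <= c ->
  lam ^+ 2 * `|H2 PZ Z (shf (lam *: y) avg) a - H2 PZ Z avg a| <=
  5 * A * (lam + 36 * g * lam ^+ 2) * enorm a ^+ 2.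
Proof.
move=> c25; have ms : mRd (shf (lam *: y) avg) by apply: mRd_shf; exact: avg_meas.
have as1 z : `|shf (lam *: y) avg z| <= 1 by exact: avg_abs.
have A0' := A0; have lam0' := ltW lam0; have g0' := ltW g0.
have [a0|aN0] := eqVneq (enorm a) 0.
  have Z0 F : mRd F -> (forall z, `|F z| <= 1) -> H2 PZ Z F a = 0.
    move=> mF F1; have := H2_le HZ mF F1 a; rewrite a0 expr0n/= mulr0 normr_le0.
    by move/eqP.
  have z1 := Z0 _ ms as1; have z2 := Z0 _ avg_meas avg_abs.
  by apply: (num_diff0 _ z1 z2); pos.
pose e := (enorm a)^-1 *: a.
have ap : 0 < enorm a by rewrite lt_def aN0 enorm_ge0.
have e1 : enorm e = 1 by rewrite enormZ gtr0_norm ?invr_gt0// mulVf.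
have aE : enorm a *: e = a by rewrite scalerA mulfV// scale1r.
have h1 : H2 PZ Z (shf (lam *: y) avg) a = enorm a ^+ 2 * H2 PZ Z (shf (lam *: y) avg) e.
  by rewrite -{1}aE; exact: (H2Z HZ ms as1).
have h2 : H2 PZ Z avg a = enorm a ^+ 2 * H2 PZ Z avg e.
  by rewrite -{1}aE; exact: (H2Z HZ avg_meas avg_abs).
apply: (num_homog h1 h2).
have osc z r : 0 <= r <= 1 -> `|avg (z + r *: e) - avg z| <= om.
  by move=> /andP[r0 r1]; apply: avg_osc; rewrite enormZ e1 mulr1 ger0_norm.
have B1 := H2_osc HZ avg_meas avg_abs e1 osc.
have B2 : `|H2 PZ Z (shf (lam *: y) avg) e| <= 5 / 2 * om.
  apply: (H2_osc HZ ms as1 e1) => z r r01.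
  by rewrite /shf (addrAC z); exact: osc.
have omle : lam ^+ 2 * om <= A * (lam + 36 * g * lam ^+ 2).
  rewrite omE mulrCA ler_wpM2l//.
  have -> : lam ^+ 2 * ((sc + 10 * g) / c + 11 * g) = lam + (10 * g / c + 11 * g) * lam ^+ 2.
    by rewrite lamE; field; rewrite !gt_eqF.
  rewrite lerD2l ler_wpM2r ?sqr_ge0//.
  have : 10 * g / c <= 25 * g by rewrite ler_pdivrMr//; exact: num_25.
  exact: num_36.
apply: (@le_trans _ _ (lam ^+ 2 * (5 * om))).
  rewrite ler_wpM2l ?sqr_ge0// (le_trans (ler_normB _ _))//.
  exact: (num_sum2 B2 B1).
by rewrite -mulrA mulrCA ler_wpM2l.
Qed.

(** For large times, where [lam ^+ 3] is integrable, the bound 1 on [avg] is enough. *)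
Lemma avg_H2_triv a y :
  lam ^+ 2 * `|H2 PZ Z (shf (lam *: y) avg) a - H2 PZ Z avg a| <=
  7 / 2 * lam ^+ 3 * enorm y * enorm a ^+ 2.
Proof.
apply: le_trans (ler_wpM2l (sqr_ge0 _) (H2_shift HZ avg_meas avg_abs a (lam *: y))) _.
by rewrite enormZ gtr0_norm// le_eqVlt; apply/orP; left; apply/eqP; ring.
Qed.

Section gauss_comparison.
Hypothesis D0 : 0 <= D.
Hypothesis c25 : 2 / 5 <= c.
Hypothesis HK1 : forall s u, usub s u ->
  pr P [set w | s (V w) <= 25 * g] <= pr PZ [set w | s (Z w) <= 0] + D.
Hypothesis HK2 : forall s u, usub s u ->
  pr PZ [set w | s (Z w) <= 0] <= pr P [set w | s (V w) <= 0] + D.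

(** The function [s] itself replaces the envelope here: on the Gaussian side all regularity comes
    from the stability of the Gaussian law. *)
Definition hG x := rho (s x / l).

Let hG01 x : 0 <= hG x <= 1. Proof. exact: rho01. Qed.

Let hG_abs x : `|hG x| <= 1.
Proof. by have /andP[? ?] := hG01 x; rewrite ger0_norm. Qed.

Let hG_lip : lip (2 / l) hG.
Proof.
move=> x y; rewrite (le_trans (rho_lip _ _))// -mulrBl normrM (@ger0_norm _ l^-1) ?invr_ge0 ?(ltW l0)//.
have := usub_lip su x y; rewrite mul1r mulrA mulrAC => h.
by rewrite ler_wpM2l// divr_ge0// ltW.
Qed.

Let mhG : mRd hG. Proof. exact: lip_borel hG_lip. Qed.

Definition avgG (z : 'cV[R]_d) : R := Ex PZ (fun w => hG (c *: Z w + sc *: z)).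

Let margG z : cmeas (fun w => c *: Z w + sc *: z).
Proof. by apply: cmeasD; [exact: cmeasZ|exact: cmeas_cst]. Qed.

Let mhGZ z : measurable_fun setT (fun w => hG (c *: Z w + sc *: z)).
Proof. exact: measurableT_comp mhG (cmeas_borel (margG z)). Qed.

Let ihGZ z : itg PZ (fun w => hG (c *: Z w + sc *: z)).
Proof. exact: itg_bnd (mhGZ z) (fun w => hG_abs _). Qed.

Let avgG_abs z : `|avgG z| <= 1.
Proof. by apply: Ex_bnd => [|w]; [exact: mhGZ|exact: hG_abs]. Qed.

Let avgG_lip : lip (2 / l * sc) avgG.
Proof.
move=> x y; rewrite /avgG -ExB; [|exact: ihGZ|exact: ihGZ].
apply: Ex_bnd => [|w]; first by apply: measurable_funB; exact: mhGZ.
rewrite (le_trans (hG_lip _ _))// shift_sc enormZ gtr0_norm// mulrA//.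
Qed.

Let mavgG : mRd avgG. Proof. exact: lip_borel avgG_lip. Qed.

Let gauss_stable_Ex (F : Rd R d -> R) : mRd F -> (forall x, 0 <= F x <= 1) ->
  Ex PZ (fun w' => Ex PZ (fun w => F (c *: Z w + sc *: Z w'))) = Ex PZ (fun w => F (Z w)).
Proof.
move=> mF F01; have F1 x : `|F x| <= 1 by have /andP[? ?] := F01 x; rewrite ger0_norm.
have mpair : measurable_fun setT (fun x : OZ * OZ => F (c *: Z x.2 + sc *: Z x.1)).
  apply: measurableT_comp mF _; apply: cmeas_borel; apply: cmeasD; apply: cmeasZ => //.
    by move=> j; apply: measurableT_comp (mZ j) _.
  by move=> j; apply: measurableT_comp (mZ j) _.
have b1 (x y : OZ) : `|F (c *: Z y + sc *: Z x)| <= 1 * 1 by rewrite mulr1.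
have h := gauss_stable HZ (Phi := EFin \o F) c0 csc _ _.
rewrite /Ex /Rintegral -h; last 2 first.
- exact/measurable_EFinP.
- by move=> z; rewrite lee_fin; have /andP[] := F01 z.
congr fine; apply: eq_integral => w _.
rewrite fineK//; have := dom_itg1 (f := fun x y => F (c *: Z y + sc *: Z x)) mpair (itg_cst PZ 1) b1 w.
exact: integrable_fin_num.
Qed.

Let H0_avgG y : H0 PZ Z (shf (lam *: y) avgG) = H0 PZ Z (shf (c *: y) hG).
Proof.
rewrite /H0 -(gauss_stable_Ex (F := shf (c *: y) hG)); last 2 first.
- exact: mRd_shf.
- by move=> x; exact: hG01.
apply: Ex_ext => w'; apply: Ex_ext => w.
by rewrite scalerDr scalerA mulrC lamsc /shf addrA.
Qed.

(** By stability, the Gaussian means of [avgG] shifted by [lam *: y] and of [hG] shifted by [c *: y]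
    are the same function of [y]. Differentiating twice along [a] identifies the second derivatives,
    and the right-hand side stays bounded as [sc] tends to 0. *)
Let H2_avgG a y : lam ^+ 2 * H2 PZ Z (shf (lam *: y) avgG) a = c ^+ 2 * H2 PZ Z (shf (c *: y) hG) a.
Proof.
pose F1 := shf (lam *: y) avgG; pose F2 := shf (c *: y) hG.
have m1 : mRd F1 by exact: mRd_shf.
have m2 : mRd F2 by exact: mRd_shf.
have b1 z : `|F1 z| <= 1 by exact: avgG_abs.
have b2 z : `|F2 z| <= 1 by exact: hG_abs.
have E0 : (fun r => H0 PZ Z (shf (r *: (lam *: a)) F1)) = (fun r => H0 PZ Z (shf (r *: (c *: a)) F2)).
  apply/funext => r; rewrite /F1 /F2 !shf_shf.
  have e (k : R) : r *: (k *: a) + k *: y = k *: (r *: a + y) by rewrite scalerDr !scalerA mulrC.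
  by rewrite !e H0_avgG.
have E1 : (fun r => H1 PZ Z (shf (r *: (lam *: a)) F1) (lam *: a)) = (fun r => H1 PZ Z (shf (r *: (c *: a)) F2) (c *: a)).
  apply/funext => r; have := der_H0 HZ m1 b1 (lam *: a) r; rewrite E0 => /der_unique; apply.
  exact: (der_H0 HZ m2 b2 (c *: a) r).
have : H2 PZ Z (shf (0 *: (lam *: a)) F1) (lam *: a) = H2 PZ Z (shf (0 *: (c *: a)) F2) (c *: a).
  have := der_H1_diag HZ m1 b1 (lam *: a) 0; rewrite E1 => /der_unique; apply.
  exact: (der_H1_diag HZ m2 b2 (c *: a) 0).
by rewrite !scale0r !shf0 (H2Z HZ m1 b1) (H2Z HZ m2 b2).
Qed.

Let avgG_H2_shift a y :
  lam ^+ 2 * `|H2 PZ Z (shf (lam *: y) avgG) a - H2 PZ Z avgG a| <=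
  7 / 2 * enorm y * enorm a ^+ 2.
Proof.
have e0 : lam ^+ 2 * H2 PZ Z avgG a = c ^+ 2 * H2 PZ Z hG a.
  by have := H2_avgG a 0; rewrite !scaler0 !shf0.
apply: (num_scaled_diff (H2_avgG a y) e0).
apply: le_trans (ler_wpM2l (sqr_ge0 _) (H2_shift HZ mhG hG_abs a (c *: y))) _.
rewrite enormZ gtr0_norm//.
have -> : c ^+ 2 * (7 / 2 * 1 * enorm a ^+ 2 * (c * enorm y)) = c ^+ 3 * (7 / 2 * enorm y * enorm a ^+ 2) by ring.
by rewrite ler_piMl ?exprn_ile1// ?(ltW c0)//; pos.
Qed.

(** [Ex_rho_le] reduces the claim to sublevel sets. The envelope may lie below [s] by
    [l / 4 = 10 g]; divided by [c >= 2/5], this is the 25 g of [HK1]. It never lies above [s], so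
    [HK2] has no shift. *)
Let avg_gauss z : `|avg z - avgG z| <= D.
Proof.
have mY2 : measurable_fun setT (fun w => s (c *: Z w + sc *: z) / l).
  apply: measurable_funM => //; apply: measurableT_comp (usub_meas su) _.
  exact: cmeas_borel.
pose s' t x := s (c *: x + sc *: z) / c + - (t * l / c).
have su' t : usub (s' t) (fun x => u (c *: x + sc *: z)) by apply: usubD; exact: usub_scale.
have s'E t x k : (s' t x <= k) = (s (c *: x + sc *: z) <= t * l + k * c).
  by rewrite /s' -mulrBl ler_pdivrMr// lerBlDl.
have Y2E t w : (s (c *: Z w + sc *: z) / l <= t) = (s' t (Z w) <= 0).
  by rewrite s'E mul0r addr0 ler_pdivrMr.
have D1 : avg z <= avgG z + D.
  apply: Ex_rho_le => // t.
  under [X in _ <= pr PZ X + _]eq_set do rewrite Y2E.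
  apply: le_trans (HK1 (su' t)); apply: le_pr => //; first exact: sublevel_meas (usub_comp_meas mV (su' t)).
  move=> w /=; rewrite s'E ler_pdivrMr// => h; have h1 := moreau_ge_fun su l0 (c *: V w + sc *: z).
  have := num_25 (ltW g0) c25.
  by move: h h1; rewrite lE => h h1 h2; exact: num_collar4 h h1 h2.
have D2 : avgG z <= avg z + D.
  apply: Ex_rho_le => // t.
  under eq_set do rewrite Y2E.
  apply: le_trans (HK2 (su' t)) _; rewrite lerD2r; apply: le_pr => //; first exact: sublevel_meas (usub_comp_meas mV (su' t)).
  move=> w /=; rewrite s'E mul0r addr0 ler_pdivrMr// => h.
  exact: le_trans (moreau_le_fun su l0 _) h.
exact: dist_le2 D2 D1.
Qed.

(** Decompose [avg] into [avg - avgG], which is bounded by [D] and shifted by [lam *: y], and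
    [avgG], whose second derivative is controlled uniformly in time. *)
Lemma avg_H2_large a y :
  lam ^+ 2 * `|H2 PZ Z (shf (lam *: y) avg) a - H2 PZ Z avg a| <=
  7 / 2 * (lam ^+ 3 * D + 1) * enorm y * enorm a ^+ 2.
Proof.
pose E z := avg z - avgG z.
have mE : mRd E by apply: measurable_funB; [exact: avg_meas|exact: mavgG].
have H2E' b : H2 PZ Z (shf b E) a = H2 PZ Z (shf b avg) a - H2 PZ Z (shf b avgG) a.
  rewrite /H2 -ExB; [|exact: (itg_H2 HZ avg_meas avg_abs a b)|exact: (itg_H2 HZ mavgG avgG_abs a b)].
  by apply: Ex_ext => w; rewrite /shf /E mulrBl.
have -> : H2 PZ Z (shf (lam *: y) avg) a - H2 PZ Z avg a =
  (H2 PZ Z (shf (lam *: y) E) a - H2 PZ Z E a) + (H2 PZ Z (shf (lam *: y) avgG) a - H2 PZ Z avgG a).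
  apply: num_split (H2E' _) _; have := H2E' 0; rewrite !shf0; exact.
apply: le_trans (ler_wpM2l (sqr_ge0 _) (ler_normD _ _)) _; rewrite mulrDr.
have h1 := H2_shift HZ mE avg_gauss a (lam *: y).
have h2 := avgG_H2_shift a y.
have := ler_wpM2l (sqr_ge0 lam) h1; rewrite enormZ (gtr0_norm lam0).
have -> : 7 / 2 * (lam ^+ 3 * D + 1) * enorm y * enorm a ^+ 2 =
 lam ^+ 2 * (7 / 2 * D * enorm a ^+ 2 * (lam * enorm y)) + 7 / 2 * enorm y * enorm a ^+ 2 by ring.
by move=> h3; exact: lerD h3 h2.
Qed.

End gauss_comparison.
End one_coordinate.

(** * Ornstein-Uhlenbeck interpolation *)

Lemma num_taylor (R : realType) (a b c d r : R) : `|a - b - c - d / 2| <= r ->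
  `|a - (b + c + 2^-1 * d)| <= r.
Proof. by have -> : a - (b + c + 2^-1 * d) = a - b - c - d / 2 by ring. Qed.

Lemma num_pair (R : realType) (a b p q : R) : `|a| <= p -> `|b| <= q -> `|a - b| <= p + q.
Proof. by move=> h1 h2; rewrite (le_trans (ler_normB _ _))// lerD. Qed.

Section gauss_product.
Context (R : realType) (d : nat) (dZ : measure_display)
  (OZ : measurableType dZ) (PZ : probability OZ R) (Z : OZ -> 'cV[R]_d).
Hypothesis HZ : std_gaussian PZ Z.
Let mZ : cmeas Z. Proof. exact: gauss_cmeas HZ. Qed.

Lemma gauss_fubini d0 (T : measurableType d0) (P : probability T R) (x : T -> 'cV[R]_d)
   (F : Rd R d -> R) (psi : Rd R d -> Rd R d -> R) (y : T -> 'cV[R]_d) (a : T -> R) (b : OZ -> R) :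
  cmeas x -> cmeas y -> mRd F -> (forall z, `|F z| <= 1) ->
  measurable_fun setT (fun p : Rd R d * Rd R d => psi p.1 p.2) ->
  itg P a -> itg PZ b -> (forall w z, `|psi (x w) (Z z)| <= a w * b z) ->
  [/\ itg P (fun w => Ex PZ (fun z => F (Z z + y w) * psi (x w) (Z z))),
      itg PZ (fun z => Ex P (fun w => F (Z z + y w) * psi (x w) (Z z))) &
  Ex P (fun w => Ex PZ (fun z => F (Z z + y w) * psi (x w) (Z z))) =
  Ex PZ (fun z => Ex P (fun w => F (Z z + y w) * psi (x w) (Z z)))].
Proof.
move=> mx my mF F1 mpsi Ia Ib bd.
have mf : measurable_fun setT (fun p : T * OZ => F (Z p.2 + y p.1) * psi (x p.1) (Z p.2)).
  apply: measurable_funM.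
    apply: measurableT_comp mF _; apply: cmeas_borel; apply: cmeasD => j.
      by apply: measurableT_comp (mZ j) _.
    by apply: measurableT_comp (my j) _.
  apply: (measurableT_comp mpsi (g := fun p : T * OZ => (x p.1 : Rd R d, Z p.2 : Rd R d))).
  by apply: measurable_fun_pair; apply: cmeas_borel => j;
    [apply: measurableT_comp (mx j) _|apply: measurableT_comp (mZ j) _].
have bf w z : `|F (Z z + y w) * psi (x w) (Z z)| <= a w * b z.
  by rewrite normrM (le_trans _ (bd w z))// ler_piMl.
split.
- exact: (Ex_prod1 (f := fun w z => F (Z z + y w) * psi (x w) (Z z)) mf Ia Ib bf).1.
- exact: (Ex_prod2 (f := fun w z => F (Z z + y w) * psi (x w) (Z z)) mf Ia Ib bf).1.
- exact: (Ex_swap (f := fun w z => F (Z z + y w) * psi (x w) (Z z)) mf Ia Ib bf).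
Qed.

Lemma psi_dot_meas : measurable_fun setT (fun p : Rd R d * Rd R d => dot p.1 p.2).
Proof. by apply: cmeas_dot => k; apply: measurableT_comp (cmeas_id k) _. Qed.

Lemma psi_herm_meas : measurable_fun setT (fun p : Rd R d * Rd R d => dot p.1 p.2 ^+ 2 - dot p.1 p.1).
Proof.
apply: measurable_funB; first by apply: measurable_funX; exact: psi_dot_meas.
by apply: cmeas_dot => k; apply: measurableT_comp (cmeas_id k) _.
Qed.

Lemma herm_bound (x z : 'cV[R]_d) :
  `|dot x z ^+ 2 - dot x x| <= enorm x ^+ 2 * (enorm z ^+ 2 + 1).
Proof.
rewrite (le_trans (ler_normB _ _))// mulrDr mulr1 lerD//.
  rewrite normrX -exprMn lerXn2r ?nnegrE ?mulr_ge0 ?enorm_ge0//.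
  exact: dot_le_abs.
by rewrite ger0_norm ?dotxx_ge0// sqr_enorm.
Qed.

Lemma itg_gauss_norm21 : itg PZ (fun z => enorm (Z z) ^+ 2 + 1).
Proof. by apply: itgD; [exact: itg_gauss_norm2 HZ|exact: itg_cst]. Qed.

Lemma itg_gauss_norm3 : itg PZ (fun z => enorm (Z z) ^+ 3).
Proof.
have I : itg PZ (fun z => 1 + d%:R * \sum_j dot (bvec j : 'cV[R]_d) (Z z) ^+ 4).
  by apply: itgD; [exact: itg_cst|apply: itgZ; apply: itg_sum => j _; exact: itg_mom HZ _ _].
apply: itg_le I _; first by apply: measurable_funX; exact: cmeas_enorm.
move=> z; have e0 := enorm_ge0 (Z z); rewrite ger0_norm ?exprn_ge0//.
have h4 : enorm (Z z) ^+ 4 <= d%:R * \sum_j dot (bvec j : 'cV[R]_d) (Z z) ^+ 4.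
  rewrite (exprM _ 2 2) -sum_coord_sqr.
  under [X in _ <= _ * X]eq_bigr do rewrite dotC dot_bvec (exprM _ 2 2).
  have gen (r : seq 'I_d) (f : 'I_d -> R) : (\sum_(j <- r) f j) ^+ 2 <= (size r)%:R * \sum_(j <- r) f j ^+ 2.
    elim: r => [|j r IH]; first by rewrite !big_nil expr0n mulr0.
    rewrite !big_cons /= -natr1 sqrrD.
    have : 2 * f j * (\sum_(j0 <- r) f j0) <= (size r)%:R * f j ^+ 2 + \sum_(j0 <- r) f j0 ^+ 2.
      elim: (r) => [|k r' IH']; first by rewrite !big_nil mulr0 mul0r addr0.
      rewrite !big_cons /= -natr1 mulrDr.
      have : 0 <= (f j - f k) ^+ 2 by exact: sqr_ge0.
      by rewrite sqrrB; lra.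
    by move: IH; lra.
  by have := gen (enum 'I_d) (fun j => Z z j 0 ^+ 2); rewrite size_enum_ord !big_enum.
case: (lerP (enorm (Z z)) 1) => e1.
  have : enorm (Z z) ^+ 3 <= 1 by rewrite exprn_ile1.
  have : 0 <= enorm (Z z) ^+ 4 by rewrite exprn_ge0.
  by move: h4; set x := _ * _; set p := _ ^+ 4; set q := _ ^+ 3; lra.
have : enorm (Z z) ^+ 3 <= enorm (Z z) ^+ 4 by rewrite ler_eXn2l.
by move: h4; set x := _ * _; set p := _ ^+ 4; set q := _ ^+ 3; lra.
Qed.

(** The Laplacian at 0 of the Gaussian smoothing of [F], written with its Hermite weight. *)
Definition trF (F : Rd R d -> R) := Ex PZ (fun z => F (Z z) * (enorm (Z z) ^+ 2 - d%:R)).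

Section step.
Variables (F : Rd R d -> R).
Hypotheses (mF : mRd F) (F1 : forall z, `|F z| <= 1).

Let Fx (G : OZ -> R) : itg PZ G -> itg PZ (fun z => F (Z z) * G z).
Proof. by move=> iG; apply: (@itgM_bnd _ _ _ _ _ _ 1) => //; exact: mRd_Z HZ _ mF. Qed.

Lemma trF_le : `|trF F| <= 2 * d%:R.
Proof.
have I : itg PZ (fun z => enorm (Z z) ^+ 2 - d%:R).
  by apply: itgB; [exact: itg_gauss_norm2 HZ|exact: itg_cst].
have I2 : itg PZ (fun z => enorm (Z z) ^+ 2 + d%:R).
  by apply: itgD; [exact: itg_gauss_norm2 HZ|exact: itg_cst].
apply: (le_trans (Ex_abs (Fx I))).
apply: (@le_trans _ _ (Ex PZ (fun z => enorm (Z z) ^+ 2 + d%:R))); last first.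
  rewrite ExD; [|exact: itg_gauss_norm2 HZ|exact: itg_cst].
  by rewrite (Ex_gauss_norm2 HZ) Ex_cst mulr_natl mulr2n.
apply: Ex_le => [||z]; [by apply: itg_abs; exact: Fx|exact: I2|].
rewrite normrM (le_trans (ler_piMl _ (F1 _)))// (le_trans (ler_normB _ _))//.
by rewrite !ger0_norm ?sqr_ge0.
Qed.

(** Taylor expansion at the random displacement [- e *: y + t *: Z], averaged over [Z]: the first
    moment leaves the drift along [y], the second moment e^2 y y^T + t^2 I the Hessian along [y] and
    the Laplacian. The constant is 14 = 7/2 * 4, with the 4 from [cube_add_le]. *)
Lemma gauss_step (e t : R) (y : 'cV[R]_d) : 0 <= e -> 0 <= t ->
  `|Ex PZ (fun z1 => H0 PZ Z (shf (- e *: y + t *: Z z1) F)) -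
    (H0 PZ Z F - e * H1 PZ Z F y + (e ^+ 2 * H2 PZ Z F y + t ^+ 2 * trF F) / 2)| <=
  14 * (e ^+ 3 * enorm y ^+ 3 + t ^+ 3 * Ex PZ (fun z => enorm (Z z) ^+ 3)).
Proof.
move=> e0 t0; pose v z1 := - e *: y + t *: Z z1.
have mv : cmeas v by apply: cmeasD; [exact: cmeas_cst|exact: cmeasZ].
pose S z1 := e ^+ 3 * enorm y ^+ 3 + t ^+ 3 * enorm (Z z1) ^+ 3.
have iS : itg PZ S by apply: itgD; [exact: itg_cst|apply: itgZ; exact: itg_gauss_norm3].
have vS z1 : enorm (v z1) ^+ 3 <= 4 * S z1.
  apply: (@le_trans _ _ ((e * enorm y + t * enorm (Z z1)) ^+ 3)).
    rewrite lerXn2r ?nnegrE ?enorm_ge0 ?addr_ge0 ?mulr_ge0 ?enorm_ge0//.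
    by rewrite (le_trans (enormD _ _))// !enormZ normrN !ger0_norm.
  by rewrite /S mulrDr -!exprMn; apply: cube_add_le; rewrite mulr_ge0 ?enorm_ge0.
have v2 : itg PZ (fun z1 => enorm (v z1) ^+ 2).
  apply: itg_norm2 => //; apply: itg_le (itgZ 4 iS) _ => [|z1].
    by apply: measurable_funX; exact: cmeas_enorm.
  by rewrite ger0_norm ?exprn_ge0 ?enorm_ge0.
have c0 : cmeas (fun _ : OZ => 0 : 'cV[R]_d) by exact: cmeas_cst.
have b11 (w z : OZ) : `|1 : R| <= 1 * 1 by rewrite normr1 mulr1.
have [I0 _ _] := gauss_fubini (psi := fun _ _ => 1) (a := fun=> 1) (b := fun=> 1) mv mv mF F1
  (@measurable_cst _ _ _ _ _ _) (itg_cst PZ 1) (itg_cst PZ 1) b11.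
have {}I0 : itg PZ (fun z1 => H0 PZ Z (shf (v z1) F)).
  apply: itg_ext I0 => z1.
  by apply: Ex_ext => z; rewrite mulr1.
have iv1 : itg PZ (fun z1 => enorm (v z1)).
  apply: itg_norm => //; apply: itg_le (itgZ 4 iS) _ => [|z1].
    by apply: measurable_funX; exact: cmeas_enorm.
  by rewrite ger0_norm ?exprn_ge0 ?enorm_ge0.
have [I1 _ E1] := gauss_fubini (psi := fun x z => dot x z) mv c0 mF F1 psi_dot_meas iv1 (itg_gauss_norm HZ) (fun w z => dot_le_abs (v w) (Z z)).
have [I2 _ E2] := gauss_fubini (psi := fun x z => dot x z ^+ 2 - dot x x) mv c0 mF F1 psi_herm_meas v2 itg_gauss_norm21 (fun w z => herm_bound (v w) (Z z)).
have FE (p : 'cV[R]_d -> 'cV[R]_d -> R) w : Ex PZ (fun z => F (Z z + 0) * p (v w) (Z z)) = Ex PZ (fun z => F (Z z) * p (v w) (Z z)).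
  by apply: Ex_ext => z; rewrite addr0.
have {}I1 : itg PZ (fun z1 => H1 PZ Z F (v z1)) by apply: itg_ext I1 => w; exact: FE (fun x z => dot x z) w.
have {}I2 : itg PZ (fun z1 => H2 PZ Z F (v z1)).
  by apply: itg_ext I2 => w; exact: FE (fun x z => dot x z ^+ 2 - dot x x) w.
have id z : itg PZ (fun z1 => dot (Z z1) z) by under eq_fun do rewrite dotC; exact: itg_dot HZ z.
have Ed z : Ex PZ (fun z1 => dot (Z z1) z) = 0 by under Ex_ext do rewrite dotC; exact: Ex_dot1 HZ z.
have id2 z : itg PZ (fun z1 => dot (Z z1) z ^+ 2) by under eq_fun do rewrite dotC; exact: itg_mom HZ 2 z.
have Ed2 z : Ex PZ (fun z1 => dot (Z z1) z ^+ 2) = dot z z by under Ex_ext do rewrite dotC; exact: Ex_dot2 HZ z.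
have {}E1 : Ex PZ (fun z1 => H1 PZ Z F (v z1)) = - e * H1 PZ Z F y.
  transitivity (Ex PZ (fun z => Ex PZ (fun w => F (Z z + 0) * dot (v w) (Z z)))).
    by rewrite -E1; apply: Ex_ext => w; apply: Ex_ext => z; rewrite addr0.
  rewrite -ExZ; last exact: (itg_H1 HZ mF F1).
  apply: Ex_ext => z; rewrite addr0.
  have I : itg PZ (fun w => dot (v w) (Z z)).
    apply: (itg_ext _ (itgD (itg_cst PZ (- e * dot y (Z z))) (itgZ t (id (Z z))))) => w.
    by rewrite /v dotDl !dotZl.
  rewrite (ExZ (F (Z z)) I).
  transitivity (F (Z z) * Ex PZ (fun w => - e * dot y (Z z) + t * dot (Z w) (Z z))).
    by congr (_ * _); apply: Ex_ext => w; rewrite /v dotDl !dotZl.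
  rewrite (ExD (itg_cst PZ (- e * dot y (Z z))) (itgZ t (id (Z z)))).
  by rewrite (ExZ t (id (Z z))) Ed mulr0 addr0 Ex_cst; ring.
have {}E2 : Ex PZ (fun z1 => H2 PZ Z F (v z1)) = e ^+ 2 * H2 PZ Z F y + t ^+ 2 * trF F.
  transitivity (Ex PZ (fun z => Ex PZ (fun w => F (Z z + 0) * (dot (v w) (Z z) ^+ 2 - dot (v w) (v w))))).
    by rewrite -E2; congr (Ex PZ _); apply/funext => w; congr (Ex PZ _); apply/funext => z; rewrite addr0.
  have j1 : itg PZ (fun z => F (Z z) * (dot y (Z z) ^+ 2 - dot y y)) by exact: (itg_H20 HZ mF F1).
  have j2 : itg PZ (fun z => F (Z z) * (enorm (Z z) ^+ 2 - d%:R)).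
    by apply: Fx; apply: itgB; [exact: itg_gauss_norm2 HZ|exact: itg_cst].
  rewrite /H2 /trF -(ExZ (e ^+ 2) j1) -(ExZ (t ^+ 2) j2) -(ExD (itgZ _ j1) (itgZ _ j2)).
  apply: Ex_ext => z; rewrite addr0.
  (* The terms linear in [Z w] have mean 0; the last two average to [t ^+ 2] times the weight in
     [trF]. *)
  have vE w : dot (v w) (Z z) ^+ 2 - dot (v w) (v w) =
    e ^+ 2 * (dot y (Z z) ^+ 2 - dot y y) +
    ((2 * e * t) * dot (Z w) y + (- (2 * e * t * dot y (Z z))) * dot (Z w) (Z z))
    + (t ^+ 2 * dot (Z w) (Z z) ^+ 2 - t ^+ 2 * enorm (Z w) ^+ 2).
    by rewrite /v sqr_enorm !dotDl !dotDr !dotZl !dotZr (dotC y (Z w)); ring.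
  have k1 := itg_cst PZ (e ^+ 2 * (dot y (Z z) ^+ 2 - dot y y)).
  have k2 := itgZ (2 * e * t) (id y).
  have k3 := itgZ (- (2 * e * t * dot y (Z z))) (id (Z z)).
  have k4 := itgZ (t ^+ 2) (id2 (Z z)).
  have k5 := itgZ (t ^+ 2) (itg_gauss_norm2 HZ).
  have k23 := itgD k2 k3; have k123 := itgD k1 k23; have k45 := itgB k4 k5; have k := itgD k123 k45.
  rewrite ExZ; last by apply: itg_ext k => w; rewrite vE.
  rewrite (Ex_ext _ vE) (ExD k123 k45) (ExD k1 k23) (ExD k2 k3) (ExB k4 k5) (ExZ _ (id y)).
  rewrite (ExZ _ (id (Z z))) (ExZ _ (id2 (Z z))) (ExZ _ (itg_gauss_norm2 HZ)).
  rewrite Ex_cst !Ed Ed2 (Ex_gauss_norm2 HZ) !sqr_enorm.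
  by ring.
have iR := itgB I0 (itgD (itgD (itg_cst PZ (H0 PZ Z F)) I1) (itgZ 2^-1 I2)).
have -> : Ex PZ (fun z1 => H0 PZ Z (shf (v z1) F)) -
    (H0 PZ Z F - e * H1 PZ Z F y + (e ^+ 2 * H2 PZ Z F y + t ^+ 2 * trF F) / 2) =
  Ex PZ (fun z1 => H0 PZ Z (shf (v z1) F) - (H0 PZ Z F + H1 PZ Z F (v z1) + 2^-1 * H2 PZ Z F (v z1))).
  rewrite ExB//; last first.
    by apply: itgD; [apply: itgD => //; exact: itg_cst|exact: itgZ].
  rewrite ExD; [|by apply: itgD => //; exact: itg_cst|exact: itgZ].
  rewrite ExD//; last exact: itg_cst.
  by rewrite ExZ// Ex_cst E1 E2 mulNr (mulrC 2^-1).
apply: le_trans (Ex_abs iR) _.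
have -> : e ^+ 3 * enorm y ^+ 3 + t ^+ 3 * Ex PZ (fun z => enorm (Z z) ^+ 3) = Ex PZ S.
  rewrite /S ExD; [|exact: itg_cst|apply: itgZ; exact: itg_gauss_norm3].
  by rewrite Ex_cst ExZ//; exact: itg_gauss_norm3.
rewrite -ExZ//; apply: Ex_le => [||z1]; [exact: itg_abs|exact: itgZ|].
have h0 := num_taylor (H0_taylor HZ mF F1 (v z1)).
apply: (le_trans h0); rewrite [_ * 1]mulr1.
have c0' : 0 <= 7 / 2 :> R by [].
have := ler_wpM2l c0' (vS z1).
by have -> : 7 / 2 * (4 * S z1) = 14 * S z1; [field|].
Qed.

End step.

(* Here F is the average over all the other summands. The drift at x is expanded to first
   order around 0, where the mean of x kills the constant term; the linear term cancels the
   diffusion because x and an independent copy of x have the same covariance. *)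
Section summand.
Context d0 (Omega : measurableType d0) (P : probability Omega R).
Variables (x : Omega -> 'cV[R]_d) (F : Rd R d -> R) (lam : R) (q : R -> R) (Cq : R).
Hypothesis mx : cmeas x.
Hypothesis i3 : itg P (fun w => enorm (x w) ^+ 3).
Hypothesis mean0 : forall j, Ex P (fun w => x w j 0) = 0.
Hypotheses (mF : mRd F) (F1 : forall z, `|F z| <= 1).
Hypothesis mq : measurable_fun setT q.
Hypothesis q_bnd : forall b, 0 <= b -> 0 <= q b <= Cq * (1 + b).
Hypothesis Hq : forall a y b, enorm y <= b ->
  lam ^+ 2 * `|H2 PZ Z (shf (lam *: y) F) a - H2 PZ Z F a| <= q b * enorm a ^+ 2.

Definition herm_weight (z : 'cV[R]_d) := Ex P (fun w => dot (x w) z ^+ 2 - dot (x w) (x w)).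
Definition drift (y : 'cV[R]_d) := H1 PZ Z (shf (lam *: y) F) y.
Definition diffusion (y : 'cV[R]_d) := Ex PZ (fun z => F (Z z + lam *: y) * herm_weight (Z z)).

Let v := Ex P (fun w => enorm (x w) ^+ 2).
Let i2 := itg_norm2 mx i3.
Let i1 := itg_norm mx i3.
Let mlx : cmeas (fun w => lam *: x w). Proof. exact: cmeasZ. Qed.
Let mc (y : 'cV[R]_d) : cmeas (fun _ : Omega => y). Proof. exact: cmeas_cst. Qed.

Let meas_herm (y : Omega -> 'cV[R]_d) z : cmeas y -> measurable_fun setT (fun w => dot (y w) z ^+ 2 - dot (y w) (y w)).
Proof.
move=> my; apply: measurable_funB; last exact: cmeas_dot.
by apply: measurable_funX; apply: cmeas_dot => //; exact: cmeas_cst.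
Qed.

Let itg_herm z : itg P (fun w => dot (x w) z ^+ 2 - dot (x w) (x w)).
Proof.
apply: itg_le (itgZ (enorm z ^+ 2 + 1) i2) _ => [|w]; first exact: meas_herm.
by rewrite mulrC; exact: herm_bound.
Qed.

Let itg_dd : itg P (fun w => dot (x w) (x w)).
Proof. by apply: itg_ext i2 => w; rewrite sqr_enorm. Qed.

Lemma herm_weight_bound z : `|herm_weight z| <= v * (enorm z ^+ 2 + 1).
Proof.
rewrite (le_trans (Ex_abs (itg_herm z)))// mulrC -ExZ//.
apply: Ex_le => [||w]; [exact/itg_abs/itg_herm|exact: itgZ|].
by rewrite mulrC; exact: herm_bound.
Qed.

Lemma herm_weight_meas : mRd herm_weight.
Proof.
have mf : measurable_fun setT (fun p : Rd R d * Omega => (dot (x p.2) p.1 ^+ 2)%:E).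
  apply/measurable_EFinP; apply: measurable_funX; apply: cmeas_dot => j.
    by apply: measurableT_comp (mx j) _.
  by apply: measurableT_comp (cmeas_id j) _.
have m2 : mRd (fun z => Ex P (fun w => dot (x w) z ^+ 2)).
  apply: (measurableT_comp (f := fine)); first exact: fine_measurable.
  have h0 (p : Rd R d * Omega) : (0 <= (dot (x p.2) p.1 ^+ 2)%:E)%E by rewrite lee_fin sqr_ge0.
  exact: (measurable_fun_fubini_tonelli_F (m2 := P) _ mf h0).
have -> : herm_weight = fun z => Ex P (fun w => dot (x w) z ^+ 2) - Ex P (fun w => dot (x w) (x w)).
  apply/funext => z; rewrite -ExB//.
  by apply: itg_ext (itgD (itg_herm z) itg_dd) => w; ring.
by apply: measurable_funB.
Qed.

Let drift_facts : itg P (fun w => drift (x w)).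
Proof.
have [I _ _] := gauss_fubini (psi := fun x z => dot x z) mx mlx mF F1 psi_dot_meas i1 (itg_gauss_norm HZ) (fun w z => dot_le_abs (x w) (Z z)).
exact: I.
Qed.

Let psiw_meas : measurable_fun setT (fun p : Rd R d * Rd R d => herm_weight p.2).
Proof. by apply: measurableT_comp herm_weight_meas _. Qed.

Let weight_bd (w : Omega) z : `|herm_weight (Z z)| <= 1 * (v * (enorm (Z z) ^+ 2 + 1)).
Proof. by rewrite mul1r; exact: herm_weight_bound. Qed.

Let i21 : itg PZ (fun z => v * (enorm (Z z) ^+ 2 + 1)).
Proof. by apply: itgZ; exact: itg_gauss_norm21. Qed.

Let diff_facts : itg P (fun w => diffusion (x w)).
Proof.
have [I _ _] := gauss_fubini (psi := fun _ z => herm_weight z) (a := fun=> 1) mx mlx mF F1 psiw_meas (itg_cst P 1) i21 weight_bd.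
exact: I.
Qed.

Let diffE y : itg P (fun w => H2 PZ Z (shf (lam *: y) F) (x w)) /\
  diffusion y = Ex P (fun w => H2 PZ Z (shf (lam *: y) F) (x w)).
Proof.
have [I _ E] := gauss_fubini (psi := fun x z => dot x z ^+ 2 - dot x x) mx (mc (lam *: y)) mF F1 psi_herm_meas i2 itg_gauss_norm21 (fun w z => herm_bound (x w) (Z z)).
split; first exact: I.
rewrite [RHS]E; apply: Ex_ext => z; rewrite ExZ//; exact: itg_herm.
Qed.

Let diff_bd y b : enorm y <= b -> lam ^+ 2 * `|diffusion y - diffusion 0| <= q b * v.
Proof.
move=> yb; have [I1 ->] := diffE y; have [I2 ->] := diffE 0.
rewrite scaler0 shf0 in I2 *.
rewrite -ExB// -(ger0_norm (sqr_ge0 lam)) -normrM -ExZ; last exact: itgB.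
have I3 := itgZ (lam ^+ 2) (itgB I1 I2).
apply: le_trans (Ex_abs I3) _; rewrite -ExZ//.
apply: Ex_le => [||w]; [exact: itg_abs|exact: itgZ|].
by rewrite normrM (ger0_norm (sqr_ge0 lam)); exact: Hq.
Qed.

Let drift_bd y b : enorm y <= b ->
  `|lam * drift y - lam * H1 PZ Z F y - lam ^+ 2 * H2 PZ Z F y| <= q b * enorm y ^+ 2.
Proof.
move=> yb; have [r /andP[r0 r1]] := mvt01 (der_H1_diag HZ mF F1 (lam *: y)).
rewrite scale1r scale0r shf0.
have ms : mRd (shf (lam *: y) F) by exact: mRd_shf.
have s1 z : `|shf (lam *: y) F z| <= 1 by exact: F1.
have msr : mRd (shf (r *: (lam *: y)) F) by exact: mRd_shf.
have s1r z : `|shf (r *: (lam *: y)) F z| <= 1 by exact: F1.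
rewrite (H1Z HZ ms s1) (H1Z HZ mF F1) (H2Z HZ msr s1r) => ->.
rewrite -mulrBr normrM (ger0_norm (sqr_ge0 lam)) scalerA (mulrC r) -scalerA.
apply: Hq; rewrite enormZ ger0_norm// (le_trans _ yb)// ler_piMl ?enorm_ge0//.
Qed.

Let itg_q : itg P (fun w => q (enorm (x w)) * v).
Proof.
apply: itg_le (itgZ (Cq * v) (itgD (itg_cst P 1) i1)) _ => [|w].
  by apply: measurable_funM => //; apply: measurableT_comp mq _; exact: cmeas_enorm.
have /andP[q0 q1] := q_bnd (enorm_ge0 (x w)); have v0 : 0 <= v by apply: Ex_ge0 => w'; exact: sqr_ge0.
by rewrite ger0_norm ?mulr_ge0// mulrAC ler_wpM2r.
Qed.

Let itg_q2 : itg P (fun w => q (enorm (x w)) * enorm (x w) ^+ 2).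
Proof.
apply: itg_le (itgZ Cq (itgD i2 i3)) _ => [|w].
  apply: measurable_funM; last by apply: measurable_funX; exact: cmeas_enorm.
  by apply: measurableT_comp mq _; exact: cmeas_enorm.
have /andP[q0 q1] := q_bnd (enorm_ge0 (x w)).
have -> : Cq * (enorm (x w) ^+ 2 + enorm (x w) ^+ 3) = Cq * (1 + enorm (x w)) * enorm (x w) ^+ 2 by ring.
rewrite ger0_norm; last by apply: mulr_ge0 => //; exact: sqr_ge0.
by apply: ler_wpM2r => //; exact: sqr_ge0.
Qed.

Lemma summand_bound :
  `|lam ^+ 2 * Ex P (fun w => diffusion (x w)) - lam * Ex P (fun w => drift (x w))| <=
  Ex P (fun w => q (enorm (x w)) * v) + Ex P (fun w => q (enorm (x w)) * enorm (x w) ^+ 2).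
Proof.
have [IH1 _ EH1] := gauss_fubini (psi := fun x z => dot x z) mx (mc 0) mF F1 psi_dot_meas i1 (itg_gauss_norm HZ) (fun w z => dot_le_abs (x w) (Z z)).
have {}IH1 : itg P (fun w => H1 PZ Z F (x w)).
  by apply: itg_ext IH1 => w; apply: Ex_ext => z; rewrite addr0.
have {}EH1 : Ex P (fun w => H1 PZ Z F (x w)) = 0.
  transitivity (Ex P (fun w => Ex PZ (fun z => F (Z z + 0) * dot (x w) (Z z)))).
    by apply: Ex_ext => w; apply: Ex_ext => z; rewrite addr0.
  rewrite EH1; transitivity (Ex PZ (fun=> 0)); last exact: Ex0.
  apply: Ex_ext => z.
  by rewrite ExZ; [rewrite (Ex_dot_eq0 mx i3 (Z z) mean0) mulr0|exact: (itg_dotc mx i3)].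
have [IH2 EH2] := diffE 0; rewrite scaler0 shf0 in IH2 EH2.
have J1 : itg P (fun w => lam ^+ 2 * (diffusion (x w) - diffusion 0)).
  by apply: itgZ; apply: itgB => //; exact: itg_cst.
have J2 : itg P (fun w => lam * drift (x w) - lam * H1 PZ Z F (x w) - lam ^+ 2 * H2 PZ Z F (x w)).
  by apply: itgB; [apply: itgB|]; exact: itgZ.
(* The mean of [H1] at [x] is 0 and that of [H2] at [x] is [diffusion 0], so subtracting both
   expansions changes nothing and leaves the two remainders. *)
have -> : lam ^+ 2 * Ex P (fun w => diffusion (x w)) - lam * Ex P (fun w => drift (x w)) =
  Ex P (fun w => lam ^+ 2 * (diffusion (x w) - diffusion 0)) -
  Ex P (fun w => lam * drift (x w) - lam * H1 PZ Z F (x w) - lam ^+ 2 * H2 PZ Z F (x w)).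
  rewrite ExZ; last by apply: itgB => //; exact: itg_cst.
  rewrite ExB//; last exact: itg_cst.
  rewrite Ex_cst ExB; [|by apply: itgB; exact: itgZ|exact: itgZ].
  rewrite ExB; [|exact: itgZ|exact: itgZ].
  rewrite (ExZ _ (drift_facts)) (ExZ _ IH1) (ExZ _ IH2) EH1 EH2.
  by set p := Ex _ _; set q' := Ex _ _; set r := Ex _ _; ring.
apply: num_pair.
  apply: le_trans (Ex_abs J1) _; apply: Ex_le => [||w]; [exact: itg_abs|exact: itg_q|].
  by rewrite normrM (ger0_norm (sqr_ge0 lam)); exact: diff_bd.
apply: le_trans (Ex_abs J2) _; apply: Ex_le => [||w]; [exact: itg_abs|exact: itg_q2|].
exact: drift_bd.
Qed.

End summand.
End gauss_product.

Lemma gauss_stable_Ex d dZ (R : realType) (OZ : measurableType dZ) (PZ : probability OZ R)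
  (Z : OZ -> 'cV[R]_d) (HZ : std_gaussian PZ Z) (al be : R) (F : Rd R d -> R) :
  0 < al -> al ^+ 2 + be ^+ 2 = 1 -> mRd F -> (forall x, 0 <= F x <= 1) ->
  Ex PZ (fun w' => Ex PZ (fun w => F (al *: Z w + be *: Z w'))) = Ex PZ (fun w => F (Z w)).
Proof.
move=> al0 e1 mF F01; have mZ := gauss_cmeas HZ.
have F1 x : `|F x| <= 1 by have /andP[? ?] := F01 x; rewrite ger0_norm.
have mpair : measurable_fun setT (fun x : OZ * OZ => F (al *: Z x.2 + be *: Z x.1)).
  apply: measurableT_comp mF _; apply: cmeas_borel; apply: cmeasD; apply: cmeasZ => //.
    by move=> j; apply: measurableT_comp (mZ j) _.
  by move=> j; apply: measurableT_comp (mZ j) _.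
have b1 (x y : OZ) : `|F (al *: Z y + be *: Z x)| <= 1 * 1 by rewrite mulr1.
have h := gauss_stable HZ (Phi := EFin \o F) al0 e1 _ _.
rewrite /Ex /Rintegral -h; last 2 first.
- exact/measurable_EFinP.
- by move=> z; rewrite lee_fin; have /andP[] := F01 z.
congr fine; apply: eq_integral => w _.
rewrite fineK//; have := dom_itg1 (f := fun x y => F (al *: Z y + be *: Z x)) mpair (itg_cst PZ 1) b1 w.
exact: integrable_fin_num.
Qed.

Lemma num_ou_total (R : realType) (u u' a b e l2 T H E : R) :
  a = b + e * (l2 * T - H) + e ^+ 2 * l2 / 2 * (E - T) ->
  `|u' - a| <= u -> forall m n, `|l2 * T - H| <= m -> 0 <= e -> e ^+ 2 * l2 / 2 * `|E - T| <= n ->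
  0 <= l2 -> `|u' - b| <= e * m + n + u.
Proof.
move=> aE ua m n hm e0 hn l0.
have -> : u' - b = (u' - a) + e * (l2 * T - H) + e ^+ 2 * l2 / 2 * (E - T) by rewrite aE; ring.
rewrite (le_trans (ler_normD _ _))//.
have : `|e ^+ 2 * l2 / 2 * (E - T)| <= n.
  by rewrite normrM ger0_norm// !mulr_ge0.
have : `|u' - a + e * (l2 * T - H)| <= u + e * m.
  by rewrite (le_trans (ler_normD _ _))// lerD// normrM ger0_norm// ler_wpM2l.
by move=> ? ?; lra.
Qed.

Lemma num_4d (R : realType) (k : nat) : 3 / 2 * k%:R + 2 * k%:R <= 4 * k%:R :> R.
Proof. by have : 0 <= k%:R :> R by []; lra. Qed.

Lemma num_ou_err (R : realType) (k l e x : R) : x <= 4 * k ->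
  e ^+ 2 * l ^+ 2 / 2 * x <= 2 * k * l ^+ 2 * e ^+ 2.
Proof.
move=> xk; have -> : 2 * k * l ^+ 2 * e ^+ 2 = e ^+ 2 * l ^+ 2 / 2 * (4 * k) by field.
by rewrite ler_wpM2l// divr_ge0// mulr_ge0// sqr_ge0.
Qed.

Section ornstein_uhlenbeck.
Context dO dS dZ (Omega : measurableType dO) (S : measurableType dS) (OZ : measurableType dZ)
  (R : realType) (P : probability Omega R) (PZ : probability OZ R) (n d : nat).
Variables (X : 'I_n -> Omega -> S) (h : 'I_n -> S -> 'cV[R]_d) (Z : OZ -> 'cV[R]_d).
Hypothesis HZ : std_gaussian PZ Z.
Hypothesis mX : forall i, measurable_fun setT (X i).
Hypothesis mh : forall i, cmeas (h i).
Hypothesis iX : mutually_independent P X.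
Let xi i w := h i (X i w).
Hypothesis i3 : forall i, itg P (fun w => enorm (xi i w) ^+ 3).
Hypothesis mean0 : forall i j, Ex P (fun w => xi i w j 0) = 0.
Hypothesis cov1 : forall j l, \sum_i Ex P (fun w => xi i w j 0 * xi i w l 0) = (j == l)%:R.
Let W w : 'cV[R]_d := \sum_i xi i w.
Variables (s : 'cV[R]_d -> R) (u : 'cV[R]_d -> 'cV[R]_d) (g l : R).
Hypothesis su : usub s u.
Hypothesis g0 : 0 < g.
Hypothesis lE : l = 40 * g.

Let l0 : 0 < l. Proof. by rewrite lE mulr_gt0. Qed.

Let mZ : cmeas Z. Proof. exact: gauss_cmeas HZ. Qed.
Let mxi i : cmeas (xi i). Proof. exact: (cmeas_hX mX mh i). Qed.
Let mW : cmeas W. Proof. exact: cmeas_sum. Qed.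
Let W3 : itg P (fun w => enorm (W w) ^+ 3).
Proof. exact: (itg_norm_sum3 mxi i3). Qed.
Let W2 := itg_norm2 mW W3.
Let W1 := itg_norm mW W3.
Let hh := smooth s l.
Let mhh : mRd hh. Proof. exact: smooth_meas su l0. Qed.

Definition ou_mean (c sc : R) := Ex P (fun w => Ex PZ (fun z => smooth s l (c *: (\sum_i xi i w) + sc *: Z z))).

Section scale.
Variables (c sc lam : R).
Hypothesis sc0 : 0 < sc.
Hypothesis c0 : 0 < c.
Hypothesis lamE : lam = c / sc.

Let lamsc : sc * lam = c.
Proof. by rewrite lamE mulrCA divff ?mulr1// gt_eqF. Qed.

Let lam_ge0 : 0 <= lam.
Proof. by rewrite lamE divr_ge0// ltW. Qed.

Let Fs (z : Rd R d) := hh (sc *: z).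
Let mFs : mRd Fs.
Proof. by apply: mRd_comp mhh _; apply: cmeasZ => //; exact: cmeas_id. Qed.
Let Fs1 z : `|Fs z| <= 1. Proof. exact: smooth_abs. Qed.
Let mlW : cmeas (fun w => lam *: W w). Proof. exact: (cmeasZ (a := fun=> lam)). Qed.

Let V i w : 'cV[R]_d := W w - xi i w.
Let F i := avg P (V i) s c sc l.
Let mV i : cmeas (V i). Proof. by apply: cmeasB; [exact: mW|exact: mxi]. Qed.
Let mF i : mRd (F i). Proof. exact: (avg_meas P (mV i) c su g0 sc0 lE). Qed.
Let F1 i z : `|F i z| <= 1. Proof. exact: (avg_abs P (mV i) c sc su g0 lE). Qed.

(** As [sc * lam = c], the argument of the smoothed indicator is
    [c *: V i + sc *: (Z + lam *: xi i)], with [V i] independent of [xi i]. Integrating [V i] out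
    turns [Fs] into the average [F i]. *)
Lemma decouple i (psi : Rd R d -> Rd R d -> R) (a : Omega -> R) (b : OZ -> R) :
  measurable_fun setT (fun p : Rd R d * Rd R d => psi p.1 p.2) ->
  itg P a -> itg PZ b -> (forall w z, `|psi (xi i w) (Z z)| <= a w * b z) ->
  Ex P (fun w => Ex PZ (fun z => Fs (Z z + lam *: W w) * psi (xi i w) (Z z))) =
  Ex P (fun w => Ex PZ (fun z => F i (Z z + lam *: xi i w) * psi (xi i w) (Z z))).
Proof.
move=> mpsi Ia Ib bd.
have mlx : cmeas (fun w => lam *: xi i w) by exact: (cmeasZ (a := fun=> lam)).
have [_ _ ->] := gauss_fubini HZ (mxi i) mlW mFs Fs1 mpsi Ia Ib bd.
have [_ _ ->] := gauss_fubini HZ (mxi i) mlx (mF i) (F1 i) mpsi Ia Ib bd.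
apply: Ex_ext => z.
pose Phi (x v : Rd R d) := hh (c *: v + sc *: (Z z + lam *: x)) * psi x (Z z).
have mPhi : measurable_fun setT (fun p : Rd R d * Rd R d => Phi p.1 p.2).
  apply: measurable_funM.
    apply: mRd_comp mhh _; apply: cmeasD.
      by apply: cmeasZ => // j; apply: measurableT_comp (cmeas_id j) _.
    apply: cmeasZ => //; apply: cmeasD; first exact: cmeas_cst.
    by apply: cmeasZ => // j; apply: measurableT_comp (cmeas_id j) _.
  apply: (measurableT_comp mpsi (g := fun p : Rd R d * Rd R d => (p.1, Z z : Rd R d))).
  by apply: measurable_fun_pair.
have bPhi w1 w2 : `|Phi (xi i w1) (V i w2)| <= (b z * a w1) * 1.
  rewrite mulr1 normrM (le_trans (ler_piMl _ (smooth_abs _ _ _)))// mulrC; exact: bd.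
have [_ E] := indep2_Ex (Phi := Phi) (cmeas_borel (mxi i)) (cmeas_borel (mV i))
  (indep_rest mX mh iX i) (itgZ (b z) Ia) (itg_cst P 1) mPhi bPhi.
transitivity (Ex P (fun w => Phi (xi i w) (V i w))).
  apply: Ex_ext => w; rewrite /Phi /Fs; congr (hh _ * _).
  by rewrite /V !scalerDr !scalerA lamsc scalerN addrCA subrK.
rewrite [LHS]E; apply: Ex_ext => w1.
transitivity (Ex P (fun w2 => psi (xi i w1) (Z z) * hh (c *: V i w2 + sc *: (Z z + lam *: xi i w1)))).
  by apply: Ex_ext => w2; rewrite mulrC.
rewrite ExZ; first by rewrite mulrC.
apply: itg_bnd (fun w => smooth_abs s l _); apply: mRd_comp mhh _.
by apply: cmeasD; [exact: cmeasZ|exact: cmeas_cst].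
Qed.

Let x2 i := itg_norm2 (mxi i) (i3 i).
Let x1 i := itg_norm (mxi i) (i3 i).

(* The Hermite weights of the summands add up to |z|^2 - d, because the covariances add up to
   the identity. *)
Let drift_sum :
  itg P (fun w => H1 PZ Z (shf (lam *: W w) Fs) (W w)) /\
  Ex P (fun w => H1 PZ Z (shf (lam *: W w) Fs) (W w)) =
  \sum_i Ex P (fun w => drift PZ Z (F i) lam (xi i w)).
Proof.
have bd i w z : `|dot (xi i w) (Z z)| <= enorm (xi i w) * enorm (Z z) by exact: dot_le_abs.
have E w : H1 PZ Z (shf (lam *: W w) Fs) (W w) =
    \sum_i Ex PZ (fun z => Fs (Z z + lam *: W w) * dot (xi i w) (Z z)).
  rewrite -Ex_sum => [|i _]; last exact: (itg_H1 HZ (@mRd_shf _ _ (lam *: W w) _ mFs) (M := 1) (fun z => Fs1 _)).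
  by apply: Ex_ext => z; rewrite -mulr_sumr -dot_suml.
have I i : itg P (fun w => Ex PZ (fun z => Fs (Z z + lam *: W w) * dot (xi i w) (Z z))).
  by have [] := gauss_fubini HZ (psi := fun x z => dot x z) (mxi i) mlW mFs Fs1 (@psi_dot_meas R d) (x1 i) (itg_gauss_norm HZ) (bd i).
split.
  apply: (itg_ext (fun w => esym (E w))); apply: itg_sum => i _; exact: I.
rewrite (Ex_ext _ E) Ex_sum => [|i _]; last exact: I.
apply: eq_bigr => i _.
exact: (decouple (psi := fun x z => dot x z) (@psi_dot_meas R d) (x1 i) (itg_gauss_norm HZ) (bd i)).
Qed.

Let diffusion_sum :
  itg P (fun w => trF PZ Z (shf (lam *: W w) Fs)) /\
  Ex P (fun w => trF PZ Z (shf (lam *: W w) Fs)) =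
  \sum_i Ex P (fun w => diffusion PZ Z P (xi i) (F i) lam (xi i w)).
Proof.
pose v i := Ex P (fun w => enorm (xi i w) ^+ 2).
have bd i (w : Omega) z : `|herm_weight P (xi i) (Z z)| <= 1 * (v i * (enorm (Z z) ^+ 2 + 1)).
  by rewrite mul1r; exact: (herm_weight_bound (mxi i) (i3 i)).
have iv i : itg PZ (fun z => v i * (enorm (Z z) ^+ 2 + 1)).
  by apply: itgZ; exact: itg_gauss_norm21 HZ.
have mw i : measurable_fun setT (fun p : Rd R d * Rd R d => herm_weight P (xi i) p.2).
  by apply: measurableT_comp (herm_weight_meas (mxi i) (i3 i)) _.
have sumw z : \sum_i herm_weight P (xi i) z = enorm z ^+ 2 - d%:R.
  transitivity (\sum_i (Ex P (fun w => dot (xi i w) z ^+ 2) - Ex P (fun w => enorm (xi i w) ^+ 2))).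
    apply: eq_bigr => i _; rewrite /herm_weight -ExB.
    - by apply: Ex_ext => w; rewrite sqr_enorm.
    - apply: itg_le (itgZ (enorm z ^+ 2) (x2 i)) _ => [|w].
        by apply: measurable_funX; apply: cmeas_dot => //; exact: cmeas_cst.
      rewrite normrX mulrC -exprMn lerXn2r ?nnegrE ?mulr_ge0 ?enorm_ge0//.
      exact: dot_le_abs.
    - exact: x2.
  by rewrite sumrB (sum_dot2 mX mh i3 cov1) (sum_norm2 mX mh i3 cov1).
have E w : trF PZ Z (shf (lam *: W w) Fs) =
    \sum_i Ex PZ (fun z => Fs (Z z + lam *: W w) * herm_weight P (xi i) (Z z)).
  rewrite -Ex_sum => [|i _].
    by apply: Ex_ext => z; rewrite -mulr_sumr sumw.
  apply: (@itgM_bnd _ _ _ _ _ _ 1) => //.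
    exact: (mRd_Z HZ (@mRd_shf _ _ (lam *: W w) _ mFs)).
  apply: itg_le (iv i) _ => [|z]; first exact: (mRd_Z HZ (herm_weight_meas (mxi i) (i3 i))).
  by exact: (herm_weight_bound (mxi i) (i3 i)).
have I i : itg P (fun w => Ex PZ (fun z => Fs (Z z + lam *: W w) * herm_weight P (xi i) (Z z))).
  by have [] := gauss_fubini HZ (psi := fun _ z => herm_weight P (xi i) z) (mxi i) mlW mFs Fs1 (mw i) (itg_cst P 1) (iv i) (bd i).
split.
  apply: (itg_ext (fun w => esym (E w))); apply: itg_sum => i _; exact: I.
rewrite (Ex_ext _ E) Ex_sum => [|i _]; last exact: I.
apply: eq_bigr => i _.
exact: (decouple (psi := fun _ z => herm_weight P (xi i) z) (mw i) (itg_cst P 1) (iv i) (bd i)).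
Qed.

Variables (q : 'I_n -> R -> R) (Cq : 'I_n -> R).
Hypothesis mq : forall i, measurable_fun setT (q i).
Hypothesis q_bnd : forall i b, 0 <= b -> 0 <= q i b <= Cq i * (1 + b).
Hypothesis Hq : forall i a y b, enorm y <= b ->
  lam ^+ 2 * `|H2 PZ Z (shf (lam *: y) (F i)) a - H2 PZ Z (F i) a| <= q i b * enorm a ^+ 2.

Lemma generator_bound :
  `|lam ^+ 2 * Ex P (fun w => trF PZ Z (shf (lam *: W w) Fs)) -
    lam * Ex P (fun w => H1 PZ Z (shf (lam *: W w) Fs) (W w))| <=
  \sum_i (Ex P (fun w => q i (enorm (xi i w)) * Ex P (fun w => enorm (xi i w) ^+ 2)) +
          Ex P (fun w => q i (enorm (xi i w)) * enorm (xi i w) ^+ 2)).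
Proof.
rewrite drift_sum.2 diffusion_sum.2 !mulr_sumr -sumrB.
apply: le_trans (ler_norm_sum _ _ _) _; apply: ler_sum => i _.
exact: (summand_bound HZ (mxi i) (i3 i) (mean0 i) (mF i) (F1 i) (mq i) (q_bnd i) (Hq i)).
Qed.

Variables (e c' sc' : R).
Hypothesis e0 : 0 <= e.
Hypothesis e1 : e <= 1.
Hypothesis csc : c ^+ 2 + sc ^+ 2 = 1.
Hypothesis csc' : c' ^+ 2 + sc' ^+ 2 = 1.
Hypothesis sc'0 : 0 < sc'.
Hypothesis c'E : c' = (1 - e) * c.
Variable tau : R.
Hypothesis tau0 : 0 <= tau.
Hypothesis tauE : tau ^+ 2 = 2 * e - e ^+ 2.

(** A step multiplies the coefficient of [W] by 1 - e and adds an independent Gaussian with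
    coefficient [c * tau]. As [tau ^+ 2 = 1 - (1 - e)^2], the total Gaussian variance becomes
    [sc' ^+ 2], and stability merges the two Gaussians. *)
Let ou_next w : Ex PZ (fun z => hh (c' *: W w + sc' *: Z z)) =
  Ex PZ (fun z1 => H0 PZ Z (shf (- e *: (lam *: W w) + (lam * tau) *: Z z1) (shf (lam *: W w) Fs))).
Proof.
pose G z := hh (c' *: W w + sc' *: z).
have mG : mRd G.
  apply: mRd_comp mhh _; apply: cmeasD; first exact: cmeas_cst.
  by apply: cmeasZ => //; exact: cmeas_id.
have al0 : 0 < sc / sc' by rewrite divr_gt0.
have albe : (sc / sc') ^+ 2 + (c * tau / sc') ^+ 2 = 1.
  have n0 : sc' ^+ 2 != 0 by rewrite expf_neq0// gt_eqF.
  rewrite !expr_div_n -mulrDl exprMn tauE -[RHS](divff n0); congr (_ / _).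
  have : c' ^+ 2 = (1 - e) ^+ 2 * c ^+ 2 by rewrite c'E exprMn.
  move: csc csc' => h1 h2 h3.
  have -> : sc ^+ 2 = 1 - c ^+ 2 by lra.
  have -> : sc' ^+ 2 = 1 - (1 - e) ^+ 2 * c ^+ 2 by lra.
  ring.
rewrite -[LHS](gauss_stable_Ex HZ al0 albe mG (fun z => smooth01 s l _)).
apply: Ex_ext => z1; apply: Ex_ext => z; rewrite /G /shf /Fs; congr hh.
have ns : sc' != 0 by rewrite gt_eqF.
have ns0 : sc != 0 by rewrite gt_eqF.
move: (W w) (Z z) (Z z1) => a b b1; apply/matrixP => j k; rewrite !mxE c'E lamE.
by field; rewrite ns ns0.
Qed.

(** With [tau ^+ 2 = 2 e - e ^+ 2] the expansion in [gauss_step] is e times the generator, bounded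
    by [generator_bound], plus e^2 lam^2 / 2 times a Hessian term minus the Laplacian, of mean at
    most 4 d in absolute value. *)
Lemma ou_step :
  `|ou_mean c' sc' - ou_mean c sc| <=
  e * \sum_i (Ex P (fun w => q i (enorm (xi i w)) * Ex P (fun w => enorm (xi i w) ^+ 2)) +
          Ex P (fun w => q i (enorm (xi i w)) * enorm (xi i w) ^+ 2)) +
  2 * d%:R * lam ^+ 2 * e ^+ 2 +
  14 * (e ^+ 3 * (lam ^+ 3 * Ex P (fun w => enorm (W w) ^+ 3)) +
        (lam * tau) ^+ 3 * Ex PZ (fun z => enorm (Z z) ^+ 3)).
Proof.
pose A w := shf (lam *: W w) Fs.
have mA w : mRd (A w) by exact: mRd_shf.
have A1 w z : `|A w z| <= 1 by exact: Fs1.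
pose U w := H0 PZ Z (A w); pose T w := trF PZ Z (A w).
pose H w := H1 PZ Z (A w) (W w); pose E2 w := H2 PZ Z (A w) (W w).
pose U' w := Ex PZ (fun z => hh (c' *: W w + sc' *: Z z)).
have iH : itg P H by exact: drift_sum.1.
have iT : itg P T by exact: diffusion_sum.1.
have iE : itg P E2.
  by have [] := gauss_fubini HZ (psi := fun x z => dot x z ^+ 2 - dot x x) mW mlW mFs Fs1
    (@psi_herm_meas R d) W2 (itg_gauss_norm21 HZ) (fun w z => herm_bound (W w) (Z z)).
have b11 (k : Omega) (z : OZ) : `|1 : R| <= 1 * 1 by rewrite normr1 mulr1.
have iU : itg P U.
  have [I _ _] := gauss_fubini HZ (psi := fun _ _ => 1) (a := fun=> 1) (b := fun=> 1) mW mlW mFs Fs1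
    (@measurable_cst _ _ _ _ _ _) (itg_cst P 1) (itg_cst PZ 1) b11.
  by apply: itg_ext I => w; apply: Ex_ext => z; rewrite mulr1.
have mF' : mRd (fun z => hh (sc' *: z)).
  by apply: mRd_comp mhh _; apply: cmeasZ => //; exact: cmeas_id.
have F'1 z : `|hh (sc' *: z)| <= 1 by exact: smooth_abs.
have iU' : itg P U'.
  have mlW' : cmeas (fun w => (c' / sc') *: W w) by exact: (cmeasZ (a := fun=> c' / sc')).
  have [I _ _] := gauss_fubini HZ (psi := fun _ _ => 1) (a := fun=> 1) (b := fun=> 1) mW mlW' mF' F'1
    (@measurable_cst _ _ _ _ _ _) (itg_cst P 1) (itg_cst PZ 1) b11.
  apply: itg_ext I => w; apply: Ex_ext => z; rewrite mulr1 scalerDr scalerA mulrCA divff ?mulr1 1?addrC//.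
  by rewrite gt_eqF.
have UE : ou_mean c sc = Ex P U.
  apply: Ex_ext => w; apply: Ex_ext => z; rewrite /A /shf /Fs scalerDr scalerA lamsc.
  by rewrite addrC.
have U'E : ou_mean c' sc' = Ex P U' by apply: Ex_ext => w; exact: Ex_ext.
pose main w := (U w + e * (lam ^+ 2 * T w - lam * H w)) + e ^+ 2 * lam ^+ 2 / 2 * (E2 w - T w).
have iTH : itg P (fun w => lam ^+ 2 * T w - lam * H w) by apply: itgB; exact: itgZ.
have iET := itgB iE iT.
have iUT := itgD iU (itgZ e iTH).
have imain : itg P main by exact: (itgD iUT (itgZ (e ^+ 2 * lam ^+ 2 / 2) iET)).
have Emain : Ex P main = Ex P U + e * (lam ^+ 2 * Ex P T - lam * Ex P H) +
    e ^+ 2 * lam ^+ 2 / 2 * (Ex P E2 - Ex P T).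
  rewrite (ExD iUT (itgZ (e ^+ 2 * lam ^+ 2 / 2) iET)) (ExD iU (itgZ e iTH)).
  rewrite (ExZ _ iTH) (ExZ _ iET) (ExB iE iT) (ExB (itgZ _ iT) (itgZ _ iH)).
  by rewrite (ExZ _ iT) (ExZ _ iH).
have lam0 := lam_ge0.
have step w : `|U' w - main w| <= 14 * (e ^+ 3 * (lam ^+ 3 * enorm (W w) ^+ 3) +
        (lam * tau) ^+ 3 * Ex PZ (fun z => enorm (Z z) ^+ 3)).
  have lt0 : 0 <= lam * tau by rewrite mulr_ge0.
  have := gauss_step HZ (mA w) (A1 w) (lam *: W w) e0 lt0.
  rewrite -ou_next enormZ (ger0_norm lam0) (exprMn _ lam (enorm _)).
  rewrite (H1Z HZ (mA w) (A1 w)) (H2Z HZ (mA w) (A1 w)).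
  suff -> : main w = U w - e * (lam * H w) + (e ^+ 2 * (lam ^+ 2 * E2 w) + (lam * tau) ^+ 2 * T w) / 2 by [].
  rewrite /main (exprMn _ lam tau) tauE.
  by move: (U w) (H w) (E2 w) (T w) => p1 p2 p3 p4; field.
have iB : itg P (fun w => 14 * (e ^+ 3 * (lam ^+ 3 * enorm (W w) ^+ 3) +
        (lam * tau) ^+ 3 * Ex PZ (fun z => enorm (Z z) ^+ 3))).
  apply: itgZ; apply: itgD; last exact: itg_cst.
  by do 2! apply: itgZ.
have iD := itgB iU' imain.
have S1 : `|Ex P U' - Ex P main| <= 14 * (e ^+ 3 * (lam ^+ 3 * Ex P (fun w => enorm (W w) ^+ 3)) +
        (lam * tau) ^+ 3 * Ex PZ (fun z => enorm (Z z) ^+ 3)).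
  rewrite -(ExB iU' imain); apply: le_trans (Ex_abs iD) _.
  apply: le_trans (Ex_le (itg_abs iD) iB step) _.
  have j1 := itgZ (lam ^+ 3) W3; have j2 := itgZ (e ^+ 3) j1.
  have j3 := itg_cst P ((lam * tau) ^+ 3 * Ex PZ (fun z => enorm (Z z) ^+ 3)).
  by rewrite (ExZ _ (itgD j2 j3)) (ExD j2 j3) Ex_cst (ExZ _ j1) (ExZ _ W3).
have ET2 : `|Ex P E2 - Ex P T| <= 4 * d%:R.
  rewrite -(ExB iE iT); apply: le_trans (Ex_abs iET) _.
  have iR : itg P (fun w => 3 / 2 * enorm (W w) ^+ 2 + 2 * d%:R).
    by apply: itgD; [exact: itgZ|exact: itg_cst].
  apply: (le_trans (Ex_le (itg_abs iET) iR _)) => [w|].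
    apply: num_pair.
      by have := H2_le HZ (mA w) (A1 w) (W w); rewrite mulr1.
    exact: trF_le HZ _ (mA w) (A1 w).
  rewrite (ExD (itgZ _ W2) (itg_cst P (2 * d%:R))) (ExZ _ W2) Ex_cst (Ex_norm2_W mX mh iX i3 mean0 cov1).
  exact: num_4d.
have hG : `|lam ^+ 2 * Ex P T - lam * Ex P H| <= \sum_i (Ex P (fun w => q i (enorm (xi i w)) *
  Ex P (fun w => enorm (xi i w) ^+ 2)) + Ex P (fun w => q i (enorm (xi i w)) * enorm (xi i w) ^+ 2)).
  exact: generator_bound.
have hN : e ^+ 2 * lam ^+ 2 / 2 * `|Ex P E2 - Ex P T| <= 2 * d%:R * lam ^+ 2 * e ^+ 2.
  exact: num_ou_err ET2.
rewrite UE U'E.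
exact: (num_ou_total Emain S1 hG e0 hN (sqr_ge0 lam)).
Qed.

End scale.
End ornstein_uhlenbeck.

(** * Summing the rates along the interpolation *)

Lemma num_age0 (R : realType) (A g b : R) : 0 <= A -> 0 <= g -> 0 <= b -> 0 <= 93 / 200 * A / g * b.
Proof. by move=> A0 g0 b0; apply: mulr_ge0 b0; apply: divr_ge0 g0; apply: mulr_ge0 A0; lra. Qed.

Section schedule.
Variable R : realType.
Implicit Types (A g D b x lam e : R).

(* Bound on lam^2 |H2 (F (. + lam y)) a - H2 F a| / |a|^2 for |y| <= b at Ornstein-Uhlenbeck
   time x^2 / 2, F being the average over the other summands. The four regimes use in turn:
   the crude bound, the second differences of F, its oscillation, and the comparison of F with
   its Gaussian counterpart up to the error D. *)
Definition rate A g D x lam b :=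
  if 1 <= x then 7 / 2 * lam ^+ 3 * b
  else if x < 40 * g then 93 / 200 * A / g * lam * b
  else if x < b then 5 * A * (lam + 36 * g * lam ^+ 2)
  else 7 / 2 * (lam ^+ 3 * D + 1) * b.

Lemma rate_meas A g D x lam : measurable_fun setT (rate A g D x lam).
Proof.
have [x1|x1] := boolP (1 <= x).
  rewrite (_ : rate A g D x lam = fun b => 7 / 2 * lam ^+ 3 * b); first exact: measurable_funM.
  by apply/funext => b; rewrite /rate x1.
have [xg|xg] := boolP (x < 40 * g).
  rewrite (_ : rate A g D x lam = fun b => 93 / 200 * A / g * lam * b); first exact: measurable_funM.
  by apply/funext => b; rewrite /rate (negbTE x1) xg.
rewrite (_ : rate A g D x lam = fun b => if x < b then 5 * A * (lam + 36 * g * lam ^+ 2)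
  else 7 / 2 * (lam ^+ 3 * D + 1) * b); last first.
  by apply/funext => b; rewrite /rate (negbTE x1) (negbTE xg).
by apply: measurable_fun_ifT; [exact: measurable_fun_ltr|exact: measurable_cst|exact: measurable_funM].
Qed.

Lemma rate_bnd A g D x lam b : 0 <= A -> 0 < g -> 0 <= D -> 0 <= lam -> 0 <= b ->
  0 <= rate A g D x lam b <=
  (7 / 2 * lam ^+ 3 + 93 / 200 * A / g * lam + 5 * A * (lam + 36 * g * lam ^+ 2) + 7 / 2 * (lam ^+ 3 * D + 1)) * (1 + b).
Proof.
move=> A0 g0 D0 lam0 b0; have g0' := ltW g0.
set a1 := 7 / 2 * lam ^+ 3; set a2 := 93 / 200 * A / g * lam.
set a3 := 5 * A * _; set a4 := 7 / 2 * (_ + 1).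
have h1 : 0 <= a1 by rewrite mulr_ge0// exprn_ge0.
have h2 : 0 <= a2 by exact: num_age0.
have h3 : 0 <= a3 by rewrite mulr_ge0 ?addr_ge0 ?mulr_ge0// exprn_ge0.
have h4 : 0 <= a4 by rewrite mulr_ge0// addr_ge0// mulr_ge0// exprn_ge0.
have hb1 : 0 <= a1 * b by rewrite mulr_ge0.
have hb2 : 0 <= a2 * b by rewrite mulr_ge0.
have hb3 : 0 <= a3 * b by rewrite mulr_ge0.
have hb4 : 0 <= a4 * b by rewrite mulr_ge0.
rewrite mulrDr mulr1 !mulrDl /rate -/a1 -/a2 -/a3 -/a4.
move: a1 a2 a3 a4 h1 h2 h3 h4 hb1 hb2 hb3 hb4 => a1 a2 a3 a4 h1 h2 h3 h4 hb1 hb2 hb3 hb4.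
by case: ifP => _; [|case: ifP => _; [|case: ifP => _]]; apply/andP; split=> //; lra.
Qed.

(** Discrete form of dt / x = dx for t = x^2 / 2. *)
Lemma sqr_gap (x0 x1 e : R) : 0 <= x0 -> 0 < x1 -> 0 <= e -> x1 ^+ 2 = x0 ^+ 2 + 2 * e ->
  x0 <= x1 /\ e / x1 <= x1 - x0.
Proof.
move=> x00 x10 e0 E; have x01 : x0 <= x1.
  by rewrite -(@ler_pXn2r _ 2) ?nnegrE// ?(ltW x10)// E lerDl mulr_ge0.
split=> //; rewrite ler_pdivrMr//.
have : 0 <= (x1 - x0) ^+ 2 by exact: sqr_ge0.
by rewrite sqrrB; move: E; rewrite !expr2 mulrBl; lra.
Qed.

(** Discrete form of dt / x^3 = - d (1 / x). *)
Lemma inv_gap (x1 x2 e : R) : 0 < x1 -> 0 <= e -> x2 ^+ 2 = x1 ^+ 2 + 2 * e -> 0 < x2 ->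
  e / x2 ^+ 3 <= x1^-1 - x2^-1.
Proof.
move=> x10 e0 E x20; have [x12 h] := sqr_gap (ltW x10) x20 e0 E.
have -> : x1^-1 - x2^-1 = (x2 - x1) / (x1 * x2) by field; rewrite !gt_eqF.
have -> : e / x2 ^+ 3 = e / x2 / (x2 * x2) by field; rewrite gt_eqF.
apply: ler_pM => //; first by rewrite divr_ge0// ltW.
  by rewrite invr_ge0 mulr_ge0// ltW.
by rewrite lef_pV2 ?posrE ?mulr_gt0// ler_pM2r.
Qed.

Lemma min_mono (x0 x1 L : R) : x0 <= x1 -> 0 <= Num.min x1 L - Num.min x0 L.
Proof. by rewrite subr_ge0 /Num.min => ?; do 2 case: ltP => ?; lra. Qed.

Lemma min_below (x0 x1 L : R) : x0 <= x1 -> x1 <= L -> Num.min x1 L - Num.min x0 L = x1 - x0.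
Proof. by rewrite /Num.min => ? ?; do 2 case: ltP => ?; lra. Qed.

Lemma max_mono (x1 x2 L : R) : 0 < L -> x1 <= x2 -> 0 <= (Num.max x1 L)^-1 - (Num.max x2 L)^-1.
Proof.
move=> L0 h; rewrite subr_ge0 lef_pV2 ?posrE ?lt_max ?L0 ?orbT//.
by rewrite ge_max !le_max lexx h !orbT.
Qed.

Lemma max_above (x1 x2 L : R) : L <= x1 -> x1 <= x2 -> (Num.max x1 L)^-1 - (Num.max x2 L)^-1 = x1^-1 - x2^-1.
Proof. by move=> h1 h2; rewrite (max_idPl h1) (max_idPl (le_trans h1 h2)). Qed.

(* Increments of the potential dominate the rate, so that the rates sum up telescopically. *)
Definition potential A g D b x x' :=
  93 / 200 * A / g * b * Num.min x (40 * g) + 19 / 2 * A * Num.min x b + 7 / 2 * b * Num.min (x ^+ 2 / 2) (1 / 2)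
  - 7 / 2 * D * b * (Num.max x' (Num.max (40 * g) b))^-1 - 7 / 2 * b * (Num.max x' 1)^-1.

(** Three consecutive scales are involved: [e * lam] is at most the past increment [x1 - x0], while
    [e * lam ^+ 3] is at most the next increment of the inverse, from [x1] to [x2]. This is why
    [potential] takes two arguments. In each regime one term of the potential pays for the rate, and
    the others only increase. *)
Lemma rate_potential A g D b lam e x0 x1 x2 : 0 <= A -> 0 < g -> 0 <= D -> 0 <= b -> 0 <= e ->
  0 <= x0 -> 0 < x1 -> 0 < x2 -> x1 ^+ 2 = x0 ^+ 2 + 2 * e -> x2 ^+ 2 = x1 ^+ 2 + 2 * e ->
  0 <= lam -> lam <= x2^-1 ->
  e * rate A g D x1 lam b <= potential A g D b x1 x2 - potential A g D b x0 x1.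
Proof.
move=> A0 g0 D0 b0 e0 x00 x10 x20 E1 E2 lam0 lamx; have g0' := ltW g0.
have [x01 G1] := sqr_gap x00 x10 e0 E1; have [x12 G2] := sqr_gap (ltW x10) x20 e0 E2.
have G3 := inv_gap x10 e0 E2 x20.
have lam1 : e * lam <= x1 - x0.
  by apply: le_trans G1; apply: ler_wpM2l => //; apply: le_trans lamx _; rewrite lef_pV2 ?posrE.
have lam3 : e * lam ^+ 3 <= x1^-1 - x2^-1.
  by apply: le_trans G3; apply: ler_wpM2l => //; rewrite -exprVn lerXn2r ?nnegrE// invr_ge0 ltW.
set M := Num.max (40 * g) b.
have M0 : 0 < M by rewrite lt_max mulr_gt0.
have P1 := min_mono (40 * g) x01; have P2 := min_mono b x01.
have xx : x0 ^+ 2 / 2 <= x1 ^+ 2 / 2 by rewrite E1; lra.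
have P3 := min_mono (1 / 2) xx.
have P4 := max_mono M0 x12; have P5 := max_mono ltr01 x12.
have K1 : 0 <= 93 / 200 * A / g * b by exact: num_age0.
have K2 : 0 <= 19 / 2 * A by rewrite mulr_ge0.
have K3 : 0 <= 7 / 2 * b by rewrite mulr_ge0.
have K4 : 0 <= 7 / 2 * D * b by rewrite !mulr_ge0.
have -> : potential A g D b x1 x2 - potential A g D b x0 x1 =
  93 / 200 * A / g * b * (Num.min x1 (40 * g) - Num.min x0 (40 * g)) +
  19 / 2 * A * (Num.min x1 b - Num.min x0 b) +
  7 / 2 * b * (Num.min (x1 ^+ 2 / 2) (1 / 2) - Num.min (x0 ^+ 2 / 2) (1 / 2)) +
  7 / 2 * D * b * ((Num.max x1 M)^-1 - (Num.max x2 M)^-1) +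
  7 / 2 * b * ((Num.max x1 1)^-1 - (Num.max x2 1)^-1).
  rewrite /potential -/M; set q1 := 93 / 200 * A / g * b.
  move: (Num.min _ _) (Num.min _ _) (Num.min _ _) (Num.min _ _) (Num.min _ _) (Num.min _ _) => p1 p2 p3 p4 p5 p6.
  move: (_^-1) (_^-1) (_^-1) (_^-1) => p7 p8 p9 p10; ring.
have N1 := mulr_ge0 K1 P1; have N2 := mulr_ge0 K2 P2; have N3 := mulr_ge0 K3 P3.
have N4 := mulr_ge0 K4 P4; have N5 := mulr_ge0 K3 P5.
rewrite /rate; case: ifPn => [x1g|]; last rewrite -ltNge => x1l.
  rewrite (_ : e * _ = 7 / 2 * b * (e * lam ^+ 3)); last by ring.
  have := ler_wpM2l K3 lam3; rewrite (max_above x1g x12) in N5 *.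
  by move: N1 N2 N3 N4; set q1 := _ * (_ - _); set q2 := _ * (_ - _); set q3 := _ * (_ - _); set q4 := _ * (_ - _); set q5 := _ * (_ - _); lra.
case: ifPn => [xg|]; last rewrite -leNgt => gx.
  rewrite (_ : e * _ = 93 / 200 * A / g * b * (e * lam)); last by ring.
  have := ler_wpM2l K1 lam1; rewrite (min_below x01 (ltW xg)) in N1 *.
  by move: N2 N3 N4 N5; set q1 := _ * (_ - _); set q2 := _ * (_ - _); set q3 := _ * (_ - _); set q4 := _ * (_ - _); set q5 := _ * (_ - _); lra.
case: ifPn => [xb|]; last rewrite -leNgt => bx.
  (* From [lam <= 1 / x2] and [x2 >= 40 g]. It gives 19/2 = 5 * (1 + 9/10) in the potential. *)
  have g36 : 36 * g * lam <= 9 / 10.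
    have : 40 * g * lam <= 1.
      apply: (@le_trans _ _ (x2 * x2^-1)); last by rewrite divff// gt_eqF.
      by apply: ler_pM => //; [rewrite mulr_ge0|exact: le_trans gx x12].
    by lra.
  have : e * (5 * A * (lam + 36 * g * lam ^+ 2)) <= 19 / 2 * A * (e * lam).
    have := ler_wpM2l (mulr_ge0 (mulr_ge0 (mulr_ge0 e0 lam0) A0) (ler0n R 5)) g36.
    by rewrite !expr2; lra.
  move/le_trans; apply; have := ler_wpM2l K2 lam1; rewrite (min_below x01 (ltW xb)) in N2 *.
  by move: N1 N3 N4 N5; set q1 := _ * (_ - _); set q2 := _ * (_ - _); set q3 := _ * (_ - _); set q4 := _ * (_ - _); set q5 := _ * (_ - _); lra.
have Mx : M <= x1 by rewrite ge_max gx bx.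
rewrite (_ : e * _ = 7 / 2 * D * b * (e * lam ^+ 3) + 7 / 2 * b * e); last by ring.
have := ler_wpM2l K4 lam3; rewrite (max_above Mx x12) in N4 *.
have x1s : x1 ^+ 2 / 2 <= 1 / 2.
  by rewrite ler_wpM2r// exprn_ile1// ltW.
rewrite (min_below xx x1s) in N3 *; have -> : x1 ^+ 2 / 2 - x0 ^+ 2 / 2 = e by rewrite E1; lra.
by move: N1 N2 N5; set q1 := _ * (_ - _); set q2 := _ * (_ - _); set q3 := _ * (_ - _); set q4 := _ * (_ - _); lra.
Qed.

(** Each capped term ranges over an interval whose length is its cap: 281/10 = 93/5 + 19/2 and 21/4
    = 7/4 + 7/2. *)
Lemma potential_range A g D b x x' y y' : 0 <= A -> 0 < g -> 0 <= D -> 0 <= b ->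
  0 <= x -> 0 < x' -> 0 <= y -> 0 < y' ->
  potential A g D b y y' - potential A g D b x x' <=
  (281 / 10 * A + 21 / 4) * b + 7 / 2 * D * (b / Num.max (40 * g) b).
Proof.
move=> A0 g0 D0 b0 x0 x'0 y0 y'0; set M := Num.max (40 * g) b.
have M0 : 0 < M by rewrite lt_max mulr_gt0.
have g0' := ltW g0.
have K1 : 0 <= 93 / 200 * A / g * b by exact: num_age0.
have K2 : 0 <= 19 / 2 * A by rewrite mulr_ge0.
have K3 : 0 <= 7 / 2 * b by rewrite mulr_ge0.
have K4 : 0 <= 7 / 2 * D * b by rewrite !mulr_ge0.
have mi (z L : R) : 0 <= z -> 0 <= L -> 0 <= Num.min z L <= L.
  by move=> ? ?; rewrite le_min ge_min lexx orbT andbT; apply/andP; split.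
have ma (z L : R) : 0 < L -> 0 <= (Num.max z L)^-1 <= L^-1.
  by move=> L0; rewrite invr_ge0 lef_pV2 ?posrE ?lt_max ?L0 ?orbT// !le_max lexx (ltW L0) !orbT.
have x2 : 0 <= x ^+ 2 / 2 by rewrite divr_ge0// sqr_ge0.
have y2 : 0 <= y ^+ 2 / 2 by rewrite divr_ge0// sqr_ge0.
rewrite /potential -/M.
have /andP[a1 _] := mi x (40 * g) x0 (mulr_ge0 (ler0n _ _) g0').
have /andP[_ a2] := mi y (40 * g) y0 (mulr_ge0 (ler0n _ _) g0').
have /andP[a3 _] := mi x b x0 b0; have /andP[_ a4] := mi y b y0 b0.
have h12 : 0 <= 1 / 2 :> R by [].
have /andP[a5 _] := mi (x ^+ 2 / 2) (1 / 2) x2 h12; have /andP[_ a6] := mi (y ^+ 2 / 2) (1 / 2) y2 h12.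
have /andP[_ a7] := ma x' M M0; have /andP[a8 _] := ma y' M M0.
have /andP[_ a9] := ma x' 1 ltr01; have /andP[a10 _] := ma y' 1 ltr01.
have c1 := mulr_ge0 K1 a1; have c2 := ler_wpM2l K1 a2.
have c3 := mulr_ge0 K2 a3; have c4 := ler_wpM2l K2 a4.
have c5 := mulr_ge0 K3 a5; have c6 := ler_wpM2l K3 a6.
have c7 := ler_wpM2l K4 a7; have c8 := mulr_ge0 K4 a8.
have c9 := ler_wpM2l K3 a9; have c10 := mulr_ge0 K3 a10.
have E1 : 93 / 200 * A / g * b * (40 * g) = 93 / 5 * A * b by field; rewrite gt_eqF.
rewrite E1 in c2; rewrite (_ : 7 / 2 * D * (b / M) = 7 / 2 * D * b * M^-1); last by ring.
move: c1 c2 c3 c4 c5 c6 c7 c8 c9 c10; rewrite invr1 mulr1.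
move: (Num.min y _) (Num.min y _) (Num.min x _) (Num.min x _) (Num.min (y ^+ 2 / 2) _) (Num.min (x ^+ 2 / 2) _) => p1 p2 p3 p4 p5 p6.
move: (Num.max x' M)^-1 (Num.max y' M)^-1 (Num.max x' 1)^-1 (Num.max y' 1)^-1 (M^-1) => p7 p8 p9 p10 p11.
lra.
Qed.

End schedule.

(** * Transfer of the a priori bound to the deleted sums *)

Section independent_displacement.
Context d0 (Omega : measurableType d0) (R : realType) (P : probability Omega R) (d : nat).
Variables (x V : Omega -> 'cV[R]_d) (A g : R).
Hypothesis mx : cmeas x.
Hypothesis mV : cmeas V.
Hypothesis xV : indep2 P (x : Omega -> Rd R d) (V : Omega -> Rd R d).
Hypothesis ix : itg P (fun w => enorm (x w)).
Hypothesis collarV : forall s u, usub s u -> forall q, 0 <= q ->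
  pr P [set w | 0 <= s (V w) <= q] <= A * (q + 11 * g).
Variables (s : 'cV[R]_d -> R) (u : 'cV[R]_d -> 'cV[R]_d).
Hypothesis su : usub s u.

Let ms (y : Omega -> 'cV[R]_d) t : cmeas y -> measurable [set w | s (y w) <= t].
Proof. by move=> my; exact: sublevel_meas (usub_comp_meas my su). Qed.

Let mxx (y : 'cV[R]_d) : cmeas (fun w => V w + y).
Proof. by apply: cmeasD => //; exact: cmeas_cst. Qed.

Let mVx : cmeas (fun w => V w + x w). Proof. exact: cmeasD. Qed.

Let displaced : itg P (fun w1 => pr P [set w | s (V w + x w1) <= 0]) /\
  pr P [set w | s (V w + x w) <= 0] = Ex P (fun w1 => pr P [set w | s (V w + x w1) <= 0]).
Proof.
pose Phi (y v : Rd R d) : R := \1_[set z | s z <= 0] (v + y).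
have mS : measurable ([set z | s z <= 0] : set (Rd R d)).
  exact: sublevel_meas (usub_meas su).
have mI : mRd (\1_[set z : Rd R d | s z <= 0] : Rd R d -> R) by exact: measurable_indic.
have mPhi : measurable_fun setT (fun p : Rd R d * Rd R d => Phi p.1 p.2).
  apply: mRd_comp mI _; apply: cmeasD => j; apply: measurableT_comp (cmeas_id j) _ => //.
have bPhi w1 w2 : `|Phi (x w1) (V w2)| <= 1 * 1.
  by rewrite mulr1 /Phi indicE; case: (_ \in _); rewrite ?normr1 ?normr0.
have mpair : measurable_fun setT (fun p : Omega * Omega => Phi (x p.1) (V p.2)).
  apply: (measurableT_comp mPhi (g := fun p : Omega * Omega => (x p.1 : Rd R d, V p.2 : Rd R d))).
  by apply: measurable_fun_pair; apply: cmeas_borel => j;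
    [apply: measurableT_comp (mx j) _|apply: measurableT_comp (mV j) _].
have IE y w : Phi y (V w) = \1_[set w | s (V w + y) <= 0] w.
  by rewrite /Phi !indicE; congr (_%:R); rewrite /= !in_setE.
have E1 w1 : Ex P (fun w2 => Phi (x w1) (V w2)) = pr P [set w | s (V w + x w1) <= 0].
  rewrite -Ex_indic; last exact: ms.
  by apply: Ex_ext => w; exact: IE.
have [_ E] := indep2_Ex (Phi := Phi) (cmeas_borel mx) (cmeas_borel mV) xV (itg_cst P 1) (itg_cst P 1) mPhi bPhi.
split.
  apply: itg_ext E1 _.
  exact: (Ex_prod1 (f := fun w1 w2 => Phi (x w1) (V w2)) mpair (itg_cst P 1) (itg_cst P 1) bPhi).1.
rewrite -Ex_indic; last exact: ms.
transitivity (Ex P (fun w => Phi (x w) (V w))).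
  by apply: Ex_ext => w; rewrite IE !indicE; congr (_%:R).
by rewrite [LHS]E; exact: Ex_ext.
Qed.

Let m := Ex P (fun w => enorm (x w)).

Let slip y v : s (v + y) <= s v + enorm y /\ s v <= s (v + y) + enorm y.
Proof.
have := usub_lip su (v + y) v; rewrite mul1r addrAC subrr add0r ler_norml => /andP[h1 h2].
by split; lra.
Qed.

Let collar_shift r t : 0 <= r + t -> pr P [set w | - r <= s (V w) <= t] <= A * (r + t + 11 * g).
Proof.
move=> rt; have := collarV (usubD r su) rt; congr (_ <= _); congr pr.
by apply/seteqP; split => w /= /andP[? ?]; apply/andP; split; lra.
Qed.

Let mcollar r t : measurable [set w | r <= s (V w) <= t].
Proof. exact: slab_meas (usub_comp_meas mV su). Qed.

(** Given [x], which is independent of [V], the displacement moves [s] by at most |x|, so the two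
    events differ by a collar of [V] of width |x| + t. Integrating over [x] leaves only the mean
    [m]. *)
Lemma level_up t : 0 <= t ->
  pr P [set w | s (V w) <= t] <= pr P [set w | s (V w + x w) <= 0] + A * (m + t + 11 * g).
Proof.
move=> t0; have [I ->] := displaced.
have I2 : itg P (fun w => A * (enorm (x w) + (t + 11 * g))).
  by apply: itgZ; apply: itgD => //; exact: itg_cst.
have -> : A * (m + t + 11 * g) = Ex P (fun w => A * (enorm (x w) + (t + 11 * g))).
  have j := itg_cst P (t + 11 * g).
  by rewrite (ExZ _ (itgD ix j)) (ExD ix j) Ex_cst addrA.
rewrite -ExD// -[leLHS](Ex_cst P); apply: Ex_le => [||w1]; [exact: itg_cst|exact: itgD|].
have r0 := enorm_ge0 (x w1).
have m1 := ms 0 (mxx (x w1)).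
have m2 := mcollar (- enorm (x w1)) t.
apply: (@le_trans _ _ (pr P ([set w | s (V w + x w1) <= 0] `|` [set w | - enorm (x w1) <= s (V w) <= t]))).
  apply: le_pr; [exact: ms|exact: measurableU|] => w /= h.
  have [h1 h2] := slip (x w1) (V w); case: (leP (s (V w)) (- enorm (x w1))) => h3.
    by left; lra.
  by right; rewrite (ltW h3).
rewrite (le_trans (pr_setU _ _ _))// lerD2l addrA.
by apply: collar_shift; rewrite addr_ge0.
Qed.

Lemma level_down :
  pr P [set w | s (V w + x w) <= 0] <= pr P [set w | s (V w) <= 0] + A * (m + 11 * g).
Proof.
have [I ->] := displaced.
have I2 : itg P (fun w => pr P [set w | s (V w) <= 0] + A * (enorm (x w) + 11 * g)).
  by apply: itgD; [exact: itg_cst|apply: itgZ; apply: itgD => //; exact: itg_cst].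
have -> : pr P [set w | s (V w) <= 0] + A * (m + 11 * g) =
    Ex P (fun w => pr P [set w | s (V w) <= 0] + A * (enorm (x w) + 11 * g)).
  rewrite ExD ?ExZ ?ExD ?Ex_cst//; [exact: itg_cst|by apply: itgD => //; exact: itg_cst|exact: itg_cst|].
  by apply: itgZ; apply: itgD => //; exact: itg_cst.
apply: Ex_le => [||w1] //.
have r0 := enorm_ge0 (x w1).
have m1 := ms 0 mV; have m2 := mcollar (- 0) (enorm (x w1)).
apply: (@le_trans _ _ (pr P ([set w | s (V w) <= 0] `|` [set w | - 0 <= s (V w) <= enorm (x w1)]))).
  apply: le_pr; [by apply: ms; exact: mxx|exact: measurableU|] => w /= h.
  have [h1 h2] := slip (x w1) (V w); case: (leP (s (V w)) 0) => h3; [by left|right].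
  by rewrite oppr0 (ltW h3); lra.
rewrite (le_trans (pr_setU _ _ _))// lerD2l.
by have := @collar_shift 0 (enorm (x w1)); rewrite add0r => /(_ r0).
Qed.

End independent_displacement.

Lemma num_11_36 (R : realType) (A m g : R) : 0 <= A -> 0 <= g -> A * (m + 11 * g) <= A * (m + 36 * g).
Proof. by move=> A0 g0; apply: ler_wpM2l => //; lra. Qed.

Section bootstrap_step.
Context dO dS dZ (Omega : measurableType dO) (S : measurableType dS) (OZ : measurableType dZ)
  (R : realType) (P : probability Omega R) (PZ : probability OZ R) (n d : nat).
Variables (X : 'I_n -> Omega -> S) (h : 'I_n -> S -> 'cV[R]_d) (Z : OZ -> 'cV[R]_d).
Hypothesis HZ : std_gaussian PZ Z.
Hypothesis mX : forall i, measurable_fun setT (X i).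
Hypothesis mh : forall i, cmeas (h i).
Hypothesis iX : mutually_independent P X.
Let xi i w := h i (X i w).
Hypothesis i3 : forall i, itg P (fun w => enorm (xi i w) ^+ 3).
Hypothesis mean0 : forall i j, Ex P (fun w => xi i w j 0) = 0.
Hypothesis cov1 : forall j l, \sum_i Ex P (fun w => xi i w j 0 * xi i w l 0) = (j == l)%:R.
Variables (g : R).
Hypothesis g0 : 0 < g.
Hypothesis mom3 : \sum_i Ex P (fun w => enorm (xi i w) ^+ 3) <= g.
Hypothesis d0 : (0 < d)%N.
Hypothesis g_small : g <= 1 / 100.
Let W w : 'cV[R]_d := \sum_i xi i w.

Variable K : R.
Hypothesis K0 : 0 <= K.
Hypothesis HK : forall s u, usub s u ->
  `|pr P [set w | s (W w) <= 0] - pr PZ [set w | s (Z w) <= 0]| <= K.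

Variables A : R.
Hypothesis AE : A = 5 / 3 * Num.sqrt d%:R.

Let mxi i : cmeas (xi i). Proof. exact: (cmeas_hX mX mh i). Qed.
Let mW : cmeas W. Proof. exact: cmeas_sum. Qed.
Let V i w : 'cV[R]_d := W w - xi i w.
Let mV i : cmeas (V i). Proof. by apply: cmeasB; [exact: mW|exact: mxi]. Qed.
Let x1 i := itg_norm (mxi i) (i3 i).
Let A0 : 0 <= A.
Proof. by rewrite AE mulr_ge0// sqrtr_ge0. Qed.

Let collarV i s u : usub s u -> forall q, 0 <= q ->
  pr P [set w | 0 <= s (V i w) <= q] <= A * (q + 11 * g).
Proof.
move=> su q q0; rewrite AE.
exact: (deleted_collar mX mh iX i3 mean0 cov1 g0 mom3 i su d0 g_small q0).
Qed.

Let mean i := Ex P (fun w => enorm (xi i w)).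
(** Error of the Gaussian comparison for [V i] when it is [K] for [W]; 36 g is the level shift 25 g
    plus the 11 g of the collar bound. *)
Let D i := K + A * (mean i + 36 * g).

Let VW i w : V i w + xi i w = W w. Proof. by rewrite /V subrK. Qed.

Let WE i (s : 'cV[R]_d -> R) : [set w | s (V i w + xi i w) <= 0] = [set w | s (W w) <= 0].
Proof. by apply/seteqP; split => w /=; rewrite VW. Qed.

Let HK1 i s u : usub s u ->
  pr P [set w | s (V i w) <= 25 * g] <= pr PZ [set w | s (Z w) <= 0] + D i.
Proof.
move=> su; have g25 : 0 <= 25 * g by rewrite mulr_ge0// ltW.
have := level_up (mxi i) (mV i) (indep_rest mX mh iX i) (x1 i) (@collarV i) su g25.
rewrite (WE i s) -/(mean i).
have := HK su; rewrite ler_norml => /andP[_ hK].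
rewrite (_ : mean i + 25 * g + 11 * g = mean i + 36 * g); last by ring.
rewrite /D; move: (A * _) (pr _ _) (pr _ _) (pr _ _) hK => p1 p2 p3 p4; lra.
Qed.

Let HK2 i s u : usub s u ->
  pr PZ [set w | s (Z w) <= 0] <= pr P [set w | s (V i w) <= 0] + D i.
Proof.
move=> su.
have := level_down (mxi i) (mV i) (indep_rest mX mh iX i) (x1 i) (@collarV i) su.
rewrite (WE i s) -/(mean i).
have := HK su; rewrite ler_norml => /andP[hK _].
have := num_11_36 (mean i) A0 (ltW g0).
rewrite /D; move: (A * _) (A * _) (pr _ _) (pr _ _) (pr _ _) hK => p0 p1 p2 p3 p4; lra.
Qed.

Let mean_ge0 i : 0 <= mean i.
Proof. by apply: Ex_ge0 => w; exact: enorm_ge0. Qed.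

Let D0 i : 0 <= D i.
Proof. by rewrite /D addr_ge0// mulr_ge0// addr_ge0// mulr_ge0// ltW. Qed.

Variables (s : 'cV[R]_d -> R) (u : 'cV[R]_d -> 'cV[R]_d) (l : R).
Hypothesis su : usub s u.
Hypothesis lE : l = 40 * g.

Lemma rate_valid i c sc lam x a y b : 0 < c -> 0 < sc -> c ^+ 2 + sc ^+ 2 = 1 -> lam = c / sc ->
  (x < 1 -> 2 / 5 <= c) -> enorm y <= b ->
  lam ^+ 2 * `|H2 PZ Z (shf (lam *: y) (avg P (V i) s c sc l)) a - H2 PZ Z (avg P (V i) s c sc l) a|
  <= rate A g (D i) x lam b * enorm a ^+ 2.
Proof.
move=> c0 sc0 csc lamE c25 yb; have a20 := sqr_ge0 (enorm a).
have y0 := enorm_ge0 y; have b0 := le_trans y0 yb.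
have lam0 : 0 <= lam by rewrite lamE divr_ge0// ltW.
have lam30 : 0 <= lam ^+ 3 by rewrite exprn_ge0.
rewrite /rate; case: ifPn => [x1'|]; last rewrite -ltNge => /c25 c25'.
  apply: le_trans (avg_H2_triv P HZ (mV i) su g0 c0 sc0 lE lamE a y) _.
  by apply: ler_wpM2r => //; apply: ler_wpM2l => //; apply: mulr_ge0.
case: ifPn => [xg|gx].
  apply: le_trans (avg_H2_small HZ (mV i) su g0 A0 c0 sc0 csc (@collarV i) lE lamE a y) _.
  apply: (ler_wpM2r a20); apply: (ler_wpM2l _ yb); apply: mulr_ge0 lam0.
  by apply: divr_ge0 (ltW g0); apply: mulr_ge0 A0; lra.
case: ifPn => [xb|bx].
  exact: (avg_H2_mid HZ (mV i) su g0 A0 c0 sc0 (@collarV i) lE lamE erefl a y c25').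
apply: le_trans (avg_H2_large HZ (mV i) su g0 c0 sc0 csc lE lamE c25' (@HK1 i) (@HK2 i) a y) _.
apply: ler_wpM2r => //; apply: ler_wpM2l => //; apply: mulr_ge0 => //; apply: addr_ge0 => //.
exact: mulr_ge0.
Qed.

End bootstrap_step.

Section moments.
Context d0 (Omega : measurableType d0) (R : realType) (P : probability Omega R) (d : nat).
Variables (x : Omega -> 'cV[R]_d).
Hypothesis mx : cmeas x.
Hypothesis i3 : itg P (fun w => enorm (x w) ^+ 3).
Let m := Ex P (fun w => enorm (x w)).
Let v := Ex P (fun w => enorm (x w) ^+ 2).
Let i1 := itg_norm mx i3.
Let i2 := itg_norm2 mx i3.

Lemma num_cube (a b : R) : 0 <= a -> 0 <= b -> b ^+ 2 * a + b * a ^+ 2 + - b ^+ 3 <= a ^+ 3.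
Proof.
move=> a0 b0; have : 0 <= (a + b) * (a - b) ^+ 2 by rewrite mulr_ge0 ?addr_ge0 ?sqr_ge0.
by rewrite !exprS !expr0; lra.
Qed.

(** [num_cube] is the expanded form of (a + b) (a - b)^2 >= 0; with b = [m] its expectation loses
    the two terms [m ^+ 3]. *)
Lemma moment_product : m * v <= Ex P (fun w => enorm (x w) ^+ 3).
Proof.
have m0 : 0 <= m by apply: Ex_ge0 => w; exact: enorm_ge0.
have j1 := itgZ (m ^+ 2) i1; have j2 := itgZ m i2; have j3 := itgD j1 j2.
have j4 := itg_cst P (- m ^+ 3).
have := Ex_le (itgD j3 j4) i3 (fun w => num_cube (enorm_ge0 (x w)) m0).
rewrite (ExD j3 j4) (ExD j1 j2) (ExZ _ i1) (ExZ _ i2) Ex_cst -/m -/v.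
by move: (Ex _ _) => E; rewrite !exprS !expr0; lra.
Qed.

Variables (N : nat) (q : nat -> R -> R) (C : nat -> R) (al be : R).
Hypothesis mq : forall j, measurable_fun setT (q j).
Hypothesis q_bnd : forall j b, 0 <= b -> 0 <= q j b <= C j * (1 + b).
Hypothesis al0 : 0 <= al.
Hypothesis be0 : 0 <= be.
Hypothesis q_sum : forall b, 0 <= b -> \sum_(j < N) q j b <= al * b + be * m.

Lemma num_moments (t al1 be1 m1 v1 t1 : R) : 0 <= al1 -> 0 <= be1 -> t1 = m1 * v1 -> t1 <= t ->
  (al1 * m1 + be1 * m1) * v1 + (al1 * t + be1 * m1 * v1) <= 2 * (al1 + be1) * t.
Proof.
move=> a0 b0 tE tt.
have h1 : al1 * t1 <= al1 * t by rewrite ler_wpM2l.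
have h2 : be1 * t1 <= be1 * t by rewrite ler_wpM2l.
by rewrite tE in h1 h2; lra.
Qed.

(** The summed rate is used at b = |x|, once against [v] and once against the square of |x|. By
    [moment_product] all products [m * v] are at most the third moment, whence the factor 2. *)
Lemma rate_sum : \sum_(j < N) (Ex P (fun w => q j (enorm (x w)) * v) + Ex P (fun w => q j (enorm (x w)) * enorm (x w) ^+ 2))
  <= 2 * (al + be) * Ex P (fun w => enorm (x w) ^+ 3).
Proof.
have v0 : 0 <= v by apply: Ex_ge0 => w'; exact: sqr_ge0.
have m0 : 0 <= m by apply: Ex_ge0 => w; exact: enorm_ge0.
have mqx j : measurable_fun setT (fun w => q j (enorm (x w))).
  by apply: measurableT_comp (mq j) _; exact: cmeas_enorm.
have I1 j : itg P (fun w => q j (enorm (x w)) * v).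
  apply: itg_le (itgZ (C j * v) (itgD (itg_cst P 1) i1)) _ => [|w]; first exact: measurable_funM.
  have /andP[q0 q1] := q_bnd j (enorm_ge0 (x w)).
  rewrite ger0_norm; last exact: mulr_ge0.
  by rewrite mulrAC; apply: ler_wpM2r.
have I2 j : itg P (fun w => q j (enorm (x w)) * enorm (x w) ^+ 2).
  apply: itg_le (itgZ (C j) (itgD i2 i3)) _ => [|w].
    by apply: measurable_funM => //; apply: measurable_funX; exact: cmeas_enorm.
  have /andP[q0 q1] := q_bnd j (enorm_ge0 (x w)).
  have -> : C j * (enorm (x w) ^+ 2 + enorm (x w) ^+ 3) = C j * (1 + enorm (x w)) * enorm (x w) ^+ 2 by ring.
  rewrite ger0_norm; last by apply: mulr_ge0 => //; exact: sqr_ge0.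
  by apply: ler_wpM2r => //; exact: sqr_ge0.
rewrite big_split/= -Ex_sum// -Ex_sum//.
have J1 : itg P (fun w => (al * enorm (x w) + be * m) * v).
  by under eq_fun do rewrite mulrC; apply: itgZ; apply: itgD; [exact: itgZ|exact: itg_cst].
have J2 : itg P (fun w => al * enorm (x w) ^+ 3 + be * m * enorm (x w) ^+ 2).
  by apply: itgD; exact: itgZ.
apply: (@le_trans _ _ (Ex P (fun w => (al * enorm (x w) + be * m) * v) +
  Ex P (fun w => al * enorm (x w) ^+ 3 + be * m * enorm (x w) ^+ 2))).
  have S1 : itg P (fun w => \sum_(i < N) q i (enorm (x w)) * v) by apply: itg_sum => j _; exact: I1.
  have S2 : itg P (fun w => \sum_(i < N) q i (enorm (x w)) * enorm (x w) ^+ 2).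
    by apply: itg_sum => j _; exact: I2.
  apply: lerD; [apply: (Ex_le S1 J1) => w|apply: (Ex_le S2 J2) => w].
    by rewrite -mulr_suml; apply: ler_wpM2r => //; apply: q_sum; exact: enorm_ge0.
  rewrite -mulr_suml (_ : al * _ + _ = (al * enorm (x w) + be * m) * enorm (x w) ^+ 2); last by ring.
  by apply: ler_wpM2r; [exact: sqr_ge0|apply: q_sum; exact: enorm_ge0].
rewrite (ExD (itgZ _ i3) (itgZ _ i2)) (ExZ _ i3) (ExZ _ i2) -/v.
under Ex_ext do rewrite mulrC.
have k1 := itgZ al i1; have k2 := itg_cst P (be * m).
rewrite (ExZ _ (itgD k1 k2)) (ExD k1 k2) (ExZ _ i1) Ex_cst -/m (mulrC v).
exact: num_moments al0 be0 erefl moment_product.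
Qed.

End moments.

Section scales.
Variables (R : realType) (e : R).
Hypothesis e0 : 0 < e.
Hypothesis e1 : e <= 1 / 10.

Definition ou_c (k : nat) := (1 - e) ^+ k.
Definition ou_s (k : nat) := Num.sqrt (1 - ou_c k ^+ 2).
(** The length sqrt (2 t) at time t = [k * e]; it bounds [ou_s / ou_c], the inverse of lam, from
    below. *)
Definition ou_z (k : nat) : R := Num.sqrt (2 * k%:R * e).

Lemma ou_c0 k : 0 < ou_c k.
Proof. by rewrite exprn_gt0//; have := e1; lra. Qed.

Lemma ou_c_ge k : 1 - k%:R * e <= ou_c k.
Proof.
have h0 := e0; have h1 := e1.
elim: k => [|k IH]; first by rewrite mul0r subr0 /ou_c expr0.
rewrite /ou_c exprS -/(ou_c k) -natr1.
have : (1 - e) * (1 - k%:R * e) <= (1 - e) * ou_c k by rewrite ler_wpM2l//; lra.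
have : 0 <= e * e * k%:R by rewrite !mulr_ge0// ltW.
lra.
Qed.

Lemma ou_c_le k : ou_c k * (1 + k%:R * e) <= 1.
Proof.
have h0 := e0; have h1 := e1.
elim: k => [|k IH]; first by rewrite mul0r addr0 /ou_c expr0 mulr1.
rewrite /ou_c exprS -/(ou_c k) -natr1.
have : 0 <= ou_c k * (k%:R + 1) * e ^+ 2.
  by do ! apply: mulr_ge0; rewrite ?(ltW h0) ?(ltW (ou_c0 k)) ?addr_ge0.
by rewrite !expr2; lra.
Qed.

Lemma ou_c2_le k : ou_c k ^+ 2 * (1 + 2 * k%:R * e) <= 1.
Proof. by have := ou_c_le (k * 2); rewrite /ou_c exprM natrM (mulrC 2). Qed.

Lemma ou_c_lt1 k : (0 < k)%N -> ou_c k ^+ 2 < 1.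
Proof.
move=> k0; have := ou_c2_le k; have : 0 < ou_c k ^+ 2 * (2 * k%:R * e).
  apply: mulr_gt0; first by rewrite exprn_gt0// ou_c0.
  by apply: mulr_gt0 => //; apply: mulr_gt0 => //; rewrite ltr0n.
lra.
Qed.

Lemma ou_s0 k : (0 < k)%N -> 0 < ou_s k.
Proof. by move=> k0; rewrite sqrtr_gt0 subr_gt0 ou_c_lt1. Qed.

Lemma ou_cs k : (0 < k)%N -> ou_c k ^+ 2 + ou_s k ^+ 2 = 1.
Proof. by move=> k0; rewrite sqr_sqrtr ?subrKC// subr_ge0 ltW// ou_c_lt1. Qed.

Lemma ou_z0 k : (0 < k)%N -> 0 < ou_z k.
Proof. by move=> k0; rewrite sqrtr_gt0 !mulr_gt0// ltr0n. Qed.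

Lemma ou_z2 k : ou_z k ^+ 2 = 2 * k%:R * e.
Proof. by rewrite sqr_sqrtr// !mulr_ge0// ltW. Qed.

Lemma ou_zS k : ou_z k.+1 ^+ 2 = ou_z k ^+ 2 + 2 * e.
Proof. by rewrite !ou_z2 -natr1; ring. Qed.

Lemma ou_lam_le k : (0 < k)%N -> ou_c k / ou_s k <= (ou_z k)^-1.
Proof.
move=> k0; rewrite ler_pdivrMr ?ou_s0// mulrC ler_pdivlMr ?ou_z0//.
rewrite -(@ler_pXn2r _ 2) ?nnegrE ?mulr_ge0 ?sqrtr_ge0 ?(ltW (ou_c0 k))//.
rewrite exprMn ou_z2; have := ou_cs k0; have := ou_c2_le k; lra.
Qed.

Lemma ou_z_mono j k : (j <= k)%N -> ou_z j <= ou_z k.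
Proof. by move=> jk; rewrite ler_wsqrtr// ler_pM2r// ler_pM2l// ler_nat. Qed.

(** The hypothesis says [k * e < 1/2], and one more step costs at most 1/10: 1 - 1/2 - 1/10 =
    2/5. *)
Lemma ou_c25 k : ou_z k < 1 -> 2 / 5 <= ou_c k.+1.
Proof.
move=> zk; have : ou_z k ^+ 2 < 1 by rewrite expr_lt1// sqrtr_ge0.
by rewrite ou_z2 => h; have := ou_c_ge k.+1; rewrite -natr1; have := e1; lra.
Qed.

End scales.

Lemma num_err (R : realType) (k l L e EW t EZ : R) : 0 <= l -> l <= L -> 0 <= k -> 0 <= e -> 0 <= EW -> 0 <= t -> 0 <= EZ ->
  2 * k * l ^+ 2 * e ^+ 2 + 14 * (e ^+ 3 * (l ^+ 3 * EW) + (l * t) ^+ 3 * EZ) <=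
  2 * k * L ^+ 2 * e ^+ 2 + 14 * (e ^+ 3 * (L ^+ 3 * EW) + (L * t) ^+ 3 * EZ).
Proof.
move=> l0 lL k0 e0 W0 t0 Z0; have L0 := le_trans l0 lL.
have h2 : l ^+ 2 <= L ^+ 2 by rewrite lerXn2r.
have h3 : l ^+ 3 <= L ^+ 3 by rewrite lerXn2r.
have h4 : (l * t) ^+ 3 <= (L * t) ^+ 3 by rewrite lerXn2r ?nnegrE ?mulr_ge0// ler_wpM2r.
apply: lerD.
  by apply: ler_wpM2r; [exact: sqr_ge0|apply: ler_wpM2l => //; exact: mulr_ge0].
apply: ler_wpM2l => //; apply: lerD; last exact: ler_wpM2r.
by apply: ler_wpM2l; [exact: exprn_ge0|exact: ler_wpM2r].
Qed.

(** The ratio [b / Max] is bounded by 1 against [A * m] and by b / (40 g) against [K] and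
    [A * 36 g]: 7/80 = 7/2 / 40 and 125/4 = 281/10 + 7/2 * 36/40. *)
Lemma num_range (R : realType) (A g K m b : R) : 0 <= A -> 0 < g -> 0 <= K -> 0 <= m -> 0 <= b ->
  (281 / 10 * A + 21 / 4) * b + 7 / 2 * (K + A * (m + 36 * g)) * (b / Num.max (40 * g) b) <=
  (125 / 4 * A + 21 / 4 + 7 / 80 * (K / g)) * b + 7 / 2 * A * m.
Proof.
move=> A0 g0 K0 m0 b0; set M := Num.max _ _.
have M0 : 0 < M by rewrite lt_max mulr_gt0.
have bM1 : b / M <= 1 by rewrite ler_pdivrMr// mul1r le_max lexx orbT.
have bM0 : 0 <= b / M by rewrite divr_ge0// ltW.
have bM2 : g * (b / M) <= b / 40.
  rewrite mulrA ler_pdivrMr//.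
  have : b * (40 * g) <= b * M by rewrite ler_wpM2l// le_max lexx.
  by lra.
have bM3 : b / M <= b * g^-1 / 40.
  have : g^-1 * (g * (b / M)) <= g^-1 * (b / 40) by rewrite ler_wpM2l// invr_ge0 ltW.
  by rewrite mulKf ?gt_eqF//; lra.
have h1 : K * (b / M) <= K * (b * g^-1 / 40) by rewrite ler_wpM2l.
have h2 : A * m * (b / M) <= A * m * 1 by rewrite ler_wpM2l// mulr_ge0.
have h3 : A * (g * (b / M)) <= A * (b / 40) by rewrite ler_wpM2l.
move: h1 h2 h3; move: (b / M) (g^-1) => r gi; lra.
Qed.

Lemma telescope_le (R : realType) (U : nat -> R) (B : nat -> R) N :
  (forall j, `|U j.+1 - U j| <= B j) -> `|U N - U 0%N| <= \sum_(j < N) B j.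
Proof.
move=> h; elim: N => [|N IH]; first by rewrite big_ord0 subrr normr0.
rewrite big_ord_recr/= (_ : U N.+1 - U 0%N = (U N - U 0%N) + (U N.+1 - U N)); last by ring.
by rewrite (le_trans (ler_normD _ _))// lerD.
Qed.

Section interpolation.
Context dO dS dZ (Omega : measurableType dO) (S : measurableType dS) (OZ : measurableType dZ)
  (R : realType) (P : probability Omega R) (PZ : probability OZ R) (n d : nat).
Variables (X : 'I_n -> Omega -> S) (h : 'I_n -> S -> 'cV[R]_d) (Z : OZ -> 'cV[R]_d).
Hypothesis HZ : std_gaussian PZ Z.
Hypothesis mX : forall i, measurable_fun setT (X i).
Hypothesis mh : forall i, cmeas (h i).
Hypothesis iX : mutually_independent P X.
Let xi i w := h i (X i w).
Hypothesis i3 : forall i, itg P (fun w => enorm (xi i w) ^+ 3).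
Hypothesis mean0 : forall i j, Ex P (fun w => xi i w j 0) = 0.
Hypothesis cov1 : forall j l, \sum_i Ex P (fun w => xi i w j 0 * xi i w l 0) = (j == l)%:R.
Variables (g : R).
Hypothesis g0 : 0 < g.
Hypothesis mom3 : \sum_i Ex P (fun w => enorm (xi i w) ^+ 3) <= g.
Hypothesis d0 : (0 < d)%N.
Hypothesis g_small : g <= 1 / 100.
Let W w : 'cV[R]_d := \sum_i xi i w.

Variable K : R.
Hypothesis K0 : 0 <= K.
Hypothesis HK : forall s u, usub s u ->
  `|pr P [set w | s (W w) <= 0] - pr PZ [set w | s (Z w) <= 0]| <= K.

Variables A : R.
Hypothesis AE : A = 5 / 3 * Num.sqrt d%:R.

Let mxi i : cmeas (xi i). Proof. exact: (cmeas_hX mX mh i). Qed.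
Let mW : cmeas W. Proof. exact: cmeas_sum. Qed.
Variables (s : 'cV[R]_d -> R) (u : 'cV[R]_d -> 'cV[R]_d) (l : R).
Hypothesis su : usub s u.
Hypothesis lE : l = 40 * g.

Variables (e : R) (p : nat).
Hypothesis e0 : 0 < e.
Hypothesis e1 : e <= 1 / 10.

Let lam k := ou_c e k / ou_s e k.
Let U k := ou_mean P PZ X h Z s l (ou_c e k) (ou_s e k).
Let D i := K + A * (Ex P (fun w => enorm (xi i w)) + 36 * g).
(** The scale [ou_z] lags one index behind [lam]: [rate_potential] asks for lam at most the inverse
    of the next scale, and [ou_c25] bounds the next coefficient. *)
Let q j i := rate A g (D i) (ou_z e (p + j).+1) (lam (p + j).+2).
Let v i := Ex P (fun w => enorm (xi i w) ^+ 2).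
Let B j i := Ex P (fun w => q j i (enorm (xi i w)) * v i) + Ex P (fun w => q j i (enorm (xi i w)) * enorm (xi i w) ^+ 2).
Let EW := Ex P (fun w => enorm (W w) ^+ 3).
Let EZ := Ex PZ (fun z => enorm (Z z) ^+ 3).

Definition step_error (L tau : R) := 2 * d%:R * L ^+ 2 * e ^+ 2 + 14 * (e ^+ 3 * (L ^+ 3 * EW) + (L * tau) ^+ 3 * EZ).

Let A0 : 0 <= A. Proof. by rewrite AE mulr_ge0// sqrtr_ge0. Qed.
Let m0 i : 0 <= Ex P (fun w => enorm (xi i w)). Proof. by apply: Ex_ge0 => w; exact: enorm_ge0. Qed.
Let D0 i : 0 <= D i.
Proof. by apply: addr_ge0 => //; apply: mulr_ge0 => //; apply: addr_ge0 => //; apply: mulr_ge0 => //; exact: ltW. Qed.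
Let lam0 k : 0 <= lam k.
Proof. by apply: divr_ge0; [exact: ltW (ou_c0 e1 k)|exact: sqrtr_ge0]. Qed.

Let tau := Num.sqrt (2 * e - e ^+ 2).

Let one_step j : `|U (p + j).+3 - U (p + j).+2| <= e * (\sum_i B j i) + step_error (ou_z e p.+2)^-1 tau.
Proof.
have k0 : (0 < (p + j).+2)%N by [].
have c0 := ou_c0 e1 (p + j).+2; have s0 := ou_s0 e0 e1 k0.
have csc := ou_cs e0 e1 k0.
have k0' : (0 < (p + j).+3)%N by [].
have s0' := ou_s0 e0 e1 k0'; have csc' := ou_cs e0 e1 k0'.
have c'E : ou_c e (p + j).+3 = (1 - e) * ou_c e (p + j).+2 by rewrite /ou_c exprS.
have tau2 : 0 <= 2 * e - e ^+ 2.
  have h1 := e1; have h0 := e0; have : e * e <= e * 1 by apply: ler_wpM2l; lra.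
  by rewrite expr2; lra.
have tauE : tau ^+ 2 = 2 * e - e ^+ 2 by rewrite sqr_sqrtr.
have mq i : measurable_fun setT (q j i) by exact: rate_meas.
have qb i b (b0 : 0 <= b) := rate_bnd (ou_z e (p + j).+1) A0 g0 (D0 i) (lam0 (p + j).+2) b0.
have Hq i a y b (yb : enorm y <= b) :=
  rate_valid HZ mX mh iX i3 mean0 cov1 g0 mom3 d0 g_small K0 HK AE su lE i a c0 s0 csc erefl
    (@ou_c25 _ _ e0 e1 (p + j).+1) yb.
have := ou_step HZ mX mh iX i3 mean0 cov1 su g0 lE s0 c0 erefl mq qb Hq (ltW e0) csc csc' s0' c'E (sqrtr_ge0 _) tauE.
rewrite -addrA => /le_trans; apply; apply: lerD => //.
apply: num_err; [exact: lam0| |exact: ler0n|exact: ltW| |exact: sqrtr_ge0|].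
- apply: le_trans (ou_lam_le e0 e1 k0) _.
  rewrite lef_pV2 ?posrE ?ou_z0//; apply: ou_z_mono => //.
  by rewrite !ltnS leq_addr.
- by apply: Ex_ge0 => w; rewrite exprn_ge0// enorm_ge0.
- by apply: Ex_ge0 => w; rewrite exprn_ge0// enorm_ge0.
Qed.

Let al := 125 / 4 * A + 21 / 4 + 7 / 80 * (K / g).
Let be := 7 / 2 * A.

(** The increments of the potential telescope, so the sum over time is bounded independently of the
    number of steps, except for the factor 1 / e that the step length compensates. *)
Let q_sum N i b : 0 <= b -> \sum_(j < N) q j i b <= (al / e) * b + (be / e) * Ex P (fun w => enorm (xi i w)).
Proof.
move=> b0; rewrite (_ : _ + _ = (al * b + be * Ex P (fun w => enorm (xi i w))) / e); last by ring.
rewrite ler_pdivlMr// mulrC mulr_sumr.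
pose pot j := potential A g (D i) b (ou_z e (p + j)) (ou_z e (p + j).+1).
apply: (@le_trans _ _ (\sum_(j < N) (pot j.+1 - pot j))).
  apply: ler_sum => j _; rewrite /pot addnS.
  apply: rate_potential => //; [exact: ltW|exact: sqrtr_ge0|exact: ou_z0|exact: ou_z0|exact: ou_zS|exact: ou_zS|].
  exact: ou_lam_le.
rewrite -(big_mkord xpredT (fun j => pot j.+1 - pot j)) telescope_sumr//.
apply: le_trans (num_range A0 g0 K0 (m0 i) b0).
by apply: potential_range => //; [exact: sqrtr_ge0|exact: ou_z0|exact: sqrtr_ge0|exact: ou_z0].
Qed.

Lemma interpolation_bound N : `|U (p + N).+2 - U p.+2| <=
  2 * (al + be) * g + N%:R * step_error (ou_z e p.+2)^-1 tau.
Proof.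
have steps j : `|U (p + j.+1).+2 - U (p + j).+2| <= e * (\sum_i B j i) + step_error (ou_z e p.+2)^-1 tau.
  by rewrite addnS; exact: one_step.
have := telescope_le (U := fun j => U (p + j).+2) N steps.
rewrite addn0 => /le_trans; apply.
rewrite big_split/= sumr_const card_ord -(mulr_natl (step_error _ _)).
apply: lerD => //; rewrite -mulr_sumr exchange_big/=.
have al0 : 0 <= al.
  by rewrite /al !addr_ge0// mulr_ge0// divr_ge0// ltW.
have be0 : 0 <= be by rewrite /be mulr_ge0.
apply: (@le_trans _ _ (e * \sum_i 2 * (al / e + be / e) * Ex P (fun w => enorm (xi i w) ^+ 3))).
  apply: ler_wpM2l; first exact: ltW.
  apply: ler_sum => i _.
  apply: (rate_sum (mxi i) (i3 i) (q := fun j => q j i)).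
  - by move=> j; exact: rate_meas.
  - move=> j b b0; exact: (rate_bnd (ou_z e (p + j).+1) A0 g0 (D0 i) (lam0 (p + j).+2) b0).
  - by apply: divr_ge0 => //; exact: ltW.
  - by apply: divr_ge0 => //; exact: ltW.
  - exact: q_sum.
rewrite -mulr_sumr (_ : e * _ = 2 * (al + be) * \sum_i Ex P (fun w => enorm (xi i w) ^+ 3)); last first.
  by field; rewrite gt_eqF.
by apply: ler_wpM2l => //; apply: mulr_ge0 => //; exact: addr_ge0.
Qed.

End interpolation.

Lemma num_limit (R : realType) (x M C1 : R) (C2 : nat -> R) : 0 <= C1 -> (forall a, 0 <= C2 a) ->
  (forall a r, (2 < a)%N -> (0 < r)%N -> x <= M + C1 / a%:R + C2 a / r%:R) -> x <= M.
Proof.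
move=> C10 C20 H; apply/ler_addgt0Pr => e e0.
have small (C : R) : 0 <= C -> exists2 k : nat, (2 < k)%N & C / k%:R <= e / 2.
  move=> C0; exists (Num.truncn (2 * C / e)).+3 => //.
  rewrite ler_pdivrMr//; have := truncnS_gt (2 * C / e); set k := Num.truncn _ => hk.
  have : 2 * C / e <= k.+3%:R by apply: le_trans (ltW hk) _; rewrite ler_nat !ltnS leqW.
  by rewrite ler_pdivrMr//; move: (k.+3%:R) => y; lra.
have [a a3 ha] := small C1 C10; have [r r3 hr] := small (C2 a) (C20 a).
by have := H a r a3 (ltn_trans (ltn0Sn 1) r3); lra.
Qed.

(** The total time [N * e = m] is fixed, so errors of order e^2 per step add up to O(e). Those of
    order tau^3 add up to O(tau), because [tau ^+ 2 <= 2 * e]; both e and tau are at most 1 / r. *)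
Lemma num_errors (R : realType) (a r m e k L tau EW EZ N : R) : 3 <= a -> 1 <= r -> m = 2 * a ^+ 2 ->
  e = (2 * m ^+ 2 * r ^+ 2)^-1 -> N * e = m -> L = a -> 0 <= k -> 0 <= EW -> 0 <= EZ -> 0 <= tau -> tau ^+ 2 <= 2 * e ->
  N * (2 * k * L ^+ 2 * e ^+ 2 + 14 * (e ^+ 3 * (L ^+ 3 * EW) + (L * tau) ^+ 3 * EZ)) <=
  m * (2 * k * a ^+ 2 + 14 * (a ^+ 3 * EW + 2 * a ^+ 3 * EZ)) / r.
Proof.
move=> a3 r1 mE eE Ne -> k0 W0 Z0 t0 te.
have m1 : 1 <= m.
  have : 1 <= a ^+ 2 by apply: exprn_ege1; lra.
  by rewrite mE; lra.
have mr1 : 1 <= m * r by rewrite mulr_ege1.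
have r0 : 0 < r by lra.
have eE' : e = (2 * (m * r) ^+ 2)^-1 by rewrite eE; congr (_^-1); ring.
have mr0 : 0 < m * r by apply: lt_le_trans mr1.
have e0 : 0 < e by rewrite eE' invr_gt0 mulr_gt0// exprn_gt0.
have tmr : tau <= (m * r)^-1.
  rewrite -(@ler_pXn2r _ 2) ?nnegrE ?invr_ge0 ?(ltW mr0)// (le_trans te)// eE'.
  by rewrite le_eqVlt; apply/orP; left; apply/eqP; field; rewrite !gt_eqF//; lra.
have er : e <= r^-1.
  have q0 : 0 < 2 * (m * r) ^+ 2 by apply: mulr_gt0 => //; exact: exprn_gt0.
  rewrite eE' lef_pV2 ?posrE// expr2.
  have : 1 * r <= m * r by rewrite ler_wpM2r// ltW.
  have : m * r * 1 <= m * r * (m * r) by rewrite ler_wpM2l// ltW.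
  lra.
have e1 : e <= 1 by rewrite (le_trans er)// invf_le1.
have tr : tau <= r^-1.
  rewrite (le_trans tmr)// lef_pV2 ?posrE//.
  by rewrite ler_peMl// ltW.
have e2 : e ^+ 2 <= r^-1.
  by rewrite (le_trans _ er)// expr2 ler_piMr// ltW.
have t3 : N * tau ^+ 3 <= m * (2 * r^-1).
  have N0 : 0 <= N by rewrite -(pmulr_lge0 _ e0) Ne; lra.
  have : N * tau ^+ 3 <= N * (2 * e * r^-1).
    by apply: ler_wpM2l => //; rewrite exprSr; apply: ler_pM => //; exact: exprn_ge0.
  by rewrite (_ : N * (2 * e * r^-1) = m * (2 * r^-1)) // -Ne; ring.
have a20 : 0 <= a ^+ 2 by exact: sqr_ge0.
have a30 : 0 <= a ^+ 3 by rewrite exprn_ge0//; lra.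
have m0 : 0 <= m by lra.
have -> : N * (2 * k * a ^+ 2 * e ^+ 2 + 14 * (e ^+ 3 * (a ^+ 3 * EW) + (a * tau) ^+ 3 * EZ)) =
  (N * e) * (2 * k * a ^+ 2) * e + 14 * ((N * e) * (a ^+ 3 * EW) * e ^+ 2 + (a ^+ 3 * EZ) * (N * tau ^+ 3)) by ring.
rewrite Ne.
have h1 : m * (2 * k * a ^+ 2) * e <= m * (2 * k * a ^+ 2) * r^-1.
  by apply: ler_wpM2l er; apply: mulr_ge0 => //; apply: mulr_ge0 => //; exact: mulr_ge0.
have h2 : m * (a ^+ 3 * EW) * e ^+ 2 <= m * (a ^+ 3 * EW) * r^-1.
  by apply: ler_wpM2l e2; apply: mulr_ge0 => //; exact: mulr_ge0.
have h3 : a ^+ 3 * EZ * (N * tau ^+ 3) <= a ^+ 3 * EZ * (m * (2 * r^-1)).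
  by apply: ler_wpM2l t3; exact: mulr_ge0.
have -> : m * (2 * k * a ^+ 2 + 14 * (a ^+ 3 * EW + 2 * a ^+ 3 * EZ)) / r =
  m * (2 * k * a ^+ 2) * r^-1 + 14 * (m * (a ^+ 3 * EW) * r^-1 + a ^+ 3 * EZ * (m * (2 * r^-1))) by ring.
apply: lerD => //; apply: ler_wpM2l => //; exact: lerD.
Qed.

Lemma num_start (R : realType) (c s a : R) : 0 < c -> 0 <= s -> c ^+ 2 + s ^+ 2 = 1 -> 3 <= a ->
  1 - (2 * a ^+ 2)^-1 <= c -> `|1 - c| <= a^-1 /\ `|0 - s| <= a^-1.
Proof.
move=> c0 s0 cs a3 hc; have a0 : 0 < a by lra.
have c1 : c <= 1 by rewrite -(@ler_pXn2r _ 2) ?nnegrE ?(ltW c0)// expr1n; have := sqr_ge0 s; lra.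
have E : (2 * a ^+ 2)^-1 = a^-1 ^+ 2 / 2 by rewrite invfM exprVn mulrC.
have ai : a^-1 <= 1 by rewrite invf_le1//; lra.
have ai0 : 0 < a^-1 by rewrite invr_gt0.
have ai2 : a^-1 ^+ 2 <= a^-1 by rewrite expr2 ler_piMr// ltW.
split.
  by rewrite ger0_norm; lra.
rewrite sub0r normrN ger0_norm// -(@ler_pXn2r _ 2) ?nnegrE ?(ltW ai0)//.
have : (1 - c) * c <= (1 - c) * 1 by apply: ler_wpM2l; lra.
by rewrite E in hc; move: cs; rewrite !expr2 in hc *; lra.
Qed.

Lemma num_end (R : realType) (c s a t : R) : 0 < c -> 0 <= s -> c ^+ 2 + s ^+ 2 = 1 -> 3 <= a ->
  2 * a ^+ 2 <= t -> c * (1 + t) <= 1 -> `|c - 0| <= a^-1 /\ `|s - 1| <= a^-1.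
Proof.
move=> c0 s0 cs a3 ht hc; have a0 : 0 < a by lra.
have aa : 3 * a <= a ^+ 2 by rewrite expr2 ler_wpM2r// ltW.
have ca : c <= a^-1.
  rewrite -[a^-1]mul1r ler_pdivlMr//; apply: le_trans hc.
  by apply: ler_wpM2l; [exact: ltW|lra].
have c1 : c <= 1 by rewrite (le_trans ca)// invf_le1//; lra.
have s1 : s <= 1 by rewrite -(@ler_pXn2r _ 2) ?nnegrE// expr1n; have := sqr_ge0 c; lra.
split; first by rewrite subr0 ger0_norm// ltW.
rewrite distrC ger0_norm ?subr_ge0//.
have : s * s <= s * 1 by apply: ler_wpM2l.
have : c * c <= c * 1 by apply: ler_wpM2l => //; exact: ltW.
by move: cs; rewrite !expr2; lra.
Qed.

Section comparison.
Context dO dS dZ (Omega : measurableType dO) (S : measurableType dS) (OZ : measurableType dZ)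
  (R : realType) (P : probability Omega R) (PZ : probability OZ R) (n d : nat).
Variables (X : 'I_n -> Omega -> S) (h : 'I_n -> S -> 'cV[R]_d) (Z : OZ -> 'cV[R]_d).
Hypothesis HZ : std_gaussian PZ Z.
Hypothesis mX : forall i, measurable_fun setT (X i).
Hypothesis mh : forall i, cmeas (h i).
Hypothesis iX : mutually_independent P X.
Let xi i w := h i (X i w).
Hypothesis i3 : forall i, itg P (fun w => enorm (xi i w) ^+ 3).
Hypothesis mean0 : forall i j, Ex P (fun w => xi i w j 0) = 0.
Hypothesis cov1 : forall j l, \sum_i Ex P (fun w => xi i w j 0 * xi i w l 0) = (j == l)%:R.
Variables (g : R).
Hypothesis g0 : 0 < g.
Hypothesis mom3 : \sum_i Ex P (fun w => enorm (xi i w) ^+ 3) <= g.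
Hypothesis d0 : (0 < d)%N.
Hypothesis g_small : g <= 1 / 100.
Let W w : 'cV[R]_d := \sum_i xi i w.

Let mxi i : cmeas (xi i). Proof. exact: (cmeas_hX mX mh i). Qed.
Let mW : cmeas W. Proof. exact: cmeas_sum. Qed.
Section smoothing.
Variables (s : 'cV[R]_d -> R) (u : 'cV[R]_d -> 'cV[R]_d) (l : R).
Hypothesis su : usub s u.
Hypothesis lE : l = 40 * g.

Let l0 : 0 < l. Proof. by rewrite lE mulr_gt0. Qed.
Let mZ : cmeas Z. Proof. exact: gauss_cmeas HZ. Qed.
Let mhh : mRd (smooth s l). Proof. exact: smooth_meas su l0. Qed.

(** The interpolation steps require [c] and [sc] positive; this continuity joins them to the two
    ends, [W] itself and [Z] itself. *)
Lemma ou_mean_lip c sc c' sc' :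
  `|ou_mean P PZ X h Z s l c sc - ou_mean P PZ X h Z s l c' sc'| <=
  2 / l * Num.sqrt d%:R * (`|c - c'| + `|sc - sc'|).
Proof.
pose f c sc w z := smooth s l (c *: W w + sc *: Z z).
have mf a b : measurable_fun setT (fun p : Omega * OZ => f a b p.1 p.2).
  apply: mRd_comp mhh _; apply: cmeasD.
    by apply: (cmeasZ (a := fun=> a)) => // j; apply: measurableT_comp (mW j) _.
  by apply: (cmeasZ (a := fun=> b)) => // j; apply: measurableT_comp (mZ j) _.
have bf a b w z : `|f a b w z| <= 1 * 1 by rewrite mulr1; exact: smooth_abs.
have I1 a b w : itg PZ (f a b w) := dom_itg1 (mf a b) (itg_cst PZ 1) (bf a b) w.
have I2 a b : itg P (fun w => Ex PZ (f a b w)) := (Ex_prod1 (mf a b) (itg_cst P 1) (itg_cst PZ 1) (bf a b)).1.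
have iW : itg P (fun w => enorm (W w)) by exact: (itg_norm mW (itg_norm_sum3 mxi i3)).
have iZ := itg_gauss_norm HZ.
have L0 : 0 <= 2 / l by rewrite divr_ge0// ltW.
pose b1 w z := 2 / l * (`|c - c'| * enorm (W w) + `|sc - sc'| * enorm (Z z)).
have step w z : `|f c sc w z - f c' sc' w z| <= b1 w z.
  apply: le_trans (smooth_lip su l0 _ _) _; apply: ler_wpM2l => //.
  rewrite opprD addrACA -!scalerBl (le_trans (enormD _ _))// !enormZ//.
have jZ : itg PZ (fun z => `|sc - sc'| * enorm (Z z)) by exact: itgZ.
have jW : itg P (fun w => `|c - c'| * enorm (W w)) by exact: itgZ.
have ib1 w : itg PZ (b1 w) by apply: itgZ; apply: itgD => //; exact: itg_cst.
have inner w : `|Ex PZ (f c sc w) - Ex PZ (f c' sc' w)| <= 2 / l * (`|c - c'| * enorm (W w) + `|sc - sc'| * Num.sqrt d%:R).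
  rewrite -(ExB (I1 _ _ w) (I1 _ _ w)); have iD := itgB (I1 c sc w) (I1 c' sc' w).
  apply: le_trans (Ex_abs iD) _; apply: le_trans (Ex_le (itg_abs iD) (ib1 w) (step w)) _.
  have k := itg_cst PZ (`|c - c'| * enorm (W w)).
  rewrite (ExZ _ (itgD k jZ)) (ExD k jZ) Ex_cst (ExZ _ iZ).
  by apply: ler_wpM2l => //; rewrite lerD2l; apply: ler_wpM2l => //; exact: Ex_gauss_norm HZ.
rewrite -(ExB (I2 _ _) (I2 _ _)); have iD := itgB (I2 c sc) (I2 c' sc').
apply: le_trans (Ex_abs iD) _.
have k := itg_cst P (`|sc - sc'| * Num.sqrt d%:R).
apply: le_trans (Ex_le (itg_abs iD) (itgZ (2 / l) (itgD jW k)) inner) _.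
rewrite (ExZ _ (itgD jW k)) (ExD jW k) Ex_cst (ExZ _ iW) -mulrA; apply: ler_wpM2l => //.
rewrite mulrDr (mulrC _ `|c - c'|) (mulrC _ `|sc - sc'|) lerD2r; apply: ler_wpM2l => //.
exact: (Ex_norm_W mX mh iX i3 mean0 cov1).
Qed.

Lemma ou_mean_W : ou_mean P PZ X h Z s l 1 0 = Ex P (fun w => smooth s l (W w)).
Proof.
apply: Ex_ext => w; rewrite -[RHS](Ex_cst PZ); apply: Ex_ext => z.
by rewrite scale1r scale0r addr0.
Qed.

Lemma ou_mean_Z : ou_mean P PZ X h Z s l 0 1 = Ex PZ (fun z => smooth s l (Z z)).
Proof.
rewrite -[RHS](Ex_cst P); apply: Ex_ext => w; apply: Ex_ext => z.
by rewrite scale1r scale0r add0r.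
Qed.

Variable K : R.
Hypothesis K0 : 0 <= K.
Hypothesis HK : forall s u, usub s u ->
  `|pr P [set w | s (W w) <= 0] - pr PZ [set w | s (Z w) <= 0]| <= K.

Let A : R := 5 / 3 * Num.sqrt d%:R.

Lemma smooth_comparison :
  `|Ex P (fun w => smooth s l (W w)) - Ex PZ (fun z => smooth s l (Z z))| <=
  2 * (125 / 4 * A + 21 / 4 + 7 / 80 * (K / g) + 7 / 2 * A) * g.
Proof.
pose EW := Ex P (fun w => enorm (W w) ^+ 3); pose EZ := Ex PZ (fun z => enorm (Z z) ^+ 3).
have EW0 : 0 <= EW by apply: Ex_ge0 => w; rewrite exprn_ge0// enorm_ge0.
have EZ0 : 0 <= EZ by apply: Ex_ge0 => w; rewrite exprn_ge0// enorm_ge0.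
pose C2 (a : nat) : R := (2 * a%:R ^+ 2) * (2 * d%:R * a%:R ^+ 2 + 14 * (a%:R ^+ 3 * EW + 2 * a%:R ^+ 3 * EZ)).
pose C1 : R := 2 / l * Num.sqrt d%:R * 4.
have C10 : 0 <= C1 by rewrite !mulr_ge0 ?sqrtr_ge0// invr_ge0 ltW.
have C20 a : 0 <= C2 a.
  apply: mulr_ge0; first by rewrite mulr_ge0// exprn_ge0.
  apply: addr_ge0; first by do ! apply: mulr_ge0; rewrite ?exprn_ge0.
  by apply: mulr_ge0 => //; apply: addr_ge0; do ! apply: mulr_ge0; rewrite ?exprn_ge0.
apply: (num_limit C10 C20) => a r a3 r1.
(* Interpolate from time 1 / m to time m + 1 / m in N steps of length e; the errors vanish as
   first r and then a tend to infinity. *)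
have [m mN] : exists m, m = (2 * a ^ 2)%N by eexists.
have [k0 k0N] : exists k0, k0 = (2 * m * r ^ 2)%N by eexists.
have [N NN] : exists N, N = (m ^ 2 * k0)%N by eexists.
pose e : R := (2 * m%:R ^+ 2 * r%:R ^+ 2)^-1.
have a3' : 3 <= a%:R :> R by rewrite ler_nat.
have r1' : 1 <= r%:R :> R by rewrite ler1n.
have mE : m%:R = 2 * a%:R ^+ 2 :> R by rewrite mN natrM natrX.
have a9 : 9 <= a%:R ^+ 2 :> R by rewrite (_ : 9 = 3 ^+ 2) ?lerXn2r ?nnegrE// -natrX.
have m18 : 18 <= m%:R :> R by rewrite mE; lra.
have mn0 : m%:R != 0 :> R by rewrite gt_eqF//; lra.
have rn0 : r%:R != 0 :> R by rewrite gt_eqF//; lra.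
have k0e : k0%:R * e = m%:R^-1.
  have -> : k0%:R = 2 * m%:R * r%:R ^+ 2 :> R by rewrite k0N natrM natrX natrM.
  by rewrite /e; field; rewrite mn0 rn0.
have Ne : N%:R * e = m%:R.
  by rewrite NN natrM -mulrA k0e natrX expr2 -mulrA divff// mulr1.
have k02 : (2 <= k0)%N.
  by rewrite k0N -mulnA leq_pmulr// muln_gt0 mN muln_gt0 !expn_gt0 r1 (ltn_trans _ a3).
have e0 : 0 < e by rewrite invr_gt0 !mulr_gt0 ?exprn_gt0//; lra.
have e1 : e <= 1 / 10.
  have : e * k0%:R <= m%:R^-1 by rewrite mulrC k0e.
  have : m%:R^-1 <= 18^-1 :> R by rewrite lef_pV2 ?posrE//; lra.
  have : e * 2 <= e * k0%:R by apply: ler_wpM2l; [exact: ltW|rewrite ler_nat].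
  by lra.
(* [interpolation_bound] starts at the index [p.+2]. *)
have k0E : (k0 - 2).+2 = k0 by rewrite -addn2 subnK.
have k0NE : (k0 - 2 + N).+2 = (k0 + N)%N by rewrite -addSn -addSn k0E.
have := interpolation_bound HZ mX mh iX i3 mean0 cov1 g0 mom3 d0 g_small K0 HK erefl su lE (k0 - 2) e0 e1 N.
rewrite k0E k0NE -/A.
have kp : (0 < k0)%N by exact: ltn_trans k02.
have kNp : (0 < k0 + N)%N by rewrite addn_gt0 kp.
have hs1 := ou_c_ge e0 e1 k0; rewrite k0e mE in hs1.
have [s1 s2] := num_start (ou_c0 e1 k0) (sqrtr_ge0 _) (ou_cs e0 e1 kp) a3' hs1.
have ht : 2 * a%:R ^+ 2 <= (k0 + N)%:R * e.
  by rewrite (natrD _ k0 N) [leRHS]mulrDl Ne k0e -mE lerDr invr_ge0 ler0n.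
have [t1 t2] := num_end (ou_c0 e1 (k0 + N)) (sqrtr_ge0 _) (ou_cs e0 e1 kNp) a3' ht (ou_c_le e0 e1 (k0 + N)).
have b1 := ou_mean_lip 1 0 (ou_c e k0) (ou_s e k0); rewrite ou_mean_W in b1.
have b2 := ou_mean_lip (ou_c e (k0 + N)) (ou_s e (k0 + N)) 0 1; rewrite ou_mean_Z in b2.
have L0 : 0 <= 2 / l * Num.sqrt d%:R by rewrite mulr_ge0 ?sqrtr_ge0// divr_ge0// ltW.
have {}b1 := le_trans b1 (ler_wpM2l L0 (lerD s1 s2)).
have {}b2 := le_trans b2 (ler_wpM2l L0 (lerD t1 t2)).
(* The starting time is 1 / m with [m = 2 a^2], so the starting scale sqrt (2 / m) is exactly 1 /
   a. *)
have zE : (ou_z e k0)^-1 = a%:R.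
  rewrite /ou_z -mulrA k0e mE invfM mulrA divff// mul1r -exprVn sqrtr_sqr ger0_norm ?invr_ge0//.
  by rewrite invrK.
have te : Num.sqrt (2 * e - e ^+ 2) ^+ 2 <= 2 * e.
  have e2 := sqr_ge0 e; case: (lerP 0 (2 * e - e ^+ 2)) => h2; first by rewrite sqr_sqrtr//; lra.
  by rewrite ler0_sqrtr ?expr0n ?ltW// mulr_gt0.
have := num_errors a3' r1' mE erefl Ne zE (ler0n R d) EW0 EZ0 (sqrtr_ge0 (2 * e - e ^+ 2)) te.
rewrite [X in _ <= X * _ / _]mE -/(C2 a) /step_error -/EW -/EZ.
move=> hE hU; have {hE}hU := le_trans hU (lerD (lexx _) hE).
have tri (x y z w : R) : `|x - w| <= `|x - y| + (`|z - y| + `|z - w|).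
  have -> : x - w = (x - y) + ((y - z) + (z - w)) by ring.
  rewrite (le_trans (ler_normD _ _))// lerD2l (le_trans (ler_normD _ _))// lerD2r.
  by rewrite distrC.
have := tri (Ex P (fun w => smooth s l (W w))) (ou_mean P PZ X h Z s l (ou_c e k0) (ou_s e k0))
  (ou_mean P PZ X h Z s l (ou_c e (k0 + N)) (ou_s e (k0 + N))) (Ex PZ (fun z => smooth s l (Z z))).
move: b1 b2 hU; rewrite /C1; move: (2 / l * _) (a%:R^-1) (C2 a / r%:R) => q1 q2 q3.
move: `|_ - _| `|_ - _| `|_ - _| `|_ - _| (2 * (_ + _) * g) => n1 n2 n3 n4 n5.
lra.
Qed.

End smoothing.
End comparison.

(** * Berry-Esseen bounds for sublevel sets *)

Lemma num_be_up (R : realType) (p q r E1 E2 M : R) : p <= E1 -> `|E1 - E2| <= M -> E2 <= q -> q <= r -> p <= r + M.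
Proof. by move=> h1; rewrite ler_norml => /andP[h2 h3] h4 h5; lra. Qed.

Lemma num_be_down (R : realType) (p q E1 E2 M : R) : p <= E1 -> `|E2 - E1| <= M -> E2 <= q -> p <= q + M.
Proof. by move=> h1; rewrite ler_norml => /andP[h2 h3] h4; lra. Qed.

(** Without [K] the left-hand side is at most (50 + 695/6 + 21/2) sd g, below 177 sd g, and 7/40 *
    215 is below 38: together at most 215. The part 7/40 e is at most e / 2. *)
Lemma num_be_const (R : realType) (sd g K e : R) : 1 <= sd -> 0 < g -> 0 <= e -> K = 215 * sd * g + e ->
  50 * g * sd + 2 * (125 / 4 * (5 / 3 * sd) + 21 / 4 + 7 / 80 * (K / g) + 7 / 2 * (5 / 3 * sd)) * g <= 215 * sd * g + e / 2.
Proof.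
move=> d1 g0 e0 KE.
have -> : 2 * (125 / 4 * (5 / 3 * sd) + 21 / 4 + 7 / 80 * (K / g) + 7 / 2 * (5 / 3 * sd)) * g =
  2 * (125 / 4 * (5 / 3 * sd) + 21 / 4 + 7 / 2 * (5 / 3 * sd)) * g + 7 / 40 * K by field; rewrite gt_eqF.
rewrite KE; have : 1 * g <= sd * g by rewrite ler_wpM2r// ltW.
lra.
Qed.

Section berry_esseen.
Context dO dS dZ (Omega : measurableType dO) (S : measurableType dS) (OZ : measurableType dZ)
  (R : realType) (P : probability Omega R) (PZ : probability OZ R) (n d : nat).
Variables (X : 'I_n -> Omega -> S) (h : 'I_n -> S -> 'cV[R]_d) (Z : OZ -> 'cV[R]_d).
Hypothesis HZ : std_gaussian PZ Z.
Hypothesis mX : forall i, measurable_fun setT (X i).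
Hypothesis mh : forall i, cmeas (h i).
Hypothesis iX : mutually_independent P X.
Let xi i w := h i (X i w).
Hypothesis i3 : forall i, itg P (fun w => enorm (xi i w) ^+ 3).
Hypothesis mean0 : forall i j, Ex P (fun w => xi i w j 0) = 0.
Hypothesis cov1 : forall j l, \sum_i Ex P (fun w => xi i w j 0 * xi i w l 0) = (j == l)%:R.
Variables (g : R).
Hypothesis g0 : 0 < g.
Hypothesis mom3 : \sum_i Ex P (fun w => enorm (xi i w) ^+ 3) <= g.
Hypothesis d0 : (0 < d)%N.
Hypothesis g_small : g <= 1 / 100.
Let W w : 'cV[R]_d := \sum_i xi i w.

Let mxi i : cmeas (xi i). Proof. exact: (cmeas_hX mX mh i). Qed.
Let mW : cmeas W. Proof. exact: cmeas_sum. Qed.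
Let mZ : cmeas Z. Proof. exact: gauss_cmeas HZ. Qed.

Let sublevel_le_smooth dT (T : measurableType dT) (Q : probability T R) (Y : T -> 'cV[R]_d) (mY : cmeas Y) s u l :
  usub s u -> 0 < l -> pr Q [set w | s (Y w) <= 0] <= Ex Q (fun w => smooth s l (Y w)) /\
   Ex Q (fun w => smooth s l (Y w)) <= pr Q [set w | s (Y w) <= 5 / 4 * l].
Proof.
move=> su l0.
have m t := sublevel_meas t (usub_comp_meas mY su).
have I : itg Q (fun w => smooth s l (Y w)).
  by apply: itg_bnd (fun w => smooth_abs s l _); exact: mRd_comp (smooth_meas su l0) mY.
rewrite -!Ex_indic//; split; apply: Ex_le => //; try exact: itg_indic; move=> w; rewrite indicE.
- have /andP[h0 _] := smooth01 s l (Y w).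
  by case: (boolP (w \in _)) => // /set_mem/= h1; rewrite (smooth_eq1 su l0 h1).
- have /andP[h0 h1] := smooth01 s l (Y w).
  case: (boolP (w \in _)) => // /negP h2; rewrite (smooth_eq0 su l0)//.
  by rewrite leNgt; apply/negP => h3; apply: h2; apply/mem_set; exact: ltW.
Qed.

Let sd1 : 1 <= Num.sqrt d%:R :> R.
Proof. by rewrite -[leLHS]sqrtr1 ler_wsqrtr// ler1n. Qed.

Let bound_ge0 : 0 <= 215 * Num.sqrt d%:R * g.
Proof. by apply: mulr_ge0 (ltW g0); apply: mulr_ge0; [exact: ler0n|exact: sqrtr_ge0]. Qed.

Let gauss_shift_level s u : usub s u ->
  pr PZ [set w | s (Z w) <= 50 * g] <= pr PZ [set w | s (Z w) <= 0] + 50 * g * Num.sqrt d%:R.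
Proof.
move=> su; have g50 : 0 <= 50 * g by rewrite mulr_ge0// ltW.
have m t := sublevel_meas t (usub_comp_meas mZ su).
have mc := gauss_collar_meas HZ su 0 (0 + 50 * g).
apply: (@le_trans _ _ (pr PZ ([set w | s (Z w) <= 0] `|` [set w | 0 <= s (Z w) <= 0 + 50 * g]))).
  apply: le_pr; [exact: m|exact: measurableU|] => w /= h1.
  by case: (leP (s (Z w)) 0) => h2; [left|right; rewrite add0r h1 (ltW h2)].
rewrite (le_trans (pr_setU _ (m 0) mc))// lerD2l (mulrC _ (Num.sqrt _)).
exact: (gauss_collar HZ su 0 g50).
Qed.

(* The smoothing costs O(g), while the a priori bound K enters the comparison of the smoothed
   indicators only as 7 / 40 * K: hence e can be halved. *)
Let refine (e : R) : 0 <= e -> (forall s u, usub s u ->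
  `|pr P [set w | s (W w) <= 0] - pr PZ [set w | s (Z w) <= 0]| <= 215 * Num.sqrt d%:R * g + e) ->
  forall s u, usub s u -> `|pr P [set w | s (W w) <= 0] - pr PZ [set w | s (Z w) <= 0]| <= 215 * Num.sqrt d%:R * g + e / 2.
Proof.
move=> e0 HK s u su; set K := 215 * Num.sqrt d%:R * g + e.
have K0 : 0 <= K := addr_ge0 bound_ge0 e0.
have l0 : 0 < 40 * g by rewrite mulr_gt0.
have cmp s' u' (su' : usub s' u') := smooth_comparison HZ mX mh iX i3 mean0 cov1 g0 mom3 d0 g_small su' erefl K0 HK.
have cK := num_be_const sd1 g0 e0 (erefl K).
have l5 : 5 / 4 * (40 * g) = 50 * g by field.
have g50 : 0 <= 50 * g by rewrite mulr_ge0// ltW.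
apply: dist_le2.
  (* Smoothing the shrunken set [s + 50 g <= 0] keeps the upper level for [W] at [s <= 0]; the
     collar of width 50 g is then paid under the Gaussian law, in this direction as in the other. *)
  have su' := usubD (50 * g) su.
  have [a1 a2] := sublevel_le_smooth PZ mZ su' l0; have [b1 b2] := sublevel_le_smooth P mW su' l0.
  have shift dT (T : measurableType dT) (Y : T -> 'cV[R]_d) : [set w | s (Y w) + 50 * g <= 50 * g] = [set w | s (Y w) <= 0].
    by apply/seteqP; split => w /=; rewrite gerDr.
  have shift' : [set w | s (Z w) + 50 * g <= 50 * g] = [set w | s (Z w) <= 0] by exact: shift.
  have := gauss_shift_level su'; rewrite shift' => h1.
  rewrite l5 shift in b2.
  have h2 := num_be_down a1 (cmp _ _ su') b2.
  apply: (le_trans h1); rewrite -lerBrDr; apply: (le_trans h2).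
  by rewrite lerBrDr -addrA lerD2l addrC.
have [a1 a2] := sublevel_le_smooth PZ mZ su l0; have [b1 b2] := sublevel_le_smooth P mW su l0.
rewrite l5 in a2.
have := num_be_up b1 (cmp _ _ su) a2 (gauss_shift_level su).
by move=> /le_trans; apply; rewrite -addrA lerD2l.
Qed.

(** The trivial bound 1 starts the iteration of [refine], and each application halves the excess
    over the target. *)
Lemma berry_esseen s u : usub s u ->
  `|pr P [set w | s (W w) <= 0] - pr PZ [set w | s (Z w) <= 0]| <= 215 * Num.sqrt d%:R * g.
Proof.
move=> su.
have iter k s' u' : usub s' u' ->
  `|pr P [set w | s' (W w) <= 0] - pr PZ [set w | s' (Z w) <= 0]| <= 215 * Num.sqrt d%:R * g + 2^-1 ^+ k.
  elim: k s' u' => [|k IH] s' u' su'.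
    rewrite expr0.
    have p1 := pr_le1 P (sublevel_meas 0 (usub_comp_meas mW su')); have p2 := pr_le1 PZ (sublevel_meas 0 (usub_comp_meas mZ su')).
    have p3 := pr_ge0 P [set w | s' (W w) <= 0]; have p4 := pr_ge0 PZ [set w | s' (Z w) <= 0].
    have h0 := bound_ge0.
    by rewrite ler_norml; apply/andP; split; lra.
  by rewrite exprSr; apply: (refine (e := 2^-1 ^+ k)) su'; rewrite ?exprn_ge0.
apply/ler_addgt0Pr => e e0.
have [k hk] : exists k, 2^-1 ^+ k <= e.
  have := @cvg_expr R 2^-1; rewrite ger0_norm// invf_lt1// ltr1n => /(_ isT).
  move=> /cvgrPdist_le /(_ e e0)[k _ hk]; exists k; have := hk k (leqnn k).
  by rewrite /= sub0r normrN ger0_norm// exprn_ge0.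
by apply: le_trans (iter k _ _ su) _; rewrite lerD2l.
Qed.

End berry_esseen.

Lemma pr_bigcap (R : realType) dT (T : measurableType dT) (Q : probability T R) (F : (set T)^nat) e : 0 < e ->
  (forall k, measurable (F k)) -> (forall k, F k.+1 `<=` F k) ->
  exists k, pr Q (F k) <= pr Q (\bigcap_k F k) + e.
Proof.
move=> e0 mF dF; have mI : measurable (\bigcap_k F k) by exact: bigcap_measurable.
have nF : nonincreasing_seq F by apply/nonincreasing_seqP => k; apply/subsetPset; exact: dF.
have fin : (Q (F 0%N) < +oo)%E by rewrite (pr_fin Q (mF 0%N)) ltry.
have h := nonincreasing_cvg_mu fin mF mI nF.
have {}h : (pr Q \o F) @ \oo --> pr Q (\bigcap_k F k).
  by apply: fine_cvg; rewrite -(pr_fin Q mI).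
move/cvgrPdist_le : h => /(_ e e0)[k _ hk]; exists k; have := hk k (leqnn k).
by rewrite ler_norml /= => /andP[]; lra.
Qed.

(** [concentration] asks for widths in a bounded interval [[0, B]]. The cut provides this and is
    1-Lipschitz, so the differences of [De] and [Di i] do not grow. *)
Definition cut (R : realType) (M x : R) := Num.min (Num.max x 0) M.

Lemma cut_bnd (R : realType) (M x : R) : 0 <= M -> 0 <= cut M x <= M.
Proof. by move=> M0; rewrite /cut le_min M0 andbT le_max lexx orbT/= ge_min lexx orbT. Qed.

Lemma cut_lip (R : realType) (M x y : R) : `|cut M x - cut M y| <= `|x - y|.
Proof.
have hmin (a b : R) : `|Num.min a M - Num.min b M| <= `|a - b|.
  rewrite /Num.min; do 2 case: ltP => ?; rewrite ?subrr ?normr0// ler_norml;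
    by case: (ler0P (a - b)) => ?; apply/andP; split; lra.
apply: le_trans (hmin _ _) _; rewrite /Num.max; do 2 case: ltP => ?; rewrite ?subrr ?normr0// ler_norml;
  by case: (ler0P (x - y)) => ?; apply/andP; split; lra.
Qed.

Lemma cut_id (R : realType) (M x : R) : 0 <= x -> x <= M -> cut M x = x.
Proof. by move=> x0 xM; rewrite /cut (max_idPl x0) (min_idPl xM). Qed.

Lemma cut_le (R : realType) (M x : R) : 0 <= x -> cut M x <= x.
Proof. by move=> x0; rewrite /cut (max_idPl x0) ge_min lexx. Qed.

Lemma cut_meas dT (T : measurableType dT) (R : realType) (M : R) (f : T -> R) :
  measurable_fun setT f -> measurable_fun setT (fun w => cut M (f w)).
Proof. by move=> mf; apply: measurable_minr => //; exact: measurable_maxr. Qed.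

(** With [k = 2 g] truncation keeps half of the variance, which is the origin of the factors 2 in
    the theorem; 15 = 2 * (6 + 3/2) collects [3 * k] and [(g + k) / 2]. *)
Lemma num_conc (R : realType) (p sd g C1 C2 E a : R) : 1 <= sd -> 0 < g ->
  1 / 2 * p <= E + C2 + (g + 2 * g) / 2 -> E = C1 + 3 * (2 * g) * a -> a <= sd ->
  p <= 2 * C1 + 2 * C2 + 15 * sd * g.
Proof.
move=> d1 g0 h EE ha; rewrite EE in h; have : 1 * g <= sd * g by rewrite ler_wpM2r// ltW.
have : g * a <= g * sd by rewrite ler_wpM2l// ltW.
lra.
Qed.

Lemma num_final (R : realType) (p q r c e K1 K2 : R) : p <= q + c + e -> `|q - r| <= K1 -> c <= K2 -> p <= r + (K1 + K2) + e.
Proof. by move=> h1; rewrite ler_norml => /andP[_ h2] h3; lra. Qed.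

Lemma num_final' (R : realType) (p q r c e K1 K2 : R) : p <= q + c + e -> `|p - r| <= K1 -> c <= K2 -> r <= q + (K1 + K2) + e.
Proof. by move=> h1; rewrite ler_norml => /andP[h2 _] h3; lra. Qed.

Section nonlinear.
Context dO dS dZ (Omega : measurableType dO) (S : measurableType dS) (OZ : measurableType dZ)
  (R : realType) (P : probability Omega R) (PZ : probability OZ R) (n d : nat).
Variables (X : 'I_n -> Omega -> S) (h : 'I_n -> S -> 'cV[R]_d) (Z : OZ -> 'cV[R]_d).
Hypothesis HZ : std_gaussian PZ Z.
Hypothesis mX : forall i, measurable_fun setT (X i).
Hypothesis mh : forall i, cmeas (h i).
Hypothesis iX : mutually_independent P X.
Let xi i w := h i (X i w).
Hypothesis i3 : forall i, itg P (fun w => enorm (xi i w) ^+ 3).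
Hypothesis mean0 : forall i j, Ex P (fun w => xi i w j 0) = 0.
Hypothesis cov1 : forall j l, \sum_i Ex P (fun w => xi i w j 0 * xi i w l 0) = (j == l)%:R.
Variables (g : R).
Hypothesis g0 : 0 < g.
Hypothesis mom3 : \sum_i Ex P (fun w => enorm (xi i w) ^+ 3) <= g.
Hypothesis d0 : (0 < d)%N.
Hypothesis g_small : g <= 1 / 100.
Let W w : 'cV[R]_d := \sum_i xi i w.

Let mxi i : cmeas (xi i). Proof. exact: (cmeas_hX mX mh i). Qed.
Let mW : cmeas W. Proof. exact: cmeas_sum. Qed.
Variables (T : Omega -> 'cV[R]_d) (De : Omega -> R) (Di : 'I_n -> Omega -> R) (N : set Omega).
Hypothesis mT : cmeas T.
Hypothesis mDe : measurable_fun setT De.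
Hypothesis mDi : forall i, measurable_fun setT (Di i).
Hypothesis De0 : forall w, 0 <= De w.
Hypothesis mN : measurable N.
Hypothesis N0 : pr P N = 0.
Hypothesis dom : forall w, ~ N w -> enorm (T w - W w) <= De w.
Hypothesis Di_indep : forall i, independent_of_coordinate P X i (Di i).
Hypothesis iWD : itg P (fun w => enorm (W w) * De w).
Hypothesis iD : forall i, itg P (fun w => enorm (xi i w) * `|De w - Di i w|).

Let sd1 : 1 <= Num.sqrt d%:R :> R.
Proof. by rewrite -[leLHS]sqrtr1 ler_wsqrtr// ler1n. Qed.
Let W1 : itg P (fun w => enorm (W w)).
Proof. exact: (itg_norm mW (itg_norm_sum3 mxi i3)). Qed.

Let loss := 2 * Ex P (fun w => enorm (W w) * De w) +
  2 * \sum_i Ex P (fun w => enorm (xi i w) * `|De w - Di i w|) + 15 * Num.sqrt d%:R * g.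

(* The collar lies outside the sublevel set of s for sg = false and inside it for sg = true.
   Truncating at level M preserves the independence of the i-th summand and Di i. *)
Let cut_collar M (sg : bool) s u : 0 <= M -> usub s u ->
  pr P [set w | - (sg%:R * (cut M (De w) + 3 * (2 * g))) + 2 * (2 * g) <= s (W w) <=
     - (sg%:R * (cut M (De w) + 3 * (2 * g))) + (cut M (De w) + 3 * (2 * g)) - 2 * g] <= loss.
Proof.
move=> M0 su; have k0 : 0 < 2 * g by rewrite mulr_gt0.
have th e : enorm e = 1 -> 1 / 2 <= \sum_i Ex P (fun w => dot (trunc (2 * g) (xi i w)) e ^+ 2).
  move=> e1; have := trunc_var mX mh i3 cov1 mom3 k0 e1.
  by rewrite (_ : 1 - g / (2 * g) = 1 / 2)//; field; rewrite gt_eqF.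
have mc i : indep2 P (xi i : Omega -> Rd R d) (fun w => (W w - xi i w : Rd R d, cut M (Di i w))).
  move=> B C mB mC.
  pose f (p : Rd R d * R) := (p.1, cut M p.2).
  have mf : measurable_fun setT f.
    by apply/measurable_fun_pairP; split; [exact: measurable_fst|exact: (cut_meas M measurable_snd)].
  have mC' : measurable (f @^-1` C) by rewrite -[X in measurable X]setTI; exact: mf measurableT _ mC.
  have H := indep_rest_extra mh (@Di_indep i) mB mC'.
  exact: H.
have iWc : itg P (fun w => enorm (W w) * cut M (De w)).
  apply: itg_le iWD _ => [|w].
    by apply: measurable_funM; [exact: cmeas_enorm|exact: cut_meas].
  have /andP[c0 _] := cut_bnd (De w) M0.
  rewrite ger0_norm; last by apply: mulr_ge0 => //; exact: enorm_ge0.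
  by apply: ler_wpM2l; [exact: enorm_ge0|exact: cut_le].
have iDc i : itg P (fun w => enorm (xi i w) * `|cut M (De w) - cut M (Di i w)|).
  apply: itg_le (iD i) _ => [|w].
    apply: measurable_funM; first exact: cmeas_enorm.
    by apply: measurableT_comp => //; apply: measurable_funB; exact: cut_meas.
  rewrite ger0_norm; last by apply: mulr_ge0 => //; exact: enorm_ge0.
  by apply: ler_wpM2l; [exact: enorm_ge0|exact: cut_lip].
have := concentration mxi i3 mean0 g0 k0 mom3 (fun i j ij => indep_pair mX mh iX ij) (cut_meas M mDe)
  (fun i => cut_meas M (mDi i)) (fun w => cut_bnd (De w) M0) (fun i w => cut_bnd (Di i w) M0) mc th sg su.
have EE : Ex P (fun w => enorm (\sum_i xi i w) * (cut M (De w) + 3 * (2 * g))) =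
    Ex P (fun w => enorm (W w) * cut M (De w)) + 3 * (2 * g) * Ex P (fun w => enorm (W w)).
  rewrite -(ExZ _ W1) -(ExD iWc (itgZ _ W1)); apply: Ex_ext => w.
  by rewrite mulrDr (mulrC (3 * _)).
move=> h1; apply: (le_trans (num_conc sd1 g0 h1 EE (Ex_norm_W mX mh iX i3 mean0 cov1))).
rewrite /loss lerD2r; apply: lerD; apply: ler_wpM2l => //.
  apply: (Ex_le iWc iWD) => w; apply: ler_wpM2l; [exact: enorm_ge0|exact: cut_le].
apply: ler_sum => i _; apply: (Ex_le (iDc i) (iD i)) => w.
by apply: ler_wpM2l; [exact: enorm_ge0|exact: cut_lip].
Qed.

Let mcollar (lo hi : Omega -> R) s u : usub s u -> measurable_fun setT lo -> measurable_fun setT hi ->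
  measurable [set w | lo w <= s (W w) <= hi w].
Proof.
move=> su mlo mhi; have ms := usub_comp_meas mW su.
rewrite (_ : [set w | _] = [set w | lo w <= s (W w)] `&` [set w | s (W w) <= hi w]); last first.
  by apply/seteqP; split => w /=; [move/andP|case=> -> ->].
apply: measurableI; rewrite -[X in measurable X]setTI.
  exact: measurable_fun_le.
exact: measurable_fun_le.
Qed.

Let m0 : measurable_fun setT (fun _ : Omega => 0 : R). Proof. exact: measurable_cst. Qed.

Let tail e : 0 < e -> exists2 M : R, 0 <= M & pr P [set w | M < De w] <= e.
Proof.
move=> e0; pose F (k : nat) := [set w | k%:R < De w].
have mF k : measurable (F k).
  have := mDe measurableT (measurable_itv `]k%:R, +oo[).
  by rewrite setTI; congr measurable; apply/seteqP; split => w /=; rewrite in_itv/= andbT.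
have dF k : F k.+1 `<=` F k by move=> w /=; apply: lt_trans; rewrite ltr_nat.
have [k hk] := pr_bigcap P e0 mF dF; exists k%:R => //; apply: (le_trans hk).
rewrite (_ : \bigcap_k F k = set0) ?/pr ?measure0 ?add0r//.
apply/seteqP; split => // w /= h1.
by have := h1 (Num.truncn (De w)).+1 I; rewrite /F/= ltNge (ltW (truncnS_gt _)).
Qed.

Let mDM M : measurable [set w | M < De w].
Proof.
have := mDe measurableT (measurable_itv `]M, +oo[).
by rewrite setTI; congr measurable; apply/seteqP; split => w /=; rewrite in_itv/= andbT.
Qed.

Let up_collar s u : usub s u -> pr P [set w | 0 <= s (W w) <= De w] <= loss.
Proof.
move=> su; apply/ler_addgt0Pr => e e0; have [M M0 hM] := tail e0.
have mC := mcollar su m0 (cut_meas M mDe).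
(* The shift by [4 g] cancels both margins: the window is then exactly from 0 to the cut width. *)
have := cut_collar false M0 (usubD (2 * (2 * g)) su).
rewrite (_ : [set w | _ <= _ <= _] = [set w | 0 <= s (W w) <= cut M (De w)]); last first.
  by apply/seteqP; split => w /=; rewrite mul0r oppr0 !add0r => /andP[? ?]; apply/andP; split; lra.
move=> h1; apply: (@le_trans _ _ (pr P ([set w | 0 <= s (W w) <= cut M (De w)] `|` [set w | M < De w]))).
  apply: le_pr; [exact: (mcollar su m0 mDe)|by apply: measurableU|] => w /= /andP[a1 a2].
  by case: (leP (De w) M) => hw; [left; rewrite cut_id// a1|right].
by rewrite (le_trans (pr_setU _ _ _))// lerD.
Qed.

Let down_collar s u : usub s u -> pr P [set w | - De w <= s (W w) <= 0] <= loss.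
Proof.
move=> su; apply/ler_addgt0Pr => e e0; have [M M0 hM] := tail e0.
have mC := mcollar su (measurable_funN (cut_meas M mDe)) m0.
(* Below 0 the upper margin is [2 g], and the shift by [- 2 g] makes the window end at 0. *)
have := cut_collar true M0 (usubD (- (2 * g)) su).
rewrite (_ : [set w | _ <= _ <= _] = [set w | - cut M (De w) <= s (W w) <= 0]); last first.
  by apply/seteqP; split => w /=; rewrite mul1r => /andP[? ?]; apply/andP; split; lra.
move=> h1; apply: (@le_trans _ _ (pr P ([set w | - cut M (De w) <= s (W w) <= 0] `|` [set w | M < De w]))).
  apply: le_pr; [exact: (mcollar su (measurable_funN mDe) m0)|by apply: measurableU|] => w /= /andP[a1 a2].
  by case: (leP (De w) M) => hw; [left; rewrite cut_id// a1|right].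
by rewrite (le_trans (pr_setU _ _ _))// lerD.
Qed.

Let slip s u w : usub s u -> ~ N w -> `|s (T w) - s (W w)| <= De w.
Proof.
move=> su Nw; apply: le_trans (dom Nw); have := usub_lip su (T w) (W w).
by rewrite mul1r.
Qed.

(** Off the null set [N], if [T] and [W] lie on different sides of the level then [s (W w)] is
    within [De w] of it, outside the set in one direction and inside in the other; each collar costs
    [loss]. *)
Lemma level_comparison s u : usub s u ->
  `|pr P [set w | s (T w) <= 0] - pr PZ [set w | s (Z w) <= 0]| <= 215 * Num.sqrt d%:R * g + loss.
Proof.
move=> su; have BE := berry_esseen HZ mX mh iX i3 mean0 cov1 g0 mom3 d0 g_small su.
have mWs := sublevel_meas 0 (usub_comp_meas mW su); have mTs := sublevel_meas 0 (usub_comp_meas mT su).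
have mU := mcollar su m0 mDe.
have mD := mcollar su (measurable_funN mDe) m0.
have drop_null A B C : measurable A -> measurable B -> measurable C -> A `<=` B `|` C `|` N -> pr P A <= pr P B + pr P C + 0.
  move=> mA mB mC ABC; rewrite -N0.
  apply: (@le_trans _ _ (pr P (B `|` C `|` N))).
    by apply: le_pr => //; apply: measurableU => //; exact: measurableU.
  by rewrite (le_trans (pr_setU _ _ _)) ?lerD2r ?pr_setU//; exact: measurableU.
have up : pr P [set w | s (T w) <= 0] <= pr P [set w | s (W w) <= 0] + pr P [set w | 0 <= s (W w) <= De w] + 0.
  apply: drop_null => // w /= sT; case: (pselect (N w)) => [|Nw]; [by right|left].
  have := slip su Nw; rewrite ler_norml => /andP[h1 h2].
  by case: (leP (s (W w)) 0) => hw; [left|right; apply/andP; split; lra].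
have down : pr P [set w | s (W w) <= 0] <= pr P [set w | s (T w) <= 0] + pr P [set w | - De w <= s (W w) <= 0] + 0.
  apply: drop_null => // w /= sT; case: (pselect (N w)) => [|Nw]; [by right|left].
  have := slip su Nw; rewrite ler_norml => /andP[h1 h2].
  by case: (leP (s (T w)) 0) => hw; [left|right; apply/andP; split; lra].
apply: dist_le2.
  by have := num_final' down BE (down_collar su); rewrite addr0.
by have := num_final up BE (up_collar su); rewrite addr0.
Qed.

End nonlinear.

(** * Approximation of convex sets by polytopes *)

Section convex_geometry.
Context {R : realType} {d : nat}.
Variable A : set 'cV[R]_d.
Hypothesis cA : forall x y t, A x -> A y -> 0 <= t -> t <= 1 -> A (t *: x + (1 - t) *: y).

Section projection.
Variables (q a0 : 'cV[R]_d).
Hypothesis Aa0 : A a0.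
Let E := [set enorm (q - a) | a in A].
Let D := inf E.

Let E_inf : has_inf E.
Proof. by split; [exists (enorm (q - a0)), a0|exists 0 => _ [a _ <-]; exact: enorm_ge0]. Qed.

Let D_le a : A a -> D <= enorm (q - a).
Proof. by move=> Aa; apply: (ge_inf E_inf.2); exists a. Qed.

Let D0 : 0 <= D.
Proof. by apply: lb_le_inf; [exact: E_inf.1|move=> _ [a _ <-]; exact: enorm_ge0]. Qed.

Let near_opt k : exists a, A a /\ enorm (q - a) < D + k.+1%:R^-1.
Proof.
have k0 : 0 < k.+1%:R^-1 :> R by rewrite invr_gt0.
by have [_ [a Aa <-] h] := inf_adherent k0 E_inf; exists a.
Qed.

Lemma parallelogram (x y : 'cV[R]_d) :
  enorm (x - y) ^+ 2 = 2 * enorm x ^+ 2 + 2 * enorm y ^+ 2 - 4 * enorm ((1 / 2) *: x + (1 - 1 / 2) *: y) ^+ 2.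
Proof. by rewrite !sqr_enorm !dotDl !dotDr !dotZl !dotZr !dotNl !dotNr (dotC y x); field. Qed.

(** The midpoint of [a] and [b] lies in [A], hence at distance at least [D] from [q]; the
    parallelogram law then forces near-minimisers to be close. *)
Let cauchy_pair a b e : A a -> A b -> 0 <= e -> enorm (q - a) <= D + e -> enorm (q - b) <= D + e ->
  enorm ((q - a) - (q - b)) ^+ 2 <= 4 * e * (2 * D + e).
Proof.
move=> Aa Ab e0 ha hb; rewrite parallelogram.
have h12 : (1 / 2) *: (q - a) + (1 - 1 / 2) *: (q - b) = q - ((1 / 2) *: a + (1 - 1 / 2) *: b).
  by apply/matrixP => i j; rewrite !mxE; field.
have h1 : enorm (q - a) ^+ 2 <= (D + e) ^+ 2 by rewrite lerXn2r ?nnegrE ?enorm_ge0 ?addr_ge0.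
have h2 : enorm (q - b) ^+ 2 <= (D + e) ^+ 2 by rewrite lerXn2r ?nnegrE ?enorm_ge0 ?addr_ge0.
have h3 : D ^+ 2 <= enorm (q - ((1 / 2) *: a + (1 - 1 / 2) *: b)) ^+ 2.
  rewrite lerXn2r ?nnegrE ?enorm_ge0//; apply: D_le; apply: cA => //; lra.
by rewrite h12; move: h1 h2 h3; rewrite sqrrD; set x := enorm _ ^+ 2; set y := enorm _ ^+ 2; set z := enorm _ ^+ 2; lra.
Qed.

(** [q - v] is the projection of [q] on the closure of [A], described through points of [A] that
    approach it. *)
Let limit : exists v : 'cV[R]_d, forall e, 0 < e -> exists a, [/\ A a, enorm (q - a) <= D + e & enorm (q - a - v) <= e].
Proof.
have [a aP] := choice near_opt.
pose f (j : 'I_d) (k : nat) : R := (q - a k) j 0.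
have small (e : R) : 0 < e -> exists N : nat, forall k, (N <= k)%N -> k.+1%:R^-1 <= e.
  move=> e0; have [N _ NP] := near_infty_natSinv_lt (PosNum e0).
  by exists N => k Nk; exact: ltW (NP k Nk).
have cv j : cvg (f j @ \oo).
  apply: cauchy_cvg; apply: cauchy_exP => e e0.
  (* With [e' <= 1], the bound 4 e' (2 D + e') of [cauchy_pair] is below 8 e' (2 D + 1) <= e^2. *)
  pose e' := Num.min 1 (e ^+ 2 / (8 * (2 * D + 1))).
  have D1 : 0 < 8 * (2 * D + 1) by rewrite mulr_gt0// ltr_wpDl// mulr_ge0.
  have e'0 : 0 < e' by rewrite lt_min ltr01 divr_gt0// exprn_gt0.
  have [N NP] := small _ e'0; exists (f j N); exists N => // k /= Nk.
  rewrite /ball /= -(@ltr_pXn2r _ 2) ?nnegrE ?(ltW e0)//.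
  have hk : enorm (q - a k) <= D + e'.
    by rewrite (le_trans (ltW (aP k).2))// lerD2l NP.
  have hN : enorm (q - a N) <= D + e'.
    by rewrite (le_trans (ltW (aP N).2))// lerD2l NP.
  have := cauchy_pair (aP N).1 (aP k).1 (ltW e'0) hN hk.
  have -> : f j N - f j k = ((q - a N) - (q - a k)) j 0 by rewrite /f !mxE.
  have : `|((q - a N) - (q - a k)) j 0| ^+ 2 <= enorm ((q - a N) - (q - a k)) ^+ 2.
    by rewrite lerXn2r ?nnegrE ?enorm_ge0// coord_le_enorm.
  move=> /le_trans h /h{h} /le_lt_trans; apply.
  have h1 : e' <= 1 by rewrite ge_min lexx.
  have h2 : e' * (8 * (2 * D + 1)) <= e ^+ 2 by rewrite -ler_pdivlMr// ge_min lexx orbT.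
  have h3 : e' * e' <= e' * 1 by rewrite ler_wpM2l// ltW.
  have h4 : 0 <= e' * D by rewrite mulr_ge0// ltW.
  lra.
exists (\col_j lim (f j @ \oo)) => e e0.
pose e' := e / (d%:R + 1).
have d1 : 0 < d%:R + 1 :> R by rewrite ltr_wpDl.
have e'0 : 0 < e' by rewrite divr_gt0.
have := @filter_forall _ 'I_d (fun j k => `|lim (f j @ \oo) - f j k| <= e') \oo _.
case=> [j|N1 _ N1P]; first by have /cvgrPdist_le/(_ _ e'0) := cv j.
have [N2 N2P] := small _ e0.
have := N1P (maxn N1 N2) (leq_maxl _ _); have := N2P (maxn N1 N2) (leq_maxr _ _).
set k := maxn _ _ => h1 h2; exists (a k); split; first exact: (aP k).1.
  by rewrite (le_trans (ltW (aP k).2))// lerD2l.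
apply: (le_trans (enorm_le_sum _)).
apply: (@le_trans _ _ (\sum_(j < d) e')).
  by apply: ler_sum => j _; rewrite !mxE distrC; have := h2 j; rewrite /f !mxE.
rewrite sumr_const card_ord -(mulr_natl e') /e' mulrA ler_pdivrMr// mulrC.
by apply: ler_wpM2l; [exact: ltW|rewrite lerDl].
Qed.

(** [v] is the shortest vector in the closure of [q - A]; moving from the projection [q - v] towards
    a point [a] cannot shorten it, which bounds [dot v (a - q + v)] by 0. The separating hyperplane
    passes through the projection. *)
Lemma separation : 0 < D -> exists v c, [/\ enorm v = 1, forall a, A a -> dot v a - c <= 0 & 0 < dot v q - c].
Proof.
move=> Dp; have [v vP] := limit.
have vD : enorm v <= D.
  apply/ler_addgt0Pr => e e0; have e20 : 0 < e / 2 by rewrite divr_gt0.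
  have [a [Aa h1 h2]] := vP _ e20.
  have := enormB (q - a) (q - a - v); rewrite opprB addrC subrK => h3.
  by lra.
have Dv a t : A a -> 0 <= t -> t <= 1 -> D <= enorm (v - t *: (a - q + v)).
  move=> Aa t0 t1; apply/ler_addgt0Pr => e e0; have [b [Ab _ hb]] := vP _ e0.
  apply: (le_trans (D_le (cA Aa Ab t0 t1))).
  have -> : q - (t *: a + (1 - t) *: b) = (v - t *: (a - q + v)) + (1 - t) *: (q - b - v).
    by apply/matrixP => i j; rewrite !mxE; ring.
  rewrite (le_trans (enormD _ _))// lerD2l enormZ ger0_norm ?subr_ge0//.
  by rewrite (le_trans _ hb)// ler_piMl ?enorm_ge0// lerBlDr lerDl.
have vE : enorm v = D.
  apply/eqP; rewrite eq_le vD/=; have := Dv a0 0 Aa0 (lexx _) ler01.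
  by rewrite scale0r subr0.
have key a : A a -> dot v (a - q + v) <= 0.
  move=> Aa; apply/ler_addgt0Pr => e e0; rewrite add0r.
  have [b bE] : exists b, b = a - q + v by eexists.
  rewrite -bE; have b0 : 0 <= dot b b by exact: dotxx_ge0.
  (* The comparison of lengths yields 2 (v . b) <= t |b|^2, which this choice keeps below 2 e. *)
  pose t := Num.min 1 (2 * e / (dot b b + 1)).
  have b1 : 0 < dot b b + 1 by rewrite ltr_wpDl.
  have t0 : 0 < t by rewrite lt_min ltr01 divr_gt0// mulr_gt0.
  have t1 : t <= 1 by rewrite ge_min lexx.
  have tb : t * (dot b b + 1) <= 2 * e by rewrite -ler_pdivlMr// ge_min lexx orbT.
  have := Dv a t Aa (ltW t0) t1; rewrite -bE -vE => h.
  have : enorm v ^+ 2 <= enorm (v - t *: b) ^+ 2 by rewrite lerXn2r ?nnegrE ?enorm_ge0.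
  rewrite !sqr_enorm !dotDl !dotDr !dotNl !dotNr !dotZl !dotZr (dotC b v) => h'.
  have : t * (2 * dot v b) <= t * (t * dot b b) by lra.
  by rewrite ler_pM2l// => h2; lra.
have D20 : dot v v = D ^+ 2 by rewrite -sqr_enorm vE.
exists (D^-1 *: v), (D^-1 * (dot v q - D ^+ 2)); split.
- by rewrite enormZ vE ger0_norm ?invr_ge0// mulVf// gt_eqF.
- move=> a Aa; rewrite dotZl -mulrBr pmulr_rle0 ?invr_gt0//.
  by have := key a Aa; rewrite dotDr dotBr D20; lra.
- rewrite dotZl -mulrBr pmulr_rgt0 ?invr_gt0// opprB addrCA subrr addr0.
  by rewrite exprn_gt0.
Qed.

Lemma close_point : D <= 0 -> forall e, 0 < e -> exists a, A a /\ enorm (q - a) < e.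
Proof.
move=> D00 e e0; have [_ [a Aa <-] h] := inf_adherent e0 E_inf.
by exists a; split => //; rewrite (lt_le_trans h)//; rewrite -/D; lra.
Qed.

End projection.

(* A convex set that is dense in a box contains every point of the box: fix the coordinates
   of an approximating point one after the other. *)
Lemma dense_box (x : 'cV[R]_d) (r : R) :
  (forall y : 'cV[R]_d, (forall j, `|y j 0 - x j 0| < r) -> forall e, 0 < e -> exists a, A a /\ forall j, `|a j 0 - y j 0| < e) ->
  0 < r -> A x.
Proof.
move=> dense r0.
have step k : forall y : 'cV[R]_d, (forall j, `|y j 0 - x j 0| < r) -> forall e, 0 < e ->
    exists a, [/\ A a, forall j : 'I_d, (j < k)%N -> a j 0 = y j 0 & forall j, `|a j 0 - y j 0| < e].
  elim: k => [|k IH] y yx e e0.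
    by have [a [Aa ha]] := dense y yx e e0; exists a; split.
  have [kd|kd] := ltnP k d; last first.
    have [a [Aa h1 h2]] := IH y yx e e0; exists a; split => // j jk.
    by apply: h1; rewrite (leq_trans (ltn_ord j)).
  pose i := Ordinal kd.
  pose m := Num.min (e / 2) ((r - `|y i 0 - x i 0|) / 2).
  have m0 : 0 < m by rewrite lt_min !divr_gt0// subr_gt0.
  have me : m <= e / 2 by rewrite ge_min lexx.
  have mr : m <= (r - `|y i 0 - x i 0|) / 2 by rewrite ge_min lexx orbT.
  have yi := yx i; have ny := normr_ge0 (y i 0 - x i 0).
  pose yy (sg : R) := y + (sg * m) *: bvec i.
  have yyi sg : yy sg i 0 = y i 0 + sg * m by rewrite !mxE !eqxx mulr1.
  have yyj sg (j : 'I_d) : j != i -> yy sg j 0 = y j 0.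
    by move=> ji; rewrite !mxE (negbTE ji) mulr0 addr0.
  have yyx sg : `|sg| = 1 -> forall j, `|yy sg j 0 - x j 0| < r.
    move=> sg1 j; have [->|ji] := eqVneq j i; last by rewrite yyj.
    rewrite yyi addrAC (le_lt_trans (ler_normD _ _))// normrM sg1 mul1r (gtr0_norm m0); lra.
  have n1 : `|1 : R| = 1 by rewrite normr1.
  have n2 : `|- 1 : R| = 1 by rewrite normrN normr1.
  have [a [Aa a1 a2]] := IH _ (yyx _ n1) m m0.
  have [b [Ab b1 b2]] := IH _ (yyx _ n2) m m0.
  have ai := a2 i; have bi := b2 i; rewrite !yyi mul1r mulN1r in ai bi.
  have ai' : y i 0 < a i 0 by move: ai; rewrite ltr_norml => /andP[]; lra.
  have bi' : b i 0 < y i 0 by move: bi; rewrite ltr_norml => /andP[]; lra.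
  have ab : 0 < a i 0 - b i 0 by lra.
  (* [a] and [b] approximate the points moved up and down by [m] in coordinate [i], so they lie on
     either side of [y i 0]; this combination hits it exactly and keeps the coordinates already
     fixed. *)
  have [t tE] : exists t, t = (y i 0 - b i 0) / (a i 0 - b i 0) by eexists.
  have t0 : 0 <= t by rewrite tE divr_ge0//; lra.
  have t1 : t <= 1 by rewrite tE ler_pdivrMr//; lra.
  exists (t *: a + (1 - t) *: b); split; first exact: cA.
    move=> j; rewrite ltnS leq_eqVlt => /orP[/eqP jk|jk].
      have -> : j = i by apply: val_inj.
      by rewrite !mxE tE; field; rewrite gt_eqF.
    have ji : j != i by rewrite -val_eqE/= ltn_eqF.
    by rewrite !mxE a1// b1// !yyj//; ring.
  move=> j; have [->|ji] := eqVneq j i.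
    have -> : (t *: a + (1 - t) *: b) i 0 = y i 0 by rewrite !mxE tE; field; rewrite gt_eqF.
    by rewrite subrr normr0.
  have aj := a2 j; have bj := b2 j; rewrite !yyj// in aj bj.
  rewrite !mxE (_ : _ - _ = t * (a j 0 - y j 0) + (1 - t) * (b j 0 - y j 0)); last by ring.
  rewrite (le_lt_trans (ler_normD _ _))// !normrM (ger0_norm t0) (@ger0_norm _ (1 - t)) ?subr_ge0//.
  have : t * `|a j 0 - y j 0| <= t * m by rewrite ler_wpM2l// ltW.
  have : (1 - t) * `|b j 0 - y j 0| <= (1 - t) * m by rewrite ler_wpM2l ?subr_ge0// ltW.
  lra.
have xx j : `|x j 0 - x j 0| < r by rewrite subrr normr0.
have [a [Aa h1 _]] := step d x xx 1 ltr01.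
by have -> : x = a by apply/colP => j; rewrite h1.
Qed.

End convex_geometry.

Section polytopes.
Context {R : realType} {d : nat}.

Definition aff (p : 'cV[R]_d * R) x := dot p.1 x - p.2.

Fixpoint smax (f : nat -> 'cV[R]_d * R) k x :=
  if k is k'.+1 then Num.max (smax f k' x) (aff (f k) x) else aff (f 0%N) x.

Lemma smax_le f k x t : smax f k x <= t <-> forall i, (i <= k)%N -> aff (f i) x <= t.
Proof.
elim: k => [|k IH] /=; first by split => [h i|]; [rewrite leqn0 => /eqP ->|apply].
rewrite ge_max; split => [/andP[/IH h1 h2] i|h].
  by rewrite leq_eqVlt => /orP[/eqP -> //|]; exact: h1.
by rewrite h// andbT; apply/IH => i ik; apply: h; exact: leqW.
Qed.

Lemma usub_aff p : enorm p.1 = 1 -> usub (aff p) (fun=> p.1).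
Proof. by move=> p1; split => [|//|x y]; [exact: cmeas_cst|rewrite /aff dotBr; lra]. Qed.

Lemma usub_max (s1 s2 : 'cV[R]_d -> R) u1 u2 : usub s1 u1 -> usub s2 u2 ->
  usub (fun x => Num.max (s1 x) (s2 x)) (fun x => if s1 x < s2 x then u2 x else u1 x).
Proof.
move=> su1 su2; have m1 := usub_meas su1; have m2 := usub_meas su2.
case: su1 => mu1 n1 h1; case: su2 => mu2 n2 h2; split.
- move=> j; under eq_fun do rewrite (fun_if (fun z : 'cV[R]_d => z j 0)).
  by apply: measurable_fun_ifT; [exact: measurable_fun_ltr|exact: mu2|exact: mu1].
- by move=> x; case: ifP.
- move=> x y; rewrite le_max /Num.max; case: ifPn => _.
    by rewrite h2 orbT.
  by rewrite h1.
Qed.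

Lemma smax_usub f k : (forall i, enorm (f i).1 = 1) -> exists u, usub (smax f k) u.
Proof.
move=> f1; elim: k => [|k [u su]]; first by exists (fun=> (f 0%N).1); exact: usub_aff.
exact: (ex_intro _ _ (usub_max su (usub_aff (f1 k.+1)))).
Qed.

Lemma rat_approx (y : 'cV[R]_d) e : 0 < e -> exists q : 'cV[rat]_d, forall j, `|ratr (q j 0) - y j 0| < e.
Proof.
move=> e0; have h j : exists r : rat, `|ratr r - y j 0| < e.
  have : y j 0 - e < y j 0 + e by rewrite ltrBlDr -addrA ltrDl addr_gt0.
  by move=> /rat_in_itvoo[r]; rewrite in_itv/= => rP; exists r; rewrite ltr_distl.
by have [Q QP] := choice h; exists (\col_j Q j) => j; rewrite mxE.
Qed.

(** Each rational point is given a half-space that contains [A] and excludes the point, whenever one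
    exists. If all functionals are at most [- eta] at [x], no rational point near [x] is excluded,
    so [A] is dense near [x] and [dense_box] applies. If no rational point is excluded at all, [A]
    is the whole space. *)
Lemma halfspaces (A : set 'cV[R]_d) a0 :
  (forall x y t, A x -> A y -> 0 <= t -> t <= 1 -> A (t *: x + (1 - t) *: y)) -> A a0 ->
  A = setT \/ exists f : nat -> 'cV[R]_d * R, [/\ forall k, enorm (f k).1 = 1,
    forall a k, A a -> aff (f k) a <= 0 &
    forall x eta, 0 < eta -> (forall k, aff (f k) x <= - eta) -> A x].
Proof.
move=> cA Aa0; pose emb (q : 'cV[rat]_d) : 'cV[R]_d := \col_j ratr (q j 0).
pose good q (p : 'cV[R]_d * R) := [/\ enorm p.1 = 1, forall a, A a -> aff p a <= 0 & 0 < aff p (emb q)].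
have bad q : ~ (exists p, good q p) -> forall e, 0 < e -> exists a, A a /\ forall j, `|a j 0 - emb q j 0| < e.
  move=> ng e e0; have Dq : inf [set enorm (emb q - a) | a in A] <= 0.
    rewrite leNgt; apply/negP => /(separation cA Aa0)[v [c [h1 h2 h3]]].
    by apply: ng; exists (v, c); split.
  have [a [Aa ha]] := close_point Aa0 Dq e0; exists a; split => // j.
  by rewrite distrC (le_lt_trans _ ha)//; have := coord_le_enorm (emb q - a) j; rewrite !mxE.
have embE q j : emb q j 0 = ratr (q j 0) by rewrite mxE.
case: (pselect (exists q p, good q p)) => [[q0 [p0 g0]]|none]; last first.
  left; apply/seteqP; split => // x _; apply: (dense_box cA (r := 1)) => // y _ e e0.
  have e20 : 0 < e / 2 by rewrite divr_gt0.
  have [q hq] := rat_approx y e20.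
  have [|a [Aa ha]] := bad q _ _ e20; first by move=> [p gp]; apply: none; exists q, p.
  exists a; split => // j; rewrite (le_lt_trans (ler_distD (emb q j 0) _ _))// [ltRHS](splitr e) ltrD//.
  by rewrite embE.
right.
(* The default [p0] is one of the half-spaces, so every term of the sequence contains [A]. *)
pose pick q := if pselect (exists p, good q p) is left h then projT1 (cid h) else p0.
pose f k := if unpickle k is Some q then pick q else p0.
have pickP q : (enorm (pick q).1 = 1 /\ forall a, A a -> aff (pick q) a <= 0) /\
    ((exists p, good q p) -> 0 < aff (pick q) (emb q)).
  rewrite /pick; case: pselect => [h|h]; first by case: (projT2 (cid h)).
  by case: g0.
exists f; split.
- by move=> k; rewrite /f; case: unpickle => [q|]; [exact: (pickP q).1.1|case: g0].
- move=> a k Aa; rewrite /f; case: unpickle => [q|]; first exact: (pickP q).1.2.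
  by case: g0 => _ h _; exact: h.
move=> x eta eta0 hx; have d1 : 0 < 2 * (d%:R + 1) :> R by rewrite mulr_gt0// ltr_wpDl.
(* A rational point within [2 * r] of [x] in each coordinate is at Euclidean distance less than
   [eta], and a functional with unit normal is negative there. *)
pose r := eta / (2 * (d%:R + 1)).
have r0 : 0 < r by rewrite divr_gt0.
apply: (dense_box cA (r := r)) => // y yx e e0.
have m0 : 0 < Num.min (e / 2) r by rewrite lt_min r0 divr_gt0.
have [q hq] := rat_approx y m0.
have me : Num.min (e / 2) r <= e / 2 by rewrite ge_min lexx.
have mr : Num.min (e / 2) r <= r by rewrite ge_min lexx orbT.
have ng : ~ (exists p, good q p).
  move=> /(pickP q).2 h; have := hx (pickle q); rewrite /f pickleK => h'.
  have : enorm (emb q - x) < eta.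
    apply: (le_lt_trans (enorm_le_sum _)).
    apply: (@le_lt_trans _ _ (\sum_(j < d) (2 * r))).
      apply: ler_sum => j _; rewrite !mxE ltW// (le_lt_trans (ler_distD (y j 0) _ _))//.
      by have := lt_le_trans (hq j) mr; have := yx j; lra.
    rewrite sumr_const card_ord -(mulr_natl (2 * r)).
    have -> : eta = (d%:R + 1) * (2 * r) by rewrite /r; field; rewrite gt_eqF// ltr_wpDl.
    by rewrite [ltRHS]mulrDl mul1r ltrDl mulr_gt0.
  have := dot_le (pick q).1 (emb q - x); rewrite (pickP q).1.1 mul1r dotBr.
  by move: h h'; rewrite /aff; lra.
have e20 : 0 < e / 2 by rewrite divr_gt0.
have [a [Aa ha]] := bad q ng _ e20.
exists a; split => // j; rewrite (le_lt_trans (ler_distD (emb q j 0) _ _))// [ltRHS](splitr e) ltrD//.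
by rewrite embE (lt_le_trans (hq j)).
Qed.

End polytopes.

(** [A] lies between the limits of the polytopes at level [- eta] and at level 0. Both directions
    need only inclusions for [Y], because the gap between the two levels is paid under the Gaussian
    law, where [gauss_collar] bounds it uniformly in the number of half-spaces. *)
Lemma convex_level (R : realType) d d1 d2 (Omega1 : measurableType d1) (Omega2 : measurableType d2)
    (P : probability Omega1 R) (PZ : probability Omega2 R) (Y : Omega1 -> 'cV[R]_d) (Z : Omega2 -> 'cV[R]_d)
    (A : set 'cV[R]_d) (B : R) :
  cmeas Y -> std_gaussian PZ Z -> 0 <= B ->
  (forall s u, usub s u -> `|pr P [set w | s (Y w) <= 0] - pr PZ [set w | s (Z w) <= 0]| <= B) ->
  (forall x y t, A x -> A y -> 0 <= t -> t <= 1 -> A (t *: x + (1 - t) *: y)) ->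
  measurable (Y @^-1` A) -> measurable (Z @^-1` A) ->
  `|pr P (Y @^-1` A) - pr PZ (Z @^-1` A)| <= B.
Proof.
move=> mY HZ B0 HB cA mYA mZA; have mZ := gauss_cmeas HZ.
have [->|/set0P[a0 Aa0]] := eqVneq A set0; first by rewrite !preimage_set0 /pr !measure0 subrr normr0.
have [->|[f [f1 fA fx]]] := halfspaces cA Aa0.
  by rewrite !preimage_setT /pr !probability_setT subrr normr0.
(* Chosen so that the Gaussian collar of width [eta e] has probability at most [e]. *)
pose eta (e : R) := e / (Num.sqrt d%:R + 1).
have sd0 : 0 < Num.sqrt d%:R + 1 :> R by rewrite ltr_wpDl ?sqrtr_ge0.
pose F dT (OT : measurableType dT) (V : OT -> 'cV[R]_d) (t : R) k := [set w | smax f k (V w) <= t].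
have mF dT (OT : measurableType dT) (V : OT -> 'cV[R]_d) t k : cmeas V -> measurable (F _ _ V t k).
  by move=> mV; have [u su] := smax_usub k f1; exact: (sublevel_meas t (usub_comp_meas mV su)).
have dF dT (OT : measurableType dT) (V : OT -> 'cV[R]_d) t k : F _ _ V t k.+1 `<=` F _ _ V t k.
  by move=> w /smax_le h; apply/smax_le => i ik; apply: h; exact: leqW.
have AF dT (OT : measurableType dT) (V : OT -> 'cV[R]_d) k : V @^-1` A `<=` F _ _ V 0 k.
  by move=> w Aw; apply/smax_le => i _; exact: fA.
have FA dT (OT : measurableType dT) (V : OT -> 'cV[R]_d) t : 0 < t -> \bigcap_k F _ _ V (- t) k `<=` V @^-1` A.
  move=> t0 w h; apply: (fx _ _ t0) => k; have /smax_le := h k I; exact.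
have close dT (OT : measurableType dT) (Q : probability OT R) (V : OT -> 'cV[R]_d) e : 0 < e -> cmeas V -> measurable (V @^-1` A) ->
    exists k, pr Q (F _ _ V (- eta e) k) <= pr Q (V @^-1` A) + e.
  move=> e0 mV mVA; have eta0 : 0 < eta e by rewrite divr_gt0.
  have [k hk] := pr_bigcap Q e0 (fun k => mF _ _ V (- eta e) k mV) (fun k => @dF _ _ V (- eta e) k).
  exists k; apply: (le_trans hk); rewrite lerD2r; apply: le_pr => //; last exact: FA.
  by apply: bigcap_measurable => // i _; exact: mF.
have collar k e : 0 < e -> pr PZ (F _ _ Z 0 k) <= pr PZ (F _ _ Z (- eta e) k) + e.
  move=> e0; have eta0 : 0 < eta e by rewrite divr_gt0.
  have [u su] := smax_usub k f1.
  have mC := gauss_collar_meas HZ su (- eta e) (- eta e + eta e).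
  apply: (@le_trans _ _ (pr PZ (F _ _ Z (- eta e) k `|` [set w | - eta e <= smax f k (Z w) <= - eta e + eta e]))).
    apply: le_pr; [exact: mF|by apply: measurableU => //; exact: mF|] => w /= h.
    by case: (leP (smax f k (Z w)) (- eta e)) => h'; [left|right; rewrite (ltW h')/= addNr].
  rewrite (le_trans (pr_setU _ _ _))//; first exact: mF.
  rewrite lerD2l (le_trans (gauss_collar HZ su _ (ltW eta0)))// /eta mulrA ler_pdivrMr// mulrC.
  by rewrite ler_wpM2l ?(ltW e0)// lerDl.
have HF k t : `|pr P (F _ _ Y t k) - pr PZ (F _ _ Z t k)| <= B.
  have [u su] := smax_usub k f1; have := HB _ _ (usubD (- t) su).
  have E dT (OT : measurableType dT) (V : OT -> 'cV[R]_d) : [set w | smax f k (V w) - t <= 0] = F _ _ V t k.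
    by apply/seteqP; split => w /=; rewrite subr_le0.
  have -> : [set w | smax f k (Y w) - t <= 0] = F _ _ Y t k by exact: E.
  by have -> : [set w | smax f k (Z w) - t <= 0] = F _ _ Z t k by exact: E.
apply: dist_le2; apply/ler_addgt0Pr => e e0; have e20 : 0 < e / 2 by rewrite divr_gt0.
  have [k hk] := close _ _ P Y _ e20 mY mYA.
  have h1 := le_pr PZ mZA (mF _ _ Z 0 k mZ) (@AF _ _ Z k).
  have h2 := collar k _ e20; have := HF k (- eta (e / 2)); rewrite ler_norml => /andP[h3 _].
  by move: hk h1 h2 h3; lra.
have [k hk] := close _ _ PZ Z _ e20 mZ mZA.
have h1 := le_pr P mYA (mF _ _ Y 0 k mY) (@AF _ _ Y k).
have h2 := collar k _ e20; have := HF k 0; rewrite ler_norml => /andP[_ h3].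
by move: hk h1 h2 h3; lra.
Qed.

Section convex_bound.
Context dO dS dZ (Omega : measurableType dO) (S : measurableType dS) (OZ : measurableType dZ)
  (R : realType) (P : probability Omega R) (PZ : probability OZ R) (n d : nat).
Variables (X : 'I_n -> Omega -> S) (h : 'I_n -> S -> 'cV[R]_d) (Z : OZ -> 'cV[R]_d).
Hypothesis HZ : std_gaussian PZ Z.
Hypothesis mX : forall i, measurable_fun setT (X i).
Hypothesis mh : forall i, cmeas (h i).
Hypothesis iX : mutually_independent P X.
Let xi i w := h i (X i w).
Hypothesis i3 : forall i, itg P (fun w => enorm (xi i w) ^+ 3).
Hypothesis mean0 : forall i j, Ex P (fun w => xi i w j 0) = 0.
Hypothesis cov1 : forall j l, \sum_i Ex P (fun w => xi i w j 0 * xi i w l 0) = (j == l)%:R.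
Let W w : 'cV[R]_d := \sum_i xi i w.

Let mxi i : cmeas (xi i). Proof. exact: (cmeas_hX mX mh i). Qed.
Let mW : cmeas W. Proof. exact: cmeas_sum. Qed.
Variables (T : Omega -> 'cV[R]_d) (De : Omega -> R) (Di : 'I_n -> Omega -> R) (N : set Omega).
Hypothesis mT : cmeas T.
Hypothesis mDe : measurable_fun setT De.
Hypothesis mDi : forall i, measurable_fun setT (Di i).
Hypothesis De0 : forall w, 0 <= De w.
Hypothesis mN : measurable N.
Hypothesis N0 : pr P N = 0.
Hypothesis dom : forall w, ~ N w -> enorm (T w - W w) <= De w.
Hypothesis Di_indep : forall i, independent_of_coordinate P X i (Di i).
Hypothesis iWD : itg P (fun w => enorm (W w) * De w).
Hypothesis iD : forall i, itg P (fun w => enorm (xi i w) * `|De w - Di i w|).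

Let g := \sum_i Ex P (fun w => enorm (xi i w) ^+ 3).
Let loss := 2 * Ex P (fun w => enorm (W w) * De w) + 2 * \sum_i Ex P (fun w => enorm (xi i w) * `|De w - Di i w|).

Lemma convex_bound (A : set 'cV[R]_d) :
  (forall x y t, A x -> A y -> 0 <= t -> t <= 1 -> A (t *: x + (1 - t) *: y)) ->
  measurable (T @^-1` A) -> measurable (Z @^-1` A) ->
  `|pr P (T @^-1` A) - pr PZ (Z @^-1` A)| <= 259 * Num.sqrt d%:R * g + loss.
Proof.
move=> cA mTA mZA.
have g0 : 0 <= g by apply: sumr_ge0 => i _; apply: Ex_ge0 => w; rewrite exprn_ge0// enorm_ge0.
have sd0 : 0 <= Num.sqrt d%:R :> R by exact: sqrtr_ge0.
have loss0 : 0 <= loss.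
  apply: addr_ge0; apply: mulr_ge0 => //.
    by apply: Ex_ge0 => w; apply: mulr_ge0 => //; exact: enorm_ge0.
  by apply: sumr_ge0 => i _; apply: Ex_ge0 => w; apply: mulr_ge0 => //; exact: enorm_ge0.
have sg0 : 0 <= Num.sqrt d%:R * g by exact: mulr_ge0.
have bound0 : 0 <= 259 * Num.sqrt d%:R * g + loss by rewrite -mulrA; apply: addr_ge0 loss0; apply: mulr_ge0 sg0; exact: ler0n.
(* In dimension 0 there are no unit vectors, so [usub] has no instance and the level bound holds
   vacuously. *)
case: (posnP d) => [dz|dpos].
  apply: (convex_level mT HZ bound0 _ cA mTA mZA) => s u [_ u1 _]; exfalso.
  have := u1 0; rewrite /enorm big1 ?sqrtr0 => [/eqP|j _]; first by rewrite eq_sym oner_eq0.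
  by move: (ltn_ord j); rewrite [in X in (_ < X)%N]dz.
have sd1 : 1 <= Num.sqrt d%:R :> R by rewrite -[leLHS]sqrtr1 ler_wsqrtr// ler1n.
(* If the first term is at least 1 the claim is trivial; otherwise [g] is below 1/259 since sqrt d
   >= 1. *)
case: (lerP 1 (259 * Num.sqrt d%:R * g)) => big.
  have p1 := pr_le1 P mTA; have p2 := pr_le1 PZ mZA.
  have p3 := pr_ge0 P (T @^-1` A); have p4 := pr_ge0 PZ (Z @^-1` A).
  by rewrite ler_norml; move: loss0 big; move: loss => c h1 h2; apply/andP; split; lra.
have g_small : g <= 1 / 200.
  have : 1 * g <= Num.sqrt d%:R * g by rewrite ler_wpM2r.
  by move: big; rewrite -mulrA; lra.
apply/ler_addgt0Pr => e e0.
(* A positive majorant [g + eps <= 1/100] enters the level bound; its constant is 230 = 215 + 15,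
   and [eps] costs at most [e]. *)
pose eps := Num.min (e / (230 * Num.sqrt d%:R)) (1 / 200).
have sd230 : 0 < 230 * Num.sqrt d%:R :> R by lra.
have eps0 : 0 < eps by rewrite lt_min; apply/andP; split; [exact: divr_gt0|rewrite divr_gt0 ?ltr0n].
have eps1 : eps * (230 * Num.sqrt d%:R) <= e by rewrite -ler_pdivlMr// ge_min lexx.
have eps2 : eps <= 1 / 200 by rewrite ge_min lexx orbT.
have g'0 : 0 < g + eps by rewrite ltr_wpDl.
have g'1 : g + eps <= 1 / 100 by lra.
have mom : \sum_i Ex P (fun w => enorm (xi i w) ^+ 3) <= g + eps by rewrite lerDl ltW.
have LC := level_comparison HZ mX mh iX i3 mean0 cov1 g'0 mom dpos g'1 mT mDe mDi De0 mN N0 dom Di_indep iWD iD.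
have b0 : 0 <= 215 * Num.sqrt d%:R * (g + eps) + (loss + 15 * Num.sqrt d%:R * (g + eps)).
  by have : 0 <= Num.sqrt d%:R * eps; [apply: mulr_ge0 => //; exact: ltW|move=> h1; lra].
apply: (le_trans (convex_level mT HZ b0 LC cA mTA mZA)).
by move: sg0 eps1; clearbody loss; move: (Num.sqrt d%:R) (g) (eps) => x y z; lra.
Qed.

End convex_bound.

(** * Extended-real expectations and conclusion *)

Section expectations.
Context d0 (Omega : measurableType d0) (R : realType) (P : probability Omega R).

Lemma finite_expect (f : Omega -> R) : measurable_fun setT f -> (forall w, 0 <= f w) ->
  ('E_P[f] < +oo)%E -> itg P f.
Proof.
rewrite unlock => mf f0 h; apply/integrableP; split; first exact/measurable_EFinP.
by under eq_integral do rewrite /= ger0_norm//.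
Qed.

Lemma expect_itg (f : Omega -> R) : itg P f -> 'E_P[f]%E = (Ex P f)%:E.
Proof. by rewrite unlock; exact: itg_fin. Qed.

Lemma expect_ae (f g : Omega -> R) : measurable_fun setT f -> measurable_fun setT g ->
  {ae P, forall w, f w = g w} -> 'E_P[f]%E = 'E_P[g]%E.
Proof.
rewrite unlock => mf mg fg; apply: ae_eq_integral => //; try exact/measurable_EFinP.
by apply: filterS fg => w E _; rewrite E.
Qed.

End expectations.

Theorem theorem2p1 (R : realType) (n d : nat)
    (d0 dX dZ : measure_display)
    (Omega : measurableType d0) (P : probability Omega R)
    (calX : measurableType dX)
    (X : 'I_n -> {RV P >-> calX})
    (X_indep : mutually_independent P (fun i => X i : Omega -> calX))
    (stat : n.-tuple calX -> 'cV[R]_d) (stat_meas : borel_fun stat)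
    (h : 'I_n -> calX -> 'cV[R]_d) (h_meas : forall i, borel_fun (h i))
    (OmegaZ : measurableType dZ) (PZ : probability OmegaZ R)
    (Z : OmegaZ -> 'cV[R]_d) (Z_gauss : std_gaussian PZ Z) :
  let T (w : Omega) : 'cV[R]_d := stat [tuple X i w | i < n] in
  let xi (i : 'I_n) (w : Omega) : 'cV[R]_d := h i (X i w) in
  let W (w : Omega) : 'cV[R]_d := \sum_(i < n) xi i w in
  let D (w : Omega) : 'cV[R]_d := T w - W w in
  let gamma : \bar R := (\sum_(i < n) 'E_P[fun w => (enorm (xi i w) ^+ 3)%R])%E in
  (forall (i : 'I_n) (j : 'I_d), 'E_P[fun w => (xi i w j 0)%R]%E = 0%E) ->
  (forall j k : 'I_d,
    (\sum_(i < n) 'E_P[fun w => ((xi i w *m (xi i w)^T) j k)%R])%E =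
    ((1%:M : 'M[R]_d) j k)%:E) ->
  forall (Delta : {RV P >-> R}) (Deltai : 'I_n -> {RV P >-> R}),
    {ae P, forall w, enorm (D w) <= Delta w} ->
    (forall i : 'I_n, independent_of_coordinate P
      (fun j => X j : Omega -> calX) i (Deltai i : Omega -> R)) ->
    (convex_discrepancy P PZ T Z <=
       (259 * Num.sqrt d%:R)%:E * gamma
       + 2%:E * 'E_P[fun w => (enorm (W w) * Delta w)%R]
       + 2%:E * \sum_(i < n)
           'E_P[fun w => (enorm (xi i w) * `|Delta w - Deltai i w|)%R])%E.

Proof.
move=> T xi W D gamma mean cov De Di dom indep.
have mX i : measurable_fun setT (X i) by exact: measurable_funPT.
have mh i : cmeas (h i) by exact: borel_cmeas (h_meas i).
have mxi i : cmeas (xi i) by exact: cmeas_hX mX mh i.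
have mW : cmeas W by exact: cmeas_sum.
have mT : cmeas T.
  apply: borel_cmeas; apply: (measurableT_comp stat_meas).
  apply/measurable_fun_tnthP => i; rewrite (_ : _ \o _ = X i)//.
  by apply/funext => w /=; rewrite tnth_mktuple.
have mDe : measurable_fun setT De by exact: measurable_funPT.
have mDi i : measurable_fun setT (Di i) by exact: measurable_funPT.
(* [De] dominates a norm only almost everywhere; its positive part is nonnegative everywhere and has
   the same expectations. *)
pose De' w := Num.max (De w) 0.
have mDe' : measurable_fun setT De' by exact: measurable_maxr.
have De'0 w : 0 <= De' w by rewrite le_max lexx orbT.
have DeE : {ae P, forall w, De w = De' w}.
  apply: filterS dom => w h1; rewrite /De' (max_idPl _)//.
  exact: le_trans (enorm_ge0 _) h1.
pose E1 := 'E_P[fun w => (enorm (W w) * De' w)%R]%E.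
pose E2 i := 'E_P[fun w => (enorm (xi i w) * `|De' w - Di i w|)%R]%E.
have -> : 'E_P[fun w => (enorm (W w) * De w)%R]%E = E1.
  apply: expect_ae; try by apply: measurable_funM => //; exact: cmeas_enorm.
  by apply: filterS DeE => w ->.
under eq_bigr => i _.
  rewrite (_ : 'E_P[_]%E = E2 i); last first.
    apply: expect_ae; try by apply: measurable_funM; [exact: cmeas_enorm|apply: measurableT_comp => //; exact: measurable_funB].
    by apply: filterS DeE => w ->.
  over.
have E_ge0 (f : Omega -> R) : (forall w, 0 <= f w) -> (0 <= 'E_P[f])%E.
  by move=> f0; rewrite unlock; apply: integral_ge0 => w _; rewrite lee_fin.
have E10 : (0 <= E1)%E by apply: E_ge0 => w; apply: mulr_ge0 => //; exact: enorm_ge0.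
have E20 i : (0 <= E2 i)%E by apply: E_ge0 => w; apply: mulr_ge0 => //; exact: enorm_ge0.
pose E3 i := 'E_P[fun w => (enorm (xi i w) ^+ 3)%R]%E.
have E30 i : (0 <= E3 i)%E by apply: E_ge0 => w; rewrite exprn_ge0// enorm_ge0.
have gamma0 : (0 <= gamma)%E by apply: sume_ge0 => i _; exact: E30.
have c0 : 0 <= 259 * Num.sqrt d%:R :> R by apply: mulr_ge0; [exact: ler0n|exact: sqrtr_ge0].
have S20 : (0 <= \sum_(i < n) E2 i)%E by apply: sume_ge0 => i _; exact: E20.
have n0 : d != 0%N -> 0 < 259 * Num.sqrt d%:R :> R.
  by move=> dn; apply: mulr_gt0; rewrite ?sqrtr_gt0 ltr0n ?lt0n.
have two0 : (0 < 2%:E :> \bar R)%E by rewrite lte_fin.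
have t10 : (0 <= (259 * Num.sqrt d%:R)%:E * gamma)%E by apply: mule_ge0.
have t20 : (0 <= 2%:E * E1)%E by apply: mule_ge0.
have t30 : (0 <= 2%:E * \sum_(i < n) E2 i)%E by apply: mule_ge0.
have infty (x y z : \bar R) : (0 <= x)%E -> (0 <= y)%E -> (0 <= z)%E ->
    x = +oo%E \/ y = +oo%E \/ z = +oo%E -> (x + y + z = +oo)%E.
  by move: x y z => [x| |] [y| |] [z| |] // _ _ _ [//|[//|//]].
have lty_or (x : \bar R) : (0 <= x)%E -> x = +oo%E \/ (x < +oo)%E.
  by case: x => [r| |] // _; [right; rewrite ltry|left].
(* If one of the three terms is infinite the bound is trivial; otherwise all the expectations are
   real and [convex_bound] applies. *)
have [g_oo|g_fin] := lty_or _ gamma0.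
  rewrite (infty _ _ _ t10 t20 t30); [exact: leey|left].
  rewrite g_oo gt0_muley ?lte_fin//; apply: n0.
  (* In dimension 0 the coefficient of [gamma] is 0, but every norm vanishes there and [gamma] is
     finite. *)
  apply/eqP => dz; move: g_oo; rewrite /gamma big1 => // i _.
  transitivity ('E_P[cst (0%R : R)])%E; last by rewrite expectation_cst.
  congr expectation; apply/funext => w.
  rewrite /enorm big1 ?sqrtr0 ?expr0n// => j _.
  by move: (ltn_ord j); rewrite [in X in (_ < X)%N]dz.
have [E1_oo|E1_fin] := lty_or _ E10.
  by rewrite infty ?leey//; right; left; rewrite E1_oo gt0_muley.
have [S2_oo|S2_fin] := lty_or _ S20.
  by rewrite infty ?leey//; right; right; rewrite S2_oo gt0_muley.
have E3_fin i : (E3 i < +oo)%E.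
  apply: le_lt_trans g_fin; rewrite /gamma (bigD1 i)//= leeDl//.
  by apply: sume_ge0 => j _; exact: E30.
have E2_fin i : (E2 i < +oo)%E.
  apply: le_lt_trans S2_fin; rewrite (bigD1 i)//= leeDl//.
  by apply: sume_ge0 => j _; exact: E20.
have i3 i : itg P (fun w => enorm (xi i w) ^+ 3).
  apply: finite_expect (E3_fin i); first by apply: measurable_funX; exact: cmeas_enorm.
  by move=> w; rewrite exprn_ge0// enorm_ge0.
have iWD : itg P (fun w => enorm (W w) * De' w).
  apply: finite_expect E1_fin; first by apply: measurable_funM => //; exact: cmeas_enorm.
  by move=> w; apply: mulr_ge0 => //; exact: enorm_ge0.
have iD i : itg P (fun w => enorm (xi i w) * `|De' w - Di i w|).
  apply: finite_expect (E2_fin i).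
    by apply: measurable_funM; [exact: cmeas_enorm|apply: measurableT_comp => //; exact: measurable_funB].
  by move=> w; apply: mulr_ge0 => //; exact: enorm_ge0.
have mean0 i j : Ex P (fun w => xi i w j 0) = 0.
  by have := mean i j; rewrite expect_itg ?itg_coord// => -[].
have icov i j k : itg P (fun w => xi i w j 0 * xi i w k 0).
  apply: itg_le (itg_norm2 (mxi i) (i3 i)) _ => [|w]; first by apply: measurable_funM; exact: mxi.
  by rewrite normrM expr2 ler_pM ?coord_le_enorm.
have cov1 j k : \sum_i Ex P (fun w => xi i w j 0 * xi i w k 0) = (j == k)%:R.
  have := cov j k; rewrite mxE.
  under eq_bigr => i _.
    rewrite (_ : 'E_P[_]%E = (Ex P (fun w => xi i w j 0 * xi i w k 0))%:E); first over.
    rewrite -expect_itg//; congr expectation; apply/funext => w.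
    by rewrite mxE big_ord1 mxE.
  by rewrite sumEFin => -[].
(* The measurable complement of the event where the domination holds; it is null because it lies in
   the null set provided by [dom]. *)
pose N := ~` [set w | enorm (D w) <= De' w].
have mN : measurable N.
  apply: measurableC; rewrite -[X in measurable X]setTI.
  by apply: measurable_fun_le => //; apply: cmeas_enorm; exact: cmeasB.
have N0 : pr P N = 0.
  have [N' [mN' PN' sN']] := dom.
  apply/eqP; rewrite eq_le pr_ge0 andbT -[leRHS](_ : pr P N' = 0); last by rewrite /pr PN'.
  apply: le_pr => // w Nw; apply: sN' => /= h1; apply: Nw.
  by rewrite /= /De' le_max h1.
have domN w : ~ N w -> enorm (T w - W w) <= De' w by move=> /contrapT.
apply: ge_ereal_sup => _ [A [cA mTA mZA] <-].
have cA' x y t : A x -> A y -> 0 <= t -> t <= 1 -> A (t *: x + (1 - t) *: y).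
  move=> Ax Ay t0 t1; have := cA x y (Itv01 t0 t1) (mem_set Ax) (mem_set Ay).
  by move/set_mem.
have := convex_bound Z_gauss mX mh X_indep i3 mean0 cov1 mT mDe' mDi De'0 mN N0 domN indep iWD iD cA' mTA mZA.
rewrite (pr_fin P mTA) (pr_fin PZ mZA) -EFinB/= -lee_fin => /le_trans; apply.
have -> : gamma = (\sum_(i < n) Ex P (fun w => enorm (xi i w) ^+ 3))%:E.
  by rewrite -sumEFin; apply: eq_bigr => i _; exact: expect_itg.
have -> : (\sum_(i < n) E2 i)%E = (\sum_(i < n) Ex P (fun w => enorm (xi i w) * `|De' w - Di i w|))%:E.
  by rewrite -sumEFin; apply: eq_bigr => i _; exact: expect_itg.
by rewrite /E1 (expect_itg iWD) -!EFinM -!EFinD addrA.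
Qed.
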